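(* Let $D\subset\mathbb{C}^2$ be an open polydisk centered at the origin, let $G(z,w)$ and $H(z,w)$ be analytic on $D$ with $H(0,0)\neq 0$, and let $F(z,w):=G(z,w)/H(z,w)=\sum_{r,s\ge 0}f_{r,s}z^rw^s$ near the origin, with $[z^rw^s]F:=f_{r,s}$. Let $K\subset D$ be a compact set of strictly minimal simple zeros of $H$, and let $(\zeta_c,\omega_c)\in K$ satisfy $H_w(\zeta_c,\omega_c)\neq0$. Let $g$ be the analytic function near $\zeta_c$ with $g(\zeta_c)=\omega_c$ such that near $(\zeta_c,\omega_c)$ the zero set of $H$ is $\{w=g(z)\}$. For $(\zeta,\omega)\in K$ put $d(\zeta,\omega):=\frac{\zeta H_z(\zeta,\omega)}{\omega H_w(\zeta,\omega)}$ and $$\Lambda:=\bigcup_{(\zeta,\omega)\in K}\{(r,s)\in\mathbb{R}^2: r/s=d(\zeta,\omega)\}.$$ For each $(r,s)\in\Lambda$ let $(\zeta,\omega)=(\zeta(r,s),\omega(r,s))\in K$ be a point with $r/s=d(\zeta,\omega)$, chosen so that $(\zeta(r,s),\omega(r,s))=(\zeta_c,\omega_c)$ when $r/s=d(\zeta_c,\omega_c)$ and so that $(\zeta(r,s),\omega(r,s))\to(\zeta_c,\omega_c)$ as $r/s\to d(\zeta_c,\omega_c)$. For $\theta$ small and $\zeta$ close to $\zeta_c$ define $$a(\zeta,\theta):=\frac{-G(\zeta e^{i\theta},g(\zeta e^{i\theta}))}{g(\zeta e^{i\theta})\,H_w(\zeta e^{i\theta},g(\zeta e^{i\theta}))},\qquad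 f(\zeta,\theta):=\ln\left\{\frac{g(\zeta e^{i\theta})}{g(\zeta)}\right\}-i\theta\frac{\zeta g'(\zeta)}{g(\zeta)},$$ (the logarithm being the branch with $\ln 1=0$). Suppose there are nonnegative integers $p\le q$ such that $a(\zeta,\theta)$ has a $p$-to-$q$ change of degree about $\theta=0$ as $\zeta\to\zeta_c$, while $f(\zeta,\theta)$ vanishes to constant degree $n$ about $\theta=0$ as $\zeta\to\zeta_c$. Then there is a constant $C>0$ and functions $A_k(\zeta)$ and $B_k(\zeta;s)$, $p\le k\le q$, analytic in $\zeta$ near $\zeta=\zeta_c$, such that $A_k(\zeta_c)=0$ for $p\le k<q$, $A_q(\zeta_c)\neq0$, and $$[z^rw^s]F=\frac{\zeta^{-r}\omega^{-s}}{2\pi}\left\{\sum_{k=p}^q A_k(\zeta)B_k(\zeta;s)+O(e^{-sC})\right\},\qquad (\zeta,\omega)=(\zeta(r,s),\omega(r,s)),$$ uniformly for all $(r,s)\in\Lambda$ with $r/s$ sufficiently close to $d(\zeta_c,\omega_c)$. Furthermore, there are coefficients $c_k(\zeta;j)$, $j\ge k$, analytic in $\zeta$ near $\zeta_c$, such that each $B_k$ admits the asymptotic expansion $$B_k(\zeta;s)\approx\sum_{j=k}^\infty c_k(\zeta;j)\left(1+(-1)^jD(j,n)\right)\frac1n\Gamma\!\left(\frac{j+1}{n}\right)s^{-(j+1)/n}$$ as $s\to\infty$, uniformly for all $(r,s)\in\Lambda$ with $r/s$ sufficiently close to $d(\zeta_c,\omega_c)$, where $$D(j,n):=\begin{cases}1,&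 n\text{ even},\\ \exp\!\left(-\frac{i\pi(j+1)}{n}\,\mathrm{sign}\{i\cdot[\theta^n]f(\zeta_c,\theta)\}\right),& n\text{ odd}.\end{cases}$$
   Context: A point $(\zeta,\omega)$ is a simple zero of $H$ if $H(\zeta,\omega)=0$ and the complex gradient $\nabla H(\zeta,\omega)\ne0$; it is strictly minimal if $\zeta\omega\neq0$ and $(\zeta,\omega)$ is the only zero of $H$ in the closed polydisk $\{|z|\le|\zeta|,|w|\le|\omega|\}$. $H_z,H_w$ denote complex partial derivatives. For $U(z,w)$ analytic near $(z_0,w_0)$, its Hartogs series in powers of $(w-w_0)$ is $U(z,w)=\sum_{k\ge0}U_k(z)(w-w_0)^k$ with $U_k(z)=\frac1{k!}\frac{\partial^kU}{\partial w^k}(z,w_0)$. For nonnegative integers $p<q$, $U$ has a $p$-to-$q$ change of degree about $w=w_0$ as $z\to z_0$ if $U(z,w)=U_p(z)(w-w_0)^p+\dots+U_q(z)(w-w_0)^q+\dots$ (i.e. $U_k\equiv0$ for $k<p$) with $U_j(z_0)=0$ for $p\le j<q$ and $U_q(z_0)\neq0$; $U$ vanishes to constant degree $p$ (equivalently has a $p$-to-$p$ change of degree) if $U=U_p(z)(w-w_0)^p+\dots$ with $U_p(z_0)\ne0$. $[\theta^n]f(\zeta_c,\theta)$ denotes the coefficient of $\theta^n$ in the Taylor series of $f(\zeta_c,\cdot)$ at $0$. The notation $B(s)\approx\sum_{j\ge k}b_j s^{-(j+1)/n}$ means that for every $m\ge k$, $B(s)-\sum_{j=k}^m b_js^{-(j+1)/n}=O(s^{-(m+2)/n})$.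 *)

(* Defs.v *)
From Stdlib Require Export Reals List Arith.
From Coquelicot Require Export Coquelicot.
Open Scope R_scope.
Open Scope C_scope.

Definition Cexp (z : C) : C :=
  (exp (Re z) * cos (Im z), exp (Re z) * sin (Im z))%R.

(* Principal branch: 2 atan (y / (|z| + x)) is the argument of z = x + iy in
   (-pi, pi) off the closed negative real axis; on that axis the value is
   meaningless. *)
Definition Clog (z : C) : C :=
  (ln (Cmod z), 2 * atan (Im z / (Cmod z + Re z)))%R.

Definition Gamma (x : R) : R :=
  RInt_gen (fun t => Rpower t (x - 1) * exp (- t))%R
    (at_right 0) (Rbar_locally p_infty).

Definition compact_set {T : UniformSpace} (K : T -> Prop) : Prop :=
  forall (I : Type) (U : I -> T -> Prop),
    (forall i, open (U i)) ->
    (forall x, K x -> exists i, U i x) ->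
    exists l : list I, forall x, K x -> exists i, In i l /\ U i x.

Definition analytic_at (U : C -> C) (z0 : C) : Prop :=
  exists (a : nat -> C) (rho : R), (0 < rho)%R /\
    forall z, (Cmod (z - z0) < rho)%R ->
      is_pseries (K := C_AbsRing) (V := C_NormedModule) a (z - z0) (U z).

(* The double series is summed along the diagonals k + l = n; the order is
   immaterial since absolute convergence is part of the definition. *)
Definition is_pseries2 (a : nat -> nat -> C) (z w l : C) : Prop :=
  ex_series (fun n =>
    sum_n (fun k => Cmod (a k (n - k)%nat * z ^ k * w ^ (n - k)%nat)) n) /\
  is_series (K := C_AbsRing) (V := C_NormedModule)
    (fun n => sum_n (G := C_AbelianGroup)
       (fun k => a k (n - k)%nat * z ^ k * w ^ (n - k)%nat) n) l.

Definition is_pseries2_near (a : nat -> nat -> C) (U : C -> C -> C)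
    (z0 w0 : C) : Prop :=
  exists rho : R, (0 < rho)%R /\
    forall z w, (Cmod (z - z0) < rho)%R -> (Cmod (w - w0) < rho)%R ->
      is_pseries2 a (z - z0) (w - w0) (U z w).

Definition analytic2_at (U : C -> C -> C) (z0 w0 : C) : Prop :=
  exists a, is_pseries2_near a U z0 w0.

Definition polydisk (rho1 rho2 : R) (z w : C) : Prop :=
  (Cmod z < rho1)%R /\ (Cmod w < rho2)%R.

(* [C_derive f z] is computed as a limit along the horizontal line through z;
   it is the complex derivative wherever f is complex differentiable. *)
Fixpoint C_derive_n (f : C -> C) (k : nat) (z : C) : C :=
  match k with
  | O => f z
  | S k => C_derive (C_derive_n f k) z
  end.

Definition Dz (H : C -> C -> C) (z w : C) : C := C_derive (fun x => H x w) z.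
Definition Dw (H : C -> C -> C) (z w : C) : C := C_derive (fun y => H z y) w.

Definition simple_zero (H : C -> C -> C) (z w : C) : Prop :=
  H z w = 0 /\ (Dz H z w, Dw H z w) <> (RtoC 0, RtoC 0).

Definition strictly_minimal (H : C -> C -> C) (zeta omega : C) : Prop :=
  zeta * omega <> 0 /\ H zeta omega = 0 /\
  forall z w, (Cmod z <= Cmod zeta)%R -> (Cmod w <= Cmod omega)%R ->
    H z w = 0 -> z = zeta /\ w = omega.

Definition hartogs (U : C -> C -> C) (w0 : C) (k : nat) (z : C) : C :=
  C_derive_n (U z) k w0 / INR (fact k).

(* Meant for U analytic near (z0, w0) and p <= q; for p = q this says that U
   vanishes to constant degree p. *)
Definition change_of_degree (p q : nat) (U : C -> C -> C) (z0 w0 : C) : Prop :=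
  (forall k, (k < p)%nat ->
     locally (T := C_UniformSpace) z0 (fun z => hartogs U w0 k z = 0)) /\
  (forall j, (p <= j < q)%nat -> hartogs U w0 j z0 = 0) /\
  hartogs U w0 q z0 <> 0.

Definition constant_degree (n : nat) : (C -> C -> C) -> C -> C -> Prop :=
  change_of_degree n n.

Definition dir (H : C -> C -> C) (zeta omega : C) : C :=
  (zeta * Dz H zeta omega) / (omega * Dw H zeta omega).

(* The quotients r/s and [dir] are only meaningful for nonzero denominators
   (omega <> 0 at a strictly minimal point), hence the explicit conditions. *)
Definition has_direction (H : C -> C -> C) (r s : R) (zeta omega : C) : Prop :=
  s <> 0%R /\ Dw H zeta omega <> 0 /\ RtoC (r / s)%R = dir H zeta omega.

Definition Lambda (H : C -> C -> C) (K : C * C -> Prop) (r s : R) : Prop :=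
  exists zeta omega : C, K (zeta, omega) /\ has_direction H r s zeta omega.

Definition amplitude (G H : C -> C -> C) (g : C -> C) (zeta theta : C) : C :=
  let z := zeta * Cexp (Ci * theta) in
  - G z (g z) / (g z * Dw H z (g z)).

Definition phase (g : C -> C) (zeta theta : C) : C :=
  Clog (g (zeta * Cexp (Ci * theta)) / g zeta)
  - Ci * theta * (zeta * C_derive g zeta / g zeta).

(* [fn] stands for the coefficient of theta^n in f(zeta_c, theta). For n odd,
   i * fn is a real number at a minimal point, so its sign is that of its real
   part. *)
Definition Dfactor (fn : C) (j n : nat) : C :=
  if Nat.even n then 1
  else Cexp (- (Ci * RtoC (PI * INR (j + 1) / INR n * sign (Re (Ci * fn)))%R)).

(* Main.v *)
From Stdlib Require Import Lra Lia Classical IndefiniteDescription.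
Require Import Defs.

(** The coefficient of [z^r w^s] is an integral of [F] over a torus. By strict
    minimality, after deforming the [w]-circle the only pole met is [w = g z],
    for [z] on a short arc of the circle through [zeta]; its residue leaves
    [zeta^-r omega^-s / 2 pi] times the integral of [a e^(-s f)] over a short
    segment of angles [theta], up to an exponentially small error.

    Write [a = sum_(p <= k < q) a_k(zeta) theta^k + theta^q u(zeta, theta)], so
    that [A_k = a_k] for [k < q] and [A_q = 1]. Each half of the segment may be
    rotated slightly to make [Re f >= c |theta|^n] on it; this matters only if
    [[theta^n] f] is imaginary at [zeta_c], which must be the case for [n] odd
    because minimality forces [Re f >= 0] there.

    Put [y = theta f_n^(1/n)] where [f = theta^n f_n], so [y^n = f]. Dividing
    [theta^k u] repeatedly by powers of [y] times [dy/dtheta] gives an expansion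
    in [y^j dy/dtheta] without inverting [theta |-> y]. The integral of each
    term along a half segment is [(1/n) Gamma((j+1)/n) s^(-(j+1)/n)] up to an
    exponentially small error, and the two halves contribute [1] and
    [(-1)^j D(j,n)]. If the critical direction is not real, no [(r, s)] is close
    to it and the claim is vacuous. *)

(** * Continuity *)

(** What shapes the proof is uniformity. One neighbourhood of the critical direction must serve
    every order of the expansion, so no radius may shrink with the order: Taylor quotients and
    remainders all stay on one bidisc, and only the constants of the error terms change. Bounds at
    [zeta_c] are carried to nearby [zeta] by a tube lemma over segments; an extra real variable
    placed at 0 (the factor [mu] in [mu |F| < 1], the increment of a radius) turns the existence of
    a bound into an open condition.

    Descent is obtained from a bound on arguments. With [f = y^n], one has [y = chi t e^rho] on a
    rotated ray, where [chi^n = 1] and [n |Im rho| <= b < PI/2]. The two halves are rotated by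
    different angles and use the principal roots of two different leading coefficients; [chi] is 1
    on the positive half, on the negative half it compares the two roots, and [D(j,n)] is
    [chi^(j+1)] up to sign.

    Derivatives are required to be continuous, so that Cauchy's theorem amounts to differentiating
    an integral with respect to a deformation parameter. *)

Notation CU := C_UniformSpace.

Ltac Cring := lazymatch goal with |- ?a = ?b => change (@eq C a b) end; ring.

Ltac Creduce := unfold Cminus, Cplus, Copp, Cmult, RtoC, Re, Im, Ci in *; simpl in *.

Lemma ball_C_Cmod (x y : C) (e : R) : (Cmod (y - x) < e)%R -> ball (M := CU) x e y.
Proof. intros h; exact (C_NormedModule_mixin_compat1 x y e h). Qed.

(** Balls of [C_UniformSpace] are squares, so passing back to the modulus costs a factor [sqrt 2],
    rounded up to 2. *)
Lemma Cmod_ball_C (x y : C) (e : R) :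
  (0 < e)%R -> ball (M := CU) x e y -> (Cmod (y - x) < 2 * e)%R.
Proof.
  intros he h.
  pose proof (C_NormedModule_mixin_compat2 x y (mkposreal e he) h) as h1.
  assert (h2 : (sqrt 2 < 2)%R).
  { rewrite <- (sqrt_Rsqr 2) at 2 by lra; apply sqrt_lt_1; unfold Rsqr; lra. }
  change (Cmod (minus y x)) with (Cmod (y - x)) in h1; simpl in h1; nra.
Qed.

Lemma locally_C_Cmod (z : C) (P : C -> Prop) :
  locally (T := CU) z P <->
  exists d : R, (0 < d)%R /\ forall y, (Cmod (y - z) < d)%R -> P y.
Proof.
  split.
  - intros [d hd]; exists d; split; [apply cond_pos|].
    intros y hy; apply hd, ball_C_Cmod, hy.
  - intros [d [hd h]].
    assert (hd2 : (0 < d / 2)%R) by lra.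
    exists (mkposreal _ hd2); intros y hy; apply h.
    pose proof (Cmod_ball_C _ _ _ hd2 hy); lra.
Qed.

Lemma locally_Cball (z : C) (d : R) :
  (0 < d)%R -> locally (T := CU) z (fun y => (Cmod (y - z) < d)%R).
Proof. intros hd; apply locally_C_Cmod; exists d; auto. Qed.

Lemma continuous_C_Cmod {T : UniformSpace} (f : T -> C) (x : T) :
  continuous (U := CU) f x <->
  forall e : R, (0 < e)%R -> locally x (fun y => (Cmod (f y - f x) < e)%R).
Proof.
  split.
  - intros h e he; exact (h _ (locally_Cball (f x) e he)).
  - intros h P hP; apply locally_C_Cmod in hP; destruct hP as [d [hd hP]].
    unfold filtermap; generalize (h d hd); apply filter_imp; auto.
Qed.

Lemma continuous_locally_C {T : UniformSpace} (f : T -> C) (x : T) (e : R) :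
  continuous (U := CU) f x -> (0 < e)%R ->
  locally x (fun y => (Cmod (f y - f x) < e)%R).
Proof. intros h; apply (proj1 (continuous_C_Cmod f x)), h. Qed.

Lemma continuous_R_Rabs {T : UniformSpace} (f : T -> R) (x : T) :
  continuous (U := R_UniformSpace) f x <->
  forall e : R, (0 < e)%R -> locally x (fun y => (Rabs (f y - f x) < e)%R).
Proof.
  split.
  - intros h e he; apply (h (fun u => (Rabs (u - f x) < e)%R)).
    exists (mkposreal e he); intros y hy; exact hy.
  - intros h P [d hP].
    unfold filtermap; generalize (h d (cond_pos d)); apply filter_imp; intros y hy; apply hP, hy.
Qed.

Lemma locally_lt_continuous {T : UniformSpace} (f g : T -> R) (x : T) :
  continuous (U := R_UniformSpace) f x -> continuous (U := R_UniformSpace) g x ->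
  (f x < g x)%R -> locally x (fun y => (f y < g y)%R).
Proof.
  intros hf hg hlt.
  pose proof (proj1 (continuous_R_Rabs f x) hf ((g x - f x) / 2)%R ltac:(lra)) as h1.
  pose proof (proj1 (continuous_R_Rabs g x) hg ((g x - f x) / 2)%R ltac:(lra)) as h2.
  generalize (filter_and _ _ h1 h2); apply filter_imp; intros y [a b].
  apply Rabs_def2 in a; apply Rabs_def2 in b; lra.
Qed.

Lemma continuous_Re {T : UniformSpace} (f : T -> C) (x : T) :
  continuous (U := CU) f x -> continuous (U := R_UniformSpace) (fun y => Re (f y)) x.
Proof.
  intros h; apply continuous_R_Rabs; intros e he.
  generalize (continuous_locally_C f x e h he); apply filter_imp; intros y hy.
  eapply Rle_lt_trans; [|exact hy].
  replace (Re (f y) - Re (f x))%R with (Re (f y - f x)) by (Creduce; ring).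
  apply re_le_Cmod.
Qed.

Lemma im_le_Cmod (c : C) : (Rabs (Im c) <= Cmod c)%R.
Proof. eapply Rle_trans; [apply Rmax_r|apply Rmax_Cmod]. Qed.

Lemma continuous_Im {T : UniformSpace} (f : T -> C) (x : T) :
  continuous (U := CU) f x -> continuous (U := R_UniformSpace) (fun y => Im (f y)) x.
Proof.
  intros h; apply continuous_R_Rabs; intros e he.
  generalize (continuous_locally_C f x e h he); apply filter_imp; intros y hy.
  eapply Rle_lt_trans; [|exact hy].
  replace (Im (f y) - Im (f x))%R with (Im (f y - f x)) by (Creduce; ring).
  apply im_le_Cmod.
Qed.

Lemma Cmod_le_Rabs (c : C) : (Cmod c <= Rabs (Re c) + Rabs (Im c))%R.
Proof.
  replace c with (RtoC (Re c) + Ci * RtoC (Im c)) at 1.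
  - eapply Rle_trans; [apply Cmod_triangle|].
    rewrite Cmod_mult, Cmod_Ci, !Cmod_R; lra.
  - apply injective_projections; Creduce; ring.
Qed.

Lemma continuous_Cpair {T : UniformSpace} (f g : T -> R) (x : T) :
  continuous (U := R_UniformSpace) f x -> continuous (U := R_UniformSpace) g x ->
  continuous (U := CU) (fun y => (f y, g y) : C) x.
Proof.
  intros hf hg; apply continuous_C_Cmod; intros e he.
  pose proof (proj1 (continuous_R_Rabs f x) hf (e / 2)%R ltac:(lra)) as h1.
  pose proof (proj1 (continuous_R_Rabs g x) hg (e / 2)%R ltac:(lra)) as h2.
  generalize (filter_and _ _ h1 h2); apply filter_imp; intros y [a b].
  eapply Rle_lt_trans; [apply Cmod_le_Rabs|]; simpl.
  unfold Rminus in a, b; lra.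
Qed.

Lemma continuous_RtoC {T : UniformSpace} (f : T -> R) (x : T) :
  continuous (U := R_UniformSpace) f x ->
  continuous (U := CU) (fun y => RtoC (f y)) x.
Proof. intros h; apply continuous_Cpair; [exact h|apply continuous_const]. Qed.

Lemma continuous_ext_C {T : UniformSpace} (f g : T -> C) (x : T) :
  (forall y, f y = g y) -> continuous (U := CU) f x -> continuous (U := CU) g x.
Proof. intros h; apply continuous_ext, h. Qed.

Lemma continuous_Cplus {T : UniformSpace} (f g : T -> C) (x : T) :
  continuous (U := CU) f x -> continuous (U := CU) g x ->
  continuous (U := CU) (fun y => f y + g y) x.
Proof.
  intros hf hg.
  apply (continuous_Cpair (fun y => Re (f y) + Re (g y))%R (fun y => Im (f y) + Im (g y))%R).
  - apply (continuous_plus (V := R_NormedModule)); apply continuous_Re; assumption.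
  - apply (continuous_plus (V := R_NormedModule)); apply continuous_Im; assumption.
Qed.

Lemma continuous_Copp {T : UniformSpace} (f : T -> C) (x : T) :
  continuous (U := CU) f x -> continuous (U := CU) (fun y => - f y) x.
Proof.
  intros hf.
  apply (continuous_Cpair (fun y => - Re (f y))%R (fun y => - Im (f y))%R).
  - apply (continuous_opp (V := R_NormedModule)); apply continuous_Re; assumption.
  - apply (continuous_opp (V := R_NormedModule)); apply continuous_Im; assumption.
Qed.

Lemma continuous_Cminus {T : UniformSpace} (f g : T -> C) (x : T) :
  continuous (U := CU) f x -> continuous (U := CU) g x ->
  continuous (U := CU) (fun y => f y - g y) x.
Proof. intros hf hg; apply continuous_Cplus; [exact hf|apply continuous_Copp, hg]. Qed.

Lemma continuous_Rmult {T : UniformSpace} (f g : T -> R) (x : T) :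
  continuous (U := R_UniformSpace) f x -> continuous (U := R_UniformSpace) g x ->
  continuous (U := R_UniformSpace) (fun y => f y * g y)%R x.
Proof. exact (continuous_mult (K := R_AbsRing) f g x). Qed.

Lemma continuous_Rplus {T : UniformSpace} (f g : T -> R) (x : T) :
  continuous (U := R_UniformSpace) f x -> continuous (U := R_UniformSpace) g x ->
  continuous (U := R_UniformSpace) (fun y => f y + g y)%R x.
Proof. exact (continuous_plus (V := R_NormedModule) f g x). Qed.

Lemma continuous_Ropp {T : UniformSpace} (f : T -> R) (x : T) :
  continuous (U := R_UniformSpace) f x ->
  continuous (U := R_UniformSpace) (fun y => - f y)%R x.
Proof. exact (continuous_opp (V := R_NormedModule) f x). Qed.

Lemma continuous_Rminus {T : UniformSpace} (f g : T -> R) (x : T) :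
  continuous (U := R_UniformSpace) f x -> continuous (U := R_UniformSpace) g x ->
  continuous (U := R_UniformSpace) (fun y => f y - g y)%R x.
Proof. exact (continuous_minus (V := R_NormedModule) f g x). Qed.

Lemma continuous_Cmult {T : UniformSpace} (f g : T -> C) (x : T) :
  continuous (U := CU) f x -> continuous (U := CU) g x ->
  continuous (U := CU) (fun y => f y * g y) x.
Proof.
  intros hf hg.
  pose proof (continuous_Re _ _ hf); pose proof (continuous_Re _ _ hg).
  pose proof (continuous_Im _ _ hf); pose proof (continuous_Im _ _ hg).
  apply (continuous_Cpair (fun y => Re (f y) * Re (g y) - Im (f y) * Im (g y))%R
    (fun y => Re (f y) * Im (g y) + Im (f y) * Re (g y))%R).
  - apply continuous_Rminus; apply continuous_Rmult; assumption.
  - apply continuous_Rplus; apply continuous_Rmult; assumption.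
Qed.

Lemma continuous_Rinv_fun {T : UniformSpace} (f : T -> R) (x : T) :
  continuous (U := R_UniformSpace) f x -> f x <> 0%R ->
  continuous (U := R_UniformSpace) (fun y => / f y)%R x.
Proof.
  intros hf h0; apply (continuous_comp f Rinv); [exact hf|].
  apply continuous_Rinv, h0.
Qed.

Lemma continuous_Cinv {T : UniformSpace} (f : T -> C) (x : T) :
  continuous (U := CU) f x -> f x <> 0 ->
  continuous (U := CU) (fun y => / f y) x.
Proof.
  intros hf h0.
  pose proof (continuous_Re _ _ hf); pose proof (continuous_Im _ _ hf).
  assert (hn : (Re (f x) * Re (f x) + Im (f x) * Im (f x) <> 0)%R).
  { intros hz; apply h0; apply injective_projections; simpl; unfold Re, Im in hz; nra. }
  assert (hd : continuous (U := R_UniformSpace)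
     (fun y => / (Re (f y) * Re (f y) + Im (f y) * Im (f y)))%R x).
  { apply continuous_Rinv_fun; [|exact hn].
    apply continuous_Rplus; apply continuous_Rmult; assumption. }
  apply continuous_ext_C with (f := fun y =>
     ((Re (f y) * / (Re (f y) * Re (f y) + Im (f y) * Im (f y)))%R,
      (- Im (f y) * / (Re (f y) * Re (f y) + Im (f y) * Im (f y)))%R) : C).
  - intros y; unfold Cinv, Re, Im, Rdiv; simpl; rewrite !Rmult_1_r; reflexivity.
  - apply continuous_Cpair; apply continuous_Rmult; auto.
    apply continuous_Ropp; assumption.
Qed.

Lemma continuous_Cdiv {T : UniformSpace} (f g : T -> C) (x : T) :
  continuous (U := CU) f x -> continuous (U := CU) g x -> g x <> 0 ->
  continuous (U := CU) (fun y => f y / g y) x.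
Proof.
  intros hf hg h0; apply continuous_Cmult; [exact hf|apply continuous_Cinv; assumption].
Qed.

Lemma continuous_Cpow {T : UniformSpace} (f : T -> C) (n : nat) (x : T) :
  continuous (U := CU) f x -> continuous (U := CU) (fun y => f y ^ n) x.
Proof.
  intros hf; induction n as [|n IH]; simpl; [apply continuous_const|].
  apply continuous_Cmult; assumption.
Qed.

Lemma continuous_Cmod {T : UniformSpace} (f : T -> C) (x : T) :
  continuous (U := CU) f x -> continuous (U := R_UniformSpace) (fun y => Cmod (f y)) x.
Proof.
  intros h; apply continuous_R_Rabs; intros e he.
  generalize (continuous_locally_C f x e h he); apply filter_imp; intros y hy.
  eapply Rle_lt_trans; [|exact hy].
  assert (h1 := Cmod_triangle (f y - f x) (f x)).
  assert (h2 := Cmod_triangle (f x - f y) (f y)).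
  replace (f y - f x + f x) with (f y) in h1 by ring.
  replace (f x - f y + f y) with (f x) in h2 by ring.
  rewrite <- (Cmod_opp (f x - f y)) in h2.
  replace (- (f x - f y)) with (f y - f x) in h2 by ring.
  apply Rabs_le; lra.
Qed.

Lemma continuous_Rcomp {T : UniformSpace} (h : R -> R) (f : T -> R) (x : T) :
  continuous (U := R_UniformSpace) f x -> continuity_pt h (f x) ->
  continuous (U := R_UniformSpace) (fun y => h (f y)) x.
Proof.
  intros hf hh; apply (continuous_comp f h); [exact hf|].
  apply continuity_pt_filterlim, hh.
Qed.

Lemma continuous_Cexp {T : UniformSpace} (f : T -> C) (x : T) :
  continuous (U := CU) f x -> continuous (U := CU) (fun y => Cexp (f y)) x.
Proof.
  intros h; pose proof (continuous_Re _ _ h); pose proof (continuous_Im _ _ h).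
  apply continuous_Cpair; apply continuous_Rmult; apply continuous_Rcomp; auto;
    apply derivable_continuous_pt;
    (apply derivable_pt_exp || apply derivable_pt_cos || apply derivable_pt_sin).
Qed.

Lemma continuous_pair {T U V : UniformSpace} (f : T -> U) (g : T -> V) (x : T) :
  continuous f x -> continuous g x -> continuous (fun y => (f y, g y)) x.
Proof.
  intros hf hg P [e hP].
  pose proof (hf _ (locally_ball (f x) e)) as h1.
  pose proof (hg _ (locally_ball (g x) e)) as h2.
  unfold filtermap in *; generalize (filter_and _ _ h1 h2); apply filter_imp.
  intros y [a b]; apply hP; split; assumption.
Qed.

Lemma continuous_uncurry {T U V W : UniformSpace} (F : U -> V -> W)
    (f : T -> U) (g : T -> V) (x : T) :
  continuous f x -> continuous g x ->
  continuous (fun p => F (fst p) (snd p)) (f x, g x) ->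
  continuous (fun y => F (f y) (g y)) x.
Proof.
  intros hf hg hF.
  apply (continuous_comp (fun y => (f y, g y)) (fun p => F (fst p) (snd p))); [|exact hF].
  apply continuous_pair; assumption.
Qed.

Lemma continuous_fst_pt {U V : UniformSpace} (p : U * V) :
  continuous (T := prod_UniformSpace U V) (U := U) (fun q => fst q) p.
Proof. destruct p; apply (continuous_fst (U := U) (V := V)). Qed.

Lemma continuous_snd_pt {U V : UniformSpace} (p : U * V) :
  continuous (T := prod_UniformSpace U V) (U := V) (fun q => snd q) p.
Proof. destruct p; apply (continuous_snd (U := U) (V := V)). Qed.

Lemma continuous_fst_of {T U V : UniformSpace} (f : T -> U * V) (x : T) :
  continuous (U := prod_UniformSpace U V) f x -> continuous (fun y => fst (f y)) x.
Proof.
  intros h; apply (continuous_comp (V := prod_UniformSpace U V) f fst); [exact h|].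
  apply continuous_fst_pt.
Qed.

Lemma continuous_snd_of {T U V : UniformSpace} (f : T -> U * V) (x : T) :
  continuous (U := prod_UniformSpace U V) f x -> continuous (fun y => snd (f y)) x.
Proof.
  intros h; apply (continuous_comp (V := prod_UniformSpace U V) f snd); [exact h|].
  apply continuous_snd_pt.
Qed.

Ltac cont_step := lazymatch goal with
  | |- continuous (fun _ => ?c) _ => apply continuous_const
  | |- continuous (fun x => x) _ => apply continuous_id
  | |- continuous (fun x => fst x) _ => apply continuous_fst_pt
  | |- continuous fst _ => apply continuous_fst_pt
  | |- continuous snd _ => apply continuous_snd_pt
  | |- continuous (fun x => snd x) _ => apply continuous_snd_pt
  | |- continuous (fun x => fst (@?f x)) _ => apply (continuous_fst_of f)
  | |- continuous (fun x => snd (@?f x)) _ => apply (continuous_snd_of f)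
  | |- continuous (fun x => @?f x + @?g x) _ => apply (continuous_Cplus f g)
  | |- continuous (fun x => @?f x - @?g x) _ => apply (continuous_Cminus f g)
  | |- continuous (fun x => @?f x * @?g x) _ => apply (continuous_Cmult f g)
  | |- continuous (fun x => @?f x / @?g x) _ => apply (continuous_Cdiv f g)
  | |- continuous (fun x => - @?f x) _ => apply (continuous_Copp f)
  | |- continuous (fun x => / @?f x) _ => apply (continuous_Cinv f)
  | |- continuous (fun x => (@?f x) ^ ?n) _ => apply (continuous_Cpow f n)
  | |- continuous (fun x => Cexp (@?f x)) _ => apply (continuous_Cexp f)
  | |- continuous (fun x => RtoC (@?f x)) _ => apply (continuous_RtoC f)
  | |- continuous (fun x => Re (@?f x)) _ => apply (continuous_Re f)
  | |- continuous (fun x => Im (@?f x)) _ => apply (continuous_Im f)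
  | |- continuous (fun x => Cmod (@?f x)) _ => apply (continuous_Cmod f)
  | |- continuous (fun x => (@?f x + @?g x)%R) _ => apply (continuous_Rplus f g)
  | |- continuous (fun x => (@?f x - @?g x)%R) _ => apply (continuous_Rminus f g)
  | |- continuous (fun x => (@?f x * @?g x)%R) _ => apply (continuous_Rmult f g)
  | |- continuous (fun x => (- @?f x)%R) _ => apply (continuous_Ropp f)
  end.

Ltac cont := repeat (assumption || cont_step).

(* Tube lemma: an open condition on {x0} x [a,b] holds on a neighbourhood of x0
   uniformly in the compact variable. *)
Lemma locally_forall_segment {X : UniformSpace} (x0 : X) (a b : R) (P : X -> R -> Prop) :
  (forall t, (a <= t <= b)%R ->
     locally (T := prod_UniformSpace X R_UniformSpace) (x0, t) (fun p => P (fst p) (snd p))) ->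
  locally x0 (fun x => forall t, (a <= t <= b)%R -> P x t).
Proof.
  intros h.
  (* Choice and the compactness lemma take a gauge defined on all reals; outside the segment its
     value is an arbitrary 1. *)
  assert (hd : forall t : R, exists d : posreal, (a <= t <= b)%R ->
     forall x u, ball x0 d x -> ball (M := R_UniformSpace) t d u -> P x u).
  { intros t; destruct (classic (a <= t <= b)%R) as [ht|ht].
    - destruct (h t ht) as [d hd]; exists d; intros _ x u hx hu.
      apply (hd (x, u)); split; assumption.
    - exists (mkposreal 1 Rlt_0_1); tauto. }
  apply functional_choice in hd; destruct hd as [dl hdl].
  (* This gives one [d] such that each [t] of the segment lies within [dl u] of some [u] with
     [d <= dl u], but under a double negation; hence the classical step below. *)
  assert (hc := compactness_value_1d a b dl).
  destruct hc as [d hd].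
  exists d; intros x hx t ht.
  apply NNPP; intros hn; apply (hd t ht).
  intros [u [hu1 [hu2 hu3]]]; apply hn.
  apply (hdl u hu1 x t); [|exact hu2].
  apply ball_le with (2 := hx); exact hu3.
Qed.

(** * Complex derivatives and integrals over segments *)

Definition CInt (f : R -> C) (a b : R) : C := RInt (V := C_R_CompleteNormedModule) f a b.

Definition segcont (f : R -> C) (a b : R) : Prop :=
  forall t, (a <= t <= b)%R -> continuous (U := CU) f t.

Lemma CInt_correct (f : R -> C) (a b : R) :
  (a <= b)%R -> segcont f a b ->
  is_RInt (V := C_R_NormedModule) f a b (CInt f a b).
Proof.
  intros hab hf; apply (RInt_correct (V := C_R_CompleteNormedModule)).
  apply (ex_RInt_continuous (V := C_R_CompleteNormedModule)).
  intros z; rewrite Rmin_left, Rmax_right by exact hab; apply hf.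
Qed.

Lemma CInt_unique (f : R -> C) (a b : R) (l : C) :
  is_RInt (V := C_R_NormedModule) f a b l -> CInt f a b = l.
Proof. apply (is_RInt_unique (V := C_R_CompleteNormedModule)). Qed.

Lemma CInt_ext (f g : R -> C) (a b : R) :
  (a <= b)%R -> (forall t, (a <= t <= b)%R -> f t = g t) -> CInt f a b = CInt g a b.
Proof.
  intros hab h; apply (RInt_ext (V := C_R_CompleteNormedModule)).
  intros t; rewrite Rmin_left, Rmax_right by exact hab; intros ht; apply h; lra.
Qed.

Lemma CInt_plus (f g : R -> C) (a b : R) :
  (a <= b)%R -> segcont f a b -> segcont g a b ->
  CInt (fun t => f t + g t) a b = CInt f a b + CInt g a b.
Proof.
  intros hab hf hg; apply CInt_unique.
  apply (is_RInt_plus (V := C_R_NormedModule)); apply CInt_correct; assumption.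
Qed.

Lemma CInt_Cmult (c : C) (f : R -> C) (a b : R) :
  (a <= b)%R -> segcont f a b ->
  CInt (fun t => c * f t) a b = c * CInt f a b.
Proof.
  intros hab hf; apply CInt_unique.
  pose proof (CInt_correct f a b hab hf) as h; set (l := CInt f a b) in *; clearbody l.
  pose proof (is_RInt_fct_extend_fst (U := R_NormedModule) (V := R_NormedModule) f a b l h) as h1.
  pose proof (is_RInt_fct_extend_snd (U := R_NormedModule) (V := R_NormedModule) f a b l h) as h2.
  apply (is_RInt_fct_extend_pair (U := R_NormedModule) (V := R_NormedModule)).
  - apply (is_RInt_minus (V := R_NormedModule));
      apply (is_RInt_scal (V := R_NormedModule)); assumption.
  - apply (is_RInt_plus (V := R_NormedModule));
      apply (is_RInt_scal (V := R_NormedModule)); assumption.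
Qed.

Lemma CInt_minus (f g : R -> C) (a b : R) :
  (a <= b)%R -> segcont f a b -> segcont g a b ->
  CInt (fun t => f t - g t) a b = CInt f a b - CInt g a b.
Proof.
  intros hab hf hg; apply CInt_unique.
  apply (is_RInt_minus (V := C_R_NormedModule)); apply CInt_correct; assumption.
Qed.

Lemma CInt_const (c : C) (a b : R) : CInt (fun _ => c) a b = RtoC (b - a) * c.
Proof.
  apply CInt_unique. rewrite <- scal_R_Cmult.
  apply (is_RInt_const (V := C_R_NormedModule)).
Qed.

Lemma CInt_Chasles (f : R -> C) (a b c : R) :
  (a <= b)%R -> (b <= c)%R -> segcont f a c ->
  CInt f a c = CInt f a b + CInt f b c.
Proof.
  intros hab hbc hf; apply CInt_unique.
  apply (is_RInt_Chasles (V := C_R_NormedModule)) with b; apply CInt_correct;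
    try assumption; intros t ht; apply hf; lra.
Qed.

Lemma Cmod_CInt_le_RInt (f : R -> C) (g : R -> R) (a b l : R) :
  (a <= b)%R -> segcont f a b ->
  (forall t, (a <= t <= b)%R -> (Cmod (f t) <= g t)%R) ->
  is_RInt (V := R_NormedModule) g a b l ->
  (Cmod (CInt f a b) <= l)%R.
Proof.
  intros hab hf hg hl; rewrite Cmod_norm.
  apply (norm_RInt_le (V := C_R_NormedModule) f g a b); try assumption.
  - intros t ht; specialize (hg t ht); rewrite Cmod_norm in hg; exact hg.
  - apply CInt_correct; assumption.
Qed.

Lemma Cmod_CInt_le (f : R -> C) (a b M : R) :
  (a <= b)%R -> segcont f a b ->
  (forall t, (a <= t <= b)%R -> (Cmod (f t) <= M)%R) ->
  (Cmod (CInt f a b) <= (b - a) * M)%R.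
Proof.
  intros hab hf hM; apply (Cmod_CInt_le_RInt f (fun _ => M)); try assumption.
  apply (is_RInt_const (V := R_NormedModule)).
Qed.

(* Caratheodory's form of the complex derivative (and of the derivative of a
   curve), chosen because it turns the differentiation rules into continuity
   statements. *)
Definition cder (f : C -> C) (z l : C) : Prop :=
  exists phi : C -> C, continuous (U := CU) phi z /\ phi z = l /\
    locally (T := CU) z (fun y => f y - f z = phi y * (y - z)).

Definition rder (c : R -> C) (t : R) (l : C) : Prop :=
  exists phi : R -> C, continuous (U := CU) phi t /\ phi t = l /\
    locally (T := R_UniformSpace) t (fun u => c u - c t = phi u * RtoC (u - t)).

Lemma cder_is_derive (f : C -> C) (z l : C) :
  cder f z l -> is_derive (K := C_AbsRing) (V := C_NormedModule) f z l.
Proof.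
  intros [phi [hc [hl he]]]; split.
  - apply is_linear_scal_l.
  - intros x hx.
    apply (is_filter_lim_locally_unique (K := C_AbsRing) (V := AbsRing_NormedModule C_AbsRing)) in hx.
    subst x; intros e.
    pose proof (continuous_locally_C phi z e hc (cond_pos e)) as h1.
    apply (proj1 (locally_C _ _)).
    generalize (filter_and _ _ he h1); apply filter_imp; intros y [a b].
    change (Cmod (f y - f z - (y - z) * l) <= e * Cmod (y - z))%R.
    rewrite a, <- hl.
    replace (phi y * (y - z) - (y - z) * phi z) with ((phi y - phi z) * (y - z)) by ring.
    rewrite Cmod_mult; apply Rmult_le_compat_r; [apply Cmod_ge_0|lra].
Qed.

Lemma cder_C_derive (f : C -> C) (z l : C) : cder f z l -> C_derive f z = l.
Proof. intros h; apply is_C_derive_unique, cder_is_derive, h. Qed.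

Lemma rder_is_derive (f : R -> C) (z : R) (l : C) :
  rder f z l -> is_derive (K := R_AbsRing) (V := C_R_NormedModule) f z l.
Proof.
  intros [phi [hc [hl he]]]; split.
  - apply is_linear_scal_l.
  - intros x hx.
    apply (is_filter_lim_locally_unique (K := R_AbsRing) (V := R_NormedModule)) in hx.
    subst x; intros e.
    pose proof (continuous_locally_C phi z e hc (cond_pos e)) as h1.
    generalize (filter_and _ _ he h1); apply filter_imp; intros y [a b].
    assert (hh : (Cmod (f y - f z - RtoC (y - z) * l) <= e * Rabs (y - z))%R).
    { rewrite a, <- hl.
      replace (phi y * RtoC (y - z) - RtoC (y - z) * phi z)
        with ((phi y - phi z) * RtoC (y - z)) by ring.
      rewrite Cmod_mult, Cmod_R; apply Rmult_le_compat_r; [apply Rabs_pos|lra]. }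
    rewrite Cmod_norm in hh.
    rewrite <- scal_R_Cmult in hh. exact hh.
Qed.

Lemma CInt_FTC (F f : R -> C) (a b : R) :
  (a <= b)%R -> (forall t, (a <= t <= b)%R -> rder F t (f t)) -> segcont f a b ->
  CInt f a b = F b - F a.
Proof.
  intros hab hF hf; apply CInt_unique.
  apply (is_RInt_derive (V := C_R_CompleteNormedModule));
    rewrite Rmin_left, Rmax_right by exact hab.
  - intros t ht; apply rder_is_derive, hF, ht.
  - intros t ht; apply hf, ht.
Qed.

Lemma locally_continuous_comp {X Y : UniformSpace} (m : X -> Y) (x : X) (Q : Y -> Prop) :
  continuous m x -> locally (m x) Q -> locally x (fun u => Q (m u)).
Proof. intros h1 h2; exact (h1 Q h2). Qed.

Lemma cder_const (c z : C) : cder (fun _ => c) z 0.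
Proof.
  exists (fun _ => 0); split; [cont|split; [reflexivity|]].
  apply filter_forall; intros y; ring.
Qed.

Lemma cder_id (z : C) : cder (fun y => y) z 1.
Proof.
  exists (fun _ => 1); split; [cont|split; [reflexivity|]].
  apply filter_forall; intros y; ring.
Qed.

Lemma cder_continuous (f : C -> C) (z l : C) : cder f z l -> continuous (U := CU) f z.
Proof.
  intros [phi [hc [hl he]]].
  apply (continuous_ext_loc (T := CU) (U := CU)) with (fun y => f z + phi y * (y - z)).
  - generalize he; apply filter_imp; intros y hy; rewrite <- hy; Cring.
  - cont.
Qed.

Lemma rder_continuous (f : R -> C) (z : R) (l : C) : rder f z l -> continuous (U := CU) f z.
Proof.
  intros [phi [hc [hl he]]].
  apply (continuous_ext_loc (T := R_UniformSpace) (U := CU))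
    with (fun y => f z + phi y * RtoC (y - z)).
  - generalize he; apply filter_imp; intros y hy; rewrite <- hy; Cring.
  - cont.
Qed.

Lemma cder_plus (f g : C -> C) (z l m : C) :
  cder f z l -> cder g z m -> cder (fun y => f y + g y) z (l + m).
Proof.
  intros [p [hp [hl he]]] [q [hq [hm hf]]].
  exists (fun y => p y + q y); split; [cont|split; [congruence|]].
  generalize (filter_and _ _ he hf); apply filter_imp; intros y [a b].
  replace (f y + g y - (f z + g z)) with ((f y - f z) + (g y - g z)) by ring.
  rewrite a, b; ring.
Qed.

Lemma cder_mult (f g : C -> C) (z l m : C) :
  cder f z l -> cder g z m -> cder (fun y => f y * g y) z (l * g z + f z * m).
Proof.
  intros [p [hp [hl he]]] hg.
  pose proof (cder_continuous _ _ _ hg) as hgc.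
  destruct hg as [q [hq [hm hf]]].
  exists (fun y => p y * g y + f z * q y); split; [cont|split; [congruence|]].
  generalize (filter_and _ _ he hf); apply filter_imp; intros y [a b].
  replace (f y * g y - f z * g z) with ((f y - f z) * g y + f z * (g y - g z)) by ring.
  rewrite a, b; ring.
Qed.

Lemma cder_ext_loc (f g : C -> C) (z l : C) :
  locally (T := CU) z (fun y => f y = g y) -> cder f z l -> cder g z l.
Proof.
  intros h [p [hp [hl he]]]; exists p; split; [exact hp|split; [exact hl|]].
  assert (hz : f z = g z) by (apply (locally_singleton z _ h)).
  generalize (filter_and _ _ he h); apply filter_imp; intros y [a b].
  rewrite <- b, <- hz; exact a.
Qed.

Lemma cder_eq (f : C -> C) (z l m : C) : cder f z l -> l = m -> cder f z m.
Proof. intros h <-; exact h. Qed.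

Lemma rder_eq (f : R -> C) (z : R) (l m : C) : rder f z l -> l = m -> rder f z m.
Proof. intros h <-; exact h. Qed.

Lemma cder_comp (f g : C -> C) (z l m : C) :
  cder f z m -> cder g (f z) l -> cder (fun y => g (f y)) z (l * m).
Proof.
  intros hf; pose proof (cder_continuous _ _ _ hf) as hc; destruct hf as [p [hp [hl he]]].
  intros [q [hq [hm hg]]].
  exists (fun y => q (f y) * p y); split; [|split; [congruence|]].
  - apply continuous_Cmult; [|exact hp].
    apply (continuous_comp (U := CU) (V := CU) f q); assumption.
  - pose proof (locally_continuous_comp (X := CU) (Y := CU) f z _ hc hg) as h2.
    generalize (filter_and _ _ he h2); apply filter_imp; intros y [a b].
    rewrite b, a; ring.
Qed.

Lemma rder_comp (c : R -> C) (g : C -> C) (t : R) (l m : C) :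
  rder c t m -> cder g (c t) l -> rder (fun u => g (c u)) t (l * m).
Proof.
  intros hf; pose proof (rder_continuous _ _ _ hf) as hc; destruct hf as [p [hp [hl he]]].
  intros [q [hq [hm hg]]].
  exists (fun y => q (c y) * p y); split; [|split; [congruence|]].
  - apply continuous_Cmult; [|exact hp].
    apply (continuous_comp (V := CU) c q); assumption.
  - pose proof (locally_continuous_comp (X := R_UniformSpace) (Y := CU) c t _ hc hg) as h2.
    generalize (filter_and _ _ he h2); apply filter_imp; intros y [a b].
    rewrite b, a; ring.
Qed.

Lemma rder_affine (c d : C) (t : R) : rder (fun u => c + RtoC u * d) t d.
Proof.
  exists (fun _ => d); split; [cont|split; [reflexivity|]].
  apply filter_forall; intros u; rewrite RtoC_minus; ring.
Qed.

Lemma cder_opp (f : C -> C) (z l : C) : cder f z l -> cder (fun y => - f y) z (- l).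
Proof.
  intros h; apply cder_ext_loc with (f := fun y => (- (1)) * f y).
  - apply filter_forall; intros y; ring.
  - eapply cder_eq; [apply cder_mult; [apply cder_const|exact h]|cbv beta; ring].
Qed.

Lemma cder_minus (f g : C -> C) (z l m : C) :
  cder f z l -> cder g z m -> cder (fun y => f y - g y) z (l - m).
Proof. intros h1 h2; apply cder_plus; [exact h1|apply cder_opp, h2]. Qed.

Lemma locally_neq_0 {T : UniformSpace} (f : T -> C) (x : T) :
  continuous (U := CU) f x -> f x <> 0 -> locally x (fun y => f y <> 0).
Proof.
  intros h h0; pose proof (proj1 (Cmod_gt_0 _) h0) as hp.
  generalize (continuous_locally_C f x _ h hp); apply filter_imp; intros y hy he.
  rewrite he in hy. replace (0 - f x) with (- f x) in hy by ring.
  rewrite Cmod_opp in hy; lra.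
Qed.

Lemma cder_inv (f : C -> C) (z l : C) :
  cder f z l -> f z <> 0 -> cder (fun y => / f y) z (- l / (f z * f z)).
Proof.
  intros hf h0; pose proof (cder_continuous _ _ _ hf) as hc; destruct hf as [p [hp [hl he]]].
  exists (fun y => - p y / (f y * f z)); split; [|split; [congruence|]].
  - cont. apply Cmult_neq_0; assumption.
  - generalize (filter_and _ _ he (locally_neq_0 (T := CU) f z hc h0)).
    apply filter_imp; intros y [a b].
    replace (/ f y - / f z) with (- (f y - f z) / (f y * f z)) by (field; auto).
    rewrite a; field; auto.
Qed.

Lemma cder_pow (f : C -> C) (n : nat) (z l : C) :
  cder f z l -> cder (fun y => f y ^ n) z (INR n * f z ^ (n - 1) * l).
Proof.
  intros h; induction n as [|n IH].
  - simpl; eapply cder_eq; [apply cder_const|ring].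
  - change (fun y => f y ^ S n) with (fun y => f y * f y ^ n).
    eapply cder_eq; [apply cder_mult; [exact h|exact IH]|].
    rewrite S_INR, RtoC_plus; replace (S n - 1)%nat with n by lia.
    destruct n as [|n]; [simpl; ring|].
    replace (S n - 1)%nat with n by lia. rewrite Cpow_S; ring.
Qed.

(** * Integrals depending on a parameter *)

Definition jointly_continuous {X Y Z : UniformSpace} (F : X -> Y -> Z) (p : X * Y) : Prop :=
  continuous (T := prod_UniformSpace X Y) (fun q => F (fst q) (snd q)) p.

Lemma continuous_section {X Y Z : UniformSpace} (F : X -> Y -> Z) (x : X) (y : Y) :
  jointly_continuous F (x, y) -> continuous (F x) y.
Proof.
  intros h; apply (continuous_uncurry F (fun _ => x) (fun y => y)); auto.
  apply continuous_const. apply continuous_id.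
Qed.

Lemma continuous_section_l {X Y Z : UniformSpace} (F : X -> Y -> Z) (x : X) (y : Y) :
  jointly_continuous F (x, y) -> continuous (fun x => F x y) x.
Proof.
  intros h; apply (continuous_uncurry F (fun x => x) (fun _ => y)); auto.
  apply continuous_id. apply continuous_const.
Qed.

(** Tube lemma: joint continuity near all of [{x0} x [a, b]] makes [F x], for every [x] close to
    [x0], continuous and uniformly close to [F x0] on the segment. *)
Lemma continuous_CInt_param {X : UniformSpace} (F : X -> R -> C) (x0 : X) (a b : R) :
  (a <= b)%R ->
  (forall t, (a <= t <= b)%R -> locally (T := prod_UniformSpace X R_UniformSpace) (x0, t)
     (jointly_continuous (Y := R_UniformSpace) (Z := CU) F)) ->
  continuous (U := CU) (fun x => CInt (F x) a b) x0.
Proof.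
  intros hab h; apply continuous_C_Cmod; intros e he.
  (* The 1 in the denominator allows [a = b]; the final bound is then [e - e / (b - a + 1)],
     strictly below [e]. *)
  set (e' := (e / (b - a + 1) / 2)%R).
  assert (he1 : (0 < e / (b - a + 1))%R) by (apply Rdiv_lt_0_compat; lra).
  assert (he' : (0 < e')%R) by (unfold e'; lra).
  assert (hc : forall x, (forall t, (a <= t <= b)%R ->
      jointly_continuous (Y := R_UniformSpace) (Z := CU) F (x, t)) -> segcont (F x) a b).
  { intros x hx t ht; apply (continuous_section (Y := R_UniformSpace) (Z := CU)), hx, ht. }
  assert (h1 : locally x0 (fun x => forall t, (a <= t <= b)%R ->
     jointly_continuous (Y := R_UniformSpace) (Z := CU) F (x, t))).
  { apply (locally_forall_segment x0 a b (fun x t =>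
     jointly_continuous (Y := R_UniformSpace) (Z := CU) F (x, t))).
    intros t ht; generalize (h t ht); apply filter_imp; intros [x u] hx; exact hx. }
  pose proof (locally_singleton _ _ h1) as h10; simpl in h10.
  assert (h2 : locally x0 (fun x => forall t, (a <= t <= b)%R ->
     (Cmod (F x t - F x0 t) < 2 * e')%R)).
  { apply (locally_forall_segment x0 a b (fun x t => (Cmod (F x t - F x0 t) < 2 * e')%R)).
    intros t ht; specialize (h10 t ht).
    pose proof (continuous_locally_C _ _ _ h10 he') as h3; simpl in h3.
    pose proof (hc x0 (locally_singleton _ _ h1) t ht) as h4.
    pose proof (continuous_locally_C _ _ _ h4 he') as h5.
    assert (h6 : continuous (T := prod_UniformSpace X R_UniformSpace) (U := R_UniformSpace)
               snd (x0, t)) by apply continuous_snd.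
    pose proof (locally_continuous_comp _ _ _ h6 h5) as h7.
    generalize (filter_and _ _ h3 h7); apply filter_imp; intros [x u] [p q]; simpl in *.
    replace (F x u - F x0 u) with ((F x u - F x0 t) - (F x0 u - F x0 t)) by ring.
    eapply Rle_lt_trans; [apply Cmod_triangle|]; rewrite Cmod_opp; lra. }
  generalize (filter_and _ _ h1 h2); apply filter_imp; intros x [p q].
  rewrite <- CInt_minus; [|exact hab|apply hc, p|apply hc, h10].
  apply Rle_lt_trans with ((b - a) * (2 * e'))%R.
  - apply Cmod_CInt_le; [exact hab| |].
    + intros t ht; apply continuous_Cminus; [apply (hc x p t ht)|apply (hc x0 h10 t ht)].
    + intros t ht; left; apply q, ht.
  - unfold e'; replace ((b - a) * (2 * (e / (b - a + 1) / 2)))%R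
      with (e - e / (b - a + 1))%R by (field; lra). lra.
Qed.

Lemma Cball_segment (z0 z : C) (d t : R) :
  (0 <= t <= 1)%R -> (Cmod (z - z0) < d)%R -> (Cmod (z0 + RtoC t * (z - z0) - z0) < d)%R.
Proof.
  intros ht h. replace (z0 + RtoC t * (z - z0) - z0) with (RtoC t * (z - z0)) by ring.
  rewrite Cmod_mult, Cmod_R, Rabs_right by lra.
  pose proof (Cmod_ge_0 (z - z0)); nra.
Qed.

Lemma locally_prod_ball {X Y : UniformSpace} (x : X) (y : Y) (P : X * Y -> Prop) :
  locally (T := prod_UniformSpace X Y) (x, y) P ->
  exists d : posreal, forall u v, ball x d u -> ball y d v -> P (u, v).
Proof. intros [d hd]; exists d; intros u v hu hv; apply hd; split; assumption. Qed.

Lemma ball_C_segment (z0 z : C) (d t : R) :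
  (0 <= t <= 1)%R -> ball (M := CU) z0 d z -> ball (M := CU) z0 d (z0 + RtoC t * (z - z0)).
Proof.
  intros ht [h1 h2]; split.
  - unfold ball in *; simpl in *; unfold AbsRing_ball, abs, minus, plus, opp in *; simpl in *.
    replace (fst z0 + (t * (fst z + - fst z0) - 0 * (snd z + - snd z0)) + - fst z0)%R
      with (t * (fst z + - fst z0))%R by ring.
    rewrite Rabs_mult, (Rabs_right t) by lra. pose proof (Rabs_pos (fst z + - fst z0)); nra.
  - unfold ball in *; simpl in *; unfold AbsRing_ball, abs, minus, plus, opp in *; simpl in *.
    replace (snd z0 + (t * (snd z + - snd z0) + 0 * (fst z + - fst z0)) + - snd z0)%R
      with (t * (snd z + - snd z0))%R by ring.
    rewrite Rabs_mult, (Rabs_right t) by lra. pose proof (Rabs_pos (snd z + - snd z0)); nra.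
Qed.

(** The fundamental theorem along the segment from [z0] to [z]. The integral is the slope of [f] in
    Caratheodory's sense, in a form whose continuity in further parameters is easy to obtain. *)
Lemma cder_increment (f f' : C -> C) (z0 z : C) :
  (forall t, (0 <= t <= 1)%R -> cder f (z0 + RtoC t * (z - z0)) (f' (z0 + RtoC t * (z - z0))) /\
      continuous (T := CU) (U := CU) f' (z0 + RtoC t * (z - z0))) ->
  f z - f z0 = CInt (fun t => f' (z0 + RtoC t * (z - z0))) 0 1 * (z - z0).
Proof.
  intros h.
  assert (hs : segcont (fun t => f' (z0 + RtoC t * (z - z0))) 0 1).
  { intros t ht; apply (continuous_comp (V := CU) (fun t => z0 + RtoC t * (z - z0)) f').
    - cont.
    - apply h, ht. }
  rewrite Cmult_comm, <- CInt_Cmult by (lra || exact hs).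
  rewrite (CInt_FTC (fun t => f (z0 + RtoC t * (z - z0)))).
  - f_equal; [f_equal; ring|]. f_equal. f_equal. ring.
  - lra.
  - intros t ht; eapply rder_eq.
    + apply rder_comp; [apply rder_affine|apply h, ht].
    + ring.
  - intros t ht; apply continuous_Cmult; [cont|apply hs, ht].
Qed.

(** Differentiation under the integral sign. The slope of the integral is the integral over [t] of
    [K], the mean of [F'] over the segment from [z0] to [z], so the claim reduces to the continuity
    of a double integral. *)
Lemma cder_CInt (F F' : C -> R -> C) (a b : R) (z0 : C) :
  (a <= b)%R ->
  (forall t, (a <= t <= b)%R -> locally (T := prod_UniformSpace CU R_UniformSpace) (z0, t)
     (fun p => jointly_continuous (X := CU) (Y := R_UniformSpace) (Z := CU) F p /\
               jointly_continuous (X := CU) (Y := R_UniformSpace) (Z := CU) F' p /\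
               cder (fun z => F z (snd p)) (fst p) (F' (fst p) (snd p)))) ->
  cder (fun z => CInt (F z) a b) z0 (CInt (F' z0) a b).
Proof.
  intros hab h.
  pose (K := fun (z : C) (t : R) => CInt (fun tau => F' (z0 + RtoC tau * (z - z0)) t) 0 1).
  assert (hK : forall t, (a <= t <= b)%R ->
     locally (T := prod_UniformSpace CU R_UniformSpace) (z0, t)
     (jointly_continuous (X := CU) (Y := R_UniformSpace) (Z := CU) K)).
  { intros t ht.
    pose proof (locally_locally _ _ (h t ht)) as hl.
    apply (locally_prod_ball (X := CU) (Y := R_UniformSpace)) in hl.
    destruct hl as [d hd].
    exists d; intros [z u] [hz hu]; simpl in hz, hu.
    unfold jointly_continuous, K.
    apply (continuous_CInt_param (X := prod_UniformSpace CU R_UniformSpace)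
       (fun p tau => F' (z0 + RtoC tau * (fst p - z0)) (snd p)) (z, u) 0 1); [lra|].
    intros tau htau.
    pose (m := fun q : (C * R) * R => (z0 + RtoC (snd q) * (fst (fst q) - z0), snd (fst q))).
    assert (hm : forall q, continuous
       (T := prod_UniformSpace (prod_UniformSpace CU R_UniformSpace) R_UniformSpace)
       (U := prod_UniformSpace CU R_UniformSpace) m q).
    { intros q; apply (continuous_pair (T := prod_UniformSpace
         (prod_UniformSpace CU R_UniformSpace) R_UniformSpace) (U := CU) (V := R_UniformSpace)).
      - cont.
      - cont. }
    assert (hloc := hd (z0 + RtoC tau * (z - z0)) u (ball_C_segment _ _ _ _ htau hz) hu).
    pose proof (locally_continuous_comp
       (X := prod_UniformSpace (prod_UniformSpace CU R_UniformSpace) R_UniformSpace)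
       (Y := prod_UniformSpace CU R_UniformSpace) m ((z, u), tau) _ (hm _) hloc) as h2.
    generalize h2; apply filter_imp; intros q [_ [hq _]].
    unfold jointly_continuous in *.
    exact (continuous_comp
      (U := prod_UniformSpace (prod_UniformSpace CU R_UniformSpace) R_UniformSpace)
      (V := prod_UniformSpace CU R_UniformSpace) (W := CU) m
      (fun p => F' (fst p) (snd p)) q (hm q) hq). }
  exists (fun z => CInt (K z) a b); split; [|split].
  - apply (continuous_CInt_param (X := CU)); [exact hab|exact hK].
  - apply CInt_ext; [exact hab|]; intros t ht; unfold K.
    replace (F' z0 t) with (RtoC (1 - 0) * F' z0 t)
      by (rewrite RtoC_minus; ring).
    rewrite <- CInt_const; apply CInt_ext; [lra|]; intros tau _.
    f_equal; ring.
  - assert (ht : locally (T := CU) z0 (fun z => forall t, (a <= t <= b)%R ->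
       jointly_continuous (X := CU) (Y := R_UniformSpace) (Z := CU) F (z, t) /\
       jointly_continuous (X := CU) (Y := R_UniformSpace) (Z := CU) F' (z, t) /\
       jointly_continuous (X := CU) (Y := R_UniformSpace) (Z := CU) K (z, t) /\
       cder (fun z => F z t) z (F' z t))).
    { apply (locally_forall_segment (X := CU) z0 a b (fun z t =>
       jointly_continuous (X := CU) (Y := R_UniformSpace) (Z := CU) F (z, t) /\
       jointly_continuous (X := CU) (Y := R_UniformSpace) (Z := CU) F' (z, t) /\
       jointly_continuous (X := CU) (Y := R_UniformSpace) (Z := CU) K (z, t) /\
       cder (fun z => F z t) z (F' z t))).
      intros t ht; generalize (filter_and _ _ (h t ht) (hK t ht)).
      apply filter_imp; intros [z u]; simpl; tauto. }
    apply locally_C_Cmod in ht; destruct ht as [d [hd ht]].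
    apply locally_C_Cmod; exists d; split; [exact hd|]; intros z hz.
    assert (hz0 : (Cmod (z0 - z0) < d)%R).
    { replace (z0 - z0) with (RtoC 0) by ring; rewrite Cmod_0; exact hd. }
    assert (hsF : forall y, (Cmod (y - z0) < d)%R -> segcont (F y) a b).
    { intros y hy t htt; apply (continuous_section (X := CU) (Y := R_UniformSpace) (Z := CU)).
      apply (ht y hy t htt). }
    rewrite <- CInt_minus; [|exact hab|apply hsF, hz|apply hsF, hz0].
    rewrite Cmult_comm, <- CInt_Cmult.
    + apply CInt_ext; [exact hab|]; intros t htt.
      rewrite (cder_increment (fun z => F z t) (fun z => F' z t) z0 z).
      * unfold K; ring.
      * intros tau htau.
        destruct (ht _ (Cball_segment z0 z d tau htau hz) t htt) as [_ [p [_ q]]].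
        split; [exact q|].
        apply (continuous_section_l (X := CU) (Y := R_UniformSpace) (Z := CU)), p.
    + exact hab.
    + intros t htt; apply (continuous_section (X := CU) (Y := R_UniformSpace) (Z := CU)).
      apply (ht z hz t htt).
Qed.

Notation RU := R_UniformSpace.

Notation jcCR := (jointly_continuous (X := CU) (Y := RU) (Z := CU)).

(** Proved in real coordinates, because it is what makes the slope of [Cexp] explicit: the
    derivative [cder_Cexp] rests on it. *)
Lemma CInt_Cexp_segment (h : C) : CInt (fun t => h * Cexp (RtoC t * h)) 0 1 = Cexp h - 1.
Proof.
  apply CInt_unique.
  apply (is_RInt_fct_extend_pair (U := R_NormedModule) (V := R_NormedModule)
    (fun t => h * Cexp (RtoC t * h))).
  - destruct h as [x y]; unfold Cexp; Creduce.
    replace (exp x * cos y + - (1))%R with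
      (minus (exp (1 * x) * cos (1 * y)) (exp (0 * x) * cos (0 * y)))%R.
    2:{ unfold minus, plus, opp; simpl. rewrite !Rmult_1_l, !Rmult_0_l, exp_0, cos_0; ring. }
    refine (is_RInt_derive (V := R_CompleteNormedModule)
      (fun t => exp (t * x) * cos (t * y))%R _ 0 1 _ _).
    + intros t _; auto_derive; [exact I|].
      replace (t * x - 0 * y)%R with (t * x)%R by ring.
      replace (t * y + 0 * x)%R with (t * y)%R by ring. ring.
    + intros t _; apply (ex_derive_continuous (V := R_NormedModule)); auto_derive; exact I.
  - destruct h as [x y]; unfold Cexp; Creduce.
    replace (exp x * sin y + - 0)%R with
      (minus (exp (1 * x) * sin (1 * y)) (exp (0 * x) * sin (0 * y)))%R.
    2:{ unfold minus, plus, opp; simpl. rewrite !Rmult_1_l, !Rmult_0_l, exp_0, sin_0; ring. }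
    refine (is_RInt_derive (V := R_CompleteNormedModule)
      (fun t => exp (t * x) * sin (t * y))%R _ 0 1 _ _).
    + intros t _; auto_derive; [exact I|].
      replace (t * x - 0 * y)%R with (t * x)%R by ring.
      replace (t * y + 0 * x)%R with (t * y)%R by ring. ring.
    + intros t _; apply (ex_derive_continuous (V := R_NormedModule)); auto_derive; exact I.
Qed.

Lemma Cexp_plus (a b : C) : Cexp (a + b) = Cexp a * Cexp b.
Proof.
  destruct a as [x y], b as [u v]; unfold Cexp; Creduce.
  rewrite exp_plus, cos_plus, sin_plus; apply injective_projections; simpl; ring.
Qed.

Lemma Cexp_0 : Cexp 0 = 1.
Proof. unfold Cexp; Creduce; rewrite exp_0, cos_0, sin_0; f_equal; ring. Qed.

Lemma Cexp_nz (a : C) : Cexp a <> 0.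
Proof.
  intros h; apply C1_nz; rewrite <- Cexp_0. replace (RtoC 0) with (a + - a) by ring.
  rewrite Cexp_plus, h; ring.
Qed.

Lemma Cexp_opp (a : C) : Cexp (- a) = / Cexp a.
Proof.
  assert (h : Cexp a * Cexp (- a) = 1) by (rewrite <- Cexp_plus, <- Cexp_0; f_equal; ring).
  pose proof (Cexp_nz a).
  replace (Cexp (- a)) with ((Cexp a * Cexp (- a)) / Cexp a) by (field; assumption).
  rewrite h; field; assumption.
Qed.

Lemma Cmod_Cexp (a : C) : Cmod (Cexp a) = exp (Re a).
Proof.
  unfold Cmod, Cexp, fst, snd.
  replace ((exp (Re a) * cos (Im a)) ^ 2 + (exp (Re a) * sin (Im a)) ^ 2)%R
    with (Rsqr (exp (Re a))).
  - apply sqrt_Rsqr; left; apply exp_pos.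
  - pose proof (sin2_cos2 (Im a)) as h; unfold Rsqr in *.
    transitivity (exp (Re a) * exp (Re a)
      * (sin (Im a) * sin (Im a) + cos (Im a) * cos (Im a)))%R; [rewrite h|]; ring.
Qed.

Lemma cder_Cexp (z : C) : cder Cexp z (Cexp z).
Proof.
  exists (fun y => Cexp z * CInt (fun t => Cexp (RtoC t * (y - z))) 0 1); split; [|split].
  - apply (continuous_Cmult (T := CU)); [cont|].
    apply (continuous_CInt_param (X := CU) (fun y t => Cexp (RtoC t * (y - z)))); [lra|].
    intros t _; apply filter_forall; intros p; unfold jointly_continuous; cont.
  - rewrite <- (Cmult_1_r (Cexp z)) at 2; f_equal.
    rewrite (CInt_ext _ (fun _ => 1)); [rewrite CInt_const, RtoC_minus; ring|lra|].
    intros t _; rewrite <- Cexp_0; f_equal; ring.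
  - apply filter_forall; intros y.
    replace (Cexp y) with (Cexp z * Cexp (y - z)) by (rewrite <- Cexp_plus; f_equal; ring).
    pose proof (CInt_Cexp_segment (y - z)) as h.
    rewrite CInt_Cmult in h.
    + replace (Cexp z * Cexp (y - z) - Cexp z) with (Cexp z * (Cexp (y - z) - 1)) by ring.
      rewrite <- h; ring.
    + lra.
    + intros t _; cont.
Qed.

(** Holomorphy as continuous complex differentiability on a neighbourhood. Continuity of the
    derivative is what differentiation under the integral sign asks for; Cauchy's formula then
    yields higher derivatives and power series. *)
Definition hol (f : C -> C) (z : C) : Prop :=
  locally (T := CU) z (fun y => cder f y (C_derive f y) /\
    continuous (T := CU) (U := CU) (C_derive f) y).

Lemma hol_intro (f f' : C -> C) (z : C) :
  locally (T := CU) z (fun y => cder f y (f' y) /\ continuous (T := CU) (U := CU) f' y) ->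
  hol f z.
Proof.
  intros h; pose proof (locally_locally _ _ h) as hl.
  unfold hol; generalize (filter_and _ _ h hl); apply filter_imp; intros y [[a b] c].
  rewrite (cder_C_derive _ _ _ a); split; [exact a|].
  apply (continuous_ext_loc (T := CU) (U := CU)) with f'; [|exact b].
  generalize c; apply filter_imp; intros u [hu _]; symmetry; apply cder_C_derive, hu.
Qed.

Lemma hol_locally (f : C -> C) (z : C) : hol f z -> locally (T := CU) z (hol f).
Proof. apply locally_locally. Qed.

Lemma hol_cder (f : C -> C) (z : C) : hol f z -> cder f z (C_derive f z).
Proof. intros h; apply (locally_singleton _ _ h). Qed.

Lemma hol_continuous_derive (f : C -> C) (z : C) :
  hol f z -> continuous (T := CU) (U := CU) (C_derive f) z.
Proof. intros h; apply (locally_singleton _ _ h). Qed.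

Lemma hol_continuous (f : C -> C) (z : C) : hol f z -> continuous (T := CU) (U := CU) f z.
Proof. intros h; apply (cder_continuous _ _ _ (hol_cder _ _ h)). Qed.

Lemma hol_ext_loc (f g : C -> C) (z : C) :
  locally (T := CU) z (fun y => f y = g y) -> hol f z -> hol g z.
Proof.
  intros h hf; apply hol_intro with (C_derive f).
  generalize (filter_and _ _ (locally_locally _ _ h) hf); apply filter_imp.
  intros y [a [b c]]; split; [|exact c]. apply cder_ext_loc with f; assumption.
Qed.

Lemma hol_ext (f g : C -> C) (z : C) : (forall y, f y = g y) -> hol f z -> hol g z.
Proof. intros h; apply hol_ext_loc, filter_forall, h. Qed.

Lemma hol_const (c z : C) : hol (fun _ => c) z.
Proof.
  apply hol_intro with (fun _ => 0), filter_forall; intros y; split; [apply cder_const|cont].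
Qed.

Lemma hol_id (z : C) : hol (fun y => y) z.
Proof.
  apply hol_intro with (fun _ => 1), filter_forall; intros y; split; [apply cder_id|cont].
Qed.

Lemma hol_Cexp (z : C) : hol Cexp z.
Proof.
  apply hol_intro with Cexp, filter_forall; intros y; split; [apply cder_Cexp|].
  apply (continuous_Cexp (T := CU) (fun y => y)); cont.
Qed.

Lemma hol_plus (f g : C -> C) (z : C) : hol f z -> hol g z -> hol (fun y => f y + g y) z.
Proof.
  intros hf hg; apply hol_intro with (fun y => C_derive f y + C_derive g y).
  generalize (filter_and _ _ hf hg); apply filter_imp; intros y [[a b] [c d]].
  split; [apply cder_plus; assumption|cont].
Qed.

Lemma hol_mult (f g : C -> C) (z : C) : hol f z -> hol g z -> hol (fun y => f y * g y) z.
Proof.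
  intros hf hg; apply hol_intro with (fun y => C_derive f y * g y + f y * C_derive g y).
  generalize (filter_and _ _ hf hg); apply filter_imp; intros y [[a b] [c d]].
  pose proof (cder_continuous _ _ _ a); pose proof (cder_continuous _ _ _ c).
  split; [apply cder_mult; assumption|cont].
Qed.

Lemma hol_opp (f : C -> C) (z : C) : hol f z -> hol (fun y => - f y) z.
Proof.
  intros hf; apply hol_ext with (fun y => - (1) * f y); [intros y; ring|].
  apply hol_mult; [apply hol_const|exact hf].
Qed.

Lemma hol_minus (f g : C -> C) (z : C) : hol f z -> hol g z -> hol (fun y => f y - g y) z.
Proof. intros hf hg; apply hol_plus; [exact hf|apply hol_opp, hg]. Qed.

Lemma hol_pow (f : C -> C) (n : nat) (z : C) : hol f z -> hol (fun y => f y ^ n) z.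
Proof.
  intros hf; induction n as [|n IH]; [exact (hol_const 1 z)|].
  apply (hol_mult f (fun y => f y ^ n)); assumption.
Qed.

Lemma hol_comp (f g : C -> C) (z : C) : hol f z -> hol g (f z) -> hol (fun y => g (f y)) z.
Proof.
  intros hf hg; apply hol_intro with (fun y => C_derive g (f y) * C_derive f y).
  pose proof (locally_continuous_comp (X := CU) (Y := CU) _ _ _ (hol_continuous _ _ hf) hg) as h.
  generalize (filter_and _ _ hf h); apply filter_imp; intros y [[a b] [c d]].
  split; [apply cder_comp; assumption|].
  pose proof (cder_continuous _ _ _ a).
  apply (continuous_Cmult (T := CU)); [|exact b].
  apply (continuous_comp (U := CU) (V := CU) (W := CU) f (C_derive g)); assumption.
Qed.

Lemma hol_inv (f : C -> C) (z : C) : hol f z -> f z <> 0 -> hol (fun y => / f y) z.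
Proof.
  intros hf h0; apply hol_intro with (fun y => - C_derive f y / (f y * f y)).
  pose proof (locally_neq_0 (T := CU) f z (hol_continuous _ _ hf) h0) as h.
  generalize (filter_and _ _ hf h); apply filter_imp; intros y [[a b] c].
  pose proof (cder_continuous _ _ _ a).
  split; [apply cder_inv; assumption|cont; apply Cmult_neq_0; assumption].
Qed.

Lemma hol_div (f g : C -> C) (z : C) :
  hol f z -> hol g z -> g z <> 0 -> hol (fun y => f y / g y) z.
Proof. intros hf hg h0; apply hol_mult; [exact hf|apply hol_inv; assumption]. Qed.

(** * The unit circle, parametrised by the angle *)

Definition circle (t : R) : C := Cexp (Ci * RtoC t).

Lemma Cmod_circle (t : R) : Cmod (circle t) = 1%R.
Proof.
  unfold circle; rewrite Cmod_Cexp. Creduce.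
  replace (0 * t - 1 * 0)%R with 0%R by ring; apply exp_0.
Qed.

Lemma circle_nz (t : R) : circle t <> 0.
Proof. apply Cexp_nz. Qed.

Lemma circle_PI : circle PI = circle (- PI).
Proof.
  unfold circle, Cexp; Creduce.
  replace (0 * 0 + 1 * PI)%R with PI by ring.
  replace (0 * 0 + 1 * - PI)%R with (- PI)%R by ring.
  replace (0 * - PI - 1 * 0)%R with (0 * PI - 1 * 0)%R by ring.
  rewrite cos_neg, sin_neg, sin_PI; f_equal; ring.
Qed.

Lemma continuous_circle {T : UniformSpace} (f : T -> R) (x : T) :
  continuous (U := RU) f x -> continuous (U := CU) (fun y => circle (f y)) x.
Proof. intros h; unfold circle; cont. Qed.

Ltac cont_circle := lazymatch goal with
  | |- continuous (fun x => circle (@?f x)) _ => apply (continuous_circle f)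
  | |- continuous circle _ => apply (continuous_circle (fun x => x))
  end.

Ltac cont ::= repeat (assumption || cont_step || cont_circle).

Lemma rder_ext (f g : R -> C) (t : R) (l : C) :
  (forall u, f u = g u) -> rder f t l -> rder g t l.
Proof.
  intros h [p [hp [hl he]]]; exists p; split; [exact hp|split; [exact hl|]].
  generalize he; apply filter_imp; intros u hu; rewrite <- !h; exact hu.
Qed.

Lemma rder_circle (t : R) : rder circle t (Ci * circle t).
Proof.
  apply rder_ext with (fun t => Cexp (0 + RtoC t * Ci)).
  - intros u; unfold circle; f_equal; ring.
  - eapply rder_eq.
    + apply (rder_comp (fun t => 0 + RtoC t * Ci) Cexp); [apply rder_affine|].
      apply cder_Cexp.
    + unfold circle. rewrite Cmult_comm; f_equal; f_equal; ring.
Qed.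

(** * Cauchy's formula *)

Lemma rder_zero_const (F : R -> C) (a b : R) :
  (a <= b)%R -> (forall t, (a <= t <= b)%R -> rder F t 0) -> F b = F a.
Proof.
  intros hab h. apply Ceq_minus.
  rewrite <- (CInt_FTC F (fun _ => 0) a b hab h) by (intros t _; cont).
  rewrite CInt_const; ring.
Qed.

Lemma PI_bounds : (- PI <= PI)%R.
Proof. pose proof PI_RGT_0; lra. Qed.

(** The contour integral of [V w dw / (i w)] over the circle of radius [|lam|]. Because the variable
    is the angle, the weight [w^s] appears later where the usual coefficient formula has
    [w^(s+1)]. *)
Definition circ (V : C -> C) (lam : C) : C := CInt (fun a => V (lam * circle a)) (- PI) PI.

Lemma jc_comp (V : C -> C) (m : C -> R -> C) (p : C * R) :
  jcCR m p -> continuous (T := CU) (U := CU) V (m (fst p) (snd p)) ->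
  jcCR (fun z t => V (m z t)) p.
Proof.
  intros hm hV; unfold jointly_continuous in *.
  exact (continuous_comp (U := prod_UniformSpace CU RU) (V := CU) (W := CU) _ V p hm hV).
Qed.

Lemma cder_scale (f : C -> C) (z l c : C) : cder f z l -> cder (fun y => c * f y) z (c * l).
Proof.
  intros h; eapply cder_eq; [apply cder_mult; [apply cder_const|exact h]|cbv beta; ring].
Qed.

Lemma cder_lin (c z : C) : cder (fun y => y * c) z c.
Proof.
  eapply cder_eq; [apply cder_mult; [apply cder_id|apply cder_const]|cbv beta; ring].
Qed.

Lemma rder_scale (f : R -> C) (t : R) (l c : C) : rder f t l -> rder (fun u => c * f u) t (c * l).
Proof.
  intros h; apply (rder_comp f (fun y => c * y)); [exact h|].
  eapply cder_eq; [apply cder_scale, cder_id|ring].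
Qed.

(* The derivative in lam is (i lam)^-1 times the integral of d/da V (lam e^(ia)). *)
Lemma cder_circ (V : C -> C) (lam : C) :
  lam <> 0 -> (forall a, hol V (lam * circle a)) -> cder (circ V) lam 0.
Proof.
  intros hl hV; eapply cder_eq.
  - apply (cder_CInt (fun z a => V (z * circle a))
      (fun z a => C_derive V (z * circle a) * circle a)); [apply PI_bounds|].
    intros a _.
    assert (hm : forall p, continuous (T := prod_UniformSpace CU RU) (U := CU)
       (fun p => fst p * circle (snd p)) p).
    { intros p; apply continuous_Cmult; [cont|apply continuous_circle; cont]. }
    pose proof (locally_continuous_comp (X := prod_UniformSpace CU RU) (Y := CU)
      (fun p => fst p * circle (snd p)) (lam, a) _ (hm _) (hol_locally _ _ (hV a))) as h.
    generalize h; apply filter_imp; intros p hp; split; [|split].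
    + apply (jc_comp V (fun z t => z * circle t)); [apply hm|apply hol_continuous, hp].
    + unfold jointly_continuous; apply (continuous_Cmult (T := prod_UniformSpace CU RU)).
      * apply (jc_comp (C_derive V) (fun z t => z * circle t));
          [apply hm|apply hol_continuous_derive, hp].
      * apply continuous_circle; cont.
    + apply (cder_comp (fun z => z * circle (snd p)) V); [apply cder_lin|].
      apply hol_cder, hp.
  - assert (hs : segcont (fun a => C_derive V (lam * circle a) * circle a) (- PI) PI).
    { intros a _; apply continuous_Cmult; [|apply continuous_circle; cont].
      apply (continuous_comp (V := CU) (fun a => lam * circle a) (C_derive V)).
      - apply continuous_Cmult; [cont|apply continuous_circle; cont].
      - apply hol_continuous_derive, hV. }
    assert (h : Ci * lam * CInt (fun a => C_derive V (lam * circle a) * circle a) (- PI) PI = 0).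
    { rewrite <- CInt_Cmult; [|apply PI_bounds|exact hs].
      rewrite (CInt_FTC (fun a => V (lam * circle a))).
      - rewrite circle_PI; ring.
      - apply PI_bounds.
      - intros a _; eapply rder_eq.
        + apply rder_comp; [apply rder_scale, rder_circle|apply hol_cder, hV].
        + ring.
      - intros a ha; apply continuous_Cmult; [cont|apply hs, ha]. }
    pose proof Ci_nz.
    set (I := CInt _ _ _) in *.
    replace I with (/ (Ci * lam) * (Ci * lam * I)) by (field; auto).
    rewrite h; ring.
Qed.

Lemma rder_real_line (f : C -> C) (c d : C) (t : R) (l : C) :
  cder f (c + RtoC t * d) l -> rder (fun u => f (c + RtoC u * d)) t (l * d).
Proof. intros h; apply (rder_comp (fun u => c + RtoC u * d) f); [apply rder_affine|exact h]. Qed.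

(** Deformation of concentric circles: along [t |-> t zeta] the derivative of [circ] vanishes by
    [cder_circ]. Holomorphy is asked on the closed annulus only, so a singularity at 0 is
    allowed. *)
Lemma circ_const (V : C -> C) (zeta : C) (a b : R) :
  zeta <> 0 -> (0 < a)%R -> (a <= b)%R ->
  (forall t, (a <= t <= b)%R -> forall al, hol V (RtoC t * zeta * circle al)) ->
  circ V (RtoC b * zeta) = circ V (RtoC a * zeta).
Proof.
  intros hz ha hab hV.
  pose proof (rder_zero_const (fun t => circ V (0 + RtoC t * zeta)) a b hab) as h.
  cbv beta in h; rewrite !Cplus_0_l in h; apply h.
  intros t ht; eapply rder_eq; [apply rder_real_line, cder_circ|ring].
  - rewrite Cplus_0_l; apply Cmult_neq_0; [|exact hz].
    intros he; apply (f_equal fst) in he; simpl in he; lra.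
  - intros al; rewrite Cplus_0_l; apply hV, ht.
Qed.

Lemma Cmod_scaled_circle (t a : R) : (0 <= t)%R -> Cmod (RtoC t * circle a) = t.
Proof. intros ht; rewrite Cmod_mult, Cmod_circle, Cmod_R, Rabs_right; lra. Qed.

Lemma circle_ne_interior (t a : R) (x : C) :
  (Cmod x < t)%R -> RtoC t * circle a - x <> 0.
Proof.
  intros hx he; pose proof (Cmod_ge_0 x).
  apply (proj2 (Ceq_minus _ _)) in he.
  pose proof (Cmod_scaled_circle t a ltac:(lra)) as h; rewrite he in h; lra.
Qed.

(** Cauchy-type integral whose density is an arbitrary function of the angle. Raising [m] by one
    corresponds to differentiating in [z]. *)
Definition cauchy_int (phi : R -> C) (m : nat) (z0 : C) (t : R) (z : C) : C :=
  CInt (fun a => phi a / (z0 + RtoC t * circle a - z) ^ m) (- PI) PI.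

Lemma circle_shift_nz (z0 z : C) (t a : R) :
  (Cmod (z - z0) < t)%R -> z0 + RtoC t * circle a - z <> 0.
Proof.
  intros h. replace (z0 + RtoC t * circle a - z) with (RtoC t * circle a - (z - z0)) by ring.
  apply circle_ne_interior, h.
Qed.

Lemma open_Cball (z0 z : C) (t : R) :
  (Cmod (z - z0) < t)%R -> locally (T := CU) z (fun y => (Cmod (y - z0) < t)%R).
Proof.
  intros h; apply locally_C_Cmod; exists (t - Cmod (z - z0))%R; split; [lra|].
  intros y hy; replace (y - z0) with ((y - z) + (z - z0)) by ring.
  eapply Rle_lt_trans; [apply Cmod_triangle|lra].
Qed.

Lemma locally_fst {X Y : UniformSpace} (P : X -> Prop) (p : X * Y) :
  locally (fst p) P -> locally (T := prod_UniformSpace X Y) p (fun q => P (fst q)).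
Proof.
  intros h; apply (locally_continuous_comp (X := prod_UniformSpace X Y) (Y := X)
    (fun q => fst q) p); [apply continuous_fst_pt|exact h].
Qed.

Lemma locally_snd {X Y : UniformSpace} (P : Y -> Prop) (p : X * Y) :
  locally (snd p) P -> locally (T := prod_UniformSpace X Y) p (fun q => P (snd q)).
Proof.
  intros h; apply (locally_continuous_comp (X := prod_UniformSpace X Y) (Y := Y)
    (fun q => snd q) p); [apply continuous_snd_pt|exact h].
Qed.

Lemma jc_cauchy_kernel (phi : R -> C) (m : nat) (z0 : C) (t : R) (p : C * R) :
  (forall a, continuous (U := CU) phi a) -> (Cmod (fst p - z0) < t)%R ->
  jcCR (fun z a => phi a / (z0 + RtoC t * circle a - z) ^ m) p.
Proof.
  intros hphi hp; unfold jointly_continuous.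
  apply (continuous_Cdiv (T := prod_UniformSpace CU RU)).
  - apply (continuous_comp (U := prod_UniformSpace CU RU) (V := RU) (W := CU)
      (fun q => snd q) phi); [cont|apply hphi].
  - apply continuous_Cpow, continuous_Cminus; [|cont].
    apply continuous_Cplus; [cont|]. apply continuous_Cmult; [cont|].
    apply continuous_circle; cont.
  - apply Cpow_nz, circle_shift_nz, hp.
Qed.

Lemma cauchy_int_cder (phi : R -> C) (m : nat) (z0 : C) (t : R) (z : C) :
  (forall a, continuous (U := CU) phi a) -> (Cmod (z - z0) < t)%R ->
  cder (cauchy_int phi m z0 t) z (INR m * cauchy_int phi (S m) z0 t z).
Proof.
  intros hphi hz; eapply cder_eq.
  - apply (cder_CInt (fun z a => phi a / (z0 + RtoC t * circle a - z) ^ m)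
      (fun z a => INR m * (phi a / (z0 + RtoC t * circle a - z) ^ (S m)))); [apply PI_bounds|].
    intros a _. 
    generalize (locally_fst (X := CU) (Y := RU) _ (z, a) (open_Cball z0 z t hz)).
    apply filter_imp; intros p hp; split; [|split].
    + apply jc_cauchy_kernel; assumption.
    + apply (continuous_Cmult (T := prod_UniformSpace CU RU)); [cont|].
      apply (jc_cauchy_kernel phi (S m)); assumption.
    + pose proof (circle_shift_nz z0 (fst p) t (snd p) hp) as hn.
      set (w := z0 + RtoC t * circle (snd p)) in *.
      eapply cder_eq.
      * apply cder_mult; [apply cder_const|apply cder_inv].
        -- apply (cder_pow (fun y => w - y)), cder_minus; [apply cder_const|apply cder_id].
        -- apply Cpow_nz, hn.
      * cbv beta. rewrite Cpow_S. destruct m as [|m].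
        -- simpl; field; auto.
        -- replace (S m - 1)%nat with m by lia.
           rewrite Cpow_S. field. split; [apply Cpow_nz, hn|exact hn].
  - unfold cauchy_int. rewrite CInt_Cmult; [reflexivity|apply PI_bounds|].
    intros a _. apply (continuous_section (X := CU) (Y := RU) (Z := CU)
      (fun z a => phi a / (z0 + RtoC t * circle a - z) ^ S m)).
    apply jc_cauchy_kernel; assumption.
Qed.

Lemma cauchy_int_hol (phi : R -> C) (m : nat) (z0 : C) (t : R) (z : C) :
  (forall a, continuous (U := CU) phi a) -> (Cmod (z - z0) < t)%R ->
  hol (cauchy_int phi m z0 t) z.
Proof.
  intros hphi hz.
  apply hol_intro with (fun y => INR m * cauchy_int phi (S m) z0 t y).
  generalize (open_Cball z0 z t hz); apply filter_imp; intros y hy.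
  split; [apply cauchy_int_cder; assumption|].
  apply (continuous_Cmult (T := CU)); [cont|].
  apply (cder_continuous _ _ _ (cauchy_int_cder phi (S m) z0 t y hphi hy)).
Qed.

Lemma CInt_circle : CInt circle (- PI) PI = 0.
Proof.
  assert (h : Ci * CInt circle (- PI) PI = 0).
  { rewrite <- CInt_Cmult; [|apply PI_bounds|intros a _; apply (continuous_circle (fun a => a)); cont].
    rewrite (CInt_FTC circle).
    - rewrite circle_PI; ring.
    - apply PI_bounds.
    - intros a _; apply rder_circle.
    - intros a _; apply continuous_Cmult; [cont|apply (continuous_circle (fun a => a)); cont]. }
  pose proof Ci_nz.
  replace (CInt circle (- PI) PI) with (/ Ci * (Ci * CInt circle (- PI) PI)) by (field; auto).
  rewrite h; ring.
Qed.

Lemma continuous_scaled_circle (t a : R) : continuous (U := CU) (fun a => RtoC t * circle a) a.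
Proof. apply continuous_Cmult; [cont|apply (continuous_circle (fun a => a)); cont]. Qed.

(** The derivative in [z] is the integral with the kernel of power 2. Its integrand is, up to a
    constant factor, the derivative of [1 / (w - z)] along the closed circle, so it vanishes, and
    the value is the one at the centre. *)
Lemma winding_number (t : R) (z0 z : C) :
  (Cmod (z - z0) < t)%R ->
  cauchy_int (fun a => RtoC t * circle a) 1 z0 t z = RtoC (2 * PI).
Proof.
  intros hz.
  assert (ht : (0 < t)%R) by (pose proof (Cmod_ge_0 (z - z0)); lra).
  set (phi := fun a => RtoC t * circle a).
  assert (hphi : forall a, continuous (U := CU) phi a) by (apply continuous_scaled_circle).
  assert (h0 : forall y, (Cmod (y - z0) < t)%R -> cauchy_int phi 2 z0 t y = 0).
  { intros y hy.
    assert (hs : segcont (fun a => phi a / (z0 + RtoC t * circle a - y) ^ 2) (- PI) PI).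
    { intros a _; apply (continuous_section (X := CU) (Y := RU) (Z := CU)
      (fun z a => phi a / (z0 + RtoC t * circle a - z) ^ 2)), jc_cauchy_kernel; assumption. }
    assert (h : - Ci * cauchy_int phi 2 z0 t y = 0).
    { unfold cauchy_int; rewrite <- CInt_Cmult; [|apply PI_bounds|exact hs].
      rewrite (CInt_FTC (fun a => / (z0 - y + RtoC t * circle a))).
      - rewrite circle_PI; ring.
      - apply PI_bounds.
      - intros a _; eapply rder_eq.
        + apply (rder_comp (fun a => RtoC t * circle a) (fun x => / (z0 - y + x))).
          * apply rder_scale, rder_circle.
          * apply cder_inv; [apply cder_plus; [apply cder_const|apply cder_id]|].
            pose proof (circle_shift_nz z0 y t a hy) as hn.
            intros he; apply hn; rewrite <- he; ring.
        + pose proof (circle_shift_nz z0 y t a hy) as hn.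
          unfold phi; cbv beta; field. repeat split;
          intros he; apply hn; rewrite <- he; ring.
      - intros a ha; apply continuous_Cmult; [cont|apply hs, ha]. }
    pose proof Ci_nz.
    replace (cauchy_int phi 2 z0 t y) with (- / Ci * (- Ci * cauchy_int phi 2 z0 t y))
      by (field; auto).
    rewrite h; ring. }
  pose proof (rder_zero_const (fun s => cauchy_int phi 1 z0 t (z0 + RtoC s * (z - z0))) 0 1
    ltac:(lra)) as hc.
  cbv beta in hc.
  replace (z0 + RtoC 1 * (z - z0)) with z in hc by ring.
  replace (z0 + RtoC 0 * (z - z0)) with z0 in hc by ring.
  rewrite hc.
  - unfold cauchy_int.
    rewrite (CInt_ext _ (fun _ => 1)).
    + rewrite CInt_const, <- RtoC_mult; f_equal; ring.
    + apply PI_bounds.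
    + intros a _; unfold phi; simpl. field.
      replace (z0 + RtoC t * circle a - z0) with (RtoC t * circle a - 0) by ring.
      apply circle_ne_interior; rewrite Cmod_0; exact ht.
  - intros s hs; eapply rder_eq; [apply rder_real_line, cauchy_int_cder; [exact hphi|]|].
    + apply Cball_segment; assumption.
    + rewrite h0 by (apply Cball_segment; assumption); ring.
Qed.

Lemma Cball_convex (z0 z w : C) (t s : R) :
  (0 <= s <= 1)%R -> (Cmod (z - z0) <= t)%R -> (Cmod (w - z0) <= t)%R ->
  (Cmod (z + RtoC s * (w - z) - z0) <= t)%R.
Proof.
  intros hs hz hw.
  replace (z + RtoC s * (w - z) - z0) with (RtoC (1 - s) * (z - z0) + RtoC s * (w - z0))
    by (rewrite RtoC_minus; ring).
  eapply Rle_trans; [apply Cmod_triangle|].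
  rewrite !Cmod_mult, !Cmod_R, !Rabs_right by lra. nra.
Qed.

(* Shrinking the contour towards z along w |-> z + lam (w - z), 0 <= lam <= 1,
   leaves the integral unchanged. *)
Lemma cauchy_formula (U : C -> C) (z0 z : C) (t : R) :
  (forall y, (Cmod (y - z0) <= t)%R -> hol U y) -> (Cmod (z - z0) < t)%R ->
  cauchy_int (fun a => U (z0 + RtoC t * circle a) * (RtoC t * circle a)) 1 z0 t z
  = RtoC (2 * PI) * U z.
Proof.
  intros hU hz.
  assert (ht : (0 < t)%R) by (pose proof (Cmod_ge_0 (z - z0)); lra).
  pose (w := fun a => z0 + RtoC t * circle a).
  assert (hwc : forall a, (Cmod (w a - z0) <= t)%R).
  { intros a; unfold w; replace (z0 + RtoC t * circle a - z0) with (RtoC t * circle a) by ring.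
    rewrite Cmod_scaled_circle; lra. }
  assert (hin : forall s a, (0 <= s <= 1)%R -> hol U (z + RtoC s * (w a - z))).
  { intros s a hs; apply hU, Cball_convex; [exact hs|lra|apply hwc]. }
  pose (K := fun lam => CInt (fun a => U (z + lam * (w a - z)) * ((RtoC t * circle a) / (w a - z)))
     (- PI) PI).
  assert (hwn : forall a, w a - z <> 0) by (intros a; apply circle_shift_nz, hz).
  assert (hK : forall s, (0 <= s <= 1)%R -> cder K (RtoC s) 0).
  { intros s hs; eapply cder_eq.
    - apply (cder_CInt (fun lam a => U (z + lam * (w a - z)) * ((RtoC t * circle a) / (w a - z)))
       (fun lam a => C_derive U (z + lam * (w a - z)) * (RtoC t * circle a))); [apply PI_bounds|].
      intros a _.
      assert (hw2 : forall p, continuous (T := prod_UniformSpace CU RU) (U := CU)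
         (fun p => w (snd p)) p).
      { intros p; unfold w; apply continuous_Cplus; [cont|].
        apply continuous_Cmult; [cont|apply continuous_circle; cont]. }
      assert (hm : forall p, continuous (T := prod_UniformSpace CU RU) (U := CU)
         (fun p => z + fst p * (w (snd p) - z)) p).
      { intros p; pose proof (hw2 p); cont. }
      assert (hcirc : forall p, continuous (T := prod_UniformSpace CU RU) (U := CU)
         (fun p => RtoC t * circle (snd p)) p).
      { intros p; apply continuous_Cmult; [cont|apply continuous_circle; cont]. }
      pose proof (locally_continuous_comp (X := prod_UniformSpace CU RU) (Y := CU)
        (fun p => z + fst p * (w (snd p) - z)) (RtoC s, a) _ (hm _)
        (hol_locally _ _ (hin s a hs))) as h.
      generalize h; apply filter_imp; intros p hp; split; [|split].
      + apply (continuous_Cmult (T := prod_UniformSpace CU RU)).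
        * apply (jc_comp U (fun lam a => z + lam * (w a - z))); [apply hm|].
          apply hol_continuous, hp.
        * apply continuous_Cdiv; [apply hcirc| |apply hwn].
          pose proof (hw2 p); cont.
      + apply (continuous_Cmult (T := prod_UniformSpace CU RU)); [|apply hcirc].
        apply (jc_comp (C_derive U) (fun lam a => z + lam * (w a - z))); [apply hm|].
        apply hol_continuous_derive, hp.
      + eapply cder_eq.
        * apply cder_mult; [|apply cder_const].
          apply (cder_comp (fun lam => z + lam * (w (snd p) - z)) U); [|apply hol_cder, hp].
          apply cder_plus; [apply cder_const|apply cder_lin].
        * cbv beta. pose proof (hwn (snd p)). field; assumption.
    - assert (hs2 : segcont (fun a => C_derive U (z + RtoC s * (w a - z)) * (RtoC t * circle a))
         (- PI) PI).
      { intros a _; apply continuous_Cmult; [|apply continuous_scaled_circle].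
        apply (continuous_comp (V := CU) (fun a => z + RtoC s * (w a - z)) (C_derive U)).
        - unfold w; pose proof (continuous_scaled_circle t a); cont.
        - apply hol_continuous_derive, hin, hs. }
      (* At [s = 0] the division by [i s] used in the other case is impossible; there the integrand
         is a multiple of [circle a], whose integral is 0. *)
      destruct (Req_dec s 0) as [h0|h0].
      + rewrite (CInt_ext _ (fun a => C_derive U z * RtoC t * circle a)).
        * rewrite CInt_Cmult, CInt_circle; [ring|apply PI_bounds|].
          intros a _; apply (continuous_circle (fun a => a)); cont.
        * apply PI_bounds.
        * intros a _; rewrite h0.
          replace (z + RtoC 0 * (w a - z)) with z by ring. ring.
      (* The integrand times [i s] is the derivative in the angle of [U (z + s (w a - z))], and the
         circle is closed. *)
      + assert (h : Ci * RtoC s *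
           CInt (fun a => C_derive U (z + RtoC s * (w a - z)) * (RtoC t * circle a)) (- PI) PI = 0).
        { rewrite <- CInt_Cmult; [|apply PI_bounds|exact hs2].
          rewrite (CInt_FTC (fun a => U (z + RtoC s * (w a - z)))).
          - unfold w; rewrite circle_PI; ring.
          - apply PI_bounds.
          - intros a _; eapply rder_eq.
            + apply (rder_comp circle (fun c => U (z + RtoC s * (z0 + RtoC t * c - z)))).
              * apply rder_circle.
              * apply (cder_comp (fun c => z + RtoC s * (z0 + RtoC t * c - z)) U);
                  [|apply hol_cder, (hin s a hs)].
                apply cder_plus; [apply cder_const|]. apply cder_scale, cder_minus;
                  [|apply cder_const]. apply cder_plus; [apply cder_const|].
                apply cder_scale, cder_id.
            + unfold w; ring.
          - intros a ha; apply continuous_Cmult; [cont|apply hs2, ha]. }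
        assert (hsn : RtoC s <> 0) by (intros he; apply (f_equal fst) in he; simpl in he; lra).
        pose proof Ci_nz. set (I := CInt _ _ _) in *.
        replace I with (/ (Ci * RtoC s) * (Ci * RtoC s * I)) by (field; auto).
        rewrite h; ring. }
  pose proof (rder_zero_const (fun s => K (0 + RtoC s * 1)) 0 1 ltac:(lra)) as hc.
  cbv beta in hc.
  replace (0 + RtoC 1 * 1) with (RtoC 1) in hc by ring.
  replace (0 + RtoC 0 * 1) with (RtoC 0) in hc by ring.
  assert (hK10 : K 1 = K 0).
  { apply hc; intros s hs; eapply rder_eq; [apply rder_real_line|].
    - replace (0 + RtoC s * 1) with (RtoC s) by ring; apply hK, hs.
    - ring. }
  assert (hk1 : K 1 = cauchy_int (fun a => U (z0 + RtoC t * circle a) * (RtoC t * circle a)) 1 z0 t z).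
  { apply CInt_ext; [apply PI_bounds|]; intros a _.
    replace (z + 1 * (w a - z)) with (w a) by ring.
    rewrite Cpow_1_r; unfold w. pose proof (hwn a). field. assumption. }
  rewrite <- hk1, hK10, <- (winding_number t z0 z hz), Cmult_comm.
  unfold K, cauchy_int; rewrite <- CInt_Cmult.
  - apply CInt_ext; [apply PI_bounds|]; intros a _.
    replace (z + 0 * (w a - z)) with z by ring.
    rewrite Cpow_1_r; reflexivity.
  - apply PI_bounds.
  - intros a _; apply (continuous_section (X := CU) (Y := RU) (Z := CU)
      (fun z a => (RtoC t * circle a) / (z0 + RtoC t * circle a - z) ^ 1)).
    apply (jc_cauchy_kernel (fun a => RtoC t * circle a)); [apply continuous_scaled_circle|exact hz].
Qed.

(** * Consequences of Cauchy's formula: derivatives, power series, limits, parameter integrals,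
    primitives *)

Lemma locally_closed_disc (z : C) (P : C -> Prop) :
  locally (T := CU) z P -> exists t, (0 < t)%R /\ forall y, (Cmod (y - z) <= t)%R -> P y.
Proof.
  intros h; apply locally_C_Cmod in h; destruct h as [d [hd h]].
  exists (d / 2)%R; split; [lra|]; intros y hy; apply h; lra.
Qed.

Lemma RtoC_nz (x : R) : x <> 0%R -> RtoC x <> 0.
Proof. intros h he; apply h; apply (f_equal fst) in he; exact he. Qed.

Lemma twoPI_nz : RtoC (2 * PI) <> 0.
Proof. apply RtoC_nz; pose proof PI_RGT_0; lra. Qed.

(** This is [U dw] divided by [i da] on the circle, the density for which the Cauchy-type integral
    with [m = 1] equals [2 PI U]. *)
Definition boundary (U : C -> C) (z0 : C) (t : R) (a : R) : C :=
  U (z0 + RtoC t * circle a) * (RtoC t * circle a).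

Lemma Cmod_boundary_point (z0 : C) (t a : R) :
  (0 <= t)%R -> Cmod (z0 + RtoC t * circle a - z0) = t.
Proof.
  intros ht; replace (z0 + RtoC t * circle a - z0) with (RtoC t * circle a) by ring.
  apply Cmod_scaled_circle, ht.
Qed.

Lemma continuous_boundary (U : C -> C) (z0 : C) (t : R) :
  (0 <= t)%R -> (forall y, Cmod (y - z0) = t -> continuous (T := CU) (U := CU) U y) ->
  forall a, continuous (U := CU) (boundary U z0 t) a.
Proof.
  intros ht hU a; unfold boundary; apply continuous_Cmult; [|cont].
  apply (continuous_comp (V := CU) (fun a => z0 + RtoC t * circle a) U); [cont|].
  apply hU, Cmod_boundary_point, ht.
Qed.

Lemma cauchy_rep (U : C -> C) (z0 z : C) (t : R) :
  (forall y, (Cmod (y - z0) <= t)%R -> hol U y) -> (Cmod (z - z0) < t)%R ->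
  U z = / RtoC (2 * PI) * cauchy_int (boundary U z0 t) 1 z0 t z.
Proof.
  intros hU hz; unfold boundary; rewrite (cauchy_formula U z0 z t hU hz).
  field; apply twoPI_nz.
Qed.

Lemma cauchy_rep_derive (U : C -> C) (z0 z : C) (t : R) :
  (forall y, (Cmod (y - z0) <= t)%R -> hol U y) -> (Cmod (z - z0) < t)%R ->
  C_derive U z = / RtoC (2 * PI) * cauchy_int (boundary U z0 t) 2 z0 t z.
Proof.
  intros hU hz; apply cder_C_derive.
  assert (ht : (0 < t)%R) by (pose proof (Cmod_ge_0 (z - z0)); lra).
  apply cder_ext_loc with (fun y => / RtoC (2 * PI) * cauchy_int (boundary U z0 t) 1 z0 t y).
  - generalize (open_Cball z0 z t hz); apply filter_imp; intros y hy.
    symmetry; apply cauchy_rep; assumption.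
  - apply cder_scale. eapply cder_eq; [apply cauchy_int_cder; [|exact hz]|simpl; ring].
    apply continuous_boundary; [lra|]; intros y hy; apply hol_continuous, hU; lra.
Qed.

(** On a small disc [C_derive f] is itself a Cauchy-type integral, with the kernel of power 2, and
    such integrals are holomorphic. *)
Lemma hol_derive (f : C -> C) (z : C) : hol f z -> hol (C_derive f) z.
Proof.
  intros h; destruct (locally_closed_disc _ _ (hol_locally _ _ h)) as [t [ht hf]].
  apply hol_ext_loc with (fun y => / RtoC (2 * PI) * cauchy_int (boundary f z t) 2 z t y).
  - generalize (locally_Cball z t ht); apply filter_imp; intros y hy.
    symmetry; apply cauchy_rep_derive; assumption.
  - apply hol_mult; [apply hol_const|apply cauchy_int_hol].
    + apply continuous_boundary; [lra|]; intros y hy; apply hol_continuous, hf; lra.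
    + replace (z - z) with (RtoC 0) by ring; rewrite Cmod_0; exact ht.
Qed.

(* Continuity of mu |-> mu |F| at mu = 0 makes the tube lemma yield a bound. *)
Lemma bounded_param {X : UniformSpace} (F : X -> R -> C) (x0 : X) (a b : R) :
  (forall t, (a <= t <= b)%R -> jointly_continuous (Y := RU) (Z := CU) F (x0, t)) ->
  exists M : R, (0 < M)%R /\
    locally x0 (fun x => forall t, (a <= t <= b)%R -> (Cmod (F x t) <= M)%R).
Proof.
  intros h.
  pose proof (locally_forall_segment (X := prod_UniformSpace X RU) (x0, 0%R) a b
    (fun p t => (snd p * Cmod (F (fst p) t) < 1)%R)) as ht.
  cbv beta in ht.
  assert (hh : forall t, (a <= t <= b)%R ->
    locally (T := prod_UniformSpace (prod_UniformSpace X RU) RU) ((x0, 0%R), t)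
     (fun p => (snd (fst p) * Cmod (F (fst (fst p)) (snd p)) < 1)%R)).
  { intros t htt.
    apply (locally_lt_continuous (T := prod_UniformSpace (prod_UniformSpace X RU) RU)
      (fun p => (snd (fst p) * Cmod (F (fst (fst p)) (snd p)))%R) (fun _ => 1%R)).
    - apply continuous_Rmult; [cont|].
      apply continuous_Cmod.
      apply (continuous_uncurry (U := X) (V := RU) (W := CU) F
        (fun p => fst (fst p)) (fun p : X * R * R => snd p)).
      + cont.
      + cont.
      + apply (h t htt).
    - cont.
    - simpl; lra. }
  specialize (ht hh).
  apply (locally_prod_ball (X := X) (Y := RU)) in ht; destruct ht as [d hd].
  exists (2 / d)%R; split; [apply Rdiv_lt_0_compat; [lra|apply cond_pos]|].
  exists d; intros x hx t htt.
  assert (hb : ball (M := RU) 0%R d (d / 2)%R).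
  { pose proof (cond_pos d). change (Rabs (d / 2 - 0) < d)%R.
    rewrite Rabs_right; lra. }
  specialize (hd x (d / 2)%R hx hb t htt); simpl in hd.
  pose proof (cond_pos d) as hp.
  apply Rmult_le_reg_l with (d / 2)%R; [lra|].
  replace (d / 2 * (2 / d))%R with 1%R by (field; lra); lra.
Qed.

Lemma segcont_bounded (f : R -> C) (a b : R) :
  segcont f a b -> exists M : R, (0 < M)%R /\
    forall t, (a <= t <= b)%R -> (Cmod (f t) <= M)%R.
Proof.
  intros h; destruct (bounded_param (X := RU) (fun _ t => f t) 0%R a b) as [M [hM hl]].
  - intros t ht; unfold jointly_continuous.
    apply (continuous_comp (U := prod_UniformSpace RU RU) (V := RU) (W := CU)
      (fun q => snd q) f); [cont|apply h, ht].
  - exists M; split; [exact hM|]; apply (locally_singleton _ _ hl).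
Qed.

Lemma pow_n_Cpow (x : C) (k : nat) : pow_n (K := C_Ring) x k = x ^ k.
Proof. induction k as [|k IH]; [reflexivity|]. simpl; rewrite IH; reflexivity. Qed.

Lemma is_series_C (u : nat -> C) (l : C) :
  is_series (K := C_AbsRing) (V := C_NormedModule) u l <->
  forall e, (0 < e)%R -> exists N, forall n, (N <= n)%nat ->
    (Cmod (sum_n (G := C_AbelianGroup) u n - l) < e)%R.
Proof.
  split.
  - intros h e he.
    destruct (h _ (locally_Cball l e he)) as [N hN]; exists N; exact hN.
  - intros h P hP; apply locally_C_Cmod in hP; destruct hP as [d [hd hP]].
    destruct (h d hd) as [N hN]; exists N; intros n hn; apply hP, hN, hn.
Qed.

Lemma pow_lt_eps (q M e : R) : (0 <= q < 1)%R -> (0 < M)%R -> (0 < e)%R ->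
  exists N, forall n, (N <= n)%nat -> (M * q ^ n < e)%R.
Proof.
  intros hq hM he.
  destruct (pow_lt_1_zero q ltac:(rewrite Rabs_right; lra) (e / M) ltac:(apply Rdiv_lt_0_compat; lra))
    as [N hN].
  exists N; intros n hn; specialize (hN n hn).
  rewrite Rabs_right in hN by (apply Rle_ge, pow_le; lra).
  apply Rmult_lt_reg_l with (/ M)%R; [apply Rinv_0_lt_compat, hM|].
  replace (/ M * (M * q ^ n))%R with (q ^ n)%R by (field; lra).
  replace (/ M * e)%R with (e / M)%R by (field; lra); exact hN.
Qed.

(** The Cauchy kernel is expanded in a geometric series with its exact remainder, so sum and
    integral never have to be exchanged: the remainder carries the factor [(x / b a)^N], of modulus
    [q^N] with [q = |x| / t < 1]. *)
Lemma hol_disc_pseries (U : C -> C) (z0 : C) (t : R) :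
  (0 < t)%R -> (forall y, (Cmod (y - z0) <= t)%R -> hol U y) -> analytic_at U z0.
Proof.
  intros ht hU.
  pose (b := fun a => RtoC t * circle a).
  assert (hbn : forall a, b a <> 0).
  { intros a; unfold b; apply Cmult_neq_0; [apply RtoC_nz; lra|apply circle_nz]. }
  assert (hbc : forall a, continuous (U := CU) b a) by apply continuous_scaled_circle.
  assert (hUc : forall a, continuous (U := CU) (fun a => U (z0 + b a)) a).
  { intros a; apply (continuous_comp (V := CU) (fun a => z0 + b a) U); [unfold b; cont|].
    apply hol_continuous, hU; unfold b; rewrite Cmod_boundary_point; lra. }
  exists (fun k => / RtoC (2 * PI) * CInt (fun a => U (z0 + b a) / b a ^ k) (- PI) PI), t.
  split; [exact ht|]; intros z hz.
  set (x := z - z0) in *.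
  assert (hbx : forall a, b a - x <> 0) by (intros a; apply circle_ne_interior, hz).
  (* [Rem N] is what remains of [U z] after the terms of degree below [N]; [Rem 0] is Cauchy's
     formula. *)
  pose (Rem := fun N => / RtoC (2 * PI) *
     CInt (fun a => U (z0 + b a) * b a / (b a - x) * (x / b a) ^ N) (- PI) PI).
  assert (hRc : forall N, segcont (fun a => U (z0 + b a) * b a / (b a - x) * (x / b a) ^ N) (- PI) PI).
  { intros N a _; pose proof (hUc a); pose proof (hbc a); cont; auto. }
  assert (hR0 : Rem 0%nat = U z).
  { rewrite (cauchy_rep U z0 z t hU hz); unfold Rem; f_equal.
    apply CInt_ext; [apply PI_bounds|]; intros a _.
    unfold boundary; rewrite Cpow_1_r; fold (b a).
    replace (z0 + b a - z) with (b a - x) by (unfold x; ring). simpl; ring. }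
  assert (hsum : forall N, sum_n (G := C_AbelianGroup) (fun k => x ^ k * (/ RtoC (2 * PI) *
      CInt (fun a => U (z0 + b a) / b a ^ k) (- PI) PI)) N + Rem (S N) = U z).
  { assert (hstep : forall N, x ^ N * (/ RtoC (2 * PI) *
      CInt (fun a => U (z0 + b a) / b a ^ N) (- PI) PI) + Rem (S N) = Rem N).
    { intros N; unfold Rem.
      replace (x ^ N * (/ RtoC (2 * PI) * CInt (fun a => U (z0 + b a) / b a ^ N) (- PI) PI))
        with (/ RtoC (2 * PI) * (x ^ N * CInt (fun a => U (z0 + b a) / b a ^ N) (- PI) PI)) by ring.
      rewrite <- Cmult_plus_distr_l; f_equal.
      rewrite <- CInt_Cmult, <- CInt_plus.
      - apply CInt_ext; [apply PI_bounds|]; intros a _.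
        unfold Cdiv; rewrite !Cpow_S, !Cpow_mult_l, Cpow_inv by apply hbn.
        pose proof (hbn a); pose proof (hbx a); pose proof (Cpow_nz (b a) N (hbn a)).
        field; auto.
      - apply PI_bounds.
      - intros a _; pose proof (hUc a); pose proof (hbc a); cont. apply Cpow_nz, hbn.
      - apply hRc.
      - apply PI_bounds.
      - intros a _; pose proof (hUc a); pose proof (hbc a); cont. apply Cpow_nz, hbn. }
    induction N as [|N IH].
    - rewrite sum_O, hstep; exact hR0.
    - rewrite sum_Sn; change (@plus C_AbelianGroup) with Cplus.
      rewrite <- Cplus_assoc, hstep; exact IH. }
  destruct (segcont_bounded _ _ _ (hRc 0%nat)) as [M [hM hMb]].
  set (q := (Cmod x / t)%R).
  assert (hq : (0 <= q < 1)%R).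
  { unfold q; pose proof (Cmod_ge_0 x); split.
    - apply Rmult_le_pos; [lra|left; apply Rinv_0_lt_compat, ht].
    - apply Rmult_lt_reg_r with t; [exact ht|]; replace (Cmod x / t * t)%R with (Cmod x) by (field; lra).
      lra. }
  assert (hRb : forall N, (Cmod (Rem N) <= M * q ^ N)%R).
  { intros N; unfold Rem; pose proof PI_RGT_0 as hpi.
    rewrite Cmod_mult, Cmod_inv, Cmod_R, Rabs_right by (lra || apply twoPI_nz).
    apply Rmult_le_reg_l with (2 * PI)%R; [lra|].
    rewrite <- Rmult_assoc, Rinv_r, Rmult_1_l by lra.
    replace (2 * PI * (M * q ^ N))%R with ((PI - - PI) * (M * q ^ N))%R by ring.
    apply Cmod_CInt_le; [apply PI_bounds|apply hRc|].
    intros a ha; rewrite Cmod_mult, Cmod_pow, (Cmod_div x) by apply hbn.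
    replace (Cmod (b a)) with t by (symmetry; apply Cmod_scaled_circle; lra); fold q.
    apply Rmult_le_compat_r; [apply pow_le; lra|].
    specialize (hMb a ha); simpl in hMb; rewrite Cmult_1_r in hMb; exact hMb. }
  unfold is_pseries; apply is_series_C; intros e he.
  destruct (pow_lt_eps q M e hq hM he) as [N hN].
  exists N; intros n hn.
  rewrite <- (hsum n).
  rewrite (sum_n_ext _ (fun k => x ^ k * (/ RtoC (2 * PI) *
      CInt (fun a => U (z0 + b a) / b a ^ k) (- PI) PI))).
  2:{ intros k; rewrite pow_n_Cpow; reflexivity. }
  set (S := sum_n _ n). replace (S - (S + Rem (Datatypes.S n))) with (- Rem (Datatypes.S n)).
  - rewrite Cmod_opp; eapply Rle_lt_trans; [apply hRb|apply hN; lia].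
  - Cring.
Qed.

Lemma hol_analytic (f : C -> C) (z : C) : hol f z -> analytic_at f z.
Proof.
  intros h; destruct (locally_closed_disc _ _ (hol_locally _ _ h)) as [t [ht hf]].
  apply hol_disc_pseries with t; assumption.
Qed.

Lemma Cmod_small_zero (c : C) (M : R) :
  (forall e, (0 < e)%R -> (Cmod c <= M * e)%R) -> c = 0.
Proof.
  intros h; apply Cmod_eq_0; pose proof (Cmod_ge_0 c) as h0.
  destruct (Rle_lt_dec (Cmod c) 0) as [hle|hlt]; [lra|].
  destruct (Rle_lt_dec M 0) as [hM|hM].
  - specialize (h 1%R ltac:(lra)); lra.
  - specialize (h (Cmod c / (2 * M))%R ltac:(apply Rdiv_lt_0_compat; lra)).
    replace (M * (Cmod c / (2 * M)))%R with (Cmod c / 2)%R in h by (field; lra); lra.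
Qed.

(** The limit is continuous and inherits Cauchy's formula on a smaller circle, both sides of which
    pass to the uniform limit; a Cauchy-type integral with continuous density is holomorphic. *)
Lemma weierstrass (f : C -> C) (z0 : C) (t : R) :
  (forall e, (0 < e)%R -> exists h : C -> C, forall y, (Cmod (y - z0) <= t)%R ->
     hol h y /\ (Cmod (f y - h y) <= e)%R) ->
  forall z, (Cmod (z - z0) < t)%R -> hol f z.
Proof.
  intros happ.
  assert (hc : forall y, (Cmod (y - z0) < t)%R -> continuous (T := CU) (U := CU) f y).
  { intros y hy; apply continuous_C_Cmod; intros e he.
    destruct (happ (e / 4)%R ltac:(lra)) as [h hh].
    pose proof (continuous_locally_C h y (e / 4)%R
      (hol_continuous _ _ (proj1 (hh y (Rlt_le _ _ hy)))) ltac:(lra)) as h1.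
    generalize (filter_and _ _ h1 (open_Cball z0 y t hy)); apply filter_imp; intros u [a b].
    pose proof (proj2 (hh y (Rlt_le _ _ hy))) as h2.
    pose proof (proj2 (hh u (Rlt_le _ _ b))) as h3.
    replace (f u - f y) with ((f u - h u) + ((h u - h y) - (f y - h y))) by Cring.
    eapply Rle_lt_trans; [apply Cmod_triangle|].
    eapply Rle_lt_trans; [apply Rplus_le_compat_l, Cmod_triangle|].
    rewrite Cmod_opp; lra. }
  intros z hz.
  (* The radius lies strictly between [|z - z0|] and [t], because continuity of the limit has been
     obtained in the open disc. *)
  pose (s := ((Cmod (z - z0) + t) / 2)%R).
  assert (hs : (Cmod (z - z0) < s < t)%R) by (unfold s; lra).
  assert (hs0 : (0 < s)%R) by (pose proof (Cmod_ge_0 (z - z0)); lra).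
  assert (hbc : forall a, continuous (U := CU) (boundary f z0 s) a).
  { apply continuous_boundary; [lra|]; intros y hy; apply hc; lra. }
  assert (hrep : forall y, (Cmod (y - z0) < s)%R ->
     / RtoC (2 * PI) * cauchy_int (boundary f z0 s) 1 z0 s y = f y).
  { intros y hy; apply Ceq_minus.
    pose (k := fun a => RtoC s * circle a / (z0 + RtoC s * circle a - y)).
    assert (hkc : forall a, continuous (U := CU) k a).
    { intros a; unfold k; cont. apply circle_shift_nz, hy. }
    destruct (segcont_bounded k (- PI) PI (fun a _ => hkc a)) as [M [hM hMb]].
    apply (Cmod_small_zero _ (M + 1)%R); intros e he.
    destruct (happ e he) as [h hh].
    assert (hhol : forall u, (Cmod (u - z0) <= s)%R -> hol h u) by (intros u hu; apply hh; lra).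
    assert (hbh : forall a, continuous (U := CU) (boundary h z0 s) a).
    { apply continuous_boundary; [lra|]; intros u hu; apply hol_continuous, hhol; lra. }
    replace (/ RtoC (2 * PI) * cauchy_int (boundary f z0 s) 1 z0 s y - f y) with
      (/ RtoC (2 * PI) * (cauchy_int (boundary f z0 s) 1 z0 s y - cauchy_int (boundary h z0 s) 1 z0 s y)
       - (f y - h y)).
    2:{ rewrite (cauchy_rep h z0 y s hhol hy). Cring. }
    eapply Rle_trans; [apply Cmod_triangle|]; rewrite Cmod_opp.
    pose proof (proj2 (hh y ltac:(lra))) as h1.
    cut (Cmod (/ RtoC (2 * PI) * (cauchy_int (boundary f z0 s) 1 z0 s y
       - cauchy_int (boundary h z0 s) 1 z0 s y)) <= M * e)%R; [lra|].
    pose proof PI_RGT_0 as hpi.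
    rewrite Cmod_mult, Cmod_inv, Cmod_R, Rabs_right by (lra || apply twoPI_nz).
    apply Rmult_le_reg_l with (2 * PI)%R; [lra|].
    rewrite <- Rmult_assoc, Rinv_r, Rmult_1_l by lra.
    replace (2 * PI * (M * e))%R with ((PI - - PI) * (M * e))%R by ring.
    unfold cauchy_int; rewrite <- CInt_minus.
    - apply Cmod_CInt_le; [apply PI_bounds| |].
      + intros a _. pose proof (hbc a); pose proof (hbh a). cont;
          apply Cpow_nz, circle_shift_nz, hy.
      + intros a ha. 
        replace (boundary f z0 s a / (z0 + RtoC s * circle a - y) ^ 1
           - boundary h z0 s a / (z0 + RtoC s * circle a - y) ^ 1)
          with (k a * (f (z0 + RtoC s * circle a) - h (z0 + RtoC s * circle a))).
        * rewrite Cmod_mult; apply Rmult_le_compat; try apply Cmod_ge_0; [apply hMb, ha|].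
          apply hh. rewrite Cmod_boundary_point; lra.
        * unfold k, boundary; pose proof (circle_shift_nz z0 y s a hy); field; assumption.
    - apply PI_bounds.
    - intros a _; pose proof (hbc a); cont; apply Cpow_nz, circle_shift_nz, hy.
    - intros a _; pose proof (hbh a); cont; apply Cpow_nz, circle_shift_nz, hy. }
  apply hol_ext_loc with (fun y => / RtoC (2 * PI) * cauchy_int (boundary f z0 s) 1 z0 s y).
  - generalize (open_Cball z0 z s (proj1 hs)); apply filter_imp; exact hrep.
  - apply hol_mult; [apply hol_const|apply cauchy_int_hol; [exact hbc|apply hs]].
Qed.

(** Joint continuity of the derivative is not among the hypotheses but follows from them: Cauchy's
    formula writes the derivative as an integral over a circle that is the same for all nearby
    points. *)
Lemma hol_CInt (F : C -> R -> C) (a b : R) (z0 : C) :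
  (a <= b)%R ->
  (forall t, (a <= t <= b)%R -> locally (T := prod_UniformSpace CU RU) (z0, t)
     (fun p => jcCR F p /\ hol (fun z => F z (snd p)) (fst p))) ->
  hol (fun z => CInt (F z) a b) z0.
Proof.
  intros hab h.
  pose (F' := fun z t => C_derive (fun z => F z t) z).
  assert (hF' : forall z t, locally (T := prod_UniformSpace CU RU) (z, t)
     (fun p => jcCR F p /\ hol (fun z => F z (snd p)) (fst p)) -> jcCR F' (z, t)).
  { intros z t hl.
    apply (locally_prod_ball (X := CU) (Y := RU)) in hl; destruct hl as [d hd].
    pose proof (cond_pos d) as hp.
    pose (r := (d / 2)%R).
    assert (hr : (0 < r)%R) by (unfold r; lra).
    assert (hin : forall y u, (Cmod (y - z) <= r)%R -> ball (M := RU) t d u ->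
       jcCR F (y, u) /\ hol (fun z => F z u) y).
    { intros y u hy hu; apply (hd y u); [apply ball_C_Cmod; unfold r in hy; lra|exact hu]. }
    unfold jointly_continuous.
    apply (continuous_ext_loc (T := prod_UniformSpace CU RU) (U := CU)) with
      (fun p => / RtoC (2 * PI) * cauchy_int (boundary (fun y => F y (snd p)) z r) 2 z r (fst p)).
    - assert (h1 := locally_fst (X := CU) (Y := RU) _ (z, t) (locally_Cball z r hr)).
      assert (h2 := locally_snd (X := CU) (Y := RU) _ (z, t) (locally_ball (T := RU) t d)).
      generalize (filter_and _ _ h1 h2); apply filter_imp; intros [y u] [hy hu]; simpl in *.
      symmetry; apply (cauchy_rep_derive (fun y => F y u)); [|exact hy].
      intros v hv; apply (hin v u hv hu).
    - apply (continuous_Cmult (T := prod_UniformSpace CU RU)); [cont|].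
      apply (continuous_CInt_param (X := prod_UniformSpace CU RU)
        (fun p al => boundary (fun y => F y (snd p)) z r al
           / (z + RtoC r * circle al - fst p) ^ 2)); [apply PI_bounds|].
      intros al _.
      assert (h1 := locally_fst (X := CU) (Y := RU) _ (z, t) (locally_Cball z r hr)).
      assert (h2 := locally_snd (X := CU) (Y := RU) _ (z, t) (locally_ball (T := RU) t d)).
      assert (h3 := locally_fst (X := prod_UniformSpace CU RU) (Y := RU) _ ((z, t), al)
        (filter_and _ _ h1 h2)).
      generalize h3; apply filter_imp; intros [[y u] be] [hy hu]; simpl in hy, hu.
      unfold jointly_continuous, boundary; cbn [fst snd].
      apply (continuous_Cdiv (T := prod_UniformSpace (prod_UniformSpace CU RU) RU)).
      + apply continuous_Cmult.
        * apply (continuous_uncurry (U := CU) (V := RU) (W := CU) F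
            (fun q => z + RtoC r * circle (snd q)) (fun q : C * R * R => snd (fst q))).
          -- cont.
          -- cont.
          -- simpl. apply hin; [|exact hu]. rewrite Cmod_boundary_point; lra.
        * cont.
      + cont.
      + apply Cpow_nz, circle_shift_nz, hy. }
  assert (hQ : forall t, (a <= t <= b)%R -> locally (T := prod_UniformSpace CU RU) (z0, t)
     (fun p => jcCR F p /\ jcCR F' p /\ cder (fun z => F z (snd p)) (fst p) (F' (fst p) (snd p)))).
  { intros t ht; generalize (locally_locally _ _ (h t ht)); apply filter_imp.
    intros [z u] hl; pose proof (locally_singleton _ _ hl) as [h1 h2].
    split; [exact h1|split; [apply hF', hl|apply (hol_cder _ _ h2)]]. }
  apply hol_intro with (fun z => CInt (F' z) a b).
  assert (hT : locally (T := CU) z0 (fun z => forall t, (a <= t <= b)%R ->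
    locally (T := prod_UniformSpace CU RU) (z, t) (fun p => jcCR F p /\ jcCR F' p /\
      cder (fun z => F z (snd p)) (fst p) (F' (fst p) (snd p))))).
  { apply (locally_forall_segment (X := CU) z0 a b (fun z t =>
      locally (T := prod_UniformSpace CU RU) (z, t) (fun p => jcCR F p /\ jcCR F' p /\
      cder (fun z => F z (snd p)) (fst p) (F' (fst p) (snd p))))).
    intros t ht; generalize (locally_locally _ _ (hQ t ht)); apply filter_imp.
    intros [z u] hl; exact hl. }
  generalize hT; apply filter_imp; intros z hz; split.
  - apply cder_CInt; assumption.
  - apply (continuous_CInt_param (X := CU)); [exact hab|].
    intros t ht; generalize (hz t ht); apply filter_imp; tauto.
Qed.

(** The integral of [U] along the segment from 0 to [y], a primitive on every disc about 0 where [U]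
    is holomorphic. *)
Definition prim (U : C -> C) (y : C) : C := CInt (fun t => y * U (RtoC t * y)) 0 1.

Lemma prim_0 (U : C -> C) : prim U 0 = 0.
Proof.
  unfold prim; rewrite (CInt_ext _ (fun _ => 0)); [rewrite CInt_const; ring|lra|].
  intros t _; ring.
Qed.

(** Under the integral sign, the derivative in [y] is the derivative in [t] of [t U (t y)]. *)
Lemma cder_prim (U : C -> C) (r : R) (y : C) :
  (forall y, (Cmod y < r)%R -> hol U y) -> (Cmod y < r)%R -> cder (prim U) y (U y).
Proof.
  intros hU hy.
  assert (hseg : forall t, (0 <= t <= 1)%R -> hol U (RtoC t * y)).
  { intros t ht; apply hU; rewrite Cmod_mult, Cmod_R, Rabs_right by lra.
    pose proof (Cmod_ge_0 y); nra. }
  eapply cder_eq.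
  - apply (cder_CInt (fun y t => y * U (RtoC t * y))
      (fun y t => U (RtoC t * y) + y * (C_derive U (RtoC t * y) * RtoC t))); [lra|].
    intros t ht.
    assert (hm : forall p, jcCR (fun y t => RtoC t * y) p)
      by (intros p; unfold jointly_continuous; cont).
    pose proof (locally_continuous_comp (X := prod_UniformSpace CU RU) (Y := CU)
      (fun p => RtoC (snd p) * fst p) (y, t) _ (hm _) (hol_locally _ _ (hseg t ht))) as h.
    generalize h; apply filter_imp; intros p hp.
    assert (h1 : jcCR (fun y t => U (RtoC t * y)) p)
      by (apply (jc_comp U (fun y t => RtoC t * y)); [apply hm|apply hol_continuous, hp]).
    assert (h2 : jcCR (fun y t => C_derive U (RtoC t * y)) p)
      by (apply (jc_comp (C_derive U) (fun y t => RtoC t * y)); [apply hm|apply hol_continuous_derive, hp]).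
    unfold jointly_continuous in *; split; [cont|split; [cont|]].
    eapply cder_eq.
    + apply cder_mult; [apply cder_id|].
      apply (cder_comp (fun y => RtoC (snd p) * y) U);
        [apply cder_scale, cder_id|apply hol_cder, hp].
    + cbv beta; ring.
  - rewrite (CInt_FTC (fun t => RtoC t * U (0 + RtoC t * y))).
    + replace (0 + RtoC 1 * y) with y by ring; ring.
    + lra.
    + intros t ht; eapply rder_eq.
      * apply (rder_ext (fun t => (fun x => x * U (0 + x * y)) (0 + RtoC t * 1))).
        { intros u; cbv beta; replace (0 + RtoC u * 1) with (RtoC u) by ring; reflexivity. }
        apply (rder_real_line (fun x => x * U (0 + x * y)) 0 1). replace (0 + RtoC t * 1) with (RtoC t) by ring.
        apply cder_mult; [apply cder_id|].
        apply (cder_comp (fun x => 0 + x * y) U); [apply cder_plus; [apply cder_const|apply cder_lin]|].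
        rewrite Cplus_0_l; apply hol_cder, hseg, ht.
      * cbv beta; rewrite Cplus_0_l; ring.
    + intros t ht. pose proof (hseg t ht) as hh.
      assert (continuous (U := CU) (fun t => U (RtoC t * y)) t).
      { apply (continuous_comp (V := CU) (fun t => RtoC t * y) U); [cont|apply hol_continuous, hh]. }
      assert (continuous (U := CU) (fun t => C_derive U (RtoC t * y)) t).
      { apply (continuous_comp (V := CU) (fun t => RtoC t * y) (C_derive U));
          [cont|apply hol_continuous_derive, hh]. }
      cont.
Qed.

(** * Power series *)

Lemma bounded_prefix (u : nat -> R) (N : nat) :
  exists M, (0 < M)%R /\ forall n, (n < N)%nat -> (u n <= M)%R.
Proof.
  induction N as [|N [M [hM h]]].
  - exists 1%R; split; [lra|]; intros n hn; lia.
  - exists (Rmax M (u N)); split.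
    + eapply Rlt_le_trans; [exact hM|apply Rmax_l].
    + intros n hn; destruct (Nat.eq_dec n N) as [->|he]; [apply Rmax_r|].
      eapply Rle_trans; [apply h; lia|apply Rmax_l].
Qed.

Lemma eventually_bounded (u : nat -> R) :
  eventually (fun n => (u n <= 1)%R) -> exists M, (0 < M)%R /\ forall n, (u n <= M)%R.
Proof.
  intros [N hN]; destruct (bounded_prefix u N) as [M [hM h]].
  exists (Rmax M 1); split; [eapply Rlt_le_trans; [exact hM|apply Rmax_l]|].
  intros n; destruct (le_lt_dec N n) as [hn|hn].
  - eapply Rle_trans; [apply hN, hn|apply Rmax_r].
  - eapply Rle_trans; [apply h, hn|apply Rmax_l].
Qed.

Lemma series_terms_bounded (u : nat -> C) :
  ex_series (K := C_AbsRing) (V := C_NormedModule) u ->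
  exists M, (0 < M)%R /\ forall n, (Cmod (u n) <= M)%R.
Proof.
  intros [l h]; apply eventually_bounded.
  destruct (proj1 (is_series_C u l) h (1 / 2)%R ltac:(lra)) as [N hN].
  exists (S N); intros n hn; destruct n as [|n]; [lia|].
  pose proof (hN n ltac:(lia)) as h1. pose proof (hN (S n) ltac:(lia)) as h2.
  rewrite sum_Sn in h2; change (@plus C_AbelianGroup) with Cplus in h2.
  set (a := sum_n (G := C_AbelianGroup) u n) in *.
  replace (u (S n)) with ((a + u (S n) - l) - (a - l)) by Cring.
  eapply Rle_trans; [apply Cmod_triangle|]; rewrite Cmod_opp; lra.
Qed.

Lemma series_terms_bounded_R (u : nat -> R) :
  ex_series (K := R_AbsRing) (V := R_NormedModule) u ->
  exists M, (0 < M)%R /\ forall n, (u n <= M)%R.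
Proof.
  intros h; apply eventually_bounded.
  pose proof (ex_series_lim_0 u h) as h0.
  pose proof (h0 _ (locally_ball (T := RU) 0%R (mkposreal 1 Rlt_0_1))) as h1.
  unfold filtermap in h1; generalize h1; apply filter_imp; intros n hn.
  change (Rabs (u n - 0) < 1)%R in hn. apply Rabs_def2 in hn; lra.
Qed.

Lemma series_tail (u : nat -> C) (l : C) (M q : R) :
  is_series (K := C_AbsRing) (V := C_NormedModule) u l ->
  (0 <= q < 1)%R -> (forall n, (Cmod (u n) <= M * q ^ n)%R) ->
  forall N, (Cmod (l - sum_n (G := C_AbelianGroup) u N) <= M / (1 - q) * q ^ N)%R.
Proof.
  intros hl hq hb N.
  assert (hM : (0 <= M)%R) by (specialize (hb 0%nat); simpl in hb; pose proof (Cmod_ge_0 (u 0%nat)); lra).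
  assert (hp : forall k, (Cmod (sum_n (G := C_AbelianGroup) u (N + k) - sum_n (G := C_AbelianGroup) u N)
     <= M / (1 - q) * (q ^ N - q ^ (N + k)))%R).
  { induction k as [|k IH].
    - rewrite Nat.add_0_r. rewrite Rminus_diag, Rmult_0_r.
      replace (sum_n (G := C_AbelianGroup) u N - sum_n (G := C_AbelianGroup) u N) with (RtoC 0) by Cring.
      rewrite Cmod_0; lra.
    - rewrite Nat.add_succ_r, sum_Sn; change (@plus C_AbelianGroup) with Cplus.
      set (a := sum_n (G := C_AbelianGroup) u (N + k)) in *. set (b := sum_n (G := C_AbelianGroup) u N) in *.
      replace (a + u (S (N + k)) - b) with ((a - b) + u (S (N + k))) by Cring.
      eapply Rle_trans; [apply Cmod_triangle|].
      specialize (hb (S (N + k))).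
      assert (hpow : (0 <= q ^ (N + k))%R) by (apply pow_le; lra).
      replace (M / (1 - q) * (q ^ N - q ^ S (N + k)))%R with
        (M / (1 - q) * (q ^ N - q ^ (N + k)) + M * q ^ (N + k))%R by (simpl; field; lra).
      rewrite <- tech_pow_Rmult in hb.
      pose proof (Rmult_le_pos _ _ (Rmult_le_pos _ _ hM hpow) (ltac:(lra) : (0 <= 1 - q)%R)).
      lra. }
  apply Rnot_lt_le; intros hlt.
  set (bd := (M / (1 - q) * q ^ N)%R) in *.
  destruct (proj1 (is_series_C u l) hl (Cmod (l - sum_n (G := C_AbelianGroup) u N) - bd)%R ltac:(lra))
    as [n0 hn0].
  specialize (hn0 (N + n0)%nat ltac:(lia)). specialize (hp n0).
  set (a := sum_n (G := C_AbelianGroup) u (N + n0)) in *. set (b := sum_n (G := C_AbelianGroup) u N) in *.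
  assert (h1 : (Cmod (l - b) <= Cmod (a - l) + Cmod (a - b))%R).
  { replace (l - b) with (- (a - l) + (a - b)) by Cring.
    eapply Rle_trans; [apply Cmod_triangle|]; rewrite Cmod_opp; lra. }
  assert (h2 : (M / (1 - q) * (q ^ N - q ^ (N + n0)) <= bd)%R).
  { unfold bd; apply Rmult_le_compat_l.
    - apply Rmult_le_pos; [exact hM|left; apply Rinv_0_lt_compat; lra].
    - pose proof (pow_le q (N + n0) ltac:(lra)); lra. }
  lra.
Qed.

Lemma series_tail_small (M q e : R) : (0 <= q < 1)%R -> (0 < M)%R -> (0 < e)%R ->
  exists N, (M / (1 - q) * q ^ N <= e)%R.
Proof.
  intros hq hM he.
  destruct (pow_lt_eps q (M / (1 - q)) e hq ltac:(apply Rdiv_lt_0_compat; lra) he) as [N hN].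
  exists N; left; apply hN; lia.
Qed.

Lemma hol_sum_n (u : nat -> C -> C) (N : nat) (z : C) :
  (forall n, hol (u n) z) -> hol (fun y => sum_n (G := C_AbelianGroup) (fun n => u n y) N) z.
Proof.
  intros h; induction N as [|N IH].
  - apply hol_ext with (u 0%nat); [|apply h]. intros y; rewrite sum_O; reflexivity.
  - apply hol_ext with (fun y => sum_n (G := C_AbelianGroup) (fun n => u n y) N + u (S N) y).
    + intros y; rewrite sum_Sn; reflexivity.
    + apply hol_plus; [exact IH|apply h].
Qed.

Lemma continuous_sum_n {T : UniformSpace} (u : nat -> T -> C) (N : nat) (x : T) :
  (forall n, continuous (U := CU) (u n) x) ->
  continuous (U := CU) (fun y => sum_n (G := C_AbelianGroup) (fun n => u n y) N) x.
Proof.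
  intros h; induction N as [|N IH].
  - apply continuous_ext_C with (u 0%nat); [|apply h]. intros y; rewrite sum_O; reflexivity.
  - apply continuous_ext_C with (fun y => sum_n (G := C_AbelianGroup) (fun n => u n y) N + u (S N) y).
    + intros y; rewrite sum_Sn; reflexivity.
    + apply continuous_Cplus; [exact IH|apply h].
Qed.

(** Terms bounded at distance [rho / 2] are of size [2^-n] at distance [rho / 4]; the partial sums
    converge uniformly there and [weierstrass] applies. *)
Lemma analytic_at_hol (U : C -> C) (z0 : C) : analytic_at U z0 -> hol U z0.
Proof.
  intros [a [rho [hrho h]]].
  set (s := (rho / 2)%R). set (t := (rho / 4)%R).
  assert (hs : (Cmod (z0 + RtoC s - z0) < rho)%R).
  { replace (z0 + RtoC s - z0) with (RtoC s) by ring. rewrite Cmod_R, Rabs_right; unfold s; lra. }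
  pose proof (h (z0 + RtoC s) hs) as h1.
  destruct (series_terms_bounded _ (ex_intro _ _ h1)) as [M [hM hb]].
  apply (weierstrass U z0 t).
  2:{ replace (z0 - z0) with (RtoC 0) by ring; rewrite Cmod_0; unfold t; lra. }
  intros e he.
  destruct (series_tail_small M (1 / 2) e ltac:(lra) hM he) as [N hN].
  exists (fun z => sum_n (G := C_AbelianGroup) (fun k => (z - z0) ^ k * a k) N).
  intros y hy; split.
  - apply (hol_sum_n (fun k z => (z - z0) ^ k * a k)); intros n.
    apply hol_mult; [apply hol_pow, hol_minus; [apply hol_id|apply hol_const]|apply hol_const].
  - eapply Rle_trans; [|exact hN].
    assert (hy2 : (Cmod (y - z0) < rho)%R) by (unfold t in hy; lra).
    pose proof (h y hy2) as h2.
    rewrite (sum_n_ext _ (fun k => scal (K := C_Ring) (V := C_ModuleSpace) (pow_n (K := C_Ring) (y - z0) k) (a k))).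
    2:{ intros k; reflexivity. }
    apply (series_tail _ (U y) M (1 / 2) h2); [lra|].
    intros n. specialize (hb n).
    change (Cmod ((z0 + RtoC s - z0) ^ n * a n) <= M)%R in hb.
    change (Cmod ((y - z0) ^ n * a n) <= M * (1 / 2) ^ n)%R.
    replace (z0 + RtoC s - z0) with (RtoC s) in hb by ring.
    rewrite Cmod_mult, Cmod_pow in hb |- *. rewrite Cmod_R, Rabs_right in hb by (unfold s; lra).
    apply Rle_trans with ((1 / 2) ^ n * (s ^ n * Cmod (a n)))%R.
    + rewrite <- Rmult_assoc, <- Rpow_mult_distr.
      apply Rmult_le_compat_r; [apply Cmod_ge_0|].
      apply pow_incr; split; [apply Cmod_ge_0|unfold s, t in *; lra].
    + pose proof (pow_le (1 / 2) n ltac:(lra)). nra.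
Qed.

Notation CC := (prod_UniformSpace C_UniformSpace C_UniformSpace).

Notation jcCC := (jointly_continuous (X := CU) (Y := CU) (Z := CU)).

(** The Taylor polynomial of total degree [N], in the summation order of [is_pseries2]. *)
Definition poly2 (a : nat -> nat -> C) (z0 w0 : C) (N : nat) (z w : C) : C :=
  sum_n (G := C_AbelianGroup) (fun n => sum_n (G := C_AbelianGroup)
     (fun k => a k (n - k)%nat * (z - z0) ^ k * (w - w0) ^ (n - k)%nat) n) N.

Lemma Cmod_sum_n_le (u : nat -> C) (v : nat -> R) (N : nat) :
  (forall n, (n <= N)%nat -> (Cmod (u n) <= v n)%R) ->
  (Cmod (sum_n (G := C_AbelianGroup) u N) <= sum_n v N)%R.
Proof.
  intros h; induction N as [|N IH].
  - rewrite !sum_O; apply h; lia.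
  - rewrite !sum_Sn. change (@plus C_AbelianGroup) with Cplus.
    eapply Rle_trans; [apply Cmod_triangle|]. apply Rplus_le_compat; [apply IH; intros; apply h; lia|].
    apply h; lia.
Qed.

Lemma sum_n_Rscal (u : nat -> R) (c : R) (N : nat) :
  sum_n (fun n => c * u n)%R N = (c * sum_n u N)%R.
Proof.
  induction N as [|N IH]; [rewrite !sum_O; reflexivity|].
  rewrite !sum_Sn, IH. unfold plus; simpl; ring.
Qed.

(** The diagonal sums of moduli are bounded at the point [(z0 + rho / 2, w0 + rho / 2)]; at distance
    [rho / 4] the diagonal of degree [n] gains [2^-n]. Uniformity lets properties of polynomials
    pass to [U]. *)
Lemma pseries2_approx (a : nat -> nat -> C) (U : C -> C -> C) (z0 w0 : C) :
  is_pseries2_near a U z0 w0 ->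
  exists t, (0 < t)%R /\ forall e, (0 < e)%R -> exists N0, forall N, (N0 <= N)%nat ->
    forall z w, (Cmod (z - z0) <= t)%R -> (Cmod (w - w0) <= t)%R ->
      (Cmod (U z w - poly2 a z0 w0 N z w) <= e)%R.
Proof.
  intros [rho [hrho h]].
  set (s := (rho / 2)%R). set (t := (rho / 4)%R).
  assert (hs : forall z0, (Cmod (z0 + RtoC s - z0) < rho)%R).
  { intros z; replace (z + RtoC s - z) with (RtoC s) by ring.
    rewrite Cmod_R, Rabs_right; unfold s; lra. }
  destruct (h (z0 + RtoC s) (w0 + RtoC s) (hs z0) (hs w0)) as [h1 _].
  destruct (series_terms_bounded_R _ h1) as [M [hM hb]].
  exists t; split; [unfold t; lra|]; intros e he.
  destruct (pow_lt_eps (1 / 2) (M / (1 - 1 / 2)) e ltac:(lra) ltac:(lra) he) as [N0 hN0].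
  exists N0; intros N hN z w hz hw.
  eapply Rle_trans; [|left; apply (hN0 N hN)].
  destruct (h z w ltac:(unfold t in *; lra) ltac:(unfold t in *; lra)) as [_ h2].
  apply (series_tail _ (U z w) M (1 / 2) h2); [lra|].
  intros n.
  apply Rle_trans with (sum_n (fun k => (1 / 2) ^ n * Cmod (a k (n - k)%nat * (z0 + RtoC s - z0) ^ k
     * (w0 + RtoC s - w0) ^ (n - k)%nat))%R n).
  - apply Cmod_sum_n_le; intros k hk.
    replace (z0 + RtoC s - z0) with (RtoC s) by ring.
    replace (w0 + RtoC s - w0) with (RtoC s) by ring.
    rewrite !Cmod_mult, !Cmod_pow, Cmod_R, Rabs_right by (unfold s; lra).
    replace ((1 / 2) ^ n)%R with ((1 / 2) ^ k * (1 / 2) ^ (n - k))%R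
      by (rewrite <- pow_add; f_equal; lia).
    replace ((1 / 2) ^ k * (1 / 2) ^ (n - k) * (Cmod (a k (n - k)%nat) * s ^ k * s ^ (n - k)))%R
      with (Cmod (a k (n - k)%nat) * ((1 / 2) * s) ^ k * ((1 / 2) * s) ^ (n - k))%R
      by (rewrite !Rpow_mult_distr; ring).
    assert (hp : forall x m, (Cmod x <= t)%R -> (0 <= Cmod x ^ m <= (1 / 2 * s) ^ m)%R).
    { intros x m hx; split; [apply pow_le, Cmod_ge_0|].
      apply pow_incr; split; [apply Cmod_ge_0|unfold s, t in *; lra]. }
    pose proof (hp _ k hz); pose proof (hp _ (n - k)%nat hw); pose proof (Cmod_ge_0 (a k (n - k)%nat)).
    apply Rmult_le_compat; [apply Rmult_le_pos; lra|lra| |lra].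
    apply Rmult_le_compat_l; lra.
  - rewrite sum_n_Rscal. specialize (hb n).
    pose proof (pow_le (1 / 2) n ltac:(lra)). nra.
Qed.

Lemma hol_poly2 (a : nat -> nat -> C) (z0 w0 : C) (N : nat) (g1 g2 : C -> C) (x : C) :
  hol g1 x -> hol g2 x -> hol (fun x => poly2 a z0 w0 N (g1 x) (g2 x)) x.
Proof.
  intros h1 h2; unfold poly2.
  apply (hol_sum_n (fun n x => sum_n (G := C_AbelianGroup)
     (fun k => a k (n - k)%nat * (g1 x - z0) ^ k * (g2 x - w0) ^ (n - k)%nat) n)); intros n.
  apply (hol_sum_n (fun k x => a k (n - k)%nat * (g1 x - z0) ^ k * (g2 x - w0) ^ (n - k)%nat)).
  intros k; repeat apply hol_mult; try apply hol_const; apply hol_pow, hol_minus;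
    (assumption || apply hol_const).
Qed.

Lemma jc_poly2 (a : nat -> nat -> C) (z0 w0 : C) (N : nat) (p : C * C) :
  jcCC (poly2 a z0 w0 N) p.
Proof.
  unfold jointly_continuous, poly2.
  apply (continuous_sum_n (T := CC) (fun n q => sum_n (G := C_AbelianGroup)
     (fun k => a k (n - k)%nat * (fst q - z0) ^ k * (snd q - w0) ^ (n - k)%nat) n)); intros n.
  apply (continuous_sum_n (T := CC)
    (fun k q => a k (n - k)%nat * (fst q - z0) ^ k * (snd q - w0) ^ (n - k)%nat)).
  intros k; cont.
Qed.

Lemma analytic2_continuous (U : C -> C -> C) (z0 w0 : C) :
  analytic2_at U z0 w0 -> jcCC U (z0, w0).
Proof.
  intros [a ha]; destruct (pseries2_approx a U z0 w0 ha) as [t [ht happ]].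
  unfold jointly_continuous.
  apply (continuous_C_Cmod (T := CC)); intros e he.
  destruct (happ (e / 4)%R ltac:(lra)) as [N hN]; specialize (hN N (le_n N)).
  pose proof (continuous_locally_C (T := CC) _ _ (e / 4)%R (jc_poly2 a z0 w0 N (z0, w0)) ltac:(lra)) as h1.
  pose proof (locally_fst (X := CU) (Y := CU) _ (z0, w0) (locally_Cball z0 t ht)) as h2.
  pose proof (locally_snd (X := CU) (Y := CU) _ (z0, w0) (locally_Cball w0 t ht)) as h3.
  generalize (filter_and _ _ h1 (filter_and _ _ h2 h3)); apply filter_imp.
  intros [z w] [p1 [p2 p3]]; simpl in *.
  assert (q1 := hN z w ltac:(lra) ltac:(lra)).
  assert (z00 : forall z : C, (Cmod (z - z) <= t)%R).
  { intros y; replace (y - y) with (RtoC 0) by ring; rewrite Cmod_0; lra. }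
  assert (q2 := hN z0 w0 (z00 _) (z00 _)).
  replace (U z w - U z0 w0) with ((U z w - poly2 a z0 w0 N z w)
    + ((poly2 a z0 w0 N z w - poly2 a z0 w0 N z0 w0) - (U z0 w0 - poly2 a z0 w0 N z0 w0))) by Cring.
  eapply Rle_lt_trans; [apply Cmod_triangle|].
  eapply Rle_lt_trans; [apply Rplus_le_compat_l, Cmod_triangle|].
  rewrite Cmod_opp; lra.
Qed.

(** Uniform limit of polynomials along the curve [y |-> (g1 y, g2 y)]. Taking [g1] or [g2] constant
    gives holomorphy in each variable. *)
Lemma analytic2_hol (U : C -> C -> C) (g1 g2 : C -> C) (x : C) :
  analytic2_at U (g1 x) (g2 x) -> hol g1 x -> hol g2 x -> hol (fun y => U (g1 y) (g2 y)) x.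
Proof.
  intros [a ha] h1 h2; destruct (pseries2_approx a U _ _ ha) as [t [ht happ]].
  pose proof (continuous_locally_C (T := CU) g1 x t (hol_continuous _ _ h1) ht) as c1.
  pose proof (continuous_locally_C (T := CU) g2 x t (hol_continuous _ _ h2) ht) as c2.
  destruct (locally_closed_disc x _ (filter_and _ _ (filter_and _ _ c1 c2)
    (filter_and _ _ (hol_locally _ _ h1) (hol_locally _ _ h2)))) as [r [hr hd]].
  apply (weierstrass _ x r).
  2:{ replace (x - x) with (RtoC 0) by ring; rewrite Cmod_0; exact hr. }
  intros e he; destruct (happ e he) as [N hN]; specialize (hN N (le_n N)).
  exists (fun y => poly2 a (g1 x) (g2 x) N (g1 y) (g2 y)).
  intros y hy; destruct (hd y hy) as [[p1 p2] [p3 p4]]; split.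
  - apply hol_poly2; assumption.
  - apply hN; lra.
Qed.

(** * Functions holomorphic in two variables *)

Lemma Cmod_sqr (z : C) : (Cmod z * Cmod z = Re z * Re z + Im z * Im z)%R.
Proof. pose proof (Cmod2_alt z) as h; simpl in h; rewrite !Rmult_1_r in h; exact h. Qed.

(** The quotient [u = Im z / (|z| + Re z)] is the tangent of half the argument, so the double-angle
    formulas express cosine and sine of the argument rationally in [u]. *)
Lemma Cexp_Clog (z : C) : (0 < Cmod z + Re z)%R -> Cexp (Clog z) = z.
Proof.
  intros h.
  pose proof (Cmod_sqr z) as hs.
  assert (hm : (0 < Cmod z)%R).
  { pose proof (re_le_Cmod z) as h1; pose proof (Rle_abs (Re z)); lra. }
  unfold Cexp, Clog; simpl. rewrite exp_ln by exact hm.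
  set (u := (Im z / (Cmod z + Re z))%R).
  assert (hu : ((Cmod z + Re z) * u = Im z)%R) by (unfold u; field; lra).
  pose proof (cos_atan u) as hc; pose proof (sin_atan u) as hsn.
  assert (hq : (0 < 1 + u²)%R) by (unfold Rsqr; nra).
  pose proof (sqrt_lt_R0 _ hq) as hr. pose proof (sqrt_sqrt _ (Rlt_le _ _ hq)) as hrr.
  rewrite cos_2a, sin_2a, hc, hsn.
  set (r := sqrt (1 + u²)) in *.
  assert (hr1 : (1 / r * (1 / r) = / (1 + u²))%R) by (rewrite <- hrr; field; lra).
  assert (hr2 : (u / r * (u / r) = u² * / (1 + u²))%R) by (rewrite <- hrr; unfold Rsqr; field; lra).
  assert (hr3 : (2 * (u / r) * (1 / r) = 2 * u * / (1 + u²))%R) by (rewrite <- hrr; field; lra).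
  rewrite hr1, hr2, hr3; unfold Rsqr in *.
  assert (hk : ((Cmod z + Re z) * (1 + u * u) = 2 * Cmod z)%R).
  { apply Rmult_eq_reg_l with (Cmod z + Re z)%R; [|lra].
    replace ((Cmod z + Re z) * ((Cmod z + Re z) * (1 + u * u)))%R with
      ((Cmod z + Re z) * (Cmod z + Re z) + ((Cmod z + Re z) * u) * ((Cmod z + Re z) * u))%R by ring.
    rewrite hu; nra. }
  assert (hi : (Cmod z * / (1 + u * u) = (Cmod z + Re z) / 2)%R).
  { replace (Cmod z) with ((Cmod z + Re z) * (1 + u * u) / 2)%R at 1 by lra. field; lra. }
  apply injective_projections; simpl.
  - change (fst z) with (Re z).
    replace (Cmod z * (/ (1 + u * u) - u * u * / (1 + u * u)))%R
      with (2 * (Cmod z * / (1 + u * u)) - Cmod z)%R by (field; lra).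
    rewrite hi; lra.
  - change (snd z) with (Im z).
    replace (Cmod z * (2 * u * / (1 + u * u)))%R with (2 * u * (Cmod z * / (1 + u * u)))%R by ring.
    rewrite hi; lra.
Qed.

Lemma Re_pos_Clog_dom (z : C) : (0 < Re z)%R -> (0 < Cmod z + Re z)%R.
Proof. intros h; pose proof (Cmod_ge_0 z); lra. Qed.

Lemma Re_pos_nz (z : C) : (0 < Re z)%R -> z <> 0.
Proof. intros h ->; simpl in h; lra. Qed.

Lemma continuous_Clog (z : C) : (0 < Re z)%R -> continuous (T := CU) (U := CU) Clog z.
Proof.
  intros h. pose proof (proj1 (Cmod_gt_0 z) (Re_pos_nz z h)) as hm.
  unfold Clog; apply (continuous_Cpair (T := CU)).
  - apply (continuous_Rcomp (T := CU) ln Cmod).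
    + apply (continuous_Cmod (T := CU) (fun y => y)); cont.
    + apply derivable_continuous_pt. eexists; apply derivable_pt_lim_ln, hm.
  - apply continuous_Rmult; [cont|].
    apply (continuous_Rcomp (T := CU) atan (fun z => Im z / (Cmod z + Re z))%R).
    + apply continuous_Rmult; [apply (continuous_Im (T := CU) (fun y => y)); cont|].
      apply continuous_Rinv_fun; [|pose proof (Re_pos_Clog_dom z h); lra].
      apply continuous_Rplus; [apply (continuous_Cmod (T := CU) (fun y => y)); cont|].
      apply (continuous_Re (T := CU) (fun y => y)); cont.
    + apply derivable_continuous_pt, derivable_pt_atan.
Qed.

Lemma locally_Re_pos (z : C) : (0 < Re z)%R -> locally (T := CU) z (fun y => (0 < Re y)%R).
Proof.
  intros h; apply (locally_lt_continuous (T := CU) (fun _ => 0%R) Re); [cont| |exact h].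
  apply (continuous_Re (T := CU) (fun y => y)); cont.
Qed.

(** Derivative of an inverse in Caratheodory's form: the slope of [Cexp] at [Clog z], composed with
    [Clog], is nonzero near [z], and its inverse is the slope of [Clog]. *)
Lemma cder_Clog (z : C) : (0 < Re z)%R -> cder Clog z (/ z).
Proof.
  intros h; destruct (cder_Cexp (Clog z)) as [phi [hc [hl he]]].
  pose proof (continuous_Clog z h) as hcl.
  rewrite Cexp_Clog in hl by (apply Re_pos_Clog_dom, h).
  assert (hcp : continuous (T := CU) (U := CU) (fun y => phi (Clog y)) z)
    by (apply (continuous_comp (U := CU) (V := CU) (W := CU) Clog phi); assumption).
  assert (hn : phi (Clog z) <> 0) by (rewrite hl; apply Re_pos_nz, h).
  exists (fun y => / phi (Clog y)); split; [cont|split; [congruence|]].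
  pose proof (locally_continuous_comp (X := CU) (Y := CU) Clog z _ hcl he) as h1.
  pose proof (locally_neq_0 (T := CU) _ z hcp hn) as h2.
  generalize (filter_and _ _ (filter_and _ _ h1 h2) (locally_Re_pos z h)); apply filter_imp.
  intros y [[a b] c].
  rewrite !Cexp_Clog in a by (apply Re_pos_Clog_dom; assumption).
  rewrite a; field; exact b.
Qed.

Lemma hol_Clog (z : C) : (0 < Re z)%R -> hol Clog z.
Proof.
  intros h; apply hol_intro with Cinv.
  generalize (locally_Re_pos z h); apply filter_imp; intros y hy; split; [apply cder_Clog, hy|].
  apply (continuous_Cinv (T := CU) (fun y => y)); [cont|apply Re_pos_nz, hy].
Qed.

Lemma Clog_1 : Clog 1 = 0.
Proof.
  unfold Clog; rewrite Cmod_1, ln_1. Creduce.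
  unfold Rdiv; rewrite Rmult_0_l, atan_0, Rmult_0_r; reflexivity.
Qed.

(** * Joint holomorphy, Taylor quotients and Hartogs coefficients *)

Lemma locally_restrict {X Y Z : UniformSpace} (m : X -> Y) (x : X) (y : Y) (Q : Y -> Prop) :
  continuous m x -> m x = y -> locally y Q -> locally x (fun u => Q (m u)).
Proof. intros h <-; apply locally_continuous_comp, h. Qed.

(** Holomorphy in two variables is encoded as joint continuity together with holomorphy in each
    variable; this form is stable under the integrals over one variable from which derivatives and
    quotients are built. *)
Definition jhol_pt (U : C -> C -> C) (p : C * C) : Prop :=
  jcCC U p /\ hol (fun z => U z (snd p)) (fst p) /\ hol (U (fst p)) (snd p).

Definition jhol (U : C -> C -> C) (z0 w0 : C) : Prop :=
  locally (T := CC) (z0, w0) (jhol_pt U).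

Lemma jhol_at (U : C -> C -> C) (z0 w0 : C) : jhol U z0 w0 -> jhol_pt U (z0, w0).
Proof. intros h; apply (locally_singleton _ _ h). Qed.

Lemma jhol_ext_loc (U V : C -> C -> C) (z0 w0 : C) :
  locally (T := CC) (z0, w0) (fun p => U (fst p) (snd p) = V (fst p) (snd p)) ->
  jhol U z0 w0 -> jhol V z0 w0.
Proof.
  intros he h; unfold jhol.
  generalize (filter_and _ _ (locally_locally _ _ he) h); apply filter_imp.
  intros [z w] [a [b [c d]]]; simpl in *; split; [|split].
  - apply (continuous_ext_loc (T := CC) (U := CU)) with (fun q => U (fst q) (snd q)); assumption.
  - apply hol_ext_loc with (fun z => U z w); [|exact c].
    apply (locally_restrict (X := CU) (Y := CC) (Z := CU) (fun z => (z, w)) z (z, w)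
      (fun p => U (fst p) (snd p) = V (fst p) (snd p))); [|reflexivity|exact a].
    apply (continuous_pair (T := CU) (U := CU) (V := CU)); cont.
  - apply hol_ext_loc with (U z); [|exact d].
    apply (locally_restrict (X := CU) (Y := CC) (Z := CU) (fun w => (z, w)) w (z, w)
      (fun p => U (fst p) (snd p) = V (fst p) (snd p))); [|reflexivity|exact a].
    apply (continuous_pair (T := CU) (U := CU) (V := CU)); cont.
Qed.

Lemma jhol_fst (f : C -> C) (z0 w0 : C) : hol f z0 -> jhol (fun z _ => f z) z0 w0.
Proof.
  intros h; unfold jhol.
  generalize (locally_fst (X := CU) (Y := CU) _ (z0, w0) (hol_locally _ _ h)); apply filter_imp.
  intros p hp; split; [|split; [exact hp|apply hol_const]].
  apply (continuous_comp (U := CC) (V := CU) (W := CU) (fun q => fst q) f); [cont|].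
  apply hol_continuous, hp.
Qed.

Lemma jhol_snd (f : C -> C) (z0 w0 : C) : hol f w0 -> jhol (fun _ w => f w) z0 w0.
Proof.
  intros h; unfold jhol.
  generalize (locally_snd (X := CU) (Y := CU) _ (z0, w0) (hol_locally _ _ h)); apply filter_imp.
  intros p hp; split; [|split; [apply hol_const|exact hp]].
  apply (continuous_comp (U := CC) (V := CU) (W := CU) (fun q => snd q) f); [cont|].
  apply hol_continuous, hp.
Qed.

Lemma jhol_const (c z0 w0 : C) : jhol (fun _ _ => c) z0 w0.
Proof. apply (jhol_fst (fun _ => c)), hol_const. Qed.

Lemma jhol_plus (U V : C -> C -> C) (z0 w0 : C) :
  jhol U z0 w0 -> jhol V z0 w0 -> jhol (fun z w => U z w + V z w) z0 w0.
Proof.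
  intros h1 h2; unfold jhol; generalize (filter_and _ _ h1 h2); apply filter_imp.
  intros p [[a [b c]] [d [e f]]]; split; [|split].
  - unfold jointly_continuous in *; cont.
  - apply (hol_plus (fun z => U z (snd p)) (fun z => V z (snd p))); assumption.
  - apply (hol_plus (U (fst p)) (V (fst p))); assumption.
Qed.

Lemma jhol_mult (U V : C -> C -> C) (z0 w0 : C) :
  jhol U z0 w0 -> jhol V z0 w0 -> jhol (fun z w => U z w * V z w) z0 w0.
Proof.
  intros h1 h2; unfold jhol; generalize (filter_and _ _ h1 h2); apply filter_imp.
  intros p [[a [b c]] [d [e f]]]; split; [|split].
  - unfold jointly_continuous in *; cont.
  - apply (hol_mult (fun z => U z (snd p)) (fun z => V z (snd p))); assumption.
  - apply (hol_mult (U (fst p)) (V (fst p))); assumption.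
Qed.

Lemma jhol_comp (U : C -> C -> C) (f : C -> C) (z0 w0 : C) :
  jhol U z0 w0 -> hol f (U z0 w0) -> jhol (fun z w => f (U z w)) z0 w0.
Proof.
  intros h1 h2; unfold jhol.
  pose proof (locally_continuous_comp (X := CC) (Y := CU) (fun p => U (fst p) (snd p)) (z0, w0) _
    (proj1 (jhol_at _ _ _ h1)) (hol_locally _ _ h2)) as h3.
  generalize (filter_and _ _ h1 h3); apply filter_imp.
  intros p [[a [b c]] d]; split; [|split].
  - apply (continuous_comp (U := CC) (V := CU) (W := CU) (fun q => U (fst q) (snd q)) f);
      [exact a|apply hol_continuous, d].
  - apply (hol_comp (fun z => U z (snd p)) f); assumption.
  - apply (hol_comp (U (fst p)) f); assumption.
Qed.

Lemma jhol_opp (U : C -> C -> C) (z0 w0 : C) : jhol U z0 w0 -> jhol (fun z w => - U z w) z0 w0.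
Proof. intros h; apply (jhol_comp U Copp); [exact h|apply hol_opp, hol_id]. Qed.

Lemma jhol_minus (U V : C -> C -> C) (z0 w0 : C) :
  jhol U z0 w0 -> jhol V z0 w0 -> jhol (fun z w => U z w - V z w) z0 w0.
Proof. intros h1 h2; apply jhol_plus; [exact h1|apply jhol_opp, h2]. Qed.

Lemma jhol_div (U V : C -> C -> C) (z0 w0 : C) :
  jhol U z0 w0 -> jhol V z0 w0 -> V z0 w0 <> 0 -> jhol (fun z w => U z w / V z w) z0 w0.
Proof.
  intros h1 h2 h0; apply jhol_mult; [exact h1|].
  apply (jhol_comp V Cinv); [exact h2|]. apply (hol_inv (fun y => y)); [apply hol_id|exact h0].
Qed.

Lemma jhol_pow (U : C -> C -> C) (n : nat) (z0 w0 : C) :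
  jhol U z0 w0 -> jhol (fun z w => U z w ^ n) z0 w0.
Proof. intros h; apply (jhol_comp U (fun y => y ^ n)); [exact h|apply hol_pow, hol_id]. Qed.

Lemma jhol_CInt (F : C -> C -> R -> C) (a b : R) (z0 w0 : C) :
  (a <= b)%R ->
  (forall t, (a <= t <= b)%R -> locally (T := prod_UniformSpace CC RU) ((z0, w0), t)
    (fun q => continuous (T := prod_UniformSpace CC RU) (U := CU)
        (fun q => F (fst (fst q)) (snd (fst q)) (snd q)) q /\
      hol (fun z => F z (snd (fst q)) (snd q)) (fst (fst q)) /\
      hol (fun w => F (fst (fst q)) w (snd q)) (snd (fst q)))) ->
  jhol (fun z w => CInt (F z w) a b) z0 w0.
Proof.
  intros hab h.
  set (Q := fun q : (C * C) * R => continuous (T := prod_UniformSpace CC RU) (U := CU)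
        (fun q => F (fst (fst q)) (snd (fst q)) (snd q)) q /\
      hol (fun z => F z (snd (fst q)) (snd q)) (fst (fst q)) /\
      hol (fun w => F (fst (fst q)) w (snd q)) (snd (fst q))) in *.
  assert (hT : locally (T := CC) (z0, w0) (fun p => forall t, (a <= t <= b)%R ->
    locally (T := prod_UniformSpace CC RU) (p, t) Q)).
  { apply (locally_forall_segment (X := CC) (z0, w0) a b (fun p t =>
      locally (T := prod_UniformSpace CC RU) (p, t) Q)).
    intros t ht; generalize (locally_locally _ _ (h t ht)); apply filter_imp.
    intros [p u] hl; exact hl. }
  unfold jhol; generalize hT; apply filter_imp; intros [z w] hp; split; [|split].
  - unfold jointly_continuous.
    apply (continuous_CInt_param (X := CC) (fun p t => F (fst p) (snd p) t)); [exact hab|].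
    intros t ht; generalize (hp t ht); apply filter_imp; intros q [hq _]; exact hq.
  - apply (hol_CInt (fun z t => F z w t)); [exact hab|]; intros t ht.
    pose (m := fun q : C * R => ((fst q, w), snd q)).
    assert (hm : forall q, continuous (T := prod_UniformSpace CU RU)
       (U := prod_UniformSpace CC RU) m q).
    { intros q; apply (continuous_pair (T := prod_UniformSpace CU RU) (U := CC) (V := RU)); [|cont].
      apply (continuous_pair (T := prod_UniformSpace CU RU) (U := CU) (V := CU)); cont. }
    generalize (locally_continuous_comp (X := prod_UniformSpace CU RU)
      (Y := prod_UniformSpace CC RU) m (z, t) Q (hm _) (hp t ht)).
    apply filter_imp; intros q [q1 [q2 q3]]; split; [|exact q2].
    exact (continuous_comp (U := prod_UniformSpace CU RU) (V := prod_UniformSpace CC RU) (W := CU)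
      m _ q (hm q) q1).
  - apply (hol_CInt (fun w t => F z w t)); [exact hab|]; intros t ht.
    pose (m := fun q : C * R => ((z, fst q), snd q)).
    assert (hm : forall q, continuous (T := prod_UniformSpace CU RU)
       (U := prod_UniformSpace CC RU) m q).
    { intros q; apply (continuous_pair (T := prod_UniformSpace CU RU) (U := CC) (V := RU)); [|cont].
      apply (continuous_pair (T := prod_UniformSpace CU RU) (U := CU) (V := CU)); cont. }
    generalize (locally_continuous_comp (X := prod_UniformSpace CU RU)
      (Y := prod_UniformSpace CC RU) m (w, t) Q (hm _) (hp t ht)).
    apply filter_imp; intros q [q1 [q2 q3]]; split; [|exact q3].
    exact (continuous_comp (U := prod_UniformSpace CU RU) (V := prod_UniformSpace CC RU) (W := CU)
      m _ q (hm q) q1).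
Qed.

Lemma jhol_ball (U : C -> C -> C) (z0 w0 : C) :
  jhol U z0 w0 -> exists r, (0 < r)%R /\ forall z w,
    (Cmod (z - z0) < r)%R -> (Cmod (w - w0) < r)%R -> jhol_pt U (z, w).
Proof.
  intros h; apply (locally_prod_ball (X := CU) (Y := CU)) in h; destruct h as [d hd].
  exists d; split; [apply cond_pos|]; intros z w hz hw; apply hd; apply ball_C_Cmod; assumption.
Qed.

Lemma locally_CC_ball (z0 w0 : C) (P : C * C -> Prop) (r : R) :
  (0 < r)%R ->
  (forall z w, (Cmod (z - z0) < r)%R -> (Cmod (w - w0) < r)%R -> P (z, w)) ->
  locally (T := CC) (z0, w0) P.
Proof.
  intros hr h.
  generalize (filter_and _ _ (locally_fst (X := CU) (Y := CU) _ (z0, w0) (locally_Cball z0 r hr))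
    (locally_snd (X := CU) (Y := CU) _ (z0, w0) (locally_Cball w0 r hr))).
  apply filter_imp; intros [z w] [a b]; apply h; assumption.
Qed.

Definition Dsnd (U : C -> C -> C) (z w : C) : C := C_derive (U z) w.

(** The derivative is a Cauchy integral over a circle about [w0] that serves all nearby [w], so that
    [jhol_CInt] applies. *)
Lemma jhol_Dsnd (U : C -> C -> C) (z0 w0 : C) : jhol U z0 w0 -> jhol (Dsnd U) z0 w0.
Proof.
  intros h; destruct (jhol_ball _ _ _ h) as [d [hd hb]].
  pose (r := (d / 2)%R). assert (hr : (0 < r < d)%R) by (unfold r; lra).
  apply jhol_ext_loc with (fun z w =>
    CInt (fun a => / RtoC (2 * PI) * (boundary (U z) w0 r a / (w0 + RtoC r * circle a - w) ^ 2))
      (- PI) PI).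
  - apply locally_CC_ball with r; [lra|]; intros z w hz hw; cbn [fst snd]; unfold Dsnd.
    rewrite (cauchy_rep_derive (U z) w0 w r).
    + rewrite CInt_Cmult; [reflexivity|apply PI_bounds|].
      intros a _. apply continuous_Cdiv.
      * apply continuous_boundary; [lra|]; intros y hy; apply hol_continuous.
        apply (hb z y); lra.
      * cont.
      * apply Cpow_nz, circle_shift_nz, hw.
    + intros y hy; apply (hb z y); lra.
    + exact hw.
  - apply jhol_CInt; [apply PI_bounds|]; intros a _.
    assert (hl : locally (T := CC) (z0, w0) (fun p => (Cmod (fst p - z0) < r)%R /\
      (Cmod (snd p - w0) < r)%R)).
    { apply locally_CC_ball with r; [lra|]; auto. }
    generalize (locally_fst (X := CC) (Y := RU) _ ((z0, w0), a) hl); apply filter_imp.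
    intros [[z w] b] [hz hw]; cbn [fst snd] in *.
    assert (hbd : (Cmod (w0 + RtoC r * circle b - w0) < d)%R) by (rewrite Cmod_boundary_point; lra).
    destruct (hb z (w0 + RtoC r * circle b) ltac:(lra) hbd) as [j1 [j2 j3]].
    split; [|split].
    + apply (continuous_Cmult (T := prod_UniformSpace CC RU)); [cont|].
      apply continuous_Cdiv; [|cont|apply Cpow_nz, circle_shift_nz, hw].
      unfold boundary; apply continuous_Cmult; [|cont].
      apply (continuous_uncurry (T := prod_UniformSpace CC RU) (U := CU) (V := CU) (W := CU) U
        (fun q => fst (fst q)) (fun q => w0 + RtoC r * circle (snd q))); [cont|cont|exact j1].
    + apply hol_mult; [apply hol_const|]. unfold boundary.
      apply hol_mult; [|apply hol_const]. apply hol_mult; [exact j2|apply hol_const].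
    + apply hol_mult; [apply hol_const|]. apply hol_div; [apply hol_const| |].
      * apply hol_pow, hol_minus; [apply hol_const|apply hol_id].
      * apply Cpow_nz, circle_shift_nz, hw.
Qed.

(* Divided difference in the second variable: (U z w - U z 0) / w, extended to w = 0. *)
Definition dd (U : C -> C -> C) (z w : C) : C := CInt (fun t => Dsnd U z (RtoC t * w)) 0 1.

Lemma jhol_dd (U : C -> C -> C) (z0 w0 : C) :
  (forall t, (0 <= t <= 1)%R -> jhol U z0 (RtoC t * w0)) -> jhol (dd U) z0 w0.
Proof.
  intros h.
  apply jhol_CInt; [lra|]; intros t ht.
  pose (m := fun q : (C * C) * R => (fst (fst q), RtoC (snd q) * snd (fst q))).
  assert (hm : forall q, continuous (T := prod_UniformSpace CC RU) (U := CC) m q).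
  { intros q; apply (continuous_pair (T := prod_UniformSpace CC RU) (U := CU) (V := CU)); cont. }
  generalize (locally_continuous_comp (X := prod_UniformSpace CC RU) (Y := CC) m ((z0, w0), t) _
    (hm _) (jhol_Dsnd _ _ _ (h t ht))).
  apply filter_imp; intros q [j1 [j2 j3]]; split; [|split].
  - exact (continuous_comp (U := prod_UniformSpace CC RU) (V := CC) (W := CU) m
      (fun p => Dsnd U (fst p) (snd p)) q (hm q) j1).
  - exact j2.
  - apply (hol_comp (fun w => RtoC (snd q) * w) (Dsnd U (fst (fst q)))); [|exact j3].
    apply hol_mult; [apply hol_const|apply hol_id].
Qed.

Lemma dd_spec (U : C -> C -> C) (z w : C) :
  (forall t, (0 <= t <= 1)%R -> jhol U z (RtoC t * w)) -> U z w = U z 0 + w * dd U z w.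
Proof.
  intros h.
  pose proof (cder_increment (U z) (C_derive (U z)) 0 w) as hi.
  assert (hsg : forall t, 0 + RtoC t * (w - 0) = RtoC t * w) by (intros t; ring).
  replace (U z w) with (U z 0 + (U z w - U z 0)) by ring. rewrite hi.
  - unfold dd, Dsnd. replace (w - 0) with w by ring. rewrite Cmult_comm; f_equal; f_equal.
    apply CInt_ext; [lra|]; intros t _. f_equal. ring.
  - intros t ht; rewrite hsg.
    destruct (jhol_at _ _ _ (h t ht)) as [_ [_ j]].
    split; [apply hol_cder, j|apply hol_continuous_derive, j].
Qed.

(* Holomorphy on the bidisc of radius r about (z0, 0): unlike [jhol U z0 0], it keeps
   the radius, which must not shrink with the order of the expansions. *)
Definition jholB (z0 : C) (r : R) (U : C -> C -> C) : Prop :=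
  forall z w, (Cmod (z - z0) < r)%R -> (Cmod w < r)%R -> jhol U z w.

Lemma jhol_jholB (U : C -> C -> C) (z0 : C) :
  jhol U z0 0 -> exists r, (0 < r)%R /\ jholB z0 r U.
Proof.
  intros h; destruct (locally_prod_ball (X := CU) (Y := CU) _ _ _ (locally_locally _ _ h)) as [d hd].
  exists d; split; [apply cond_pos|]; intros z w hz hw; apply hd; apply ball_C_Cmod; [exact hz|].
  replace (w - 0) with w by ring; exact hw.
Qed.

Lemma jholB_le (U : C -> C -> C) (z0 : C) (r s : R) :
  (s <= r)%R -> jholB z0 r U -> jholB z0 s U.
Proof. intros hs h z w hz hw; apply h; lra. Qed.

Lemma Cmod_segment_0 (w : C) (t r : R) :
  (0 <= t <= 1)%R -> (Cmod w < r)%R -> (Cmod (RtoC t * w) < r)%R.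
Proof.
  intros ht hw; rewrite Cmod_mult, Cmod_R, Rabs_right by lra. pose proof (Cmod_ge_0 w); nra.
Qed.

Lemma jholB_dd (U : C -> C -> C) (z0 : C) (r : R) : jholB z0 r U -> jholB z0 r (dd U).
Proof.
  intros h z w hz hw; apply jhol_dd; intros t ht; apply h; [exact hz|].
  apply Cmod_segment_0; assumption.
Qed.

Lemma jholB_dd_spec (U : C -> C -> C) (z0 : C) (r : R) (z w : C) :
  jholB z0 r U -> (Cmod (z - z0) < r)%R -> (Cmod w < r)%R -> U z w = U z 0 + w * dd U z w.
Proof.
  intros h hz hw; apply dd_spec; intros t ht; apply h; [exact hz|].
  apply Cmod_segment_0; assumption.
Qed.

(** [ddn k U z w] is [w^-k] times the Taylor remainder of order [k] of [U z] at 0, extended to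
    [w = 0], where its value is the [k]-th Hartogs coefficient. *)
Fixpoint ddn (k : nat) (U : C -> C -> C) : C -> C -> C :=
  match k with O => U | S k => ddn k (dd U) end.

Lemma ddn_S (k : nat) (U : C -> C -> C) : ddn (S k) U = dd (ddn k U).
Proof. revert U; induction k as [|k IH]; intros U; [reflexivity|]. simpl in *; apply IH. Qed.

Lemma jholB_ddn (k : nat) (U : C -> C -> C) (z0 : C) (r : R) :
  jholB z0 r U -> jholB z0 r (ddn k U).
Proof. revert U; induction k as [|k IH]; intros U h; [exact h|]. simpl; apply IH, jholB_dd, h. Qed.

Lemma hol_C_derive_n (f : C -> C) (k : nat) (z : C) : hol f z -> hol (C_derive_n f k) z.
Proof. intros h; induction k as [|k IH]; [exact h|]. apply (hol_derive (C_derive_n f k)), IH. Qed.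

(** Leibniz' rule for a product with the factor [w], of which only two terms survive. *)
Lemma C_derive_n_factor (U V : C -> C) (c : C) (r : R) :
  (forall w, (Cmod (w - 0) < r)%R -> hol V w /\ U w = c + w * V w) ->
  forall k w, (Cmod (w - 0) < r)%R ->
    C_derive_n U (S k) w = w * C_derive_n V (S k) w + INR (S k) * C_derive_n V k w.
Proof.
  intros h k; induction k as [|k IH]; intros w hw.
  - change (C_derive_n U 1 w) with (C_derive U w).
    change (C_derive_n V 1 w) with (C_derive V w).
    change (C_derive_n V 0 w) with (V w); change (INR 1) with 1%R.
    apply cder_C_derive.
    apply cder_ext_loc with (fun w => c + w * V w).
    + generalize (open_Cball 0 w r hw); apply filter_imp; intros y hy; symmetry; apply h, hy.
    + eapply cder_eq; [apply cder_plus; [apply cder_const|apply cder_mult; [apply cder_id|]]|].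
      * apply hol_cder, h, hw.
      * cbv beta; ring.
  - change (C_derive_n U (S (S k)) w) with (C_derive (C_derive_n U (S k)) w).
    apply cder_C_derive.
    apply cder_ext_loc with (fun w => w * C_derive_n V (S k) w + INR (S k) * C_derive_n V k w).
    + generalize (open_Cball 0 w r hw); apply filter_imp; intros y hy; symmetry; apply IH, hy.
    + pose proof (proj1 (h w hw)) as hV.
      eapply cder_eq; [apply cder_plus; [apply cder_mult; [apply cder_id|]|apply cder_scale]|].
      * apply hol_cder, hol_C_derive_n, hV.
      * apply hol_cder, hol_C_derive_n, hV.
      * rewrite (S_INR (S k)), RtoC_plus.
        change (C_derive_n V (S (S k)) w) with (C_derive (C_derive_n V (S k)) w).
        change (C_derive (C_derive_n V k) w) with (C_derive_n V (S k) w). ring.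
Qed.

Lemma hartogs_dd (U : C -> C -> C) (z0 : C) (r : R) (z : C) (k : nat) :
  jholB z0 r U -> (Cmod (z - z0) < r)%R -> hartogs U 0 (S k) z = hartogs (dd U) 0 k z.
Proof.
  intros h hz; unfold hartogs.
  rewrite (C_derive_n_factor (U z) (dd U z) (U z 0) r).
  - rewrite fact_simpl, mult_INR, RtoC_mult.
    assert (RtoC (INR (S k)) <> 0) by (apply RtoC_nz, not_0_INR; lia).
    assert (RtoC (INR (fact k)) <> 0) by (apply RtoC_nz, not_0_INR, fact_neq_0).
    field; auto.
  - intros w hw. replace (w - 0) with w in hw by ring. split.
    + apply (jhol_at _ _ _ (jholB_dd _ _ _ h z w hz hw)).
    + apply (jholB_dd_spec U z0 r); assumption.
  - replace (0 - 0) with (RtoC 0) by ring; rewrite Cmod_0; pose proof (Cmod_ge_0 (z - z0)); lra.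
Qed.

Lemma hartogs_ddn (k : nat) (U : C -> C -> C) (z0 : C) (r : R) (z : C) :
  jholB z0 r U -> (Cmod (z - z0) < r)%R -> hartogs U 0 k z = ddn k U z 0.
Proof.
  revert U; induction k as [|k IH]; intros U h hz.
  - unfold hartogs; simpl. field.
  - rewrite (hartogs_dd U z0 r z k h hz). apply IH; [apply jholB_dd, h|exact hz].
Qed.

(** Recursion on the number of terms gives inductions an empty base case. [sum_n_m_fsum] returns to
    [sum_n_m], where [d + 1] terms end at [p + d]. *)
Fixpoint fsum (f : nat -> C) (p d : nat) : C :=
  match d with O => 0 | S d => fsum f p d + f (p + d)%nat end.

Lemma fsum_ext (f g : nat -> C) (p d : nat) :
  (forall k, (p <= k < p + d)%nat -> f k = g k) -> fsum f p d = fsum g p d.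
Proof.
  induction d as [|d IH]; intros h; [reflexivity|]; simpl.
  rewrite IH, h; [reflexivity|lia|intros k hk; apply h; lia].
Qed.

Lemma sum_n_m_fsum (f : nat -> C) (p d : nat) :
  sum_n_m (G := C_AbelianGroup) f p (p + d) = fsum f p (S d).
Proof.
  induction d as [|d IH].
  - rewrite Nat.add_0_r, sum_n_n; simpl; rewrite Nat.add_0_r; ring.
  - rewrite Nat.add_succ_r, sum_n_Sm by lia. rewrite IH; simpl; rewrite Nat.add_succ_r; reflexivity.
Qed.

Lemma ddn_expand (U : C -> C -> C) (z0 : C) (r : R) (z w : C) (p d : nat) :
  jholB z0 r U -> (Cmod (z - z0) < r)%R -> (Cmod w < r)%R ->
  w ^ p * ddn p U z w =
    fsum (fun k => ddn k U z 0 * w ^ k) p d + w ^ (p + d) * ddn (p + d) U z w.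
Proof.
  intros h hz hw; induction d as [|d IH].
  - simpl; rewrite Nat.add_0_r; ring.
  - rewrite IH, (jholB_dd_spec _ _ _ _ _ (jholB_ddn (p + d) U z0 r h) hz hw).
    rewrite Nat.add_succ_r, ddn_S; simpl; ring.
Qed.

Lemma ddn_vanish (U : C -> C -> C) (z0 : C) (r : R) (p : nat) (z w : C) :
  jholB z0 r U -> (Cmod (z - z0) < r)%R -> (Cmod w < r)%R ->
  (forall k, (k < p)%nat -> hartogs U 0 k z = 0) ->
  U z w = w ^ p * ddn p U z w.
Proof.
  intros h hz hw hv; induction p as [|p IH].
  - simpl; ring.
  - rewrite IH by (intros k hk; apply hv; lia).
    rewrite (jholB_dd_spec _ _ _ _ _ (jholB_ddn p U z0 r h) hz hw).
    rewrite <- (hartogs_ddn p U z0 r z h hz), hv, ddn_S by lia; simpl; ring.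
Qed.

(** * Gamma integrals *)

Lemma exp_INR_mult (m : nat) (y : R) : exp (INR m * y) = (exp y ^ m)%R.
Proof.
  induction m as [|m IH]; [simpl; rewrite Rmult_0_l; apply exp_0|].
  rewrite S_INR, Rmult_plus_distr_r, Rmult_1_l, exp_plus, IH; simpl; ring.
Qed.

Lemma pow_le_exp (m : nat) (x : R) : (1 <= m)%nat -> (0 <= x)%R -> ((x / INR m) ^ m <= exp x)%R.
Proof.
  intros hm hx. assert (hi : (0 < INR m)%R) by (apply lt_0_INR; lia).
  replace x with (INR m * (x / INR m))%R at 2 by (field; lra).
  rewrite exp_INR_mult; apply pow_incr; split.
  - apply Rmult_le_pos; [exact hx|left; apply Rinv_0_lt_compat, hi].
  - pose proof (exp_ineq1_le (x / INR m)); lra.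
Qed.

(** The majorant [1 / (1 + v^2)] is chosen because it is integrable over the half line, with
    primitive [atan]. *)
Lemma pow_exp_bound (k n : nat) (c : R) : (1 <= n)%nat -> (0 < c)%R ->
  exists M, (0 < M)%R /\ forall v, (0 <= v)%R ->
    (v ^ k * exp (- (c * v ^ n)) <= M * / (1 + v²))%R.
Proof.
  intros hn hc.
  (* Two powers beyond [k] absorb the factor [1 + v^2]; for [v > 1] the exponent [v^n] is replaced
     by the smaller [v]. *)
  set (m := (k + 2)%nat). assert (hi : (0 < INR m)%R) by (apply lt_0_INR; unfold m; lia).
  set (q := (INR m / c)%R). assert (hq : (0 < q)%R) by (apply Rdiv_lt_0_compat; assumption).
  pose proof (pow_lt q m hq) as hqm.
  exists (2 * q ^ m + 2)%R; split; [lra|]; intros v hv.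
  assert (h1 : (0 < 1 + v²)%R) by (unfold Rsqr; nra).
  apply Rmult_le_reg_r with (1 + v²)%R; [exact h1|].
  rewrite Rmult_assoc, (Rmult_assoc _ (/ _)), Rinv_l, Rmult_1_r by lra.
  pose proof (exp_pos (- (c * v ^ n))) as he.
  pose proof (pow_le v k hv) as hvk.
  destruct (Rle_lt_dec v 1) as [hv1|hv1].
  - assert (hk1 : (v ^ k <= 1)%R) by (rewrite <- (pow1 k); apply pow_incr; lra).
    assert (he1 : (exp (- (c * v ^ n)) <= 1)%R).
    { rewrite <- exp_0. pose proof (pow_le v n hv).
      assert (- (c * v ^ n) <= 0)%R by nra.
      destruct (Req_dec (- (c * v ^ n)) 0) as [->|]; [lra|]. left; apply exp_increasing; lra. }
    assert (hs1 : (1 + v² <= 2)%R) by (unfold Rsqr; nra).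
    assert (v ^ k * (exp (- (c * v ^ n)) * (1 + v²)) <= 1 * (1 * 2))%R.
    { apply Rmult_le_compat; nra. }
    lra.
  - assert (hvn : (v <= v ^ n)%R).
    { replace v with (v ^ 1)%R at 1 by ring. apply Rle_pow; [lra|lia]. }
    assert (he2 : (exp (- (c * v ^ n)) <= exp (- (c * v)))%R).
    { assert (- (c * v ^ n) <= - (c * v))%R by nra.
      destruct (Req_dec (- (c * v ^ n)) (- (c * v))) as [->|]; [lra|]. left; apply exp_increasing; lra. }
    assert (hp := pow_le_exp m (c * v) ltac:(unfold m; lia) ltac:(nra)).
    assert (hvm : (v ^ m * exp (- (c * v)) <= q ^ m)%R).
    { replace (v ^ m)%R with (q ^ m * (c * v / INR m) ^ m)%R.
      - rewrite Rmult_assoc. rewrite <- (Rmult_1_r (q ^ m)) at 2.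
        apply Rmult_le_compat_l; [lra|].
        rewrite exp_Ropp. pose proof (exp_pos (c * v)).
        apply Rmult_le_reg_r with (exp (c * v)); [lra|].
        rewrite Rmult_assoc, Rinv_l; lra.
      - rewrite <- Rpow_mult_distr; f_equal; unfold q; field; lra. }
    assert (hfin : (v ^ k * (exp (- (c * v ^ n)) * (1 + v²)) <= 2 * (v ^ m * exp (- (c * v))))%R).
    { replace (v ^ m)%R with (v ^ k * (v * v))%R by (unfold m; rewrite pow_add; simpl; ring).
      assert (1 + v² <= 2 * (v * v))%R by (unfold Rsqr; nra).
      replace (2 * (v ^ k * (v * v) * exp (- (c * v))))%R
        with (v ^ k * (exp (- (c * v)) * (2 * (v * v))))%R by ring.
      apply Rmult_le_compat_l; [exact hvk|].
      apply Rmult_le_compat; lra. }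
    lra.
Qed.

Lemma atan_le_2 (x : R) : (atan x <= 2)%R.
Proof. pose proof (atan_bound x). pose proof PI_4. lra. Qed.

Lemma is_RInt_scaled_atan (M x T : R) : (0 < x)%R ->
  is_RInt (V := R_NormedModule) (fun t => M * / (1 + (x * t)²))%R 0 T (M / x * atan (x * T))%R.
Proof.
  intros hx.
  replace (M / x * atan (x * T))%R with (minus (M / x * atan (x * T)) (M / x * atan (x * 0)))%R
    by (unfold minus, plus, opp; simpl; rewrite Rmult_0_r, atan_0; ring).
  assert (hpos : forall t, (0 < 1 + (x * t)²)%R) by (intros t; unfold Rsqr; nra).
  refine (is_RInt_derive (V := R_CompleteNormedModule) (fun t => M / x * atan (x * t))%R _ 0 T _ _).
  - intros t _. auto_derive; [exact I|]. unfold Rsqr.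
    pose proof (hpos t) as h; unfold Rsqr in h. field. split; nra.
  - intros t _. apply (ex_derive_continuous (V := R_NormedModule)). auto_derive.
    pose proof (hpos t); lra.
Qed.

(** Here [x] stands for [s^(1/n)]. The scaling [v = x t] produces the power [x^-(k+1)], and the
    constant does not depend on the endpoint [T]. *)
Lemma Cmod_CInt_scaled (k n : nat) (c : R) : (1 <= n)%nat -> (0 < c)%R ->
  exists M, (0 < M)%R /\ forall (K x T : R) (f : R -> C), (0 <= K)%R -> (0 < x)%R -> (0 <= T)%R ->
    segcont f 0 T ->
    (forall t, (0 <= t <= T)%R -> (Cmod (f t) <= K * (t ^ k * exp (- (c * (x * t) ^ n))))%R) ->
    (Cmod (CInt f 0 T) <= K * M * / x ^ (k + 1))%R.
Proof.
  intros hn hc; destruct (pow_exp_bound k n c hn hc) as [M [hM hb]].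
  exists (M * 2)%R; split; [lra|]; intros K x T f hK hx hT hf hbd.
  pose proof (pow_lt x k hx) as hxk.
  apply Rle_trans with (K * M * / x ^ k / x * atan (x * T))%R.
  - apply (Cmod_CInt_le_RInt f (fun t => K * M * / x ^ k * / (1 + (x * t)²))%R); [exact hT|exact hf| |].
    + intros t ht; eapply Rle_trans; [apply hbd, ht|].
      specialize (hb (x * t)%R ltac:(nra)).
      replace (K * M * / x ^ k * / (1 + (x * t)²))%R with (K * (/ x ^ k * (M * / (1 + (x * t)²))))%R by ring.
      apply Rmult_le_compat_l; [exact hK|].
      replace (t ^ k * exp (- (c * (x * t) ^ n)))%R with
        (/ x ^ k * ((x * t) ^ k * exp (- (c * (x * t) ^ n))))%R
        by (rewrite Rpow_mult_distr; field; lra).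
      apply Rmult_le_compat_l; [left; apply Rinv_0_lt_compat, hxk|exact hb].
    + apply is_RInt_scaled_atan, hx.
  - replace (K * (M * 2) * / x ^ (k + 1))%R with (K * M * / x ^ k / x * 2)%R
      by (rewrite pow_add; simpl; field; lra).
    apply Rmult_le_compat_l; [|apply atan_le_2].
    repeat (apply Rmult_le_pos); try lra; left; apply Rinv_0_lt_compat; assumption.
Qed.

(** * Values of Gamma as limits of integrals of [v^j e^(-v^n)] *)

Definition gker (j n : nat) (v : R) : R := (v ^ j * exp (- v ^ n))%R.

Definition gint (j n : nat) (b : R) : R := RInt (gker j n) 0 b.

Lemma continuous_gker (j n : nat) (v : R) : continuous (U := RU) (gker j n) v.
Proof.
  apply (ex_derive_continuous (V := R_NormedModule)); unfold gker; auto_derive; exact I.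
Qed.

Lemma gint_correct (j n : nat) (a b : R) :
  is_RInt (V := R_NormedModule) (gker j n) a b (RInt (gker j n) a b).
Proof.
  apply (RInt_correct (V := R_CompleteNormedModule)).
  apply (ex_RInt_continuous (V := R_CompleteNormedModule)); intros z _; apply continuous_gker.
Qed.

Lemma is_derive_gint (j n : nat) (b : R) : is_derive (V := R_NormedModule) (gint j n) b (gker j n b).
Proof.
  apply (is_derive_RInt (V := R_NormedModule) (gker j n) (gint j n) 0 b).
  - apply filter_forall; intros y; apply gint_correct.
  - apply continuous_gker.
Qed.

Lemma gint_0 (j n : nat) : gint j n 0 = 0%R.
Proof. unfold gint; apply (RInt_point (V := R_CompleteNormedModule)). Qed.

Lemma gint_diff (j n : nat) (a b : R) : (gint j n b - gint j n a)%R = RInt (gker j n) a b.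
Proof.
  unfold gint.
  rewrite <- (RInt_Chasles (V := R_CompleteNormedModule) (gker j n) 0 a b);
    [unfold plus; simpl; ring| |]; eexists; apply gint_correct.
Qed.

(** Inserting [(v / a)^N >= 1] under the integral leaves [v^(j+N) e^(-v^n)], which has an integrable
    majorant; so the tail is smaller than any power of [1 / a]. *)
Lemma gint_tail (j n N : nat) : (1 <= n)%nat ->
  exists M, (0 < M)%R /\ forall a b, (0 < a)%R -> (a <= b)%R ->
    (0 <= gint j n b - gint j n a <= M * / a ^ N)%R.
Proof.
  intros hn; destruct (pow_exp_bound (j + N) n 1 hn Rlt_0_1) as [M [hM hb]].
  exists (M * 4)%R; split; [lra|]; intros a b ha hab; rewrite gint_diff.
  pose proof (pow_lt a N ha) as haN.
  split.
  - apply RInt_ge_0; [exact hab|eexists; apply gint_correct|].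
    intros x hx; unfold gker; apply Rmult_le_pos; [apply pow_le; lra|left; apply exp_pos].
  - assert (hi : is_RInt (V := R_NormedModule) (fun t => M * / a ^ N * / (1 + (1 * t)²))%R a b
       (minus (M * / a ^ N * atan b) (M * / a ^ N * atan a))%R).
    { refine (is_RInt_derive (V := R_CompleteNormedModule) (fun t => M * / a ^ N * atan t)%R _ a b _ _).
      - intros t _. assert (0 < 1 + t²)%R by (unfold Rsqr; nra).
        auto_derive; [exact I|]. unfold Rsqr in *. field. split; nra.
      - intros t _. assert (0 < 1 + (1 * t)²)%R by (unfold Rsqr; nra).
        apply (ex_derive_continuous (V := R_NormedModule)). auto_derive. unfold Rsqr in *. nra. }
    apply Rle_trans with (RInt (fun t => M * / a ^ N * / (1 + (1 * t)²))%R a b).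
    + apply RInt_le; [exact hab|eexists; apply gint_correct|eexists; exact hi|].
      intros x hx; unfold gker.
      specialize (hb x ltac:(lra)). rewrite !Rmult_1_l in *.
      pose proof (pow_lt x N ltac:(lra)) as hxN.
      assert (hax : (/ x ^ N <= / a ^ N)%R).
      { apply Rinv_le_contravar; [exact haN|apply pow_incr; lra]. }
      replace (x ^ j * exp (- x ^ n))%R with (/ x ^ N * (x ^ (j + N) * exp (- x ^ n)))%R
        by (rewrite pow_add; field; lra).
      replace (M * / a ^ N * / (1 + x²))%R with (/ a ^ N * (M * / (1 + x²)))%R by ring.
      apply Rmult_le_compat; [left; apply Rinv_0_lt_compat, hxN| |exact hax|exact hb].
      apply Rmult_le_pos; [apply pow_le; lra|left; apply exp_pos].
    + rewrite (is_RInt_unique (V := R_CompleteNormedModule) _ _ _ _ hi).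
      unfold minus, plus, opp; simpl.
      replace (M * / a ^ N * atan b + - (M * / a ^ N * atan a))%R
        with (M * / a ^ N * (atan b - atan a))%R by ring.
      replace (M * 4 * / a ^ N)%R with (M * / a ^ N * 4)%R by ring.
      apply Rmult_le_compat_l; [apply Rmult_le_pos; [lra|left; apply Rinv_0_lt_compat, haN]|].
      pose proof (atan_bound a); pose proof (atan_bound b); pose proof PI_4; lra.
Qed.

(** The limit along the integers exists because the sequence increases and is bounded. It is taken
    before [N] is given, so one [L] serves all powers. *)
Lemma gint_limit (j n : nat) : (1 <= n)%nat ->
  exists L, forall N, exists M, (0 < M)%R /\ forall a, (0 < a)%R ->
    (Rabs (gint j n a - L) <= M * / a ^ N)%R.
Proof.
  intros hn.
  destruct (gint_tail j n 0 hn) as [M0 [hM0 h0]].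
  assert (hlim : ex_finite_lim_seq (fun m => gint j n (INR (S m)))).
  { apply ex_finite_lim_seq_incr with (gint j n 1 + M0)%R.
    - intros m; pose proof (h0 (INR (S m)) (INR (S (S m)))
        ltac:(apply lt_0_INR; lia) ltac:(apply le_INR; lia)); lra.
    - intros m.
      assert (1 <= INR (S m))%R by (apply (le_INR 1); lia).
      pose proof (h0 1%R (INR (S m)) ltac:(lra) ltac:(lra)) as h; simpl (1 ^ 0)%R in h; lra. }
  destruct hlim as [L hL]; exists L; intros N.
  destruct (gint_tail j n N hn) as [M [hM h]]; exists M; split; [exact hM|]; intros a ha.
  destruct (nfloor_ex a (Rlt_le _ _ ha)) as [m0 hm0].
  assert (hge : forall m, (m0 <= m)%nat ->
    (gint j n a <= gint j n (INR (S m)) <= gint j n a + M * / a ^ N)%R).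
  { intros m hm. assert (hle : (a <= INR (S m))%R).
    { rewrite S_INR. apply le_INR in hm. lra. }
    pose proof (h a (INR (S m)) ha hle); lra. }
  assert (hl1 : (gint j n a <= L)%R).
  { apply (is_lim_seq_le_loc (fun _ => gint j n a) (fun m => gint j n (INR (S m))) (gint j n a) L);
      [|apply is_lim_seq_const|exact hL].
    exists m0; intros m hm; apply (hge m hm). }
  assert (hl2 : (L <= gint j n a + M * / a ^ N)%R).
  { apply (is_lim_seq_le_loc (fun m => gint j n (INR (S m))) (fun _ => gint j n a + M * / a ^ N)%R L
      (gint j n a + M * / a ^ N)%R); [|exact hL|apply is_lim_seq_const].
    exists m0; intros m hm; apply (hge m hm). }
  apply Rabs_le; lra.
Qed.

Lemma Rpower_inv_pow (n : nat) (t : R) : (1 <= n)%nat -> (0 < t)%R ->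
  (Rpower t (/ INR n) ^ n = t)%R.
Proof.
  intros hn ht; assert (hi : (0 < INR n)%R) by (apply lt_0_INR; lia).
  rewrite <- Rpower_pow by apply exp_pos. rewrite Rpower_mult, Rinv_l, Rpower_1; lra.
Qed.

(** The substitution [t = v^n] in the Gamma integral with argument [(j + 1) / n], stated as a
    primitive on the open half line. *)
Lemma is_derive_gamma_antiderivative (j n : nat) (t : R) : (1 <= n)%nat -> (0 < t)%R ->
  is_derive (V := R_NormedModule) (fun t => INR n * gint j n (Rpower t (/ INR n)))%R t
    (Rpower t (INR (j + 1) / INR n - 1) * exp (- t))%R.
Proof.
  intros hn ht; assert (hi : (0 < INR n)%R) by (apply lt_0_INR; lia).
  assert (hv : is_derive (V := R_NormedModule) (fun t => Rpower t (/ INR n)) t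
     (/ INR n * Rpower t (/ INR n - 1))%R).
  { unfold Rpower; auto_derive; [exact ht|].
    replace ((/ INR n - 1) * ln t)%R with (/ INR n * ln t + - ln t)%R by ring.
    rewrite exp_plus, exp_Ropp, (exp_ln t ht); field; lra. }
  pose proof (is_derive_comp (V := R_NormedModule) (gint j n) _ t _ _ (is_derive_gint j n _) hv) as h.
  pose proof (is_derive_scal _ t (INR n) _ h) as h2.
  assert (heq : (INR n * scal (/ INR n * Rpower t (/ INR n - 1)) (gker j n (Rpower t (/ INR n)))
    = Rpower t (INR (j + 1) / INR n - 1) * exp (- t))%R).
  { unfold gker, scal; simpl; unfold mult; simpl.
    rewrite Rpower_inv_pow by assumption.
    rewrite <- Rpower_pow by apply exp_pos. rewrite Rpower_mult.
    replace (INR (j + 1) / INR n - 1)%R with ((/ INR n - 1) + / INR n * INR j)%R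
      by (rewrite plus_INR; simpl; field; lra).
    rewrite Rpower_plus; field; lra. }
  rewrite <- heq; exact h2.
Qed.

Lemma pow_lt_reg (n : nat) (x y : R) : (0 <= x)%R -> (0 <= y)%R -> (x ^ n < y ^ n)%R -> (x < y)%R.
Proof.
  intros hx hy h; apply Rnot_le_lt; intros hle.
  pose proof (pow_incr y x n (conj hy hle)); lra.
Qed.

(** The improper integral is a limit along the product of the filters at 0 and at infinity, so both
    ends are controlled at once. *)
Lemma Gamma_gint (j n : nat) (L : R) : (1 <= n)%nat ->
  (forall N, exists M, (0 < M)%R /\ forall a, (0 < a)%R -> (Rabs (gint j n a - L) <= M * / a ^ N)%R) ->
  Gamma (INR (j + 1) / INR n) = (INR n * L)%R.
Proof.
  intros hn hL; assert (hi : (0 < INR n)%R) by (apply lt_0_INR; lia).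
  unfold Gamma; apply (is_RInt_gen_unique (V := R_CompleteNormedModule)).
  intros P [e hP].
  destruct (hL 1%nat) as [M [hM hb]].
  set (e1 := (e / (4 * INR n))%R).
  pose proof (cond_pos e) as hep.
  assert (he1 : (0 < e1)%R) by (apply Rdiv_lt_0_compat; lra).
  assert (hc0 : continuous (U := RU) (gint j n) 0%R).
  { apply (ex_derive_continuous (V := R_NormedModule)); eexists; apply is_derive_gint. }
  pose proof (proj1 (continuous_R_Rabs (T := RU) _ _) hc0 e1 he1) as [d hd].
  pose proof (cond_pos d) as hdp.
  (* Below [D] the lower end [a^(1/n)] is under [d]; above [V^n] the upper end exceeds [V], beyond
     which the error [M / V] is less than [e1]. *)
  pose (D := (d ^ n)%R). assert (hD : (0 < D)%R) by (apply pow_lt, hdp).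
  pose (V := (M / e1 + 1)%R).
  assert (hV : (0 < V)%R) by (unfold V; pose proof (Rdiv_lt_0_compat _ _ hM he1); lra).
  apply (Filter_prod _ _ _ (fun a => 0 < a /\ a < D)%R (fun b => V ^ n < b /\ 0 < b)%R).
  - exists (mkposreal D hD); intros y hy hy0; split; [exact hy0|].
    change (Rabs (y - 0) < D)%R in hy; apply Rabs_def2 in hy; lra.
  - exists (Rmax (V ^ n) 0); intros y hy; split.
    + eapply Rle_lt_trans; [apply Rmax_l|exact hy].
    + eapply Rle_lt_trans; [apply Rmax_r|exact hy].
  - intros a b [ha0 haD] [hbV hb0].
    exists (minus (INR n * gint j n (Rpower b (/ INR n))) (INR n * gint j n (Rpower a (/ INR n))))%R.
    split.
    + apply (is_RInt_derive (V := R_CompleteNormedModule)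
        (fun t => INR n * gint j n (Rpower t (/ INR n)))%R
        (fun t => Rpower t (INR (j + 1) / INR n - 1) * exp (- t))%R); simpl.
      * intros t ht; apply is_derive_gamma_antiderivative; [exact hn|].
        pose proof (Rmin_glb_lt a b 0 ha0 hb0); lra.
      * intros t ht. pose proof (Rmin_glb_lt a b 0 ha0 hb0).
        apply (ex_derive_continuous (V := R_NormedModule)). unfold Rpower; auto_derive. lra.
    + apply hP.
      assert (hva : (0 < Rpower a (/ INR n) < d)%R).
      { split; [apply exp_pos|]. apply (pow_lt_reg n); [left; apply exp_pos|lra|].
        rewrite Rpower_inv_pow; assumption. }
      assert (hvb : (V < Rpower b (/ INR n))%R).
      { apply (pow_lt_reg n); [lra|left; apply exp_pos|]. rewrite Rpower_inv_pow; assumption. }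
      set (va := Rpower a (/ INR n)) in *. set (vb := Rpower b (/ INR n)) in *.
      assert (h1 : (Rabs (gint j n va) < e1)%R).
      { pose proof (hd va) as h. rewrite gint_0 in h.
        replace (gint j n va) with (gint j n va - 0)%R by ring. apply h.
        change (Rabs (va - 0) < d)%R. rewrite Rabs_right; lra. }
      assert (h2 : (Rabs (gint j n vb - L) < e1)%R).
      { eapply Rle_lt_trans; [apply hb; lra|]. rewrite pow_1.
        apply Rmult_lt_reg_r with vb; [lra|]. rewrite Rmult_assoc, Rinv_l, Rmult_1_r by lra.
        apply Rlt_trans with (e1 * V)%R; [|apply Rmult_lt_compat_l; lra].
        unfold V; replace (e1 * (M / e1 + 1))%R with (M + e1)%R by (field; lra); lra. }
      change (Rabs (INR n * gint j n vb + - (INR n * gint j n va) - INR n * L) < e)%R.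
      replace (INR n * gint j n vb + - (INR n * gint j n va) - INR n * L)%R
        with (INR n * ((gint j n vb - L) - gint j n va))%R by ring.
      rewrite Rabs_mult, (Rabs_right (INR n)) by lra.
      apply Rle_lt_trans with (INR n * (2 * e1))%R.
      * apply Rmult_le_compat_l; [lra|]. unfold Rminus at 1.
        eapply Rle_trans; [apply Rabs_triang|]. rewrite Rabs_Ropp; lra.
      * unfold e1; replace (INR n * (2 * (e / (4 * INR n))))%R with (e / 2)%R by (field; lra); lra.
Qed.

(** * The Laplace kernel and its primitive *)

Definition laplace_kernel (j n : nat) (s : R) (y : C) : C := y ^ j * Cexp (- (RtoC s * y ^ n)).

Lemma hol_laplace_kernel (j n : nat) (s : R) (y : C) : hol (laplace_kernel j n s) y.
Proof.
  unfold laplace_kernel; apply hol_mult; [apply hol_pow, hol_id|].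
  apply (hol_comp (fun y => - (RtoC s * y ^ n)) Cexp); [|apply hol_Cexp].
  apply hol_opp, hol_mult; [apply hol_const|apply hol_pow, hol_id].
Qed.

Lemma cder_laplace_prim (j n : nat) (s : R) (y : C) :
  cder (prim (laplace_kernel j n s)) y (laplace_kernel j n s y).
Proof.
  apply cder_prim with (Cmod y + 1)%R; [|lra]. intros x _; apply hol_laplace_kernel.
Qed.

Lemma CInt_RtoC (f : R -> R) (a b l : R) :
  is_RInt (V := R_NormedModule) f a b l -> CInt (fun t => RtoC (f t)) a b = RtoC l.
Proof.
  intros h; apply CInt_unique.
  apply (is_RInt_fct_extend_pair (U := R_NormedModule) (V := R_NormedModule) (fun t => RtoC (f t))).
  - exact h.
  - simpl. pose proof (is_RInt_const (V := R_NormedModule) a b 0%R) as h0.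
    unfold scal in h0; simpl in h0; unfold mult in h0; simpl in h0; rewrite Rmult_0_r in h0.
    exact h0.
Qed.

Lemma Cexp_RtoC (x : R) : Cexp (RtoC x) = RtoC (exp x).
Proof. unfold Cexp; Creduce; rewrite cos_0, sin_0; f_equal; ring. Qed.

(** Writing [s = x^n] makes the scaling [v = x t] exact, so the primitive at a real point is a
    scaled incomplete Gamma integral. *)
Lemma laplace_prim_real (j n : nat) (x T : R) : (0 < x)%R ->
  prim (laplace_kernel j n (x ^ n)) (RtoC T) = RtoC (/ x ^ (j + 1) * gint j n (x * T)).
Proof.
  intros hx; unfold prim, laplace_kernel.
  rewrite (CInt_ext _ (fun t => RtoC (T * ((t * T) ^ j * exp (- (x ^ n * (t * T) ^ n)))))).
  - apply CInt_RtoC.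
    replace (/ x ^ (j + 1) * gint j n (x * T))%R with
      (minus (/ x ^ (j + 1) * gint j n (x * T * 1)) (/ x ^ (j + 1) * gint j n (x * T * 0)))%R
      by (unfold minus, plus, opp; simpl; rewrite Rmult_1_r, Rmult_0_r, gint_0; ring).
    refine (is_RInt_derive (V := R_CompleteNormedModule)
      (fun t => / x ^ (j + 1) * gint j n (x * T * t))%R _ 0 1 _ _).
    + intros t _.
      assert (hv : is_derive (V := R_NormedModule) (fun t => x * T * t)%R t (x * T)%R)
        by (auto_derive; [exact I|ring]).
      pose proof (is_derive_comp (V := R_NormedModule) (gint j n) _ t _ _ (is_derive_gint j n _) hv) as h.
      pose proof (is_derive_scal _ t (/ x ^ (j + 1))%R _ h) as h2.
      assert (heq : (/ x ^ (j + 1) * scal (x * T) (gker j n (x * T * t))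
        = T * ((t * T) ^ j * exp (- (x ^ n * (t * T) ^ n))))%R).
      { unfold gker, scal; simpl; unfold mult; simpl.
        replace (x * T * t)%R with (x * (t * T))%R by ring.
        rewrite (Rpow_mult_distr x (t * T) n), (Rpow_mult_distr x (t * T) j).
        rewrite pow_add. pose proof (pow_lt x j hx). simpl. field. split; lra. }
      rewrite <- heq; exact h2.
    + intros t _. apply (ex_derive_continuous (V := R_NormedModule)); auto_derive; exact I.
  - lra.
  - intros t _.
    rewrite !RtoC_mult, !RtoC_pow, <- Cexp_RtoC, RtoC_opp, !RtoC_mult, !RtoC_pow, !RtoC_mult.
    reflexivity.
Qed.

(** * Laplace integrals along a ray *)

(** Compactness of a closed disc times a segment, from the tube lemma applied to one real coordinate
    after another. The disc is enclosed in a square of half side [d], whose points are within [2 d]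
    of the centre; hence the condition [2 d < r]. *)
Lemma bounded_polydisc (V : C -> C -> C) (zc eta : C) (r d eps : R) :
  (forall z w, (Cmod (z - zc) < r)%R -> (Cmod w < r)%R -> jcCC V (z, w)) ->
  (2 * d < r)%R -> (0 <= d)%R -> (eps < r)%R -> Cmod eta = 1%R ->
  exists M, (0 < M)%R /\ forall z t, (Cmod (z - zc) <= d)%R -> (0 <= t <= eps)%R ->
    (Cmod (V z (RtoC t * eta)%C) <= M)%R.
Proof.
  intros hV hd hd0 heps heta.
  (* At [mu = 0] the inequality is trivial; a positive [mu] for which it still holds everywhere
     gives the bound [1 / mu]. *)
  pose (P := fun (mu a b t : R) => (mu * Cmod (V (zc + (RtoC a + Ci * RtoC b))%C (RtoC t * eta)%C) < 1)%R).
  assert (h3 : forall a b t, (- d <= a <= d)%R -> (- d <= b <= d)%R -> (0 <= t <= eps)%R ->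
    locally (T := prod_UniformSpace (prod_UniformSpace (prod_UniformSpace RU RU) RU) RU)
      (((0%R, a), b), t)
      (fun p => P (fst (fst (fst p))) (snd (fst (fst p))) (snd (fst p)) (snd p))).
  { intros a b t ha hb ht; unfold P.
    apply (locally_lt_continuous
      (T := prod_UniformSpace (prod_UniformSpace (prod_UniformSpace RU RU) RU) RU)
      (fun p => (fst (fst (fst p)) * Cmod (V (zc + (RtoC (snd (fst (fst p))) + Ci * RtoC (snd (fst p))))%C
          (RtoC (snd p) * eta)%C))%R) (fun _ => 1%R)); [|cont|simpl; lra].
    apply continuous_Rmult; [cont|]. apply continuous_Cmod.
    apply (continuous_uncurry
      (T := prod_UniformSpace (prod_UniformSpace (prod_UniformSpace RU RU) RU) RU)
      (U := CU) (V := CU) (W := CU) V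
      (fun p => zc + (RtoC (snd (fst (fst p))) + Ci * RtoC (snd (fst p))))
      (fun p => RtoC (snd p) * eta)); [cont|cont|]; simpl.
    apply hV.
    - replace (zc + (RtoC a + Ci * RtoC b) - zc) with (RtoC a + Ci * RtoC b) by ring.
      eapply Rle_lt_trans; [apply Cmod_triangle|].
      rewrite Cmod_mult, Cmod_Ci, !Cmod_R, Rmult_1_l.
      pose proof (Rabs_le a d ha); pose proof (Rabs_le b d hb); lra.
    - rewrite Cmod_mult, Cmod_R, Rabs_right, heta by lra; lra. }
  assert (h2 : forall a b, (- d <= a <= d)%R -> (- d <= b <= d)%R ->
    locally (T := prod_UniformSpace (prod_UniformSpace RU RU) RU) ((0%R, a), b)
      (fun p => forall t, (0 <= t <= eps)%R -> P (fst (fst p)) (snd (fst p)) (snd p) t)).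
  { intros a b ha hb.
    apply (locally_forall_segment (X := prod_UniformSpace (prod_UniformSpace RU RU) RU) ((0%R, a), b)
      0 eps (fun p t => P (fst (fst p)) (snd (fst p)) (snd p) t)).
    intros t ht; apply h3; assumption. }
  assert (h1 : forall a, (- d <= a <= d)%R ->
    locally (T := prod_UniformSpace RU RU) (0%R, a)
      (fun p => forall b, (- d <= b <= d)%R -> forall t, (0 <= t <= eps)%R -> P (fst p) (snd p) b t)).
  { intros a ha.
    apply (locally_forall_segment (X := prod_UniformSpace RU RU) (0%R, a) (- d) d
      (fun p b => forall t, (0 <= t <= eps)%R -> P (fst p) (snd p) b t)).
    intros b hb; apply h2; assumption. }
  assert (h0 : locally (T := RU) 0%R (fun mu => forall a, (- d <= a <= d)%R ->
     forall b, (- d <= b <= d)%R -> forall t, (0 <= t <= eps)%R -> P mu a b t)).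
  { apply (locally_forall_segment (X := RU) 0%R (- d) d
      (fun mu a => forall b, (- d <= b <= d)%R -> forall t, (0 <= t <= eps)%R -> P mu a b t)).
    exact h1. }
  destruct h0 as [e he]. pose proof (cond_pos e) as hp.
  exists (2 / e)%R; split; [apply Rdiv_lt_0_compat; lra|].
  intros z t hz ht.
  assert (hb : ball (M := RU) 0%R e (e / 2)%R).
  { change (Rabs (e / 2 - 0) < e)%R. rewrite Rabs_right; lra. }
  assert (hre : (- d <= Re (z - zc) <= d)%R).
  { apply Rabs_le_between. eapply Rle_trans; [apply re_le_Cmod|exact hz]. }
  assert (him : (- d <= Im (z - zc) <= d)%R).
  { apply Rabs_le_between. eapply Rle_trans; [apply im_le_Cmod|exact hz]. }
  pose proof (he _ hb _ hre _ him t ht) as h; unfold P in h.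
  replace (zc + (RtoC (Re (z - zc)) + Ci * RtoC (Im (z - zc)))) with z in h.
  2:{ apply injective_projections; Creduce; ring. }
  apply Rmult_le_reg_l with (e / 2)%R; [lra|].
  replace (e / 2 * (2 / e))%R with 1%R by (field; lra); lra.
Qed.

(** * Expansion of the integrand in the functions [y^j dy/dth] *)

Lemma jholB_mult (U V : C -> C -> C) (z0 : C) (r : R) :
  jholB z0 r U -> jholB z0 r V -> jholB z0 r (fun z w => U z w * V z w).
Proof. intros h1 h2 z w hz hw; apply jhol_mult; auto. Qed.

Lemma jholB_minus (U V : C -> C -> C) (z0 : C) (r : R) :
  jholB z0 r U -> jholB z0 r V -> jholB z0 r (fun z w => U z w - V z w).
Proof. intros h1 h2 z w hz hw; apply jhol_minus; auto. Qed.

Lemma jholB_pow (U : C -> C -> C) (n : nat) (z0 : C) (r : R) :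
  jholB z0 r U -> jholB z0 r (fun z w => U z w ^ n).
Proof. intros h1 z w hz hw; apply jhol_pow; auto. Qed.

Lemma jholB_Dsnd (U : C -> C -> C) (z0 : C) (r : R) : jholB z0 r U -> jholB z0 r (Dsnd U).
Proof. intros h z w hz hw; apply jhol_Dsnd; auto. Qed.

Definition yfun (yh : C -> C -> C) (x th : C) : C := th * yh x th.

Lemma jholB_yfun (yh : C -> C -> C) (z0 : C) (r : R) : jholB z0 r yh -> jholB z0 r (yfun yh).
Proof.
  intros h; unfold yfun; apply (jholB_mult (fun _ w => w) yh); [|exact h].
  intros z w _ _; apply (jhol_snd (fun w => w)), hol_id.
Qed.

Lemma Dsnd_yfun_0 (yh : C -> C -> C) (x : C) : jhol yh x 0 -> Dsnd (yfun yh) x 0 = yh x 0.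
Proof.
  intros h; unfold Dsnd, yfun; apply cder_C_derive.
  eapply cder_eq; [apply cder_mult; [apply cder_id|apply hol_cder, (jhol_at _ _ _ h)]|].
  simpl; ring.
Qed.

(** Since [dy/dth = yh] at [th = 0], this is the multiple of [(y / th)^j dy/dth] that agrees with
    [v] at [th = 0]; subtracting it makes the difference divisible by [th]. *)
Definition next_coef (yh v : C -> C -> C) (j : nat) (x : C) : C :=
  v x 0 / (yh x 0 ^ j * Dsnd (yfun yh) x 0).

(* Successive remainders of the expansion of th^k u in the functions y^j dy/dth,
   y = th yh; the expansion plays the role of the change of variable th -> y
   without inverting y. *)
Fixpoint remainder (yh u : C -> C -> C) (k i : nat) : C -> C -> C :=
  match i with
  | O => u
  | S i => dd (fun x th => remainder yh u k i x th
      - next_coef yh (remainder yh u k i) (k + i) x * (yh x th ^ (k + i) * Dsnd (yfun yh) x th))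
  end.

(** These become the coefficients [c_k(zeta; j)]. The index [j] is absolute: the coefficient of
    [y^j dy/dth] is read off after [j - k] divisions by [th]. *)
Definition ycoef (yh u : C -> C -> C) (k j : nat) (x : C) : C :=
  next_coef yh (remainder yh u k (j - k)) j x.

Lemma hol_next_coef (yh v : C -> C -> C) (j : nat) (z0 : C) (r : R) (x : C) :
  jholB z0 r yh -> jholB z0 r v -> (forall x, (Cmod (x - z0) < r)%R -> yh x 0 <> 0) ->
  (Cmod (x - z0) < r)%R -> hol (next_coef yh v j) x.
Proof.
  intros hy hv hn hx.
  assert (h0 : (Cmod 0 < r)%R) by (rewrite Cmod_0; pose proof (Cmod_ge_0 (x - z0)); lra).
  unfold next_coef; apply hol_div.
  - apply (jhol_at _ _ _ (hv x 0 hx h0)).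
  - apply hol_mult; [apply hol_pow; apply (jhol_at _ _ _ (hy x 0 hx h0))|].
    apply (jhol_at _ _ _ (jholB_Dsnd _ _ _ (jholB_yfun _ _ _ hy) x 0 hx h0)).
  - rewrite Dsnd_yfun_0 by (apply hy; assumption).
    apply Cmult_neq_0; [apply Cpow_nz|]; apply hn, hx.
Qed.

Lemma jholB_remainder (yh u : C -> C -> C) (k i : nat) (z0 : C) (r : R) :
  jholB z0 r yh -> jholB z0 r u -> (forall x, (Cmod (x - z0) < r)%R -> yh x 0 <> 0) ->
  jholB z0 r (remainder yh u k i).
Proof.
  intros hy hu hn; induction i as [|i IH]; [exact hu|]; simpl.
  apply jholB_dd, jholB_minus; [exact IH|]. apply jholB_mult.
  - intros z w hz hw; apply (jhol_fst (next_coef yh (remainder yh u k i) (k + i))).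
    apply hol_next_coef with z0 r; assumption.
  - apply jholB_mult; [apply jholB_pow, hy|apply jholB_Dsnd, jholB_yfun, hy].
Qed.

Lemma remainder_expand (yh u : C -> C -> C) (k d : nat) (z0 : C) (r : R) (x th : C) :
  jholB z0 r yh -> jholB z0 r u -> (forall x, (Cmod (x - z0) < r)%R -> yh x 0 <> 0) ->
  (Cmod (x - z0) < r)%R -> (Cmod th < r)%R ->
  th ^ k * u x th =
    fsum (fun j => ycoef yh u k j x * (yfun yh x th ^ j * Dsnd (yfun yh) x th)) k d
    + th ^ (k + d) * remainder yh u k d x th.
Proof.
  intros hy hu hn hx hth; induction d as [|d IH].
  - simpl; rewrite Nat.add_0_r; ring.
  - rewrite IH.
    assert (h0 : (Cmod 0 < r)%R) by (rewrite Cmod_0; pose proof (Cmod_ge_0 (x - z0)); lra).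
    pose (Dv := fun x th => remainder yh u k d x th
      - next_coef yh (remainder yh u k d) (k + d) x * (yh x th ^ (k + d) * Dsnd (yfun yh) x th)).
    assert (hD : jholB z0 r Dv).
    { apply jholB_minus; [apply jholB_remainder; assumption|]. apply jholB_mult.
      - intros z w hz hw; apply (jhol_fst (next_coef yh (remainder yh u k d) (k + d))).
        apply hol_next_coef with z0 r; try assumption. apply jholB_remainder; assumption.
      - apply jholB_mult; [apply jholB_pow, hy|apply jholB_Dsnd, jholB_yfun, hy]. }
    pose proof (jholB_dd_spec Dv z0 r x th hD hx hth) as hs.
    assert (hDv0 : Dv x 0 = 0).
    { unfold Dv, next_coef. pose proof (hn x hx) as hnz.
      rewrite (Dsnd_yfun_0 yh x (hy x 0 hx h0)).
      pose proof (Cpow_nz _ (k + d) hnz). field; auto. }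
    rewrite hDv0 in hs. unfold Dv at 1 in hs.
    assert (hv : remainder yh u k d x th = next_coef yh (remainder yh u k d) (k + d) x
      * (yh x th ^ (k + d) * Dsnd (yfun yh) x th) + th * dd Dv x th).
    { rewrite Cplus_0_l in hs; rewrite <- hs; ring. }
    simpl fsum; set (S0 := fsum _ k d); unfold ycoef. replace (k + d - k)%nat with d by lia.
    rewrite hv at 1. change (remainder yh u k (S d) x th) with (dd Dv x th).
    rewrite Nat.add_succ_r, Cpow_S.
    change (yfun yh x th) with (th * yh x th). rewrite (Cpow_mult_l th (yh x th) (k + d)); ring.
Qed.

Lemma CInt_fsum (F : nat -> R -> C) (a b : R) (p d : nat) :
  (a <= b)%R -> (forall k, (p <= k < p + d)%nat -> segcont (F k) a b) ->
  CInt (fun t => fsum (fun k => F k t) p d) a b = fsum (fun k => CInt (F k) a b) p d /\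
  segcont (fun t => fsum (fun k => F k t) p d) a b.
Proof.
  intros hab; induction d as [|d IH]; intros h.
  - simpl; split; [rewrite CInt_const; ring|intros t _; cont].
  - destruct IH as [IH1 IH2]; [intros k hk; apply h; lia|]. simpl; split.
    + rewrite CInt_plus, IH1; [reflexivity|exact hab|exact IH2|apply h; lia].
    + intros t ht; apply continuous_Cplus; [apply IH2, ht|apply h; [lia|exact ht]].
Qed.

Lemma fsum_bound {A : Type} (Q : A -> Prop) (F G : A -> nat -> C) (B : A -> R) (p d : nat) :
  (forall x, Q x -> (0 <= B x)%R) ->
  (forall k, (p <= k < p + d)%nat -> exists M, (0 < M)%R /\
     forall x, Q x -> (Cmod (F x k - G x k) <= M * B x)%R) ->
  exists M, (0 < M)%R /\ forall x, Q x -> (Cmod (fsum (F x) p d - fsum (G x) p d) <= M * B x)%R.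
Proof.
  intros hB; induction d as [|d IH]; intros h.
  - exists 1%R; split; [lra|]; intros x hx; simpl.
    replace (0 - 0) with (RtoC 0) by ring; rewrite Cmod_0; specialize (hB x hx); lra.
  - destruct IH as [M1 [hM1 h1]]; [intros k hk; apply h; lia|].
    destruct (h (p + d)%nat ltac:(lia)) as [M2 [hM2 h2]].
    exists (M1 + M2)%R; split; [lra|]; intros x hx; simpl.
    replace (fsum (F x) p d + F x (p + d)%nat - (fsum (G x) p d + G x (p + d)%nat))
      with ((fsum (F x) p d - fsum (G x) p d) + (F x (p + d)%nat - G x (p + d)%nat)) by ring.
    eapply Rle_trans; [apply Cmod_triangle|]. specialize (h1 x hx); specialize (h2 x hx); lra.
Qed.

Lemma Rpower_neg_pow (n N : nat) (s : R) : (1 <= n)%nat -> (0 < s)%R ->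
  (Rpower s (- (INR N / INR n)) = / Rpower s (/ INR n) ^ N)%R.
Proof.
  intros hn hs; assert (hi : (0 < INR n)%R) by (apply lt_0_INR; lia).
  rewrite <- Rpower_pow by apply exp_pos. rewrite Rpower_mult, Rpower_Ropp.
  f_equal; f_equal; field; lra.
Qed.

Lemma Cexp_pow (z : C) (n : nat) : Cexp z ^ n = Cexp (RtoC (INR n) * z).
Proof.
  induction n as [|n IH].
  - simpl; rewrite Cmult_0_l; symmetry; apply Cexp_0.
  - rewrite Cpow_S, IH, <- Cexp_plus, S_INR, RtoC_plus; f_equal; ring.
Qed.

Lemma Re_Cexp_ge (z : C) (b L : R) : (0 <= b < PI / 2)%R -> (Rabs (Im z) <= b)%R ->
  (Rabs (Re z) <= L)%R -> (exp (- L) * cos b <= Re (Cexp z))%R.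
Proof.
  intros hb hi hr. unfold Cexp, Re at 1; cbn [fst].
  assert (hc : (cos b <= cos (Im z))%R).
  { rewrite <- (Rabs_pos_eq b) by lra.
    destruct (Rle_lt_dec 0 (Im z)) as [h|h].
    - rewrite Rabs_pos_eq in hi by exact h. rewrite (Rabs_pos_eq b) by lra.
      apply cos_decr_1; pose proof PI_RGT_0; lra.
    - rewrite Rabs_left in hi by exact h. rewrite (Rabs_pos_eq b) by lra.
      rewrite <- (cos_neg (Im z)). apply cos_decr_1; pose proof PI_RGT_0; lra. }
  assert (hcb : (0 <= cos b)%R) by (apply cos_ge_0; lra).
  apply Rabs_le_between in hr.
  apply Rmult_le_compat; [left; apply exp_pos|exact hcb| |exact hc].
  destruct (Req_dec (- L) (Re z)) as [<-|h]; [lra|]. left; apply exp_increasing; lra.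
Qed.

(** The rotation leaves [y^n] unchanged and multiplies [y^j dy] by [chi^(j+1)]. This factor is the
    source of [D(j, n)]. *)
Lemma prim_laplace_root (j n : nat) (s : R) (chi Y : C) :
  chi ^ n = 1 -> prim (laplace_kernel j n s) (chi * Y) = chi ^ (j + 1) * prim (laplace_kernel j n s) Y.
Proof.
  intros hchi; unfold prim; rewrite <- CInt_Cmult.
  - apply CInt_ext; [lra|]; intros t _; unfold laplace_kernel.
    replace (RtoC t * (chi * Y)) with (chi * (RtoC t * Y)) by ring.
    rewrite (Cpow_mult_l chi _ n), hchi, Cmult_1_l, (Cpow_mult_l chi _ j), Cpow_add_r, Cpow_1_r; ring.
  - lra.
  - intros t _; unfold laplace_kernel; cont.
Qed.

(* The path t |-> T e^(t rho) joins T to T e^rho inside the sector Re y^n > 0. *)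
Lemma prim_laplace_sector (j n : nat) (T b L : R) (s : R) (rho : C) :
  (0 < T)%R -> (0 <= s)%R -> (0 <= b < PI / 2)%R -> (INR n * Rabs (Im rho) <= b)%R ->
  (Cmod rho <= L)%R ->
  (Cmod (prim (laplace_kernel j n s) (RtoC T * Cexp rho) - prim (laplace_kernel j n s) (RtoC T))
    <= L * (T * exp L) ^ (j + 1) * exp (- (s * (T ^ n * (exp (- (INR n * L)) * cos b)))))%R.
Proof.
  intros hT hs hb him hL.
  pose (c := fun t => RtoC T * Cexp (0 + RtoC t * rho)).
  assert (hcd : forall t, rder c t (rho * c t)).
  { intros t; unfold c; eapply rder_eq.
    - apply rder_scale, rder_real_line, cder_Cexp.
    - ring. }
  assert (hcc : forall t, continuous (U := CU) c t) by (intros t; apply (rder_continuous _ _ _ (hcd t))).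
  assert (hkc : forall t, continuous (U := CU) (fun t => laplace_kernel j n s (c t)) t).
  { intros t; apply (continuous_comp (V := CU) c (laplace_kernel j n s)); [apply hcc|].
    apply hol_continuous, hol_laplace_kernel. }
  assert (hint : CInt (fun t => laplace_kernel j n s (c t) * (rho * c t)) 0 1 =
    prim (laplace_kernel j n s) (RtoC T * Cexp rho) - prim (laplace_kernel j n s) (RtoC T)).
  { rewrite (CInt_FTC (fun t => prim (laplace_kernel j n s) (c t))).
    - unfold c. replace (0 + RtoC 1 * rho) with rho by ring.
      replace (0 + RtoC 0 * rho) with (RtoC 0) by ring. rewrite Cexp_0, Cmult_1_r; reflexivity.
    - lra.
    - intros t _; apply rder_comp; [apply hcd|apply cder_laplace_prim].
    - intros t _; pose proof (hkc t); pose proof (hcc t); cont. }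
  rewrite <- hint.
  match goal with |- (_ <= ?B)%R => replace B with ((1 - 0) * B)%R by ring end.
  apply Cmod_CInt_le; [lra|intros t _; pose proof (hkc t); pose proof (hcc t); cont|].
  intros t ht.
  assert (hLp : (0 <= L)%R) by (pose proof (Cmod_ge_0 rho); lra).
  assert (hcm : (Cmod (c t) <= T * exp L)%R).
  { unfold c; rewrite Cmod_mult, Cmod_R, Rabs_right, Cmod_Cexp by lra.
    apply Rmult_le_compat_l; [lra|].
    assert (Re (0 + RtoC t * rho) <= L)%R.
    { replace (0 + RtoC t * rho) with (RtoC t * rho) by ring. rewrite re_scal_l.
      pose proof (re_le_Cmod rho) as h; pose proof (Rle_abs (Re rho)).
      destruct (Rle_lt_dec 0 (Re rho)); nra. }
    destruct (Req_dec (Re (0 + RtoC t * rho)) L) as [->|]; [lra|]. left; apply exp_increasing; lra. }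
  assert (hre : (T ^ n * (exp (- (INR n * L)) * cos b) <= Re (c t ^ n))%R).
  { unfold c. rewrite Cpow_mult_l, <- RtoC_pow, re_scal_l.
    apply Rmult_le_compat_l; [apply pow_le; lra|].
    rewrite Cexp_pow. pose proof (pos_INR n) as hn.
    assert (hnt : (0 <= INR n * t)%R) by (apply Rmult_le_pos; lra).
    replace (RtoC (INR n) * (0 + RtoC t * rho)) with (RtoC (INR n * t) * rho)
      by (rewrite RtoC_mult; ring).
    apply Re_Cexp_ge; [exact hb| |].
    - rewrite im_scal_l, Rabs_mult, (Rabs_right (INR n * t)) by lra.
      nra.
    - rewrite re_scal_l, Rabs_mult, (Rabs_right (INR n * t)) by lra.
      pose proof (re_le_Cmod rho); pose proof (Rabs_pos (Re rho)).
      pose proof (Rmult_le_pos _ _ hn (Rabs_pos (Re rho))).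
      apply Rle_trans with (INR n * Rabs (Re rho))%R; nra. }
  unfold laplace_kernel.
  rewrite !Cmod_mult, Cmod_pow, Cmod_Cexp, re_opp, re_scal_l.
  pose proof (Cmod_ge_0 (c t)) as hc0.
  assert (hpow : (Cmod (c t) ^ (j + 1) <= (T * exp L) ^ (j + 1))%R) by (apply pow_incr; lra).
  rewrite pow_add, pow_1 in hpow at 1.
  assert (hexp : (exp (- (s * Re (c t ^ n))) <= exp (- (s * (T ^ n * (exp (- (INR n * L)) * cos b)))))%R).
  { assert (- (s * Re (c t ^ n)) <= - (s * (T ^ n * (exp (- (INR n * L)) * cos b))))%R.
    { apply Ropp_le_contravar, Rmult_le_compat_l; assumption. }
    destruct (Req_dec (- (s * Re (c t ^ n))) (- (s * (T ^ n * (exp (- (INR n * L)) * cos b))))) as [->|];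
      [lra|]. left; apply exp_increasing; lra. }
  set (E1 := exp (- (s * Re (c t ^ n)))) in *.
  assert (hE1 : (0 < E1)%R) by apply exp_pos.
  replace (Cmod (c t) ^ j * E1 * (Cmod rho * Cmod (c t)))%R
    with (Cmod rho * (Cmod (c t) ^ j * Cmod (c t)) * E1)%R by ring.
  pose proof (Cmod_ge_0 rho). pose proof (pow_le _ j hc0).
  apply Rmult_le_compat; [|lra| |exact hexp].
  - apply Rmult_le_pos; [lra|apply Rmult_le_pos; lra].
  - apply Rmult_le_compat; [lra|apply Rmult_le_pos; lra|exact hL|exact hpow].
Qed.

(** * Uniform expansion of the integral along a ray *)

Definition ray_integrand (k : nat) (u f : C -> C -> C) (eta : C) (s : R) (x : C) (t : R) : C :=
  (RtoC t * eta) ^ k * u x (RtoC t * eta) * Cexp (- (RtoC s * f x (RtoC t * eta))) * eta.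

Definition ray_int (k : nat) (u f : C -> C -> C) (eta : C) (eps s : R) (x : C) : C :=
  CInt (ray_integrand k u f eta s x) 0 eps.

Definition gterm (n j : nat) (s : R) : C :=
  RtoC (1 / INR n * Gamma (INR (j + 1) / INR n)) * RtoC (Rpower s (- (INR (j + 1) / INR n))).

Lemma Cminus_0_r (z : C) : z - 0 = z.
Proof. ring. Qed.

Lemma exp_le_compat (a b : R) : (a <= b)%R -> (exp a <= exp b)%R.
Proof. intros h; destruct (Req_dec a b) as [->|]; [lra|]. left; apply exp_increasing; lra. Qed.

Lemma Rpower_root_pow (n : nat) (s : R) : (1 <= n)%nat -> (0 < s)%R ->
  (0 < Rpower s (/ INR n))%R /\ (Rpower s (/ INR n) ^ n = s)%R.
Proof. intros hn hs; split; [apply exp_pos|apply Rpower_inv_pow; assumption]. Qed.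

(** Cutting the Gamma integral off at [T s^(1/n)] costs less than any power; the free exponent [N]
    allows the errors of different terms to be brought to a common order. *)
Lemma gterm_approx (n j N : nat) (T : R) : (1 <= n)%nat -> (0 < T)%R ->
  exists M, (0 < M)%R /\ forall s, (0 < s)%R ->
   (Cmod (prim (laplace_kernel j n s) (RtoC T) - gterm n j s)
     <= M * / Rpower s (/ INR n) ^ (j + 1 + N))%R.
Proof.
  intros hn hT; assert (hi : (0 < INR n)%R) by (apply lt_0_INR; lia).
  destruct (gint_limit j n hn) as [L hL].
  pose proof (Gamma_gint j n L hn hL) as hG.
  destruct (hL N) as [M [hM hb]].
  pose proof (pow_lt T N hT) as hTN.
  exists (M * / T ^ N)%R; split; [apply Rmult_lt_0_compat; [lra|apply Rinv_0_lt_compat, hTN]|].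
  intros s hs; destruct (Rpower_root_pow n s hn hs) as [hx hxn].
  unfold gterm; rewrite Rpower_neg_pow by assumption.
  set (x := Rpower s (/ INR n)) in *.
  rewrite <- hxn at 1. rewrite laplace_prim_real by exact hx.
  rewrite <- RtoC_mult, <- RtoC_minus, Cmod_R.
  replace (1 / INR n * Gamma (INR (j + 1) / INR n))%R with L by (rewrite hG; field; lra).
  replace (/ x ^ (j + 1) * gint j n (x * T) - L * / x ^ (j + 1))%R
    with (/ x ^ (j + 1) * (gint j n (x * T) - L))%R by ring.
  pose proof (pow_lt x (j + 1) hx) as hxj. pose proof (pow_lt x N hx) as hxN.
  rewrite Rabs_mult, Rabs_right by (left; apply Rinv_0_lt_compat, hxj).
  replace (M * / T ^ N * / x ^ (j + 1 + N))%R with (/ x ^ (j + 1) * (M * / (x * T) ^ N))%R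
    by (rewrite (pow_add x (j + 1) N), Rpow_mult_distr; field; lra).
  apply Rmult_le_compat_l; [left; apply Rinv_0_lt_compat, hxj|].
  apply hb, Rmult_lt_0_compat; assumption.
Qed.

Lemma exp_le_power (n N : nat) (c : R) : (1 <= n)%nat -> (0 < c)%R ->
  exists M, (0 < M)%R /\ forall s, (0 < s)%R ->
    (exp (- (s * c)) <= M * / Rpower s (/ INR n) ^ N)%R.
Proof.
  intros hn hc; destruct (pow_exp_bound N n c hn hc) as [M [hM hb]].
  exists M; split; [exact hM|]; intros s hs.
  destruct (Rpower_root_pow n s hn hs) as [hx hxn].
  set (x := Rpower s (/ INR n)) in *.
  pose proof (pow_lt x N hx) as hxN.
  specialize (hb x (Rlt_le _ _ hx)). rewrite hxn in hb.
  apply Rmult_le_reg_l with (x ^ N)%R; [exact hxN|].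
  replace (x ^ N * (M * / x ^ N))%R with M by (field; lra).
  rewrite (Rmult_comm s c). eapply Rle_trans; [exact hb|].
  assert (0 < 1 + x²)%R by (unfold Rsqr; nra).
  rewrite <- (Rmult_1_r M) at 2. apply Rmult_le_compat_l; [lra|].
  rewrite <- Rinv_1. apply Rinv_le_contravar; [lra|]. unfold Rsqr; nra.
Qed.

Lemma hol_ycoef (yh u : C -> C -> C) (k j : nat) (zc : C) (r : R) (x : C) :
  jholB zc r yh -> jholB zc r u -> (forall x, (Cmod (x - zc) < r)%R -> yh x 0 <> 0) ->
  (Cmod (x - zc) < r)%R -> hol (ycoef yh u k j) x.
Proof.
  intros hy hu hn hx; unfold ycoef; apply hol_next_coef with zc r; try assumption.
  apply jholB_remainder; assumption.
Qed.

Definition ray_main (n k d : nat) (yh u : C -> C -> C) (chi : C) (s : R) (x : C) : C :=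
  fsum (fun j => ycoef yh u k j x * (chi ^ (j + 1) * gterm n j s)) k (S d).

(** On the ray [y = chi t e^rho] with [n |Im rho| <= b < PI / 2], so [f = y^n] has real part at
    least [c0 t^n], and the remainder of the expansion is estimated by scaling. Each main term
    [y^j e^(-s y^n) dy] has a primitive, evaluated at the end of the ray: the root of unity factors
    out, the sector estimate moves the point to the real axis, and there stands a cut-off Gamma
    integral. *)
Lemma ray_expansion (n k d : nat) (f u yh : C -> C -> C) (rho : C -> R -> C) (zc eta chi : C)
    (r dl eps b L : R) :
  (1 <= n)%nat -> jholB zc r u -> jholB zc r yh ->
  (forall x, (Cmod (x - zc) < r)%R -> yh x 0 <> 0) ->
  (forall x th, (Cmod (x - zc) < r)%R -> (Cmod th < r)%R -> f x th = yfun yh x th ^ n) ->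
  Cmod eta = 1%R -> Cmod chi = 1%R -> chi ^ n = 1 ->
  (0 < eps < r)%R -> (0 <= dl)%R -> (2 * dl < r)%R -> (0 <= b < PI / 2)%R ->
  (forall x t, (Cmod (x - zc) <= dl)%R -> (0 <= t <= eps)%R ->
     eta * yh x (RtoC t * eta) = chi * Cexp (rho x t) /\
     (INR n * Rabs (Im (rho x t)) <= b)%R /\ (Cmod (rho x t) <= L)%R) ->
  exists M, (0 < M)%R /\ forall s x, (0 < s)%R -> (Cmod (x - zc) <= dl)%R ->
    (Cmod (ray_int k u f eta eps s x
      - ray_main n k d yh u chi s x)
     <= M * Rpower s (- (INR (k + d + 2) / INR n)))%R.
Proof.
  intros hn hu hy hyn hf heta hchi hchin heps hdl hdl2 hb hrho.
  (* The primitive at the end of the ray in the [y]-plane, with the root of unity taken out. *)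
  pose (W := fun j s x => prim (laplace_kernel j n s) (RtoC eps * Cexp (rho x eps))).
  pose (rem := fun s x t => (RtoC t * eta) ^ (k + S d) * remainder yh u k (S d) x (RtoC t * eta)
     * Cexp (- (RtoC s * f x (RtoC t * eta))) * eta).
  pose proof (jholB_yfun yh zc r hy) as hyf.
  pose proof (jholB_Dsnd _ _ _ hyf) as hyd.
  pose proof (jholB_remainder yh u k (S d) zc r hy hu hyn) as hrem.
  assert (hray : forall t, (0 <= t <= eps)%R -> (Cmod (RtoC t * eta) < r)%R).
  { intros t ht; rewrite Cmod_mult, heta, Cmod_R, Rabs_right by lra; lra. }
  assert (hcray : forall (V : C -> C -> C) x t, jholB zc r V -> (Cmod (x - zc) <= dl)%R ->
     (0 <= t <= eps)%R -> continuous (U := CU) (fun t => V x (RtoC t * eta)) t).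
  { intros V x t hV hx ht.
    apply (continuous_comp (V := CU) (fun t => RtoC t * eta) (V x)); [cont|].
    apply hol_continuous. apply (jhol_at _ _ _ (hV x (RtoC t * eta) ltac:(lra) (hray t ht))). }
  assert (hfy : forall x t, (Cmod (x - zc) <= dl)%R -> (0 <= t <= eps)%R ->
     f x (RtoC t * eta) = yfun yh x (RtoC t * eta) ^ n).
  { intros x t hx ht; apply hf; [lra|apply hray, ht]. }
  assert (hremc : forall s x, (Cmod (x - zc) <= dl)%R -> segcont (rem s x) 0 eps).
  { intros s x hx t ht; unfold rem.
    pose proof (hcray _ x t hrem hx ht).
    apply (continuous_Cmult (T := RU)); [|cont]. apply (continuous_Cmult (T := RU)); [cont|].
    apply continuous_Cexp, continuous_Copp, continuous_Cmult; [cont|].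
    assert (hcf : continuous (T := CU) (U := CU) (f x) (RtoC t * eta)).
    { apply (continuous_ext_loc (T := CU) (U := CU)) with (fun th => yfun yh x th ^ n).
      - pose proof (open_Cball 0 (RtoC t * eta) r) as ho.
        replace (RtoC t * eta - 0) with (RtoC t * eta) in ho by ring.
        generalize (ho (hray t ht)); apply filter_imp; intros th hth.
        rewrite Cminus_0_r in hth.
        symmetry; apply hf; [lra|exact hth].
      - apply (continuous_Cpow (T := CU)), hol_continuous.
        apply (jhol_at _ _ _ (hyf x (RtoC t * eta) ltac:(lra) (hray t ht))). }
    apply (continuous_comp (V := CU) (fun t => RtoC t * eta) (f x)); [cont|exact hcf]. }
  assert (hid : forall s x, (0 < s)%R -> (Cmod (x - zc) <= dl)%R ->
    ray_int k u f eta eps s x =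
      fsum (fun j => ycoef yh u k j x * (chi ^ (j + 1) * W j s x)) k (S d) + CInt (rem s x) 0 eps).
  { intros s x hs hx.
    pose (F := fun j t => ycoef yh u k j x *
       (laplace_kernel j n s (yfun yh x (RtoC t * eta)) * (Dsnd (yfun yh) x (RtoC t * eta) * eta))).
    assert (hFb : forall j, segcont (fun t => laplace_kernel j n s (yfun yh x (RtoC t * eta))
         * (Dsnd (yfun yh) x (RtoC t * eta) * eta)) 0 eps).
    { intros j t ht; pose proof (hcray _ x t hyf hx ht). pose proof (hcray _ x t hyd hx ht).
      unfold laplace_kernel; cont. }
    assert (hFc : forall j, segcont (F j) 0 eps).
    { intros j t ht; unfold F; apply continuous_Cmult; [cont|apply hFb, ht]. }
    destruct (CInt_fsum F 0 eps k (S d) ltac:(lra) (fun j _ => hFc j)) as [hs1 hs2].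
    unfold ray_int.
    rewrite (CInt_ext _ (fun t => fsum (fun j => F j t) k (S d) + rem s x t)).
    - rewrite CInt_plus, hs1; [|lra|exact hs2|apply hremc, hx]. f_equal.
      apply fsum_ext; intros j _; unfold F. rewrite CInt_Cmult; [|lra|apply hFb]. f_equal.
      rewrite (CInt_FTC (fun t => prim (laplace_kernel j n s) (yfun yh x (0 + RtoC t * eta)))).
      + replace (0 + RtoC eps * eta) with (RtoC eps * eta) by ring.
        replace (0 + RtoC 0 * eta) with (RtoC 0) by ring.
        replace (yfun yh x 0) with (RtoC 0) by (unfold yfun; ring).
        rewrite prim_0. destruct (hrho x eps hx ltac:(lra)) as [he _].
        replace (yfun yh x (RtoC eps * eta)) with (chi * (RtoC eps * Cexp (rho x eps))).
        * rewrite prim_laplace_root by exact hchin. unfold W; ring.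
        * unfold yfun. replace (RtoC eps * eta * yh x (RtoC eps * eta))
            with (RtoC eps * (eta * yh x (RtoC eps * eta))) by ring. rewrite he; ring.
      + lra.
      + intros t ht; eapply rder_eq.
        * apply (rder_real_line (fun th => prim (laplace_kernel j n s) (yfun yh x th))).
          apply (cder_comp (yfun yh x) (prim (laplace_kernel j n s))); [|apply cder_laplace_prim].
          apply hol_cder. rewrite Cplus_0_l.
          apply (jhol_at _ _ _ (hyf x (RtoC t * eta) ltac:(lra) (hray t ht))).
        * rewrite Cplus_0_l. unfold Dsnd; ring.
      + apply hFb.
    - lra.
    - intros t ht; unfold ray_integrand.
      rewrite (remainder_expand yh u k (S d) zc r x (RtoC t * eta) hy hu hyn ltac:(lra) (hray t ht)).
      set (E := Cexp (- (RtoC s * f x (RtoC t * eta)))).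
      transitivity (fsum (fun j => ycoef yh u k j x *
         (yfun yh x (RtoC t * eta) ^ j * Dsnd (yfun yh) x (RtoC t * eta))) k (S d) * (E * eta)
         + rem s x t); [unfold rem; fold E; ring|]. f_equal.
      assert (hdist : forall (G : nat -> C) c p m, fsum G p m * c = fsum (fun j => G j * c) p m).
      { intros G c p m; induction m as [|m IH]; simpl; [ring|]. rewrite <- IH; ring. }
      rewrite hdist; apply fsum_ext; intros j _; unfold F, laplace_kernel, E.
      rewrite (hfy x t hx ht); ring. }
  destruct (bounded_polydisc (remainder yh u k (S d)) zc eta r dl eps) as [Mr [hMr hbr]];
    [intros z w hz hw; apply (jhol_at _ _ _ (hrem z w hz hw))|lra|lra|lra|exact heta|].
  (* A lower bound of [Re (e^(n rho))] when [|rho| <= L] and [n |Im rho| <= b]. *)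
  pose (c0 := (exp (- (INR n * L)) * cos b)%R).
  assert (hc0 : (0 < c0)%R).
  { unfold c0; apply Rmult_lt_0_compat; [apply exp_pos|apply cos_gt_0; lra]. }
  destruct (Cmod_CInt_scaled (k + S d) n c0 hn hc0) as [Ms [hMs hbs]].
  assert (hremb : forall s x, (0 < s)%R -> (Cmod (x - zc) <= dl)%R ->
    (Cmod (CInt (rem s x) 0 eps) <= (Mr * Ms) * / Rpower s (/ INR n) ^ (k + d + 2))%R).
  { intros s x hs hx; destruct (Rpower_root_pow n s hn hs) as [hX hXn].
    set (X := Rpower s (/ INR n)) in *.
    replace (k + d + 2)%nat with (k + S d + 1)%nat by lia.
    apply (hbs Mr X eps (rem s x)); [lra|exact hX|lra|apply hremc, hx|].
    intros t ht; unfold rem.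
    rewrite !Cmod_mult, Cmod_pow, Cmod_mult, heta, Cmod_R, Rabs_right by lra.
    rewrite !Rmult_1_r, Cmod_Cexp, re_opp, re_scal_l, (hfy x t hx ht).
    destruct (hrho x t hx ht) as [he [h1 h2]].
    assert (hre : (t ^ n * c0 <= Re (yfun yh x (RtoC t * eta) ^ n))%R).
    { replace (yfun yh x (RtoC t * eta)) with (RtoC t * (chi * Cexp (rho x t)))
        by (unfold yfun; rewrite <- he; ring).
      rewrite !Cpow_mult_l, hchin, Cmult_1_l, <- RtoC_pow, re_scal_l, Cexp_pow.
      apply Rmult_le_compat_l; [apply pow_le; lra|].
      pose proof (pos_INR n). unfold c0; apply Re_Cexp_ge; [exact hb| |].
      - rewrite im_scal_l, Rabs_mult, Rabs_right by lra; exact h1.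
      - rewrite re_scal_l, Rabs_mult, Rabs_right by lra.
        apply Rmult_le_compat_l; [lra|]. eapply Rle_trans; [apply re_le_Cmod|exact h2]. }
    assert (hex : (exp (- (s * Re (yfun yh x (RtoC t * eta) ^ n))) <= exp (- (c0 * (X * t) ^ n)))%R).
    { apply exp_le_compat. rewrite Rpow_mult_distr, hXn.
      replace (c0 * (s * t ^ n))%R with (s * (t ^ n * c0))%R by ring.
      apply Ropp_le_contravar, Rmult_le_compat_l; lra. }
    specialize (hbr x t hx ht). pose proof (pow_le t (k + S d) ltac:(lra)) as htp.
    pose proof (Cmod_ge_0 (remainder yh u k (S d) x (RtoC t * eta))).
    replace (Mr * (t ^ (k + S d) * exp (- (c0 * (X * t) ^ n))))%R
      with (t ^ (k + S d) * Mr * exp (- (c0 * (X * t) ^ n)))%R by ring.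
    apply Rmult_le_compat; [apply Rmult_le_pos; lra|left; apply exp_pos| |exact hex].
    apply Rmult_le_compat_l; lra. }
  destruct (fsum_bound (fun p : R * C => (0 < fst p)%R /\ (Cmod (snd p - zc) <= dl)%R)
    (fun p j => ycoef yh u k j (snd p) * (chi ^ (j + 1) * W j (fst p) (snd p)))
    (fun p j => ycoef yh u k j (snd p) * (chi ^ (j + 1) * gterm n j (fst p)))
    (fun p => / Rpower (fst p) (/ INR n) ^ (k + d + 2))%R k (S d)) as [Mf [hMf hbf]].
  - intros p _; left; apply Rinv_0_lt_compat, pow_lt, exp_pos.
  - intros j hj.
    (* The extra power brings the error of the term [j] to the common order [k + d + 2]; the
       subtraction is genuine because [j <= k + d]. *)
    destruct (gterm_approx n j (k + d + 1 - j) eps hn ltac:(lra)) as [M1 [hM1 h1]].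
    destruct (exp_le_power n (k + d + 2) (eps ^ n * c0) hn
      ltac:(apply Rmult_lt_0_compat; [apply pow_lt; lra|exact hc0])) as [M2 [hM2 h2]].
    destruct (bounded_polydisc (fun x _ => ycoef yh u k j x) zc eta r dl eps) as [Mc [hMc hbc]];
      [|lra|lra|lra|exact heta|].
    { intros z w hz hw. apply (jhol_at _ _ _ (jhol_fst (ycoef yh u k j) z w
        (hol_ycoef yh u k j zc r z hy hu hyn hz))). }
    assert (hL0 : (0 <= L)%R).
    { destruct (hrho zc 0%R) as [_ [_ h]].
      - replace (zc - zc) with (RtoC 0) by ring; rewrite Cmod_0; exact hdl.
      - lra.
      - pose proof (Cmod_ge_0 (rho zc 0%R)); lra. }
    pose (K2 := (L * (eps * exp L) ^ (j + 1))%R).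
    assert (hK2 : (0 <= K2)%R).
    { apply Rmult_le_pos; [exact hL0|apply pow_le, Rmult_le_pos; [lra|left; apply exp_pos]]. }
    exists (Mc * (K2 * M2 + M1))%R; split.
    { apply Rmult_lt_0_compat; [exact hMc|]. pose proof (Rmult_le_pos _ _ hK2 (Rlt_le _ _ hM2)); lra. }
    intros [s x] [hs hx]; cbn [fst snd] in *.
    replace (ycoef yh u k j x * (chi ^ (j + 1) * W j s x) - ycoef yh u k j x * (chi ^ (j + 1) * gterm n j s))
      with (ycoef yh u k j x * (chi ^ (j + 1) * (W j s x - gterm n j s))) by ring.
    rewrite !Cmod_mult, Cmod_pow, hchi, pow1, Rmult_1_l, Rmult_assoc.
    apply Rmult_le_compat; [apply Cmod_ge_0|apply Cmod_ge_0|apply (hbc x 0%R hx); lra|].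
    destruct (hrho x eps hx ltac:(lra)) as [_ [g1 g2]].
    pose proof (prim_laplace_sector j n eps b L s (rho x eps) ltac:(lra) ltac:(lra) hb g1 g2) as h3.
    specialize (h1 s hs). specialize (h2 s hs).
    replace (j + 1 + (k + d + 1 - j))%nat with (k + d + 2)%nat in h1 by lia.
    replace (W j s x - gterm n j s) with ((W j s x - prim (laplace_kernel j n s) (RtoC eps))
      + (prim (laplace_kernel j n s) (RtoC eps) - gterm n j s)) by ring.
    eapply Rle_trans; [apply Cmod_triangle|]. rewrite Rmult_plus_distr_r.
    apply Rplus_le_compat; [|exact h1].
    unfold W; eapply Rle_trans; [exact h3|]. fold c0; fold K2. rewrite Rmult_assoc.
    apply Rmult_le_compat_l; [exact hK2|exact h2].
  - exists (Mf + Mr * Ms)%R; split; [pose proof (Rmult_lt_0_compat _ _ hMr hMs); lra|].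
    intros s x hs hx. rewrite Rpower_neg_pow by assumption.
    rewrite (hid s x hs hx); unfold ray_main.
    specialize (hbf (s, x) (conj hs hx)); cbn beta iota delta [fst snd] in hbf. specialize (hremb s x hs hx).
    match goal with |- (Cmod (?a + ?b - ?c) <= _)%R =>
      replace (a + b - c) with ((a - c) + b) by ring end.
    eapply Rle_trans; [apply Cmod_triangle|]. lra.
Qed.

(** * Directions of descent *)

Lemma Re_CInt_ge_0 (f : R -> C) (a b : R) :
  (a <= b)%R -> segcont f a b -> (forall t, (a <= t <= b)%R -> (0 <= Re (f t))%R) ->
  (0 <= Re (CInt f a b))%R.
Proof.
  intros hab hf hp.
  pose proof (is_RInt_fct_extend_fst (U := R_NormedModule) (V := R_NormedModule) f a b _
    (CInt_correct f a b hab hf)) as h.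
  apply (is_RInt_ge_0 (fun t => fst (f t)) a b _ hab h).
  intros t ht; apply hp; lra.
Qed.

Lemma cos_1_gt : (1 / 2 < cos 1)%R.
Proof.
  rewrite <- cos_PI3. pose proof PI2_3_2.
  apply cos_decreasing_1; lra.
Qed.

(** Serves the derivative of [Re F] along the arc in [descent_angle]: a rotation by at most one
    radian keeps the real part above [1/2], and the relative error [E - 1] takes away at most
    [1/4]. *)
Lemma Cexp_add_Re_pos (s t : R) (E : C) : (-1 <= s <= 1)%R -> (0 <= t <= 1)%R ->
  (Cmod (E - 1) <= 1 / 4)%R -> (0 <= Re (Cexp (Ci * RtoC (s * t)) * E))%R.
Proof.
  intros hs ht hE.
  replace (Cexp (Ci * RtoC (s * t)) * E)
    with (Cexp (Ci * RtoC (s * t)) + Cexp (Ci * RtoC (s * t)) * (E - 1)) by ring.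
  rewrite re_plus.
  assert (h1 : (- (1 / 4) <= Re (Cexp (Ci * RtoC (s * t)) * (E - 1)))%R).
  { pose proof (re_le_Cmod (Cexp (Ci * RtoC (s * t)) * (E - 1))) as h.
    rewrite Cmod_mult in h. fold (circle (s * t)) in h. rewrite Cmod_circle, Rmult_1_l in h.
    apply Rabs_le_between in h; unfold circle in h; lra. }
  assert (h2 : (1 / 2 <= Re (Cexp (Ci * RtoC (s * t))))%R).
  { unfold Cexp; Creduce.
    replace (0 * (s * t) - 1 * 0)%R with 0%R by ring.
    replace (0 * 0 + 1 * (s * t))%R with (s * t)%R by ring.
    rewrite exp_0, Rmult_1_l.
    pose proof cos_1_gt. pose proof PI2_3_2.
    apply Rle_trans with (cos 1); [lra|].
    destruct (Rle_lt_dec 0 (s * t)) as [h|h].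
    - apply cos_decr_1; nra.
    - rewrite <- (cos_neg (s * t)). apply cos_decr_1; nra. }
  lra.
Qed.

Lemma Im_Clog_bound (z : C) : (0 < Re z)%R -> (Rabs (Im (Clog z)) < PI / 2)%R.
Proof.
  intros h; unfold Clog, Im at 1; cbn [snd].
  assert (hi := im_le_Cmod z). pose proof (Rabs_le_between (Im z) (Cmod z)) as [hb _].
  specialize (hb hi).
  set (u := (Im z / (Cmod z + Re z))%R).
  assert (hu : (-1 < u < 1)%R).
  { assert (he : ((Cmod z + Re z) * u = Im z)%R) by (unfold u; field; lra). nra. }
  assert (h1 : (- (PI / 4) < atan u < PI / 4)%R).
  { rewrite <- atan_1, <- atan_opp. split; apply atan_increasing; lra. }
  rewrite Rabs_mult, (Rabs_right 2) by lra.
  assert (Rabs (atan u) < PI / 4)%R by (apply Rabs_def1; lra). lra.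
Qed.

Lemma Clog_imaginary (z : C) : Re z = 0%R -> z <> 0 -> exists s : R,
  (s = 1 \/ s = -1)%R /\ Im z = (s * Cmod z)%R /\ sign (Im z) = s /\
  Clog z = (ln (Cmod z), (s * (PI / 2))%R).
Proof.
  intros hre hz; pose proof (proj1 (Cmod_gt_0 z) hz) as hm.
  pose proof (Cmod_sqr z) as hs; rewrite hre in hs.
  assert (hcase : (Im z = Cmod z \/ Im z = - Cmod z)%R).
  { assert (h : ((Im z - Cmod z) * (Im z + Cmod z) = 0)%R) by lra.
    apply Rmult_integral in h; destruct h; [left|right]; lra. }
  destruct hcase as [h|h].
  - exists 1%R; repeat split; [left; reflexivity|lra|apply sign_eq_1; lra|].
    unfold Clog; rewrite hre, h, Rplus_0_r.
    replace (Cmod z / Cmod z)%R with 1%R by (field; lra). rewrite atan_1; f_equal; lra.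
  - exists (-1)%R; repeat split; [right; reflexivity|lra|apply sign_eq_m1; lra|].
    unfold Clog; rewrite hre, h, Rplus_0_r.
    replace (- Cmod z / Cmod z)%R with (-1)%R by (field; lra).
    replace (-1)%R with (- (1))%R by ring. rewrite atan_opp, atan_1; f_equal; lra.
Qed.

Lemma continuous_at_0_ball (f : C -> C) (e : R) : continuous (T := CU) (U := CU) f (RtoC 0) -> (0 < e)%R ->
  exists d, (0 < d)%R /\ forall w, (Cmod w < d)%R -> (Cmod (f w - f 0) < e)%R.
Proof.
  intros h he; pose proof (continuous_locally_C (T := CU) f (RtoC 0) e h he) as hl.
  apply locally_C_Cmod in hl; destruct hl as [d [hd hl]]; exists d; split; [exact hd|].
  intros w hw; apply hl; rewrite Cminus_0_r; exact hw.
Qed.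

(* If Re fn > 0 no rotation is needed. Otherwise fn is imaginary; rotating by
   one n-th of a radian in the right direction makes Re (fn e^(i n psi)) > 0, and
   Re F increases along the arc of rotation. *)
Lemma descent_angle (n : nat) (F Fh : C -> C) (r : R) (fn : C) :
  (1 <= n)%nat -> (0 < r)%R ->
  (forall w, (Cmod w < r)%R -> hol Fh w /\ F w = w ^ n * Fh w) ->
  Fh 0 = fn -> fn <> 0 ->
  (forall t : R, (0 < t < r)%R -> (0 < Re (F (RtoC t)))%R) ->
  (0 <= Re fn)%R /\ exists psi : R, (Rabs (Im (Clog fn) + INR n * psi) < PI / 2)%R /\
    exists r', (0 < r' <= r)%R /\ forall eps t, (0 < eps < r')%R -> (0 <= t <= 1)%R ->
      (0 < Re (F (RtoC eps * Cexp (Ci * RtoC (psi * t)))%C))%R.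
Proof.
  intros hn hr hF hfn hnz hpos.
  assert (hi : (0 < INR n)%R) by (apply lt_0_INR; lia).
  assert (h0r : (Cmod 0 < r)%R) by (rewrite Cmod_0; exact hr).
  pose proof (hol_continuous _ _ (proj1 (hF 0 h0r))) as hc.
  (* A negative real part would make [Re (F t)] negative for small [t > 0], as [F t] is [t^n fn] to
     leading order. *)
  assert (hre : (0 <= Re fn)%R).
  { apply Rnot_lt_le; intros hneg.
    destruct (continuous_at_0_ball Fh (- Re fn) hc ltac:(lra)) as [d [hd hb]].
    set (t := (Rmin d r / 2)%R).
    assert (ht : (0 < t < d /\ t < r)%R).
    { unfold t; pose proof (Rmin_l d r); pose proof (Rmin_r d r).
      pose proof (Rmin_glb_lt d r 0 hd hr); lra. }
    assert (htm : Cmod (RtoC t) = t) by (rewrite Cmod_R, Rabs_right; lra).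
    pose proof (hb (RtoC t) ltac:(lra)) as h1. rewrite hfn in h1.
    pose proof (hpos t ltac:(lra)) as h2. rewrite (proj2 (hF (RtoC t) ltac:(lra))) in h2.
    rewrite <- RtoC_pow, re_scal_l in h2. pose proof (pow_lt t n ltac:(lra)).
    pose proof (re_le_Cmod (Fh (RtoC t) - fn)) as h3.
    apply (Rle_lt_trans _ _ _ h3), Rabs_def2 in h1.
    replace (Re (Fh (RtoC t) - fn)) with (Re (Fh (RtoC t)) - Re fn)%R in h1 by (Creduce; ring).
    nra. }
  split; [exact hre|].
  destruct (Req_dec (Re fn) 0) as [h0|h0].
  2:{ exists 0%R; split.
    - rewrite Rmult_0_r, Rplus_0_r; apply Im_Clog_bound; lra.
    - exists r; split; [lra|]; intros eps t he _.
      rewrite Rmult_0_l, Cmult_0_r, Cexp_0, Cmult_1_r; apply hpos, he. }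
  destruct (Clog_imaginary fn h0 hnz) as [sg [hsg [him [_ hlog]]]].
  pose proof (proj1 (Cmod_gt_0 fn) hnz) as hm.
  assert (hfi : fn = Ci * RtoC (sg * Cmod fn)).
  { apply injective_projections; [change (Re fn = Re (Ci * RtoC (sg * Cmod fn)))|
      change (Im fn = Im (Ci * RtoC (sg * Cmod fn)))].
    - rewrite h0; Creduce; ring.
    - rewrite him at 1; Creduce; ring. }
  (* The sign is opposite to that of [Im fn], so that [arg fn + n psi] has modulus [PI / 2 - 1]. *)
  set (psi := (- sg / INR n)%R).
  assert (hnpsi : (INR n * psi = - sg)%R) by (unfold psi; field; lra).
  exists psi; split.
  { rewrite hlog, hnpsi; unfold Im; cbn [snd]. pose proof PI2_3_2.
    destruct hsg as [->| ->]; apply Rabs_def1; lra. }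
  (* [w F'(w) = w^n Gh w], and the derivative of [F] along the arc is [i psi] times this. *)
  pose (Gh := fun w => RtoC (INR n) * Fh w + w * C_derive Fh w).
  assert (hGc : continuous (T := CU) (U := CU) Gh (RtoC 0)).
  { unfold Gh. pose proof (hol_continuous_derive _ _ (proj1 (hF 0 h0r))). cont. }
  (* The tolerance on [Gh] that keeps the relative error of the derivative along the arc below
     [1/4]. *)
  pose (q := (Cmod fn / (4 * Rabs psi))%R).
  assert (hpsi : (Rabs psi = / INR n)%R).
  { unfold psi, Rdiv; rewrite Rabs_mult, (Rabs_right (/ INR n))
      by (left; apply Rinv_0_lt_compat, hi).
    assert (h1 : (Rabs (- sg) = 1)%R)
      by (destruct hsg as [->| ->]; unfold Rabs; destruct Rcase_abs; lra).
    rewrite h1; ring. }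
  assert (hpp : (0 < Rabs psi)%R) by (rewrite hpsi; apply Rinv_0_lt_compat, hi).
  assert (hq : (0 < q)%R) by (unfold q; apply Rdiv_lt_0_compat; lra).
  destruct (continuous_at_0_ball Gh q hGc hq) as [d [hd hb]].
  exists (Rmin d r); split; [split; [apply Rmin_glb_lt; assumption|apply Rmin_r]|].
  intros eps t he ht.
  assert (hed : (0 < eps < d /\ eps < r)%R) by (pose proof (Rmin_l d r); pose proof (Rmin_r d r); lra).
  pose (c := fun t => RtoC eps * Cexp (0 + RtoC t * (Ci * RtoC psi))).
  assert (hceq : forall t, c t = RtoC eps * Cexp (Ci * RtoC (psi * t))).
  { intros u; unfold c; do 2 f_equal; rewrite RtoC_mult; ring. }
  assert (hcm : forall t, Cmod (c t) = eps).
  { intros u; rewrite hceq. change (Cexp (Ci * RtoC (psi * u))) with (circle (psi * u)).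
    apply Cmod_scaled_circle; lra. }
  assert (hcd : forall t, rder c t (Ci * RtoC psi * c t)).
  { intros u; unfold c; eapply rder_eq; [apply rder_scale, rder_real_line, cder_Cexp|ring]. }
  assert (hcc : forall t, continuous (U := CU) c t) by (intros u; apply (rder_continuous _ _ _ (hcd u))).
  assert (hFd : forall w, (Cmod w < r)%R -> w <> 0 -> cder F w (w ^ n * Gh w / w)).
  { intros w hw hwn. apply cder_ext_loc with (fun w => w ^ n * Fh w).
    - pose proof (open_Cball 0 w r) as ho; rewrite Cminus_0_r in ho.
      generalize (ho hw); apply filter_imp; intros v hv; rewrite Cminus_0_r in hv.
      symmetry; apply hF, hv.
    - eapply cder_eq.
      + apply cder_mult; [apply (cder_pow (fun w => w)), cder_id|apply hol_cder, hF, hw].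
      + cbv beta; unfold Gh. destruct n as [|m]; [lia|].
        replace (S m - 1)%nat with m by lia. rewrite Cpow_S. field; exact hwn. }
  assert (hder : forall u, (0 <= u <= 1)%R ->
    rder (fun u => F (c u)) u (Ci * RtoC psi * (c u ^ n * Gh (c u)))).
  { intros u hu.
    assert (hcn : c u <> 0) by (apply Cmod_gt_0; rewrite hcm; lra).
    eapply rder_eq; [apply rder_comp; [apply hcd|apply hFd; [rewrite hcm; lra|exact hcn]]|].
    field; exact hcn. }
  assert (hsc : forall T, (0 <= T <= 1)%R ->
    segcont (fun u => Ci * RtoC psi * (c u ^ n * Gh (c u))) 0 T).
  { intros T hT u hu. pose proof (hcc u).
    assert (hcg : continuous (U := CU) (fun u => Gh (c u)) u).
    { apply (continuous_comp (V := CU) c Gh); [apply hcc|].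
      assert (hh : hol Fh (c u)) by (apply hF; rewrite hcm; lra).
      unfold Gh. pose proof (hol_continuous _ _ hh). pose proof (hol_continuous_derive _ _ hh). cont. }
    cont. }
  rewrite <- hceq.
  assert (h1 : c 0%R = RtoC eps).
  { rewrite hceq, Rmult_0_r, Cmult_0_r, Cexp_0; ring. }
  pose proof (hpos eps ltac:(lra)) as h2. rewrite <- h1 in h2.
  pose proof (CInt_FTC (fun u => F (c u)) _ 0 t ltac:(lra) (fun u hu => hder u ltac:(lra)) (hsc t ht)) as hft.
  assert (h3 : (0 <= Re (F (c t) - F (c 0%R)))%R).
  { rewrite <- hft. apply Re_CInt_ge_0; [lra|apply hsc, ht|].
    intros u hu.
    assert (hGb : (Cmod (Gh (c u) - Gh 0) < q)%R) by (apply hb; rewrite hcm; lra).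
    (* As [n psi = - sg] and [fn = i sg |fn|], the leading coefficient of the derivative along the
       arc is the positive number [|fn|]. *)
    assert (hG0 : Ci * RtoC psi * Gh 0 = RtoC (Cmod fn)).
    { unfold Gh; rewrite hfn, Cmult_0_l, Cplus_0_r, hfi at 1.
      replace (Ci * RtoC psi * (RtoC (INR n) * (Ci * RtoC (sg * Cmod fn))))
        with (Ci * Ci * (RtoC (INR n * psi * (sg * Cmod fn)))) by (rewrite !RtoC_mult; ring).
      rewrite hnpsi. replace (- sg * (sg * Cmod fn))%R with (- (sg * sg) * Cmod fn)%R by ring.
      replace (sg * sg)%R with 1%R by (destruct hsg as [->| ->]; ring).
      apply injective_projections; Creduce; ring. }
    pose (E := Ci * RtoC psi * Gh (c u) / RtoC (Cmod fn)).
    assert (hmn : RtoC (Cmod fn) <> 0) by (apply RtoC_nz; lra).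
    assert (hE : (Cmod (E - 1) <= 1 / 4)%R).
    { replace (E - 1) with (Ci * RtoC psi * (Gh (c u) - Gh 0) / RtoC (Cmod fn)).
      - rewrite Cmod_div, !Cmod_mult, Cmod_Ci, !Cmod_R, (Rabs_right (Cmod fn)) by (lra || exact hmn).
        rewrite Rmult_1_l. left.
        apply Rmult_lt_reg_r with (Cmod fn); [exact hm|].
        replace (Rabs psi * Cmod (Gh (c u) - Gh 0) / Cmod fn * Cmod fn)%R
          with (Rabs psi * Cmod (Gh (c u) - Gh 0))%R by (field; lra).
        apply Rlt_le_trans with (Rabs psi * q)%R; [apply Rmult_lt_compat_l; assumption|].
        unfold q; right; field; lra.
      - unfold E. replace (Ci * RtoC psi * (Gh (c u) - Gh 0))
          with (Ci * RtoC psi * Gh (c u) - Ci * RtoC psi * Gh 0) by ring.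
        rewrite hG0; field; exact hmn. }
    replace (Ci * RtoC psi * (c u ^ n * Gh (c u))) with
      (RtoC (eps ^ n * Cmod fn) * (Cexp (Ci * RtoC (- sg * u)) * E)).
    - rewrite re_scal_l. apply Rmult_le_pos.
      + apply Rmult_le_pos; [apply pow_le; lra|lra].
      + apply Cexp_add_Re_pos; [destruct hsg as [->| ->]; lra|lra|exact hE].
    - rewrite hceq, Cpow_mult_l, Cexp_pow, RtoC_mult, RtoC_pow.
      replace (RtoC (INR n) * (Ci * RtoC (psi * u))) with (Ci * RtoC (- sg * u))
        by (rewrite <- hnpsi, !RtoC_mult; ring).
      rewrite <- hceq.
      unfold E; field; exact hmn. }
  replace (Re (F (c t) - F (c 0%R))) with (Re (F (c t)) - Re (F (c 0%R)))%R in h3 by (Creduce; ring).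
  lra.
Qed.

(** * Branches of the [n]-th root of the phase on the two half segments *)

Lemma Cmod_root_of_unity (chi : C) (n : nat) : (1 <= n)%nat -> chi ^ n = 1 -> Cmod chi = 1%R.
Proof.
  intros hn h; apply (f_equal Cmod) in h; rewrite Cmod_pow, Cmod_1 in h.
  pose proof (Cmod_ge_0 chi) as h0.
  destruct (Rtotal_order (Cmod chi) 1) as [hlt|[he|hgt]]; [|exact he|].
  - destruct n as [|n]; [lia|]. simpl in h.
    assert (Cmod chi ^ n <= 1)%R by (rewrite <- (pow1 n); apply pow_incr; lra).
    nra.
  - pose proof (Rlt_pow_R1 (Cmod chi) n hgt ltac:(lia)); lra.
Qed.

Lemma Cpow_m1_even (n : nat) : Nat.even n = true -> (- (1)) ^ n = 1.
Proof.
  intros h; apply Nat.even_spec in h; destruct h as [m ->].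
  rewrite Cpow_mult_r. replace ((- (1)) ^ 2) with (RtoC 1) by (simpl; ring). apply Cpow_1_l.
Qed.

Lemma Cpow_m1_odd (n : nat) : Nat.even n = false -> (- (1)) ^ n = - (1).
Proof.
  intros h. destruct n as [|n]; [discriminate|].
  rewrite Nat.even_succ, <- Nat.negb_even in h. rewrite Cpow_S, Cpow_m1_even; [ring|].
  destruct (Nat.even n); [reflexivity|discriminate].
Qed.

Lemma nz_Clog_dom (z : C) : (0 <= Re z)%R -> z <> 0 -> (0 < Cmod z + Re z)%R.
Proof. intros h hz; apply Cmod_gt_0 in hz; lra. Qed.

(** For even [n] the two numbers coincide. For odd [n] the two inequalities force [fn] to be
    imaginary; the logarithms of [fn] and [- fn] then have imaginary parts [s PI / 2] and
    [- s PI / 2], and their difference times [(j + 1) / n] is the exponent of [D(j, n)]. *)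
Lemma branch_ratio (n j : nat) (fn : C) : (1 <= n)%nat -> fn <> 0 ->
  (0 <= Re fn)%R -> (0 <= Re ((- (1)) ^ n * fn))%R ->
  Cexp (Clog fn / RtoC (INR n) - Clog ((- (1)) ^ n * fn) / RtoC (INR n)) ^ (j + 1) = Dfactor fn j n.
Proof.
  intros hn hnz h1 h2; unfold Dfactor.
  assert (hi : (0 < INR n)%R) by (apply lt_0_INR; lia).
  assert (hin : RtoC (INR n) <> 0) by (apply RtoC_nz; lra).
  rewrite Cexp_pow.
  destruct (Nat.even n) eqn:he.
  - rewrite Cpow_m1_even by exact he. rewrite Cmult_1_l, <- Cexp_0; f_equal; ring.
  - rewrite Cpow_m1_odd in h2 |- * by exact he.
    assert (hr : Re fn = 0%R).
    { replace (Re (- (1) * fn)) with (- Re fn)%R in h2 by (Creduce; ring). lra. }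
    destruct (Clog_imaginary fn hr hnz) as [s [hs [him [hsg hlog]]]].
    assert (hmz : - (1) * fn <> 0).
    { intros h; apply hnz. replace fn with (- (- (1) * fn)) by ring. rewrite h; ring. }
    assert (hmr : Re (- (1) * fn) = 0%R).
    { replace (Re (- (1) * fn)) with (- Re fn)%R by (Creduce; ring). lra. }
    destruct (Clog_imaginary _ hmr hmz) as [s' [hs' [him' [_ hlog']]]].
    assert (hmod : Cmod (- (1) * fn) = Cmod fn).
    { replace (- (1) * fn) with (- fn) by ring; apply Cmod_opp. }
    rewrite hmod in *.
    assert (hii : Im (- (1) * fn) = (- Im fn)%R) by (Creduce; ring).
    pose proof (proj1 (Cmod_gt_0 fn) hnz) as hm.
    assert (hss : s' = (- s)%R).
    { rewrite hii, him in him'. apply Rmult_eq_reg_r with (Cmod fn); lra. }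
    rewrite hlog, hlog', hss.
    assert (hsign : sign (Re (Ci * fn)) = (- s)%R).
    { replace (Re (Ci * fn)) with (- Im fn)%R by (Creduce; ring).
      rewrite sign_opp, hsg; reflexivity. }
    rewrite hsign. f_equal.
    assert (hpair : forall a b : R, ((a, b) : C) = RtoC a + Ci * RtoC b).
    { intros a b; apply injective_projections; Creduce; ring. }
    rewrite !hpair.
    replace (PI * INR (j + 1) / INR n * - s)%R with (- (INR (j + 1) * (s * PI) * / INR n))%R
      by (field; lra).
    replace (- s * (PI / 2))%R with (- (s * PI / 2))%R by field.
    replace (s * (PI / 2))%R with (s * PI / 2)%R by field.
    rewrite !RtoC_opp, !RtoC_mult, RtoC_inv by lra.
    replace (RtoC (s * PI / 2)) with (RtoC s * RtoC PI * / RtoC 2)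
      by (rewrite RtoC_div, RtoC_mult by lra; reflexivity).
    assert (RtoC 2 <> 0) by (apply RtoC_nz; lra).
    field; auto.
Qed.

(** Near [zeta_c] one has [f = th^n fh] with [fh] nonzero, and [yh] is the [n]-th root of [fh]
    normalised by the principal logarithm of [fn]. The negative half is treated as [w |-> f (- w)],
    with leading coefficient [fm = (-1)^n fn] and its own rotation [pm]; comparing the roots
    attached to [fn] and [fm] gives [chi]. The last clause keeps [Re f] bounded below on the arcs
    joining the real axis to the rotated rays. *)
Lemma phase_geometry (n : nat) (f : C -> C -> C) (zc fn : C) (r0 : R) :
  (1 <= n)%nat -> (0 < r0)%R -> jholB zc r0 f ->
  (forall z, (Cmod (z - zc) < r0)%R -> forall k, (k < n)%nat -> hartogs f 0 k z = 0) ->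
  fn = hartogs f 0 n zc -> fn <> 0 ->
  (forall t : R, (0 < Rabs t < r0)%R -> (0 < Re (f zc (RtoC t)))%R) ->
  exists (r : R) (yh : C -> C -> C) (rp rm : C -> R -> C) (chi : C) (pp pm b L : R),
    (0 < r <= r0)%R /\ jholB zc r yh /\
    (forall x th, (Cmod (x - zc) < r)%R -> (Cmod th < r)%R ->
       yh x th <> 0 /\ f x th = yfun yh x th ^ n) /\
    chi ^ n = 1 /\ (0 <= b < PI / 2)%R /\
    (forall x t, (Cmod (x - zc) < r)%R -> (0 <= t < r)%R ->
       circle pp * yh x (RtoC t * circle pp) = 1 * Cexp (rp x t) /\
       (INR n * Rabs (Im (rp x t)) <= b)%R /\ (Cmod (rp x t) <= L)%R) /\
    (forall x t, (Cmod (x - zc) < r)%R -> (0 <= t < r)%R ->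
       - circle pm * yh x (RtoC t * - circle pm) = chi * Cexp (rm x t) /\
       (INR n * Rabs (Im (rm x t)) <= b)%R /\ (Cmod (rm x t) <= L)%R) /\
    (forall j, - chi ^ (j + 1) = (- (1)) ^ j * Dfactor fn j n) /\
    (forall eps, (0 < eps < r)%R -> exists c0 dl : R, (0 < c0)%R /\ (0 < dl)%R /\
       forall x t, (Cmod (x - zc) < dl)%R -> (0 <= t <= 1)%R ->
         (c0 <= Re (f x (RtoC eps * circle (pp * t))%C))%R /\
         (c0 <= Re (f x (RtoC eps * - circle (pm * t))%C))%R).
Proof.
  intros hn hr0 hf hv hfn hnz hpos.
  assert (hi : (0 < INR n)%R) by (apply lt_0_INR; lia).
  assert (hin : RtoC (INR n) <> 0) by (apply RtoC_nz; lra).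
  pose (fh := ddn n f).
  pose proof (jholB_ddn n f zc r0 hf) as hfh; fold fh in hfh.
  assert (hzc : forall r, (0 < r)%R -> (Cmod (zc - zc) < r)%R).
  { intros r hr; replace (zc - zc) with (RtoC 0) by ring; rewrite Cmod_0; exact hr. }
  assert (h00 : forall r, (0 < r)%R -> (Cmod 0 < r)%R) by (intros r hr; rewrite Cmod_0; exact hr).
  assert (hfn0 : fh zc 0 = fn) by (rewrite hfn; symmetry; apply (hartogs_ddn n f zc r0); auto).
  assert (hfact : forall x th, (Cmod (x - zc) < r0)%R -> (Cmod th < r0)%R ->
    f x th = th ^ n * fh x th).
  { intros x th hx hth; apply (ddn_vanish f zc r0); auto. }
  pose (fm := (- (1)) ^ n * fn).
  assert (hm1 : (- (1)) ^ n <> 0).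
  { apply Cpow_nz; intros h; apply (f_equal fst) in h; simpl in h; lra. }
  assert (hfm : fm <> 0) by (apply Cmult_neq_0; assumption).
  destruct (descent_angle n (f zc) (fh zc) r0 fn hn hr0) as [hre [pp [hpp [r1 [hr1 harc1]]]]].
  { intros w hw; split; [|apply hfact; auto].
    apply (jhol_at _ _ _ (hfh zc w (hzc r0 hr0) hw)). }
  { exact hfn0. }
  { exact hnz. }
  { intros t ht; apply hpos; rewrite Rabs_right; lra. }
  destruct (descent_angle n (fun w => f zc (- w)) (fun w => (- (1)) ^ n * fh zc (- w)) r0 fm hn hr0)
    as [hrem [pm [hpm [r2 [hr2 harc2]]]]].
  { intros w hw; split.
    - apply hol_mult; [apply hol_const|].
      apply (hol_comp (fun w => - w) (fh zc)); [apply hol_opp, hol_id|].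
      apply (jhol_at _ _ _ (hfh zc (- w) (hzc r0 hr0) ltac:(rewrite Cmod_opp; exact hw))).
    - rewrite (hfact zc (- w)) by (try rewrite Cmod_opp; auto).
      replace (- w) with (- (1) * w) at 1 by ring. rewrite Cpow_mult_l; ring. }
  { unfold fm; replace (- 0) with (RtoC 0) by ring; rewrite hfn0; reflexivity. }
  { exact hfm. }
  { intros t ht. rewrite <- RtoC_opp; apply hpos; rewrite Rabs_Ropp, Rabs_right; lra. }
  (* The quotient is near 1, so its principal logarithm is holomorphic even when [fn] is
     imaginary. *)
  pose (lq := fun x th => Clog (fh x th / fn)).
  assert (hlq0 : jhol lq zc 0).
  { apply (jhol_comp (fun x th => fh x th / fn) Clog).
    - apply jhol_div; [apply hfh; auto|apply jhol_const|exact hnz].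
    - apply hol_Clog. rewrite hfn0. replace (fn / fn) with (RtoC 1) by (field; exact hnz). simpl; lra. }
  (* Half of the margin that the rotations leave below [PI / 2]: one [gam] is spent on the variation
     of [lq], the other is kept as [PI / 2 - b]. *)
  pose (gam := (Rmin (PI / 2 - Rabs (Im (Clog fn) + INR n * pp))
                     (PI / 2 - Rabs (Im (Clog fm) + INR n * pm)) / 2)%R).
  assert (hgam : (0 < gam /\ 2 * gam <= PI / 2 - Rabs (Im (Clog fn) + INR n * pp)
      /\ 2 * gam <= PI / 2 - Rabs (Im (Clog fm) + INR n * pm))%R).
  { unfold gam. set (u := (PI / 2 - Rabs (Im (Clog fn) + INR n * pp))%R) in *.
    set (v := (PI / 2 - Rabs (Im (Clog fm) + INR n * pm))%R) in *.
    pose proof (Rmin_l u v); pose proof (Rmin_r u v).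
    pose proof (Rmin_glb_lt u v 0 ltac:(unfold u; lra) ltac:(unfold v; lra)). lra. }
  assert (hloc : locally (T := CC) (zc, RtoC 0) (fun p =>
     (Cmod (lq (fst p) (snd p)) < gam)%R /\ (0 < Re (fh (fst p) (snd p) / fn))%R)).
  { assert (hq1 : fh zc 0 / fn = 1) by (rewrite hfn0; field; exact hnz).
    apply filter_and.
    - pose proof (continuous_locally_C (T := CC) _ _ gam (proj1 (jhol_at _ _ _ hlq0)) (proj1 hgam)) as h.
      generalize h; apply filter_imp; intros p hp; simpl in hp. unfold lq at 2 in hp.
      rewrite hq1, Clog_1, Cminus_0_r in hp; exact hp.
    - apply (locally_lt_continuous (T := CC) (fun _ => 0%R) (fun p => Re (fh (fst p) (snd p) / fn))).
      + cont.
      + apply (continuous_Re (T := CC)). apply (continuous_Cdiv (T := CC)); [|cont|exact hnz].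
        apply (jhol_at _ _ _ (hfh zc 0 (hzc r0 hr0) (h00 r0 hr0))).
      + simpl fst; simpl snd. rewrite hq1; simpl; lra. }
  destruct (locally_prod_ball (X := CU) (Y := CU) _ _ _ hloc) as [d3 hd3].
  destruct (jhol_jholB lq zc hlq0) as [r4 [hr4 hlq]].
  pose proof (cond_pos d3) as hd3p.
  pose (r := (Rmin (Rmin r1 r2) (Rmin d3 r4))%R).
  assert (hr : (0 < r /\ r <= r1 /\ r <= r2 /\ r <= d3 /\ r <= r4)%R).
  { unfold r. pose proof (Rmin_l r1 r2); pose proof (Rmin_r r1 r2).
    pose proof (Rmin_l d3 r4); pose proof (Rmin_r d3 r4).
    pose proof (Rmin_l (Rmin r1 r2) (Rmin d3 r4)); pose proof (Rmin_r (Rmin r1 r2) (Rmin d3 r4)).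
    pose proof (Rmin_glb_lt r1 r2 0 ltac:(lra) ltac:(lra)).
    pose proof (Rmin_glb_lt d3 r4 0 ltac:(lra) ltac:(lra)).
    pose proof (Rmin_glb_lt (Rmin r1 r2) (Rmin d3 r4) 0 ltac:(lra) ltac:(lra)). lra. }
  assert (hball : forall x th, (Cmod (x - zc) < r)%R -> (Cmod th < r)%R ->
     (Cmod (lq x th) < gam)%R /\ (0 < Re (fh x th / fn))%R).
  { intros x th hx hth; apply (hd3 x th); apply ball_C_Cmod; [lra|rewrite Cminus_0_r; lra]. }
  pose (l0 := Clog fn / RtoC (INR n)). pose (lm := Clog fm / RtoC (INR n)).
  pose (yh := fun x th => Cexp (l0 + lq x th / RtoC (INR n))).
  (* The minus sign is that of the direction [- circle pm]; the exponential compares the principal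
     roots of [fn] and [fm]. *)
  pose (chi := - Cexp (l0 - lm)).
  assert (hyn : forall x th, (Cmod (x - zc) < r)%R -> (Cmod th < r)%R -> yh x th ^ n = fh x th).
  { intros x th hx hth; unfold yh; rewrite Cexp_pow.
    replace (RtoC (INR n) * (l0 + lq x th / RtoC (INR n))) with (Clog fn + lq x th)
      by (unfold l0; field; exact hin).
    unfold lq; rewrite Cexp_plus, !Cexp_Clog; [field; exact hnz| |].
    - apply Re_pos_Clog_dom, hball; assumption.
    - apply nz_Clog_dom; assumption. }
  assert (hchin : chi ^ n = 1).
  { unfold chi. replace (- Cexp (l0 - lm)) with (- (1) * Cexp (l0 - lm)) by ring.
    rewrite Cpow_mult_l, Cexp_pow.
    replace (RtoC (INR n) * (l0 - lm)) with (Clog fn + - Clog fm) by (unfold l0, lm; field; exact hin).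
    rewrite Cexp_plus, Cexp_opp, !Cexp_Clog by (apply nz_Clog_dom; assumption).
    unfold fm; field; auto. }
  pose (A := fun w : R => Ci * RtoC w).
  assert (hcirc : forall w, circle w = Cexp (A w)) by reflexivity.
  pose (L := (Cmod l0 + Cmod lm + Rabs pp + Rabs pm + gam / INR n)%R).
  assert (hsmall : forall x th, (Cmod (x - zc) < r)%R -> (Cmod th < r)%R ->
     (Cmod (lq x th / RtoC (INR n)) <= gam / INR n)%R).
  { intros x th hx hth. rewrite Cmod_div, Cmod_R, (Rabs_right (INR n)) by (lra || exact hin).
    apply Rmult_le_compat_r; [left; apply Rinv_0_lt_compat, hi|].
    left; apply (hball x th hx hth). }
  assert (hImA : forall (c : C) (w : R) x th, (Cmod (x - zc) < r)%R -> (Cmod th < r)%R ->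
    (INR n * Rabs (Im (c / RtoC (INR n) + A w + lq x th / RtoC (INR n)))
       <= Rabs (Im c + INR n * w) + gam)%R).
  { intros c w x th hx hth.
    rewrite <- (Rabs_right (INR n)) at 1 by lra. rewrite <- Rabs_mult.
    replace (INR n * Im (c / RtoC (INR n) + A w + lq x th / RtoC (INR n)))%R
      with ((Im c + INR n * w) + Im (lq x th))%R.
    - eapply Rle_trans; [apply Rabs_triang|]. apply Rplus_le_compat_l.
      eapply Rle_trans; [apply im_le_Cmod|]. left; apply (hball x th hx hth).
    - rewrite <- im_scal_l.
      replace (RtoC (INR n) * (c / RtoC (INR n) + A w + lq x th / RtoC (INR n)))
        with (c + RtoC (INR n) * A w + lq x th) by (field; exact hin).
      unfold A; Creduce; ring. }
  pose (b := (PI / 2 - gam)%R).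
  exists r, yh, (fun x t => l0 + A pp + lq x (RtoC t * circle pp) / RtoC (INR n)),
    (fun x t => lm + A pm + lq x (RtoC t * - circle pm) / RtoC (INR n)), chi, pp, pm, b, L.
  assert (hray : forall w t, (0 <= t < r)%R -> (Cmod (RtoC t * circle w) < r)%R
     /\ (Cmod (RtoC t * - circle w) < r)%R).
  { intros w t ht. replace (RtoC t * - circle w) with (- (RtoC t * circle w)) by ring.
    rewrite Cmod_opp, Cmod_scaled_circle by lra; lra. }
  assert (hAm : forall w, Cmod (A w) = Rabs w).
  { intros w; unfold A; rewrite Cmod_mult, Cmod_Ci, Cmod_R; ring. }
  repeat match goal with |- _ /\ _ => split end.
  - lra.
  - lra.
  - intros x th hx hth. unfold yh.
    apply (jhol_comp (fun x th => l0 + lq x th / RtoC (INR n)) Cexp); [|apply hol_Cexp].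
    apply jhol_plus; [apply jhol_const|]. apply jhol_div; [|apply jhol_const|exact hin].
    apply hlq; lra.
  - intros x th hx hth; split; [apply Cexp_nz|].
    rewrite hfact by lra. unfold yfun; rewrite Cpow_mult_l, hyn by assumption; reflexivity.
  - exact hchin.
  - unfold b; pose proof (Rabs_pos (Im (Clog fn) + INR n * pp)); lra.
  - unfold b; lra.
  - intros x t hx ht; destruct (hray pp t ht) as [ht1 _]; split; [|split].
    + unfold yh; rewrite Cmult_1_l, hcirc, <- Cexp_plus; f_equal; ring.
    + eapply Rle_trans; [apply hImA; assumption|unfold b; lra].
    + pose proof (hsmall x _ hx ht1). pose proof (Cmod_ge_0 lm). pose proof (Rabs_pos pm).
      eapply Rle_trans; [apply Cmod_triangle|].
      eapply Rle_trans; [apply Rplus_le_compat_r, Cmod_triangle|]. rewrite hAm; unfold L; lra.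
  - intros x t hx ht; destruct (hray pm t ht) as [_ ht1]; split; [|split].
    + unfold yh, chi. rewrite !hcirc.
      transitivity (- (Cexp (A pm) * Cexp (l0 + lq x (RtoC t * - Cexp (A pm)) / RtoC (INR n)))); [ring|].
      rewrite <- Cexp_plus.
      transitivity (- (Cexp (l0 - lm) * Cexp (lm + A pm + lq x (RtoC t * - Cexp (A pm)) / RtoC (INR n)))); [|ring].
      rewrite <- Cexp_plus. do 2 f_equal. ring.
    + eapply Rle_trans; [apply hImA; assumption|unfold b; lra].
    + pose proof (hsmall x _ hx ht1). pose proof (Cmod_ge_0 l0). pose proof (Rabs_pos pp).
      eapply Rle_trans; [apply Cmod_triangle|].
      eapply Rle_trans; [apply Rplus_le_compat_r, Cmod_triangle|]. rewrite hAm; unfold L; lra.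
  - intros j. rewrite <- branch_ratio by assumption. unfold chi.
    replace (- Cexp (l0 - lm)) with (- (1) * Cexp (l0 - lm)) by ring.
    rewrite Cpow_mult_l. replace ((- (1)) ^ (j + 1)) with (- (- (1)) ^ j)
      by (rewrite Cpow_add_r, Cpow_1_r; ring).
    unfold l0, lm, fm. ring.
  - intros eps heps.
    (* The second component of [p], equal to 0 at the base point, is a candidate lower bound:
       positivity at [zc] thus gives one positive bound for all nearby [x]. *)
    pose (P := fun (p : C * R) (t : R) => (snd p < Re (f (fst p) (RtoC eps * circle (pp * t))%C))%R
       /\ (snd p < Re (f (fst p) (RtoC eps * - circle (pm * t))%C))%R).
    assert (hP : locally (T := prod_UniformSpace CU RU) (zc, 0%R) (fun p => forall t, (0 <= t <= 1)%R -> P p t)).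
    { apply (locally_forall_segment (X := prod_UniformSpace CU RU) (zc, 0%R) 0 1 P).
      intros t ht; unfold P.
      assert (hcf : forall th, (Cmod th < r)%R -> jcCC f (zc, th)).
      { intros th hth; apply (jhol_at _ _ _ (hf zc th (hzc r0 hr0) ltac:(lra))). }
      apply filter_and.
      - apply (locally_lt_continuous (T := prod_UniformSpace (prod_UniformSpace CU RU) RU)
          (fun q => snd (fst q)) (fun q => Re (f (fst (fst q)) (RtoC eps * circle (pp * snd q))%C))).
        + cont.
        + apply (continuous_Re (T := prod_UniformSpace (prod_UniformSpace CU RU) RU)).
          apply (continuous_uncurry (T := prod_UniformSpace (prod_UniformSpace CU RU) RU)
            (U := CU) (V := CU) (W := CU) f (fun q => fst (fst q))
            (fun q => RtoC eps * circle (pp * snd q))); [cont|cont|].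
          apply hcf, hray; lra.
        + cbn [fst snd]. apply harc1; lra.
      - apply (locally_lt_continuous (T := prod_UniformSpace (prod_UniformSpace CU RU) RU)
          (fun q => snd (fst q)) (fun q => Re (f (fst (fst q)) (RtoC eps * - circle (pm * snd q))%C))).
        + cont.
        + apply (continuous_Re (T := prod_UniformSpace (prod_UniformSpace CU RU) RU)).
          apply (continuous_uncurry (T := prod_UniformSpace (prod_UniformSpace CU RU) RU)
            (U := CU) (V := CU) (W := CU) f (fun q => fst (fst q))
            (fun q => RtoC eps * - circle (pm * snd q))); [cont|cont|].
          apply hcf, hray; lra.
        + cbn [fst snd]. replace (RtoC eps * - circle (pm * t)) with
            (- (RtoC eps * circle (pm * t))) by ring. apply harc2; lra. }
    destruct (locally_prod_ball (X := CU) (Y := RU) _ _ _ hP) as [d hd].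
    pose proof (cond_pos d) as hdp.
    exists (d / 2)%R, (pos d); split; [lra|split; [exact hdp|]].
    intros x t hx ht.
    assert (hbd : ball (M := RU) 0%R d (d / 2)%R).
    { change (Rabs (d / 2 - 0) < d)%R; rewrite Rabs_right; lra. }
    destruct (hd x (d / 2)%R (ball_C_Cmod _ _ _ hx) hbd t ht) as [p1 p2]; simpl in p1, p2.
    split; left; assumption.
Qed.

(** * Coefficients as torus integrals *)

(** Compactness, with the increment [e] as a variable of the tube lemma applied to the four real
    coordinates in turn: near a point outside the closed polydisc a modulus condition fails, near a
    point where [H] is nonzero the equation fails, and near [(zc, wc)] the conclusion holds. *)
Lemma zero_localization (H : C -> C -> C) (rho1 rho2 d : R) (zc wc : C) :
  (forall z w, polydisk rho1 rho2 z w -> jcCC H (z, w)) -> polydisk rho1 rho2 zc wc -> (0 < d)%R ->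
  (forall z w, (Cmod z <= Cmod zc)%R -> (Cmod w <= Cmod wc)%R -> H z w = 0 -> z = zc /\ w = wc) ->
  exists e, (0 < e)%R /\ (Cmod zc + e < rho1)%R /\ (Cmod wc + e < rho2)%R /\
    forall z w, (Cmod z <= Cmod zc + e)%R -> (Cmod w <= Cmod wc + e)%R -> H z w = 0 ->
      (Cmod (z - zc) < d)%R /\ (Cmod (w - wc) < d)%R.
Proof.
  intros hc [hp1 hp2] hd hmin.
  pose (cp := fun a b : R => RtoC a + Ci * RtoC b).
  pose (P := fun e a b a' b' : R => (Cmod (cp a b) <= Cmod zc + e)%R -> (Cmod (cp a' b') <= Cmod wc + e)%R ->
     H (cp a b) (cp a' b') = 0 -> (Cmod (cp a b - zc) < d)%R /\ (Cmod (cp a' b' - wc) < d)%R).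
  pose (X := prod_UniformSpace (prod_UniformSpace (prod_UniformSpace (prod_UniformSpace RU RU) RU) RU) RU).
  assert (h4 : forall a b a' b', locally (T := X) ((((0%R, a), b), a'), b') (fun p =>
     P (fst (fst (fst (fst p)))) (snd (fst (fst (fst p)))) (snd (fst (fst p))) (snd (fst p)) (snd p))).
  { intros a b a' b'.
    pose (zf := fun p : X => cp (snd (fst (fst (fst p)))) (snd (fst (fst p)))).
    pose (wf := fun p : X => cp (snd (fst p)) (snd p)).
    pose (ef := fun p : X => fst (fst (fst (fst p)))).
    assert (hzf : forall p, continuous (T := X) (U := CU) zf p) by (intros p; unfold zf, cp, X; cont).
    assert (hwf : forall p, continuous (T := X) (U := CU) wf p) by (intros p; unfold wf, cp, X; cont).
    assert (hef : forall p, continuous (T := X) (U := RU) ef p) by (intros p; unfold ef, X; cont).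
    set (p0 := ((((0%R, a), b), a'), b') : X).
    change (locally (T := X) p0 (fun p => (Cmod (zf p) <= Cmod zc + ef p)%R ->
      (Cmod (wf p) <= Cmod wc + ef p)%R -> H (zf p) (wf p) = 0 ->
      (Cmod (zf p - zc) < d)%R /\ (Cmod (wf p - wc) < d)%R)).
    pose proof (hzf p0) as cz. pose proof (hwf p0) as cw. pose proof (hef p0) as ce.
    destruct (Rlt_le_dec (Cmod zc) (Cmod (zf p0))) as [h1|h1].
    { assert (hl : locally (T := X) p0 (fun p => (Cmod zc + ef p < Cmod (zf p))%R)).
      { apply (locally_lt_continuous (T := X) (fun p => (Cmod zc + ef p)%R) (fun p => Cmod (zf p)));
          [cont|apply (continuous_Cmod (T := X)); exact cz|].
        change (ef p0) with 0%R; lra. }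
      generalize hl; apply filter_imp; intros p hp hp'; lra. }
    destruct (Rlt_le_dec (Cmod wc) (Cmod (wf p0))) as [h2|h2].
    { assert (hl : locally (T := X) p0 (fun p => (Cmod wc + ef p < Cmod (wf p))%R)).
      { apply (locally_lt_continuous (T := X) (fun p => (Cmod wc + ef p)%R) (fun p => Cmod (wf p)));
          [cont|apply (continuous_Cmod (T := X)); exact cw|].
        change (ef p0) with 0%R; lra. }
      generalize hl; apply filter_imp; intros p hp _ hp'; lra. }
    destruct (classic (H (zf p0) (wf p0) = 0)) as [h3|h3].
    - destruct (hmin _ _ h1 h2 h3) as [hz hw].
      pose proof (continuous_locally_C (T := X) _ _ d cz hd) as l1.
      pose proof (continuous_locally_C (T := X) _ _ d cw hd) as l2.
      generalize (filter_and _ _ l1 l2); apply filter_imp; intros p [q1 q2] _ _ _.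
      rewrite hz in q1; rewrite hw in q2; split; assumption.
    - assert (hcH : continuous (T := X) (U := CU) (fun p => H (zf p) (wf p)) p0).
      { apply (continuous_uncurry (T := X) (U := CU) (V := CU) (W := CU) H zf wf p0 cz cw).
        apply hc; split; lra. }
      generalize (locally_neq_0 (T := X) _ _ hcH h3); apply filter_imp; intros p hp _ _ hp'; tauto. }
  (* Since [e <= 1] is imposed below, all points in question have coordinates of modulus at most
     [A]. *)
  pose (A := (Cmod zc + Cmod wc + 1)%R).
  assert (hP : locally (T := RU) 0%R (fun e => forall a, (- A <= a <= A)%R -> forall b, (- A <= b <= A)%R ->
     forall a', (- A <= a' <= A)%R -> forall b', (- A <= b' <= A)%R -> P e a b a' b')).
  { apply (locally_forall_segment (X := RU) 0%R (- A) A (fun e a => forall b, (- A <= b <= A)%R ->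
     forall a', (- A <= a' <= A)%R -> forall b', (- A <= b' <= A)%R -> P e a b a' b')); intros a _.
    apply (locally_forall_segment (X := prod_UniformSpace RU RU) (0%R, a) (- A) A (fun p b =>
     forall a', (- A <= a' <= A)%R -> forall b', (- A <= b' <= A)%R -> P (fst p) (snd p) b a' b')); intros b _.
    apply (locally_forall_segment (X := prod_UniformSpace (prod_UniformSpace RU RU) RU)
     ((0%R, a), b) (- A) A (fun p a' =>
     forall b', (- A <= b' <= A)%R -> P (fst (fst p)) (snd (fst p)) (snd p) a' b')); intros a' _.
    apply (locally_forall_segment
     (X := prod_UniformSpace (prod_UniformSpace (prod_UniformSpace RU RU) RU) RU)
     (((0%R, a), b), a') (- A) A (fun p b' =>
       P (fst (fst (fst p))) (snd (fst (fst p))) (snd (fst p)) (snd p) b')); intros b' _.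
    apply h4. }
  destruct hP as [e0 he0]. pose proof (cond_pos e0) as hep.
  pose (e := (Rmin (Rmin (e0 / 2) 1) (Rmin ((rho1 - Cmod zc) / 2) ((rho2 - Cmod wc) / 2)))%R).
  assert (he : (0 < e /\ e <= e0 / 2 /\ e <= 1 /\ e <= (rho1 - Cmod zc) / 2 /\ e <= (rho2 - Cmod wc) / 2)%R).
  { unfold e. set (u := (e0 / 2)%R). set (v := ((rho1 - Cmod zc) / 2)%R). set (v' := ((rho2 - Cmod wc) / 2)%R).
    pose proof (Rmin_l u 1); pose proof (Rmin_r u 1). pose proof (Rmin_l v v'); pose proof (Rmin_r v v').
    pose proof (Rmin_l (Rmin u 1) (Rmin v v')); pose proof (Rmin_r (Rmin u 1) (Rmin v v')).
    pose proof (Rmin_glb_lt u 1 0 ltac:(unfold u; lra) ltac:(lra)).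
    pose proof (Rmin_glb_lt v v' 0 ltac:(unfold v; lra) ltac:(unfold v'; lra)).
    pose proof (Rmin_glb_lt (Rmin u 1) (Rmin v v') 0 ltac:(lra) ltac:(lra)). lra. }
  exists e; split; [lra|split; [lra|split; [lra|]]].
  intros z w hz hw h0.
  assert (hbd : ball (M := RU) 0%R e0 e).
  { change (Rabs (e - 0) < e0)%R; rewrite Rabs_right; lra. }
  assert (hbox : forall c : C, (Cmod c <= A)%R -> (- A <= Re c <= A)%R /\ (- A <= Im c <= A)%R).
  { intros c hcA; split; apply Rabs_le_between.
    - eapply Rle_trans; [apply re_le_Cmod|exact hcA].
    - eapply Rle_trans; [apply im_le_Cmod|exact hcA]. }
  assert (hcp : forall c : C, cp (Re c) (Im c) = c).
  { intros c; unfold cp; apply injective_projections; Creduce; ring. }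
  pose proof (Cmod_ge_0 zc); pose proof (Cmod_ge_0 wc).
  destruct (hbox z ltac:(unfold A; lra)) as [b1 b2]. destruct (hbox w ltac:(unfold A; lra)) as [b3 b4].
  pose proof (he0 e hbd _ b1 _ b2 _ b3 _ b4) as hfin; unfold P in hfin; rewrite !hcp in hfin; auto.
Qed.

(** * Coefficients of polynomials and power series as torus integrals *)

Lemma rder_pow_circle (c : C) (m : nat) (a : R) :
  rder (fun a => (c * circle a) ^ m) a (Ci * RtoC (INR m) * (c * circle a) ^ m).
Proof.
  eapply rder_eq.
  - apply (rder_comp (fun a => c * circle a) (fun y => y ^ m)); [apply rder_scale, rder_circle|].
    apply (cder_pow (fun y => y)), cder_id.
  - destruct m as [|m]; [simpl; ring|]. replace (S m - 1)%nat with m by lia. rewrite Cpow_S; ring.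
Qed.

Lemma CInt_pow_circle (c : C) (m : nat) : (1 <= m)%nat ->
  CInt (fun a => (c * circle a) ^ m) (- PI) PI = 0.
Proof.
  intros hm.
  assert (hs : segcont (fun a => (c * circle a) ^ m) (- PI) PI) by (intros a _; cont).
  assert (h : Ci * RtoC (INR m) * CInt (fun a => (c * circle a) ^ m) (- PI) PI = 0).
  { rewrite <- CInt_Cmult; [|apply PI_bounds|exact hs].
    rewrite (CInt_FTC (fun a => (c * circle a) ^ m)).
    - rewrite circle_PI; ring.
    - apply PI_bounds.
    - intros a _; apply rder_pow_circle.
    - intros a ha; apply continuous_Cmult; [cont|apply hs, ha]. }
  assert (hm0 : RtoC (INR m) <> 0) by (apply RtoC_nz, not_0_INR; lia).
  pose proof Ci_nz. set (I := CInt _ _ _) in *.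
  replace I with (/ (Ci * RtoC (INR m)) * (Ci * RtoC (INR m) * I)) by (field; auto). rewrite h; ring.
Qed.

Lemma CInt_inv_pow_circle (c : C) (m : nat) : c <> 0 -> (1 <= m)%nat ->
  CInt (fun a => / (c * circle a) ^ m) (- PI) PI = 0.
Proof.
  intros hc hm.
  assert (hnz : forall a, c * circle a <> 0) by (intros a; apply Cmult_neq_0; [exact hc|apply circle_nz]).
  assert (hs : segcont (fun a => / (c * circle a) ^ m) (- PI) PI).
  { intros a _; cont. apply Cpow_nz, hnz. }
  assert (h : - (Ci * RtoC (INR m)) * CInt (fun a => / (c * circle a) ^ m) (- PI) PI = 0).
  { rewrite <- CInt_Cmult; [|apply PI_bounds|exact hs].
    rewrite (CInt_FTC (fun a => / (c * circle a) ^ m)).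
    - rewrite circle_PI; ring.
    - apply PI_bounds.
    - intros a _; eapply rder_eq.
      + apply (rder_comp (fun a => (c * circle a) ^ m) Cinv); [apply rder_pow_circle|].
        apply (cder_inv (fun y => y)); [apply cder_id|apply Cpow_nz, hnz].
      + pose proof (Cpow_nz _ m (hnz a)). field; auto.
    - intros a ha; apply continuous_Cmult; [cont|apply hs, ha]. }
  assert (hm0 : RtoC (INR m) <> 0) by (apply RtoC_nz, not_0_INR; lia).
  pose proof Ci_nz. set (I := CInt _ _ _) in *.
  replace I with (- / (Ci * RtoC (INR m)) * (- (Ci * RtoC (INR m)) * I)) by (field; auto). rewrite h; ring.
Qed.

Lemma CInt_monomial (c : C) (k r : nat) : c <> 0 ->
  CInt (fun a => (c * circle a) ^ k / (c * circle a) ^ r) (- PI) PI =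
  if Nat.eq_dec k r then RtoC (2 * PI) else 0.
Proof.
  intros hc.
  assert (hnz : forall a, c * circle a <> 0) by (intros a; apply Cmult_neq_0; [exact hc|apply circle_nz]).
  destruct (Nat.eq_dec k r) as [->|hne].
  - rewrite (CInt_ext _ (fun _ => 1)).
    + rewrite CInt_const, Cmult_1_r; f_equal; ring.
    + apply PI_bounds.
    + intros a _. field. apply Cpow_nz, hnz.
  - destruct (Nat.lt_total k r) as [hl|[he|hl]]; [|lia|].
    + rewrite (CInt_ext _ (fun a => / (c * circle a) ^ (r - k))).
      * apply CInt_inv_pow_circle; [exact hc|lia].
      * apply PI_bounds.
      * intros a _. replace r with (k + (r - k))%nat at 1 by lia. rewrite Cpow_add_r.
        pose proof (Cpow_nz _ k (hnz a)). pose proof (Cpow_nz _ (r - k) (hnz a)). field; auto.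
    + rewrite (CInt_ext _ (fun a => (c * circle a) ^ (k - r))).
      * apply CInt_pow_circle; lia.
      * apply PI_bounds.
      * intros a _. replace k with (r + (k - r))%nat at 1 by lia. rewrite Cpow_add_r.
        pose proof (Cpow_nz _ r (hnz a)). field; auto.
Qed.

Lemma CInt_sum_n (F : nat -> R -> C) (a b : R) (N : nat) :
  (a <= b)%R -> (forall k, segcont (F k) a b) ->
  CInt (fun t => sum_n (G := C_AbelianGroup) (fun k => F k t) N) a b
  = sum_n (G := C_AbelianGroup) (fun k => CInt (F k) a b) N.
Proof.
  intros hab h; induction N as [|N IH].
  - rewrite sum_O. apply CInt_ext; [exact hab|]; intros t _; rewrite sum_O; reflexivity.
  - rewrite sum_Sn, <- IH. change (@plus C_AbelianGroup) with Cplus.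
    rewrite <- CInt_plus; [|exact hab| |apply h].
    + apply CInt_ext; [exact hab|]; intros t _; rewrite sum_Sn; reflexivity.
    + intros t ht; apply (continuous_sum_n (T := RU) F N); intros k; apply h, ht.
Qed.

Lemma sum_n_zero_C (u : nat -> C) (N : nat) :
  (forall k, (k <= N)%nat -> u k = 0) -> sum_n (G := C_AbelianGroup) u N = RtoC 0.
Proof.
  intros h; induction N as [|N IH]; [rewrite sum_O; apply h; lia|].
  rewrite sum_Sn, IH, h by (try intros; try apply h; lia). change (@plus C_AbelianGroup) with Cplus. Cring.
Qed.

Lemma sum_n_single (u : nat -> C) (k0 N : nat) :
  (k0 <= N)%nat -> (forall k, (k <= N)%nat -> k <> k0 -> u k = 0) ->
  sum_n (G := C_AbelianGroup) u N = u k0.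
Proof.
  intros hk h; induction N as [|N IH].
  - rewrite sum_O; f_equal; lia.
  - rewrite sum_Sn; change (@plus C_AbelianGroup) with Cplus.
    destruct (Nat.eq_dec k0 (S N)) as [->|hne].
    + rewrite sum_n_zero_C; [Cring|]. intros k hk'; apply h; lia.
    + rewrite IH, (h (S N)) by (try (intros; apply h); lia). Cring.
Qed.

(** Integrals in the two angles, without the factor [(2 PI)^-2]. The [w]-integral is the inner one
    because it is the one deformed across the pole. *)
Definition torus_int (U : C -> C -> C) (r s : nat) (lam mu : C) : C :=
  CInt (fun a => CInt (fun b => U (lam * circle a) (mu * circle b) / (mu * circle b) ^ s) (- PI) PI
    / (lam * circle a) ^ r) (- PI) PI.

Lemma torus_int_poly2 (F : nat -> nat -> C) (N r s : nat) (lam mu : C) :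
  lam <> 0 -> mu <> 0 -> (r + s <= N)%nat ->
  torus_int (poly2 F 0 0 N) r s lam mu = RtoC (2 * PI) * RtoC (2 * PI) * F r s.
Proof.
  intros hl hm hN; unfold torus_int, poly2.
  assert (hnl : forall a, lam * circle a <> 0) by (intros a; apply Cmult_neq_0; [exact hl|apply circle_nz]).
  assert (hnm : forall a, mu * circle a <> 0) by (intros a; apply Cmult_neq_0; [exact hm|apply circle_nz]).
  pose (J := fun k r : nat => if Nat.eq_dec k r then RtoC (2 * PI) else 0).
  assert (hinner : forall a, CInt (fun b => sum_n (G := C_AbelianGroup) (fun n => sum_n (G := C_AbelianGroup)
      (fun k => F k (n - k)%nat * (lam * circle a - 0) ^ k * (mu * circle b - 0) ^ (n - k)) n) N
        / (mu * circle b) ^ s) (- PI) PI =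
     sum_n (G := C_AbelianGroup) (fun n => sum_n (G := C_AbelianGroup)
      (fun k => F k (n - k)%nat * (lam * circle a) ^ k * J (n - k)%nat s) n) N).
  { intros a.
    rewrite (CInt_ext _ (fun b => sum_n (G := C_AbelianGroup) (fun n => sum_n (G := C_AbelianGroup)
      (fun k => F k (n - k)%nat * (lam * circle a) ^ k * ((mu * circle b) ^ (n - k) / (mu * circle b) ^ s)) n) N)).
    - rewrite (CInt_sum_n (fun n b => sum_n (G := C_AbelianGroup)
      (fun k => F k (n - k)%nat * (lam * circle a) ^ k * ((mu * circle b) ^ (n - k) / (mu * circle b) ^ s)) n)).
      + apply sum_n_ext; intros n.
        rewrite (CInt_sum_n (fun k b => F k (n - k)%nat * (lam * circle a) ^ k
           * ((mu * circle b) ^ (n - k) / (mu * circle b) ^ s))).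
        * apply sum_n_ext; intros k. rewrite CInt_Cmult, CInt_monomial; [reflexivity|exact hm|apply PI_bounds|].
          intros b _; cont; apply Cpow_nz, hnm.
        * apply PI_bounds.
        * intros k b _; cont; apply Cpow_nz, hnm.
      + apply PI_bounds.
      + intros n b _. apply (continuous_sum_n (T := RU) (fun k b => F k (n - k)%nat * (lam * circle a) ^ k
           * ((mu * circle b) ^ (n - k) / (mu * circle b) ^ s))). intros k; cont; apply Cpow_nz, hnm.
    - apply PI_bounds.
    - intros b _. unfold Cdiv.
      assert (hd : forall (u : nat -> C) c M, sum_n (G := C_AbelianGroup) u M * c
         = sum_n (G := C_AbelianGroup) (fun k => u k * c) M).
      { intros u c M; induction M as [|M IH]; [rewrite !sum_O; reflexivity|].
        rewrite !sum_Sn; change (@plus C_AbelianGroup) with Cplus; rewrite <- IH; ring. }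
      rewrite hd; apply sum_n_ext; intros n. rewrite hd; apply sum_n_ext; intros k.
      rewrite !Cminus_0_r. Cring. }
  rewrite (CInt_ext _ (fun a => sum_n (G := C_AbelianGroup) (fun n => sum_n (G := C_AbelianGroup)
      (fun k => F k (n - k)%nat * J (n - k)%nat s * ((lam * circle a) ^ k / (lam * circle a) ^ r)) n) N)).
  - rewrite (CInt_sum_n (fun n a => sum_n (G := C_AbelianGroup)
      (fun k => F k (n - k)%nat * J (n - k)%nat s * ((lam * circle a) ^ k / (lam * circle a) ^ r)) n)).
    + rewrite (sum_n_ext _ (fun n => sum_n (G := C_AbelianGroup)
        (fun k => F k (n - k)%nat * J (n - k)%nat s * J k r) n)).
      * rewrite (sum_n_single _ (r + s)%nat N hN).
        -- rewrite (sum_n_single _ r (r + s)); [|lia|].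
           ++ replace (r + s - r)%nat with s by lia. unfold J.
              destruct (Nat.eq_dec s s) as [_|h]; [|lia]. destruct (Nat.eq_dec r r) as [_|h]; [|lia]. ring.
           ++ intros k hk hne; unfold J. destruct (Nat.eq_dec k r); [lia|]. ring.
        -- intros n hn hne; apply sum_n_zero_C; intros k hk; unfold J.
           destruct (Nat.eq_dec k r) as [->|]; [|ring]. destruct (Nat.eq_dec (n - r) s); [lia|]. ring.
      * intros n. rewrite (CInt_sum_n (fun k a => F k (n - k)%nat * J (n - k)%nat s
           * ((lam * circle a) ^ k / (lam * circle a) ^ r))).
        -- apply sum_n_ext; intros k. rewrite CInt_Cmult, CInt_monomial; [reflexivity|exact hl|apply PI_bounds|].
           intros b _; cont; apply Cpow_nz, hnl.
        -- apply PI_bounds.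
        -- intros k b _; cont; apply Cpow_nz, hnl.
    + apply PI_bounds.
    + intros n b _. apply (continuous_sum_n (T := RU) (fun k a => F k (n - k)%nat * J (n - k)%nat s
         * ((lam * circle a) ^ k / (lam * circle a) ^ r))). intros k; cont; apply Cpow_nz, hnl.
  - apply PI_bounds.
  - intros a _. rewrite hinner. unfold Cdiv.
    assert (hd : forall (u : nat -> C) c M, sum_n (G := C_AbelianGroup) u M * c
         = sum_n (G := C_AbelianGroup) (fun k => u k * c) M).
    { intros u c M; induction M as [|M IH]; [rewrite !sum_O; reflexivity|].
      rewrite !sum_Sn; change (@plus C_AbelianGroup) with Cplus; rewrite <- IH; ring. }
    rewrite hd; apply sum_n_ext; intros n. rewrite hd; apply sum_n_ext; intros k. Cring.
Qed.

Lemma torus_int_segcont (U : C -> C -> C) (s : nat) (lam mu : C) :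
  lam <> 0 -> mu <> 0 ->
  (forall a b, jcCC U (lam * circle a, mu * circle b)) ->
  (forall a, segcont (fun b => U (lam * circle a) (mu * circle b) / (mu * circle b) ^ s) (- PI) PI) /\
  (forall a, continuous (U := CU) (fun a =>
     CInt (fun b => U (lam * circle a) (mu * circle b) / (mu * circle b) ^ s) (- PI) PI) a).
Proof.
  intros hl hm hU.
  assert (hnm : forall a, mu * circle a <> 0) by (intros a; apply Cmult_neq_0; [exact hm|apply circle_nz]).
  assert (hj : forall p, jointly_continuous (X := RU) (Y := RU) (Z := CU)
     (fun a b => U (lam * circle a) (mu * circle b) / (mu * circle b) ^ s) p).
  { intros [a b]; unfold jointly_continuous.
    apply (continuous_Cdiv (T := prod_UniformSpace RU RU)); [|cont|apply Cpow_nz, hnm].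
    apply (continuous_uncurry (T := prod_UniformSpace RU RU) (U := CU) (V := CU) (W := CU) U
      (fun q => lam * circle (fst q)) (fun q => mu * circle (snd q))); [cont|cont|apply hU]. }
  split.
  - intros a b _; apply (continuous_section (X := RU) (Y := RU) (Z := CU)
      (fun a b => U (lam * circle a) (mu * circle b) / (mu * circle b) ^ s)), hj.
  - intros a; apply (continuous_CInt_param (X := RU)
      (fun a b => U (lam * circle a) (mu * circle b) / (mu * circle b) ^ s)); [apply PI_bounds|].
    intros b _; apply filter_forall; intros p; apply hj.
Qed.

(** On a small torus the Taylor polynomials converge uniformly, and each of them has the exact
    coefficient once its degree reaches [r + s]; so both sides differ by an arbitrarily small
    amount. *)
Lemma coefficient_torus (F : nat -> nat -> C) (U : C -> C -> C) :
  is_pseries2_near F U 0 0 ->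
  exists t0, (0 < t0)%R /\ forall (r s : nat) (lam mu : C), lam <> 0 -> mu <> 0 ->
    (Cmod lam <= t0)%R -> (Cmod mu <= t0)%R ->
    (forall a b, jcCC U (lam * circle a, mu * circle b)) ->
    torus_int U r s lam mu = RtoC (2 * PI) * RtoC (2 * PI) * F r s.
Proof.
  intros hF; destruct (pseries2_approx F U 0 0 hF) as [t0 [ht0 happ]].
  exists t0; split; [exact ht0|]; intros r s lam mu hl hm hlt hmt hU.
  assert (hml : (0 < Cmod lam)%R) by (apply Cmod_gt_0, hl).
  assert (hmm : (0 < Cmod mu)%R) by (apply Cmod_gt_0, hm).
  apply Ceq_minus.
  apply (Cmod_small_zero _ ((PI - - PI) * ((PI - - PI) * / Cmod mu ^ s * / Cmod lam ^ r))%R).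
  intros e he; destruct (happ e he) as [N0 hN0].
  set (N := (N0 + r + s)%nat).
  rewrite <- (torus_int_poly2 F N r s lam mu hl hm ltac:(unfold N; lia)).
  destruct (torus_int_segcont U s lam mu hl hm hU) as [c1 c2].
  destruct (torus_int_segcont (poly2 F 0 0 N) s lam mu hl hm (fun a b => jc_poly2 F 0 0 N _)) as [c3 c4].
  assert (hnl : forall a, lam * circle a <> 0) by (intros a; apply Cmult_neq_0; [exact hl|apply circle_nz]).
  assert (hnm : forall a, mu * circle a <> 0) by (intros a; apply Cmult_neq_0; [exact hm|apply circle_nz]).
  assert (hmc : forall c a, Cmod (c * circle a) = Cmod c) by (intros c a; rewrite Cmod_mult, Cmod_circle; ring).
  unfold torus_int.
  assert (hs1 : forall V : R -> C, (forall a, continuous (U := CU) V a) ->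
     segcont (fun a => V a / (lam * circle a) ^ r) (- PI) PI).
  { intros V hV a _; pose proof (hV a); cont; apply Cpow_nz, hnl. }
  rewrite <- CInt_minus; [|apply PI_bounds|apply hs1, c2|apply hs1, c4].
  replace ((PI - - PI) * ((PI - - PI) * / Cmod mu ^ s * / Cmod lam ^ r) * e)%R
    with ((PI - - PI) * ((PI - - PI) * (e * / Cmod mu ^ s) * / Cmod lam ^ r))%R by ring.
  apply Cmod_CInt_le; [apply PI_bounds| |].
  - intros a ha; apply continuous_Cminus; [apply (hs1 _ c2 a ha)|apply (hs1 _ c4 a ha)].
  - intros a _. set (I1 := CInt _ _ _). set (I2 := CInt _ _ _).
    replace (I1 / (lam * circle a) ^ r - I2 / (lam * circle a) ^ r)
      with ((I1 - I2) / (lam * circle a) ^ r) by (field; apply Cpow_nz, hnl).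
    rewrite Cmod_div by (apply Cpow_nz, hnl). rewrite Cmod_pow, hmc.
    apply Rmult_le_compat_r; [left; apply Rinv_0_lt_compat, pow_lt, hml|].
    unfold I1, I2; rewrite <- CInt_minus; [|apply PI_bounds|apply c1|apply c3].
    apply Cmod_CInt_le; [apply PI_bounds| |].
    + intros b hb; apply continuous_Cminus; [apply (c1 a b hb)|apply (c3 a b hb)].
    + intros b _.
      set (V1 := U _ _). set (V2 := poly2 _ _ _ _ _ _).
      replace (V1 / (mu * circle b) ^ s - V2 / (mu * circle b) ^ s)
        with ((V1 - V2) / (mu * circle b) ^ s) by (field; apply Cpow_nz, hnm).
      rewrite Cmod_div by (apply Cpow_nz, hnm). rewrite Cmod_pow, hmc.
      apply Rmult_le_compat_r; [left; apply Rinv_0_lt_compat, pow_lt, hmm|].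
      apply hN0; [unfold N; lia| |]; rewrite Cminus_0_r, hmc; assumption.
Qed.

(** * The contribution of a simple pole *)

Lemma circ_const_real (V : C -> C) (a b : R) :
  (0 < a)%R -> (a <= b)%R ->
  (forall w, (Cmod w <= b)%R -> w <> 0 -> hol V w) ->
  circ V (RtoC b) = circ V (RtoC a).
Proof.
  intros ha hab hV.
  rewrite <- (Cmult_1_r (RtoC b)), <- (Cmult_1_r (RtoC a)).
  apply circ_const; [apply C1_nz|exact ha|exact hab|].
  intros t ht al; rewrite Cmult_1_r; apply hV.
  - rewrite Cmod_scaled_circle; lra.
  - apply Cmult_neq_0; [apply RtoC_nz; lra|apply circle_nz].
Qed.

(** Hadamard's form of [(f w - f g0) / (w - g0)] as a mean of [f'], which makes it holomorphic at
    [g0] too. *)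
Lemma difference_quotient (f : C -> C) (g0 : C) (T : R) :
  (Cmod g0 <= T)%R -> (forall w, (Cmod w <= T)%R -> hol f w) ->
  exists k : C -> C, k g0 = C_derive f g0 /\
    forall w, (Cmod w <= T)%R -> hol k w /\ f w = f g0 + (w - g0) * k w.
Proof.
  intros hg hf.
  assert (hseg : forall w t, (Cmod w <= T)%R -> (0 <= t <= 1)%R -> hol f (g0 + RtoC t * (w - g0))).
  { intros w t hw ht; apply hf.
    pose proof (Cball_convex 0 g0 w T t ht) as h; rewrite !Cminus_0_r in h; apply h; assumption. }
  exists (fun w => CInt (fun t => C_derive f (g0 + RtoC t * (w - g0))) 0 1); split.
  - rewrite (CInt_ext _ (fun _ => C_derive f g0)); [rewrite CInt_const, RtoC_minus; ring|lra|].
    intros t _; f_equal; ring.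
  - intros w hw; split.
    + apply (hol_CInt (fun w t => C_derive f (g0 + RtoC t * (w - g0)))); [lra|]; intros t ht.
      assert (hm : forall p, jcCR (fun w t => g0 + RtoC t * (w - g0)) p)
        by (intros p; unfold jointly_continuous; cont).
      generalize (locally_continuous_comp (X := prod_UniformSpace CU RU) (Y := CU)
        (fun p => g0 + RtoC (snd p) * (fst p - g0)) (w, t) _ (hm _)
        (hol_locally _ _ (hseg w t hw ht))).
      apply filter_imp; intros p hp; split.
      * apply (jc_comp (C_derive f) (fun w t => g0 + RtoC t * (w - g0))); [apply hm|].
        apply hol_continuous_derive, hp.
      * apply (hol_comp (fun w => g0 + RtoC (snd p) * (w - g0)) (C_derive f)).
        -- apply hol_plus; [apply hol_const|]. apply hol_mult; [apply hol_const|].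
           apply hol_minus; [apply hol_id|apply hol_const].
        -- apply hol_derive, hp.
    + rewrite Cmult_comm, <- (cder_increment f (C_derive f) g0 w); [ring|].
      intros t ht; split; [apply hol_cder, hseg; assumption|apply hol_continuous_derive, hseg; assumption].
Qed.

(** The circle does not enclose [g0], so only the singularity at 0 counts. Induction on [s] by the
    partial fraction [1 / ((w - g0) w) = (1 / (w - g0) - 1 / w) / g0], starting from Cauchy's
    formula at 0. *)
Lemma CInt_simple_pole (g0 : C) (t : R) (s : nat) : (0 < t < Cmod g0)%R ->
  circ (fun w => / (w - g0) / w ^ s) (RtoC t) = - RtoC (2 * PI) / g0 ^ (s + 1).
Proof.
  intros ht. assert (hg : g0 <> 0) by (apply Cmod_gt_0; lra).
  assert (hnz : forall a, RtoC t * circle a <> 0).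
  { intros a; apply Cmult_neq_0; [apply RtoC_nz; lra|apply circle_nz]. }
  assert (hng : forall w, (Cmod w <= t)%R -> w - g0 <> 0).
  { intros w hw h; apply (proj2 (Ceq_minus _ _)) in h; subst w; lra. }
  assert (hng' : forall a, RtoC t * circle a - g0 <> 0).
  { intros a; apply hng; rewrite Cmod_scaled_circle; lra. }
  unfold circ; induction s as [|s IH].
  - assert (hc := cauchy_formula (fun w => / (w - g0)) 0 0 t).
    rewrite (CInt_ext _ (fun a => / (0 + RtoC t * circle a - g0) * (RtoC t * circle a)
       / (0 + RtoC t * circle a - 0) ^ 1)).
    + etransitivity; [apply hc|].
      * intros y hy; rewrite Cminus_0_r in hy. apply (hol_inv (fun w => w - g0)); [|apply hng, hy].
        apply hol_minus; [apply hol_id|apply hol_const].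
      * rewrite Cminus_0_r, Cmod_0; lra.
      * simpl.
        field; auto.
    + apply PI_bounds.
    + intros a _. rewrite Cplus_0_l, Cminus_0_r. pose proof (hnz a); pose proof (hng' a).
      set (w := RtoC t * circle a) in *; clearbody w; simpl; field; auto.
  - rewrite (CInt_ext _ (fun a => / g0 * (/ (RtoC t * circle a - g0) / (RtoC t * circle a) ^ s
       - / (RtoC t * circle a) ^ (s + 1)))).
    + assert (c1 : segcont (fun a => / (RtoC t * circle a - g0) / (RtoC t * circle a) ^ s) (- PI) PI).
      { intros a _; cont; [apply hng'|apply Cpow_nz, hnz]. }
      assert (c2 : segcont (fun a => / (RtoC t * circle a) ^ (s + 1)) (- PI) PI).
      { intros a _; cont. apply Cpow_nz, hnz. }
      rewrite CInt_Cmult, CInt_minus, IH, CInt_inv_pow_circle;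
        [|apply RtoC_nz; lra|lia|apply PI_bounds|exact c1|exact c2|apply PI_bounds|].
      * replace (S s + 1)%nat with (S (s + 1)) by lia. rewrite Cpow_S.
        pose proof (Cpow_nz g0 (s + 1) hg). field; auto.
      * intros a ha; apply continuous_Cminus; [apply c1, ha|apply c2, ha].
    + apply PI_bounds.
    + intros a _. replace (s + 1)%nat with (S s) by lia. rewrite !Cpow_S.
      pose proof (Cpow_nz _ s (hnz a)). pose proof (hnz a). pose proof (hng' a).
      set (w := RtoC t * circle a) in *; clearbody w; field; auto.
Qed.

(** With [k] the difference quotient of [h], the quotient [q / h] is [(q / k) / (w - g0)], that is,
    a simple pole plus a function [P] holomorphic on the whole disc of radius [T]. The pole is
    integrated explicitly over the inner circle, while [P] is moved to the outer one, where [w^-s]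
    is small compared with [g0^-s]. *)
Lemma near_coefficient (q h : C -> C) (g0 : C) (t T : R) (s : nat) :
  (0 < t < Cmod g0)%R -> (Cmod g0 < T)%R ->
  (forall w, (Cmod w <= T)%R -> hol q w /\ hol h w) ->
  h g0 = 0 -> C_derive h g0 <> 0 -> (forall w, (Cmod w <= T)%R -> h w = 0 -> w = g0) ->
  circ (fun w => q w / h w / w ^ s) (RtoC t) =
    RtoC (2 * PI) * (- q g0 / (g0 * C_derive h g0) / g0 ^ s)
    + circ (fun w => (q w / h w - q g0 / C_derive h g0 / (w - g0)) / w ^ s) (RtoC T).
Proof.
  intros ht hT hqh h0 hd hz. assert (hg : g0 <> 0) by (apply Cmod_gt_0; lra).
  destruct (difference_quotient h g0 T ltac:(lra) (fun w hw => proj2 (hqh w hw))) as [k [hk hks]].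
  assert (hkn : forall w, (Cmod w <= T)%R -> k w <> 0).
  { intros w hw he; destruct (Ceq_dec w g0) as [->|hne]; [rewrite hk in he; tauto|].
    apply hne, hz; [exact hw|]. rewrite (proj2 (hks w hw)), h0, he; ring. }
  destruct (difference_quotient (fun w => q w / k w) g0 T ltac:(lra)) as [P [_ hP]].
  { intros w hw; apply hol_div; [apply hqh, hw|apply hks, hw|apply hkn, hw]. }
  assert (hdec : forall w, (Cmod w <= T)%R -> w <> g0 ->
     q w / h w = q g0 / C_derive h g0 / (w - g0) + P w).
  { intros w hw hne. assert (hn : w - g0 <> 0) by (apply Cminus_eq_contra, hne).
    destruct (hP w hw) as [_ hPw].
    rewrite (proj2 (hks w hw)), h0, Cplus_0_l.
    replace (q w / ((w - g0) * k w)) with (q w / k w / (w - g0)) by (field; auto).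
    rewrite hPw, hk. field; auto. }
  assert (hnz : forall u a, (0 < u)%R -> RtoC u * circle a <> 0).
  { intros u a hu; apply Cmult_neq_0; [apply RtoC_nz; lra|apply circle_nz]. }
  assert (hmod : forall u a, (0 < u)%R -> Cmod (RtoC u * circle a) = u)
    by (intros u a hu; apply Cmod_scaled_circle; lra).
  assert (hng : forall u a, (0 < u)%R -> u <> Cmod g0 -> RtoC u * circle a <> g0).
  { intros u a hu hne he; apply hne. rewrite <- he, hmod; [reflexivity|exact hu]. }
  assert (hPs : forall w, (Cmod w <= T)%R -> w <> 0 -> hol (fun w => P w / w ^ s) w).
  { intros w hw hw0; apply hol_div; [apply hP, hw|apply hol_pow, hol_id|apply Cpow_nz, hw0]. }
  assert (hT2 : circ (fun w => (q w / h w - q g0 / C_derive h g0 / (w - g0)) / w ^ s) (RtoC T)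
     = circ (fun w => P w / w ^ s) (RtoC T)).
  { apply CInt_ext; [apply PI_bounds|]; intros a _. f_equal.
    rewrite hdec; [ring|rewrite hmod; lra|apply hng; lra]. }
  rewrite hT2, (circ_const_real _ t T) by (lra || exact hPs).
  replace (RtoC (2 * PI) * (- q g0 / (g0 * C_derive h g0) / g0 ^ s))
    with (q g0 / C_derive h g0 * (- RtoC (2 * PI) / g0 ^ (s + 1))).
  2:{ replace (s + 1)%nat with (S s) by lia; rewrite Cpow_S. pose proof (Cpow_nz g0 s hg). field; auto. }
  rewrite <- (CInt_simple_pole g0 t s ht). unfold circ.
  assert (c1 : segcont (fun a => / (RtoC t * circle a - g0) / (RtoC t * circle a) ^ s) (- PI) PI).
  { intros a _; cont; [apply Cminus_eq_contra, hng; lra|apply Cpow_nz, hnz; lra]. }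
  assert (c2 : segcont (fun a => P (RtoC t * circle a) / (RtoC t * circle a) ^ s) (- PI) PI).
  { intros a _. apply (continuous_comp (V := CU) (fun a => RtoC t * circle a) (fun w => P w / w ^ s)); [cont|].
    apply hol_continuous, hPs; [rewrite hmod; lra|apply hnz; lra]. }
  rewrite <- CInt_Cmult, <- CInt_plus; [|apply PI_bounds| |exact c2|apply PI_bounds|exact c1].
  - apply CInt_ext; [apply PI_bounds|]; intros a _.
    rewrite (hdec (RtoC t * circle a)); [|rewrite hmod; lra|apply hng; lra].
    assert (RtoC t * circle a - g0 <> 0) by (apply Cminus_eq_contra, hng; lra).
    pose proof (Cpow_nz _ s (hnz t a (proj1 ht))).
    set (w := RtoC t * circle a) in *; clearbody w; field; auto.
  - intros a ha; apply continuous_Cmult; [cont|apply c1, ha].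
Qed.

Lemma Cmod_circ_le (V : C -> C) (T M : R) (s : nat) : (0 < T)%R ->
  (forall a, continuous (U := CU) (fun a => V (RtoC T * circle a)) a) ->
  (forall a, (- PI <= a <= PI)%R -> (Cmod (V (RtoC T * circle a)%C) <= M)%R) ->
  (Cmod (circ (fun w => V w / w ^ s)%C (RtoC T)) <= (PI - - PI) * (M * / T ^ s))%R.
Proof.
  intros hT hc hM.
  assert (hnz : forall a, RtoC T * circle a <> 0).
  { intros a; apply Cmult_neq_0; [apply RtoC_nz; lra|apply circle_nz]. }
  apply Cmod_CInt_le; [apply PI_bounds| |].
  - intros a _; pose proof (hc a); cont; apply Cpow_nz, hnz.
  - intros a ha; rewrite Cmod_div by (apply Cpow_nz, hnz). rewrite Cmod_pow, Cmod_scaled_circle by lra.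
    apply Rmult_le_compat_r; [left; apply Rinv_0_lt_compat, pow_lt, hT|]. apply hM, ha.
Qed.

(** The device of [bounded_param] with two compact variables: [mu |F| < 1] is extended from
    [mu = 0]. *)
Lemma bounded_param2 {X : UniformSpace} (F : X -> R -> R -> C) (x0 : X) (a b a' b' : R) :
  (forall t u, (a <= t <= b)%R -> (a' <= u <= b')%R ->
     continuous (T := prod_UniformSpace (prod_UniformSpace X RU) RU) (U := CU)
       (fun q => F (fst (fst q)) (snd (fst q)) (snd q)) ((x0, t), u)) ->
  exists M : R, (0 < M)%R /\
    locally x0 (fun x => forall t, (a <= t <= b)%R -> forall u, (a' <= u <= b')%R ->
      (Cmod (F x t u) <= M)%R).
Proof.
  intros h.
  pose (Y := prod_UniformSpace (prod_UniformSpace (prod_UniformSpace X RU) RU) RU).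
  assert (hl : locally (T := prod_UniformSpace X RU) (x0, 0%R) (fun p => forall t, (a <= t <= b)%R ->
     forall u, (a' <= u <= b')%R -> (snd p * Cmod (F (fst p) t u) < 1)%R)).
  { apply (locally_forall_segment (X := prod_UniformSpace X RU) (x0, 0%R) a b (fun p t =>
     forall u, (a' <= u <= b')%R -> (snd p * Cmod (F (fst p) t u) < 1)%R)); intros t ht.
    apply (locally_forall_segment (X := prod_UniformSpace (prod_UniformSpace X RU) RU) ((x0, 0%R), t) a' b'
      (fun p u => (snd (fst p) * Cmod (F (fst (fst p)) (snd p) u) < 1)%R)); intros u hu.
    apply (locally_lt_continuous (T := Y)
      (fun q => (snd (fst (fst q)) * Cmod (F (fst (fst (fst q))) (snd (fst q)) (snd q)))%R) (fun _ => 1%R)).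
    - apply continuous_Rmult; [unfold Y; cont|]. apply continuous_Cmod.
      apply (continuous_comp (U := Y) (V := prod_UniformSpace (prod_UniformSpace X RU) RU) (W := CU)
        (fun q => ((fst (fst (fst q)), snd (fst q)), snd q))
        (fun q => F (fst (fst q)) (snd (fst q)) (snd q))); [|apply (h t u ht hu)].
      apply (continuous_pair (T := Y) (U := prod_UniformSpace X RU) (V := RU)); [|unfold Y; cont].
      apply (continuous_pair (T := Y) (U := X) (V := RU)); unfold Y; cont.
    - cont.
    - simpl; lra. }
  apply (locally_prod_ball (X := X) (Y := RU)) in hl; destruct hl as [d hd].
  pose proof (cond_pos d) as hp.
  exists (2 / d)%R; split; [apply Rdiv_lt_0_compat; lra|].
  exists d; intros x hx t ht u hu.
  assert (hb : ball (M := RU) 0%R d (d / 2)%R).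
  { change (Rabs (d / 2 - 0) < d)%R; rewrite Rabs_right; lra. }
  specialize (hd x (d / 2)%R hx hb t ht u hu); simpl in hd.
  apply Rmult_le_reg_l with (d / 2)%R; [lra|].
  replace (d / 2 * (2 / d))%R with 1%R by (field; lra); lra.
Qed.

(** Along the graph of [g] the derivative is a Cauchy integral over a circle of fixed radius about
    the moving centre [g z]. *)
Lemma hol_Dw_curve (H : C -> C -> C) (rho1 rho2 : R) (g : C -> C) (x : C) :
  (forall z w, polydisk rho1 rho2 z w -> analytic2_at H z w) ->
  hol g x -> polydisk rho1 rho2 x (g x) -> hol (fun z => Dw H z (g z)) x.
Proof.
  intros hH hg [hp1 hp2].
  pose (t := ((rho2 - Cmod (g x)) / 2)%R). assert (ht : (0 < t)%R) by (unfold t; lra).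
  assert (hin : locally (T := CU) x (fun z => hol g z /\ (Cmod z < rho1)%R /\ (Cmod (g z) + t < rho2)%R)).
  { apply filter_and; [apply hol_locally, hg|]. apply filter_and.
    - apply (locally_lt_continuous (T := CU) (fun z => Cmod z) (fun _ => rho1)); [|cont|exact hp1].
      apply (continuous_Cmod (T := CU) (fun z => z)); cont.
    - apply (locally_lt_continuous (T := CU) (fun z => (Cmod (g z) + t)%R) (fun _ => rho2)); [|cont|unfold t; lra].
      apply (continuous_Rplus (T := CU)); [|cont]. apply (continuous_Cmod (T := CU)), hol_continuous, hg. }
  assert (hpt : forall z w, (Cmod z < rho1)%R -> (Cmod (g z) + t < rho2)%R -> (Cmod (w - g z) <= t)%R ->
     polydisk rho1 rho2 z w).
  { intros z w h1 h2 h3; split; [exact h1|].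
    replace w with ((w - g z) + g z) by ring. eapply Rle_lt_trans; [apply Cmod_triangle|lra]. }
  apply hol_ext_loc with (fun z => / RtoC (2 * PI) *
    CInt (fun a => H z (g z + RtoC t * circle a) * (RtoC t * circle a) / (g z + RtoC t * circle a - g z) ^ 2)
      (- PI) PI).
  - generalize hin; apply filter_imp; intros z [_ [h1 h2]]. unfold Dw.
    rewrite (cauchy_rep_derive (fun y => H z y) (g z) (g z) t).
    + reflexivity.
    + intros y hy. apply (analytic2_hol H (fun _ => z) (fun y => y) y);
        [apply hH, hpt; assumption|apply hol_const|apply hol_id].
    + replace (g z - g z) with (RtoC 0) by ring; rewrite Cmod_0; exact ht.
  - apply hol_mult; [apply hol_const|].
    apply (hol_CInt (fun z a => H z (g z + RtoC t * circle a) * (RtoC t * circle a)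
       / (g z + RtoC t * circle a - g z) ^ 2)); [apply PI_bounds|].
    intros a _. generalize (locally_fst (X := CU) (Y := RU) _ (x, a) hin); apply filter_imp.
    intros [z b] [h1 [h2 h3]]; cbn [fst snd] in *.
    assert (hbn : forall z b, g z + RtoC t * circle b - g z <> 0).
    { intros z' b'. replace (g z' + RtoC t * circle b' - g z') with (RtoC t * circle b') by ring.
      apply Cmult_neq_0; [apply RtoC_nz; lra|apply circle_nz]. }
    assert (hpd : polydisk rho1 rho2 z (g z + RtoC t * circle b)).
    { apply hpt; try assumption. rewrite Cmod_boundary_point; lra. }
    split.
    + unfold jointly_continuous. pose proof (hol_continuous _ _ h1) as hgc.
      assert (hgc2 : continuous (T := prod_UniformSpace CU RU) (U := CU) (fun q => g (fst q)) (z, b)).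
      { apply (continuous_comp (U := prod_UniformSpace CU RU) (V := CU) (W := CU) (fun q => fst q) g);
          [cont|exact hgc]. }
      apply (continuous_Cdiv (T := prod_UniformSpace CU RU)); [|cont|apply Cpow_nz, hbn].
      apply continuous_Cmult; [|cont].
      apply (continuous_uncurry (T := prod_UniformSpace CU RU) (U := CU) (V := CU) (W := CU) H
        (fun q => fst q) (fun q => g (fst q) + RtoC t * circle (snd q))); [cont|cont|].
      apply analytic2_continuous, hH, hpd.
    + assert (hgt : hol (fun z => g z + RtoC t * circle b) z)
        by (apply hol_plus; [exact h1|apply hol_const]).
      apply hol_div; [|apply hol_pow, hol_minus; assumption|apply Cpow_nz, hbn].
      apply hol_mult; [|apply hol_const].
      apply (analytic2_hol H (fun z => z) (fun z => g z + RtoC t * circle b));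
        [apply hH, hpd|apply hol_id|exact hgt].
Qed.

(** The amplitude before rotation: [amplitude G H g z th] is this function at [z e^(i th)]. *)
Definition residue (G H : C -> C -> C) (g : C -> C) (z : C) : C :=
  - G z (g z) / (g z * Dw H z (g z)).

Lemma near_facts (rho1 rho2 : R) (G H : C -> C -> C) (g : C -> C) (zc wc : C) :
  (forall z w, polydisk rho1 rho2 z w -> analytic2_at G z w) ->
  (forall z w, polydisk rho1 rho2 z w -> analytic2_at H z w) ->
  polydisk rho1 rho2 zc wc -> wc <> 0 -> Dw H zc wc <> 0 -> hol g zc -> g zc = wc ->
  locally (T := CC) (zc, wc) (fun x => H (fst x) (snd x) = 0 <-> snd x = g (fst x)) ->
  locally (T := CU) zc (fun z => (hol g z /\ g z <> 0 /\ Dw H z (g z) <> 0 /\ H z (g z) = 0) /\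
    polydisk rho1 rho2 z (g z) /\ hol (residue G H g) z).
Proof.
  intros hG hH [hp1 hp2] hw hd hg hgc hz.
  pose proof (hol_continuous _ _ hg) as hgcont.
  assert (hdw : hol (fun z => Dw H z (g z)) zc).
  { apply hol_Dw_curve with rho1 rho2; [exact hH|exact hg|rewrite hgc; split; assumption]. }
  assert (h1 : locally (T := CU) zc (fun z => g z <> 0))
    by (apply (locally_neq_0 (T := CU)); [exact hgcont|rewrite hgc; exact hw]).
  assert (h2 : locally (T := CU) zc (fun z => Dw H z (g z) <> 0))
    by (apply (locally_neq_0 (T := CU)); [apply hol_continuous, hdw|rewrite hgc; exact hd]).
  assert (h3 : locally (T := CU) zc (fun z => H z (g z) = 0)).
  { assert (hm : continuous (T := CU) (U := CC) (fun z => (z, g z)) zc)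
      by (apply (continuous_pair (T := CU) (U := CU) (V := CU)); [cont|exact hgcont]).
    rewrite <- hgc in hz.
    generalize (locally_continuous_comp (X := CU) (Y := CC) _ zc _ hm hz).
    apply filter_imp; intros z [_ q]; apply q; reflexivity. }
  assert (h4 : locally (T := CU) zc (fun z => polydisk rho1 rho2 z (g z))).
  { apply filter_and.
    - apply (locally_lt_continuous (T := CU) (fun z => Cmod z) (fun _ => rho1)); [|cont|exact hp1].
      apply (continuous_Cmod (T := CU) (fun z => z)); cont.
    - apply (locally_lt_continuous (T := CU) (fun z => Cmod (g z)) (fun _ => rho2));
        [|cont|rewrite hgc; exact hp2]. apply (continuous_Cmod (T := CU)), hgcont. }
  generalize (filter_and _ _ (filter_and _ _ (hol_locally _ _ hg) h1)
    (filter_and _ _ (filter_and _ _ h2 h3) (filter_and _ _ h4 (hol_locally _ _ hdw)))).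
  apply filter_imp; intros z [[a b] [[c d] [e f]]].
  split; [tauto|split; [exact e|]].
  unfold residue; apply hol_div.
  - apply hol_opp. apply (analytic2_hol G (fun z => z) g); [apply hG, e|apply hol_id|exact a].
  - apply hol_mult; assumption.
  - apply Cmult_neq_0; assumption.
Qed.

(** * Reduction of a coefficient to an integral over a short arc *)

Lemma circle_minus_1 (t eps : R) : (0 < eps)%R -> (eps <= Rabs t <= PI)%R ->
  (sqrt (2 - 2 * cos eps) <= Cmod (circle t - 1))%R.
Proof.
  intros he ht. unfold Cmod. apply sqrt_le_1_alt.
  assert (hc : (cos t <= cos eps)%R).
  { destruct (Rle_lt_dec 0 t) as [h|h].
    - rewrite Rabs_right in ht by lra. apply cos_decr_1; lra.
    - rewrite Rabs_left in ht by lra. rewrite <- (cos_neg t). apply cos_decr_1; lra. }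
  unfold circle, Cexp; Creduce.
  replace (0 * t - 1 * 0)%R with 0%R by ring. replace (0 * 0 + 1 * t)%R with t by ring.
  rewrite exp_0. pose proof (sin2_cos2 t) as h; unfold Rsqr in h. nra.
Qed.

Lemma CInt_split3 (f : R -> C) (a b c d : R) :
  (a <= b)%R -> (b <= c)%R -> (c <= d)%R -> segcont f a d ->
  CInt f a d = CInt f b c + (CInt f a b + CInt f c d).
Proof.
  intros h1 h2 h3 hf.
  rewrite (CInt_Chasles f a c d); [|lra|lra|exact hf].
  rewrite (CInt_Chasles f a b c); [ring|lra|lra|]. intros t ht; apply hf; lra.
Qed.

Lemma ratio_pow_le (a b : R) (s : nat) : (0 < a)%R -> (0 < b)%R ->
  forall x, (0 <= x <= a)%R -> (x ^ s * / b ^ s <= exp (- (INR s * ln (b / a))))%R.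
Proof.
  intros ha hb x hx.
  assert (hba : (0 < b / a)%R) by (apply Rdiv_lt_0_compat; assumption).
  rewrite exp_Ropp, exp_INR_mult, exp_ln by exact hba.
  replace (/ (b / a) ^ s)%R with (a ^ s * / b ^ s)%R.
  - apply Rmult_le_compat_r; [left; apply Rinv_0_lt_compat, pow_lt, hb|apply pow_incr; lra].
  - unfold Rdiv; rewrite Rpow_mult_distr, pow_inv. pose proof (pow_lt a s ha); pose proof (pow_lt b s hb).
    field; lra.
Qed.

(** The [w]-integral is a holomorphic function [Phi s] of [z] on a disc larger than the critical
    one, so the [z]-circle may pass through [zeta]. For angles below [eps] the [w]-circle is
    enlarged across the pole [g z]; for the other angles no zero of [H] is met up to a radius beyond
    [|wc|]. In both cases the rest is of size [(|omega| / T)^s] with [T > |omega|]. [eps] precedes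
    the other constants because the zero-free radius on the far arc depends on it. *)
Lemma coefficient_integral (rho1 rho2 : R) (G H : C -> C -> C) (F : nat -> nat -> C) (g : C -> C) (zc wc : C) :
  (forall z w, polydisk rho1 rho2 z w -> analytic2_at G z w) ->
  (forall z w, polydisk rho1 rho2 z w -> analytic2_at H z w) ->
  is_pseries2_near F (fun z w => G z w / H z w) 0 0 ->
  polydisk rho1 rho2 zc wc -> zc <> 0 -> wc <> 0 ->
  (forall z w, (Cmod z <= Cmod zc)%R -> (Cmod w <= Cmod wc)%R -> H z w = 0 -> z = zc /\ w = wc) ->
  Dw H zc wc <> 0 -> hol g zc -> g zc = wc ->
  locally (T := CC) (zc, wc) (fun x => H (fst x) (snd x) = 0 <-> snd x = g (fst x)) ->
  exists e1, (0 < e1)%R /\ forall eps, (0 < eps < e1)%R ->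
  exists dl M C0, (0 < dl)%R /\ (0 < C0)%R /\
  forall zeta omega : C, (Cmod (zeta - zc) < dl)%R -> (Cmod (omega - wc) < dl)%R -> forall r s : nat,
    (Cmod (RtoC (2 * PI) * F r s * zeta ^ r * omega ^ s
      - CInt (fun a => residue G H g (zeta * circle a) * (omega / g (zeta * circle a)) ^ s / circle a ^ r)%C
          (- eps) eps) <= M * exp (- (INR s * C0)))%R.
Proof.
  intros hG hH hF hp hzc hwc hmin hcw hg hgc hgz.
  pose proof (proj1 (Cmod_gt_0 _) hzc) as hmz. pose proof (proj1 (Cmod_gt_0 _) hwc) as hmw.
  pose proof PI_RGT_0 as hpi.
  assert (hGc : forall z w, polydisk rho1 rho2 z w -> jcCC G (z, w))
    by (intros; apply analytic2_continuous; auto).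
  assert (hHc : forall z w, polydisk rho1 rho2 z w -> jcCC H (z, w))
    by (intros; apply analytic2_continuous; auto).
  destruct (locally_prod_ball (X := CU) (Y := CU) _ _ _ hgz) as [d0 hd0].
  pose proof (cond_pos d0) as hd0p.
  (* Within [d0] the zeros of [H] are the points of the graph of [g]; within [|wc| / 2] of [wc] they
     stay away from the small [w]-circle that extracts the coefficient. *)
  destruct (zero_localization H rho1 rho2 (Rmin d0 (Cmod wc / 2)) zc wc hHc hp
    ltac:(apply Rmin_glb_lt; lra) hmin) as [n1 [hn1 [hn1a [hn1b hzero1]]]].
  pose proof (Rmin_l d0 (Cmod wc / 2)) as hmn1. pose proof (Rmin_r d0 (Cmod wc / 2)) as hmn2.
  pose (T1 := (Cmod wc + n1)%R). assert (hT1 : (0 < T1)%R) by (unfold T1; lra).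
  assert (hCabs : forall x y : C, (Cmod x <= Cmod y + Cmod (x - y))%R).
  { intros x y; replace x with (y + (x - y)) at 1 by ring; apply Cmod_triangle. }
  assert (hCabs' : forall x y : C, (Cmod y <= Cmod x + Cmod (x - y))%R).
  { intros x y; replace y with (x + - (x - y)) at 1 by ring.
    eapply Rle_trans; [apply Cmod_triangle|]. rewrite Cmod_opp; lra. }
  pose proof (hol_continuous _ _ hg) as hgcont.
  (* This tolerance keeps [|g z|] strictly between the radii [t] and [T1] of the two [w]-circles. *)
  pose (dg := Rmin (n1 / 2) (Cmod wc / 2)).
  assert (hdg : (0 < dg /\ dg <= n1 / 2 /\ dg <= Cmod wc / 2)%R).
  { unfold dg; pose proof (Rmin_l (n1 / 2) (Cmod wc / 2)); pose proof (Rmin_r (n1 / 2) (Cmod wc / 2)).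
    pose proof (Rmin_glb_lt (n1 / 2) (Cmod wc / 2) 0 ltac:(lra) ltac:(lra)); lra. }
  pose proof (continuous_locally_C (T := CU) g zc dg hgcont (proj1 hdg)) as hgl. rewrite hgc in hgl.
  (* What is left of [G / H] on the circle of radius [T1] after removal of the pole at [g z]. *)
  pose (W1 := fun z a => G z (RtoC T1 * circle a) / H z (RtoC T1 * circle a)
     - G z (g z) / Dw H z (g z) / (RtoC T1 * circle a - g z)).
  pose proof (near_facts rho1 rho2 G H g zc wc hG hH hp hwc hcw hg hgc hgz) as hnf.
  assert (hH1 : forall z w, (Cmod z <= Cmod zc + n1)%R -> (Cmod w <= T1)%R ->
     (Cmod (w - wc) < Cmod wc / 2)%R \/ H z w <> 0).
  { intros z w hz hw; destruct (classic (H z w = 0)) as [h|h]; [left|right; exact h].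
    destruct (hzero1 z w hz hw h); lra. }
  (* A zero on the circle of radius [T1] would lie on the graph of [g], whereas [|g z| < T1]. *)
  assert (hH1T : forall z a, (Cmod z <= Cmod zc + n1)%R -> (Cmod (g z - wc) < dg)%R ->
     H z (RtoC T1 * circle a) = 0 -> (Cmod (z - zc) < d0)%R -> False).
  { intros z a hz hgz' h hzd.
    destruct (hzero1 z (RtoC T1 * circle a) hz) as [q1 q2]; [rewrite Cmod_scaled_circle; unfold T1 in *; lra|exact h|].
    assert (hb1 : ball (M := CU) zc d0 z) by (apply ball_C_Cmod; lra).
    assert (hb2 : ball (M := CU) wc d0 (RtoC T1 * circle a)) by (apply ball_C_Cmod; lra).
    pose proof (proj1 (hd0 z (RtoC T1 * circle a) hb1 hb2) h) as he; simpl in he.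
    pose proof (hCabs (g z) wc) as hc. rewrite <- he in hc at 1. rewrite Cmod_scaled_circle in hc by lra.
    unfold T1 in hc; lra. }
  assert (hzz : (Cmod (zc - zc) < d0)%R) by (replace (zc - zc) with (RtoC 0) by ring; rewrite Cmod_0; lra).
  assert (hwz : (Cmod (g zc - wc) < dg)%R)
    by (rewrite hgc; replace (wc - wc) with (RtoC 0) by ring; rewrite Cmod_0; lra).
  destruct (bounded_param (X := CU) W1 zc (- PI) PI) as [M1 [hM1 hbM1]].
  { intros a _; unfold jointly_continuous, W1.
    assert (hpd : polydisk rho1 rho2 zc (RtoC T1 * circle a)).
    { split; [apply hp|rewrite Cmod_scaled_circle; unfold T1 in *; lra]. }
    assert (hcomp : forall U, jcCC U (zc, RtoC T1 * circle a) ->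
      continuous (T := prod_UniformSpace CU RU) (U := CU)
        (fun q => U (fst q) (RtoC T1 * circle (snd q))) (zc, a)).
    { intros U hU. apply (continuous_uncurry (T := prod_UniformSpace CU RU) (U := CU) (V := CU) (W := CU) U
        (fun q => fst q) (fun q => RtoC T1 * circle (snd q))); [cont|cont|exact hU]. }
    assert (hfst : forall f : C -> C, hol f zc ->
      continuous (T := prod_UniformSpace CU RU) (U := CU) (fun q => f (fst q)) (zc, a)).
    { intros f hf. apply (continuous_comp (U := prod_UniformSpace CU RU) (V := CU) (W := CU)
        (fun q => fst q) f); [cont|apply hol_continuous, hf]. }
    pose proof (hcomp G (hGc _ _ hpd)). pose proof (hcomp H (hHc _ _ hpd)).
    assert (hGg : hol (fun z => G z (g z)) zc).
    { apply (analytic2_hol G (fun z => z) g); [rewrite hgc; apply hG, hp|apply hol_id|exact hg]. }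
    assert (hDg : hol (fun z => Dw H z (g z)) zc).
    { apply hol_Dw_curve with rho1 rho2; [exact hH|exact hg|rewrite hgc; exact hp]. }
    pose proof (hfst _ hGg). pose proof (hfst _ hDg). pose proof (hfst _ hg).
    apply (continuous_Cminus (T := prod_UniformSpace CU RU)).
    - apply (continuous_Cdiv (T := prod_UniformSpace CU RU)); [assumption|assumption|].
      intros h; apply (hH1T zc a); [lra|exact hwz|exact h|exact hzz].
    - apply (continuous_Cdiv (T := prod_UniformSpace CU RU)); [|cont|].
      + apply (continuous_Cdiv (T := prod_UniformSpace CU RU)); [assumption|assumption|].
        simpl; rewrite hgc; exact hcw.
      + simpl; rewrite hgc. intros h; apply (proj2 (Ceq_minus _ _)) in h.
        assert (he : Cmod (RtoC T1 * circle a) = Cmod wc) by (rewrite h; reflexivity).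
        rewrite Cmod_scaled_circle in he by lra. unfold T1 in he; lra. }
  assert (hnear : locally (T := CU) zc (fun z =>
     ((hol g z /\ g z <> 0 /\ Dw H z (g z) <> 0 /\ H z (g z) = 0) /\ polydisk rho1 rho2 z (g z)
        /\ hol (residue G H g) z) /\
     ((Cmod (g z - wc) < dg)%R /\ (Cmod (z - zc) < Rmin n1 d0)%R) /\
     (forall a, (- PI <= a <= PI)%R -> (Cmod (W1 z a) <= M1)%R))).
  { apply filter_and; [exact hnf|]. apply filter_and; [|exact hbM1].
    apply filter_and; [exact hgl|apply locally_Cball, Rmin_glb_lt; lra]. }
  apply locally_C_Cmod in hnear; destruct hnear as [d2 [hd2 hnear]].
  destruct (coefficient_torus F (fun z w => G z w / H z w) hF) as [t0 [ht0 htorus]].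
  (* Small enough for the torus formula of [F] and for [H] to have no zero with [|w| <= t]. *)
  pose (t := (Rmin t0 (Cmod wc / 4))%R).
  assert (ht : (0 < t /\ t <= t0 /\ t <= Cmod wc / 4)%R).
  { unfold t; pose proof (Rmin_l t0 (Cmod wc / 4)); pose proof (Rmin_r t0 (Cmod wc / 4)).
    pose proof (Rmin_glb_lt t0 (Cmod wc / 4) 0 ltac:(lra) ltac:(lra)); lra. }
  assert (hHt : forall z w, (Cmod z <= Cmod zc + n1)%R -> (Cmod w <= t)%R -> H z w <> 0).
  { intros z w hz hw. destruct (hH1 z w hz ltac:(unfold T1; lra)) as [h|h]; [|exact h].
    pose proof (hCabs' w wc); lra. }
  pose (Q := fun z w => G z w / H z w).
  assert (hQc : forall z w, polydisk rho1 rho2 z w -> H z w <> 0 -> jcCC Q (z, w)).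
  { intros z w hpd hn; unfold jointly_continuous, Q.
    apply (continuous_Cdiv (T := CC)); [apply hGc, hpd|apply hHc, hpd|exact hn]. }
  assert (hholz : forall z w, polydisk rho1 rho2 z w -> hol (fun z => G z w) z /\ hol (fun z => H z w) z).
  { intros z w hpd; split.
    - apply (analytic2_hol G (fun z => z) (fun _ => w)); [apply hG, hpd|apply hol_id|apply hol_const].
    - apply (analytic2_hol H (fun z => z) (fun _ => w)); [apply hH, hpd|apply hol_id|apply hol_const]. }
  assert (hholw : forall z w, polydisk rho1 rho2 z w -> hol (G z) w /\ hol (H z) w).
  { intros z w hpd; split.
    - apply (analytic2_hol G (fun _ => z) (fun w => w)); [apply hG, hpd|apply hol_const|apply hol_id].
    - apply (analytic2_hol H (fun _ => z) (fun w => w)); [apply hH, hpd|apply hol_const|apply hol_id]. }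
  (* Up to the factor [2 PI], the coefficient of [w^s] of the quotient as a function of [z]. *)
  pose (Phi := fun s z => circ (fun w => Q z w / w ^ s) (RtoC t)).
  assert (hnzt : forall b, RtoC t * circle b <> 0).
  { intros b; apply Cmult_neq_0; [apply RtoC_nz; lra|apply circle_nz]. }
  assert (hPhi : forall s z, (Cmod z < Cmod zc + n1)%R -> hol (Phi s) z).
  { intros s z hz; unfold Phi, circ.
    apply (hol_CInt (fun z b => Q z (RtoC t * circle b) / (RtoC t * circle b) ^ s)); [apply PI_bounds|].
    intros b _.
    assert (hl : locally (T := CU) z (fun y => (Cmod y < Cmod zc + n1)%R)).
    { apply (locally_lt_continuous (T := CU) (fun y => Cmod y) (fun _ => (Cmod zc + n1)%R)); [|cont|exact hz].
      apply (continuous_Cmod (T := CU) (fun y => y)); cont. }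
    generalize (locally_fst (X := CU) (Y := RU) _ (z, b) hl); apply filter_imp.
    intros [y c] hy; cbn [fst snd] in *.
    assert (hw : (Cmod (RtoC t * circle c) <= t)%R) by (rewrite Cmod_scaled_circle; lra).
    assert (hpd : polydisk rho1 rho2 y (RtoC t * circle c)) by (split; lra).
    assert (hn := hHt y (RtoC t * circle c) ltac:(lra) hw).
    split.
    - unfold jointly_continuous. apply (continuous_Cdiv (T := prod_UniformSpace CU RU)); [|cont|apply Cpow_nz, hnzt].
      apply (continuous_uncurry (T := prod_UniformSpace CU RU) (U := CU) (V := CU) (W := CU) Q
        (fun q => fst q) (fun q => RtoC t * circle (snd q))); [cont|cont|apply hQc; assumption].
    - destruct (hholz y _ hpd) as [q1 q2].
      apply hol_div; [apply hol_div; assumption|apply hol_const|apply Cpow_nz, hnzt]. }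
  assert (hcoef : forall (zeta : C) r s, zeta <> 0 -> (Cmod zeta < Cmod zc + n1)%R ->
    CInt (fun a => Phi s (zeta * circle a) / (zeta * circle a) ^ r) (- PI) PI
      = RtoC (2 * PI) * RtoC (2 * PI) * F r s).
  { intros zeta r s hz hzm.
    pose proof (proj1 (Cmod_gt_0 _) hz) as hzp.
    (* The circle of radius [tau |zeta|] is small enough for the torus formula; [circ_const] carries
       the integral out to [|zeta|]. *)
    pose (tau := (Rmin 1 (t / Cmod zeta))%R).
    assert (htz : (0 < t / Cmod zeta)%R) by (apply Rdiv_lt_0_compat; lra).
    assert (htau : (0 < tau <= 1 /\ tau * Cmod zeta <= t)%R).
    { unfold tau; pose proof (Rmin_l 1 (t / Cmod zeta)); pose proof (Rmin_r 1 (t / Cmod zeta)) as hr.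
      pose proof (Rmin_glb_lt 1 (t / Cmod zeta) 0 ltac:(lra) ltac:(lra)).
      split; [lra|]. apply Rmult_le_compat_r with (r := Cmod zeta) in hr; [|lra].
      replace (t / Cmod zeta * Cmod zeta)%R with t in hr by (field; lra). exact hr. }
    pose proof (circ_const (fun z => Phi s z / z ^ r) zeta tau 1 hz ltac:(lra) ltac:(lra)) as hcc.
    rewrite Cmult_1_l in hcc.
    assert (htn : RtoC tau * zeta <> 0) by (apply Cmult_neq_0; [apply RtoC_nz; lra|exact hz]).
    assert (htm : Cmod (RtoC tau * zeta) = (tau * Cmod zeta)%R)
      by (rewrite Cmod_mult, Cmod_R, Rabs_right; lra).
    rewrite <- (htorus r s (RtoC tau * zeta) (RtoC t) htn ltac:(apply RtoC_nz; lra)).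
    - unfold torus_int; apply hcc. intros u hu al.
      assert (hmod : Cmod (RtoC u * zeta * circle al) = (u * Cmod zeta)%R).
      { rewrite !Cmod_mult, Cmod_circle, Cmod_R, Rabs_right by lra; ring. }
      apply hol_div; [apply hPhi; rewrite hmod; nra|apply hol_pow, hol_id|apply Cpow_nz].
      apply Cmod_gt_0; rewrite hmod; apply Rmult_lt_0_compat; lra.
    - rewrite htm; lra.
    - rewrite Cmod_R, Rabs_right; lra.
    - intros a b.
      assert (hm1 : Cmod (RtoC tau * zeta * circle a) = (tau * Cmod zeta)%R)
        by (rewrite Cmod_mult, Cmod_circle, htm; ring).
      apply hQc; [|apply hHt].
      + split; [rewrite hm1|rewrite Cmod_scaled_circle]; nra.
      + rewrite hm1; nra.
      + rewrite Cmod_scaled_circle; lra. }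
  (* Moving the [w]-circle from radius [t] to radius [T1] crosses the pole [g z] and nothing
     else. *)
  assert (hnearPhi : forall z s, (Cmod (z - zc) < d2)%R ->
    (Cmod (Phi s z - RtoC (2 * PI) * (residue G H g z / g z ^ s)) <= (PI - - PI) * (M1 * / T1 ^ s))%R).
  { intros z s hz. destruct (hnear z hz) as [[[q1 [q2 [q3 q4]]] [q5 q6]] [[q7 q8] q9]].
    pose proof (Rmin_l n1 d0); pose proof (Rmin_r n1 d0).
    assert (hzm : (Cmod z <= Cmod zc + n1)%R) by (pose proof (hCabs z zc); lra).
    assert (hgm : (Cmod wc / 2 < Cmod (g z) < T1)%R).
    { pose proof (hCabs (g z) wc); pose proof (hCabs' (g z) wc); unfold T1; lra. }
    unfold Phi, Q. rewrite (near_coefficient (G z) (H z) (g z) t T1 s).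
    - change (C_derive (H z) (g z)) with (Dw H z (g z)).
      match goal with |- (Cmod (?a + ?b - ?c) <= _)%R => replace (a + b - c) with b by (unfold residue; ring) end.
      apply (Cmod_circ_le (fun w => G z w / H z w - G z (g z) / Dw H z (g z) / (w - g z))); [exact hT1| |].
      + intros a.
        assert (hpd : polydisk rho1 rho2 z (RtoC T1 * circle a)).
        { split; [apply q5|rewrite Cmod_scaled_circle; unfold T1 in *; lra]. }
        destruct (hholw z _ hpd) as [p1 p2].
        assert (hw : continuous (T := CU) (U := CU)
          (fun w => G z w / H z w - G z (g z) / Dw H z (g z) / (w - g z)) (RtoC T1 * circle a)).
        { pose proof (hol_continuous _ _ p1). pose proof (hol_continuous _ _ p2).
          apply (continuous_Cminus (T := CU)).
          - apply (continuous_Cdiv (T := CU)); [assumption|assumption|].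
            intros h; apply (hH1T z a); [lra|exact q7|exact h|lra].
          - cont. intros h; apply (proj2 (Ceq_minus _ _)) in h.
            assert (he : Cmod (RtoC T1 * circle a) = Cmod (g z)) by (rewrite h; reflexivity).
            rewrite Cmod_scaled_circle in he by lra. lra. }
        apply (continuous_comp (V := CU) (fun a => RtoC T1 * circle a)
          (fun w => G z w / H z w - G z (g z) / Dw H z (g z) / (w - g z))); [cont|exact hw].
      + intros a ha; apply (q9 a ha).
    - lra.
    - lra.
    - intros w hw; apply hholw; split; [apply q5|unfold T1 in *; lra].
    - exact q4.
    - exact q3.
    - intros w hw h. destruct (hzero1 z w hzm hw h) as [z1 z2].
      assert (hb1 : ball (M := CU) zc d0 z) by (apply ball_C_Cmod; lra).
      assert (hb2 : ball (M := CU) wc d0 w) by (apply ball_C_Cmod; lra).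
      apply (hd0 z w hb1 hb2), h. }
  assert (hrot : locally (T := prod_UniformSpace CU RU) (zc, 0%R) (fun p => (Cmod (fst p * circle (snd p) - zc) < d2)%R)).
  { assert (hc : continuous (T := prod_UniformSpace CU RU) (U := CU) (fun p => fst p * circle (snd p)) (zc, 0%R)) by cont.
    pose proof (continuous_locally_C (T := prod_UniformSpace CU RU) _ _ d2 hc hd2) as h.
    generalize h; apply filter_imp; intros p hp0.
    assert (he : zc * circle 0 = zc) by (unfold circle; rewrite Cmult_0_r, Cexp_0; ring).
    change (Cmod (fst p * circle (snd p) - zc * circle 0) < d2)%R in hp0.
    rewrite he in hp0; exact hp0. }
  destruct (locally_prod_ball (X := CU) (Y := RU) _ _ _ hrot) as [d4 hd4].
  pose proof (cond_pos d4) as hd4p.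
  exists (Rmin d4 PI); split; [apply Rmin_glb_lt; lra|]. intros eps heps.
  assert (heps4 : (0 < eps < d4 /\ eps < PI)%R) by (pose proof (Rmin_l d4 PI); pose proof (Rmin_r d4 PI); lra).
  (* The least distance from [zc] to the points [zc e^(i a)] with [|a| >= eps]; half of it is
     reserved for the distance between [zeta] and [zc]. *)
  pose (kap := (Cmod zc * sqrt (2 - 2 * cos eps))%R).
  assert (hkap : (0 < kap)%R).
  { unfold kap; apply Rmult_lt_0_compat; [exact hmz|apply sqrt_lt_R0].
    assert (cos eps < cos 0)%R by (apply cos_decreasing_1; lra). rewrite cos_0 in *; lra. }
  pose (d3 := (kap / 2)%R).
  destruct (zero_localization H rho1 rho2 d3 zc wc hHc hp ltac:(unfold d3; lra) hmin)
    as [n2 [hn2 [hn2a [hn2b hzero2]]]].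
  pose (T2 := (Cmod wc + n2)%R). assert (hT2 : (0 < T2)%R) by (unfold T2; lra).
  assert (hrotmod : forall z a, Cmod (z * circle a) = Cmod z) by (intros z a; rewrite Cmod_mult, Cmod_circle; ring).
  assert (hfar : forall (zeta : C) a, (Cmod (zeta - zc) < Rmin d3 n2)%R -> (eps <= Rabs a <= PI)%R ->
     forall w, (Cmod w <= T2)%R -> polydisk rho1 rho2 (zeta * circle a) w /\ H (zeta * circle a) w <> 0).
  { intros zeta a hz ha w hw.
    pose proof (Rmin_l d3 n2); pose proof (Rmin_r d3 n2). pose proof (hCabs zeta zc).
    split; [split; [rewrite hrotmod; lra|unfold T2 in *; lra]|].
    intros h; destruct (hzero2 (zeta * circle a) w) as [z1 _];
      [rewrite hrotmod; lra|exact hw|exact h|].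
    pose proof (circle_minus_1 a eps ltac:(lra) ha) as hc1.
    assert (hk : (kap <= Cmod (zc * (circle a - 1)))%R).
    { rewrite Cmod_mult; unfold kap; apply Rmult_le_compat_l; lra. }
    replace (zc * (circle a - 1)) with ((zeta * circle a - zc) + - ((zeta - zc) * circle a)) in hk by ring.
    pose proof (Cmod_triangle (zeta * circle a - zc) (- ((zeta - zc) * circle a))) as h3.
    rewrite Cmod_opp, hrotmod in h3. unfold d3 in *; lra. }
  assert (hzc0 : (Cmod (zc - zc) < Rmin d3 n2)%R).
  { replace (zc - zc) with (RtoC 0) by ring; rewrite Cmod_0; apply Rmin_glb_lt; unfold d3; lra. }
  assert (hfarc : forall a b, (eps <= Rabs a <= PI)%R ->
     continuous (T := prod_UniformSpace (prod_UniformSpace CU RU) RU) (U := CU)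
       (fun q => Q (fst (fst q) * circle (snd (fst q))) (RtoC T2 * circle (snd q))) ((zc, a), b)).
  { intros a b ha.
    apply (continuous_uncurry (T := prod_UniformSpace (prod_UniformSpace CU RU) RU) (U := CU) (V := CU) (W := CU) Q
      (fun q => fst (fst q) * circle (snd (fst q))) (fun q => RtoC T2 * circle (snd q))); [cont|cont|].
    simpl. destruct (hfar zc a hzc0 ha (RtoC T2 * circle b)) as [p1 p2];
      [rewrite Cmod_scaled_circle; lra|]. apply hQc; assumption. }
  destruct (bounded_param2 (X := CU) (fun z a b => Q (z * circle a) (RtoC T2 * circle b)) zc eps PI (- PI) PI)
    as [M2 [hM2 hb2]].
  { intros a b ha _; apply hfarc; rewrite Rabs_right; lra. }
  destruct (bounded_param2 (X := CU) (fun z a b => Q (z * circle a) (RtoC T2 * circle b)) zc (- PI) (- eps) (- PI) PI)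
    as [M3 [hM3 hb3]].
  { intros a b ha _; apply hfarc; rewrite Rabs_left; lra. }
  destruct (proj1 (locally_C_Cmod _ _) (filter_and _ _ hb2 hb3)) as [d5 [hd5 hbound]].
  pose (n3 := Rmin n1 n2).
  assert (hn3 : (0 < n3 /\ n3 <= n1 /\ n3 <= n2)%R).
  { unfold n3; pose proof (Rmin_l n1 n2); pose proof (Rmin_r n1 n2).
    pose proof (Rmin_glb_lt n1 n2 0 ltac:(lra) ltac:(lra)); lra. }
  (* One has [|omega| <= A < T], and [T] is at most [T1] and [T2]; hence both errors are bounded by
     [(A / T)^s = e^(-s C0)]. *)
  pose (T := (Cmod wc + n3)%R). pose (A := (Cmod wc + n3 / 2)%R).
  assert (hTA : (0 < A < T)%R) by (unfold T, A; lra).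
  pose (C0 := ln (T / A)).
  assert (hC0 : (0 < C0)%R).
  { unfold C0; rewrite <- ln_1; apply ln_increasing; [lra|].
    apply Rmult_lt_reg_r with A; [lra|]. replace (T / A * A)%R with T by (field; lra). lra. }
  pose (dl := Rmin (Rmin (Rmin d4 (Rmin d3 n2)) (Rmin d5 (n3 / 2))) (Rmin n1 (Cmod zc))).
  assert (hdl : (0 < dl /\ dl <= d4 /\ dl <= Rmin d3 n2 /\ dl <= d5 /\ dl <= n3 / 2 /\ dl <= n1 /\ dl <= Cmod zc)%R).
  { unfold dl. set (u := Rmin d3 n2).
    assert (hu : (0 < u)%R) by (apply Rmin_glb_lt; unfold d3; lra).
    pose proof (Rmin_l d4 u); pose proof (Rmin_r d4 u). pose proof (Rmin_l d5 (n3 / 2)); pose proof (Rmin_r d5 (n3 / 2)).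
    pose proof (Rmin_l n1 (Cmod zc)); pose proof (Rmin_r n1 (Cmod zc)).
    set (v := Rmin d4 u) in *. set (v2 := Rmin d5 (n3 / 2)) in *. set (v3 := Rmin n1 (Cmod zc)) in *.
    assert (0 < v)%R by (apply Rmin_glb_lt; lra). assert (0 < v2)%R by (apply Rmin_glb_lt; lra).
    assert (0 < v3)%R by (apply Rmin_glb_lt; lra).
    pose proof (Rmin_l v v2); pose proof (Rmin_r v v2).
    assert (0 < Rmin v v2)%R by (apply Rmin_glb_lt; lra).
    pose proof (Rmin_l (Rmin v v2) v3); pose proof (Rmin_r (Rmin v v2) v3).
    assert (0 < Rmin (Rmin v v2) v3)%R by (apply Rmin_glb_lt; lra). lra. }
  exists dl, (2 * PI * (M1 + M2 + M3))%R, C0; split; [lra|split; [exact hC0|]].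
  intros zeta omega hz hw r s.
  assert (hzn : zeta <> 0).
  { intros ->. replace (0 - zc) with (- zc) in hz by ring. rewrite Cmod_opp in hz; lra. }
  assert (hzm : (Cmod zeta < Cmod zc + n1)%R) by (pose proof (hCabs zeta zc); lra).
  assert (hwm : (0 <= Cmod omega <= A)%R).
  { pose proof (hCabs omega wc); pose proof (Cmod_ge_0 omega); unfold A; lra. }
  assert (hcn : forall a, zeta * circle a <> 0) by (intros a; apply Cmult_neq_0; [exact hzn|apply circle_nz]).
  pose (I0 := fun a => Phi s (zeta * circle a) / (zeta * circle a) ^ r * (zeta ^ r * omega ^ s / RtoC (2 * PI))).
  assert (hPc : segcont (fun a => Phi s (zeta * circle a) / (zeta * circle a) ^ r) (- PI) PI).
  { intros a _. apply (continuous_comp (V := CU) (fun a => zeta * circle a) (fun z => Phi s z / z ^ r)); [cont|].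
    apply hol_continuous, hol_div; [apply hPhi; rewrite hrotmod; exact hzm|apply hol_pow, hol_id|apply Cpow_nz, hcn]. }
  assert (hIc : segcont I0 (- PI) PI).
  { intros a ha; unfold I0; apply continuous_Cmult; [apply hPc, ha|cont]. }
  assert (hI : RtoC (2 * PI) * F r s * zeta ^ r * omega ^ s = CInt I0 (- PI) PI).
  { unfold I0. rewrite (CInt_ext _ (fun a => (zeta ^ r * omega ^ s / RtoC (2 * PI))
       * (Phi s (zeta * circle a) / (zeta * circle a) ^ r))); [|apply PI_bounds|intros; ring].
    rewrite CInt_Cmult, hcoef; [|exact hzn|exact hzm|apply PI_bounds|exact hPc].
    field; apply twoPI_nz. }
  rewrite hI, (CInt_split3 I0 (- PI) (- eps) eps PI) by (lra || exact hIc).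
  set (E0 := (exp (- (INR s * C0)))%R).
  assert (hE0 : (0 < E0)%R) by apply exp_pos.
  assert (hpw : forall U, (T <= U)%R -> (Cmod omega ^ s * / U ^ s <= E0)%R).
  { intros U hU. apply Rle_trans with (Cmod omega ^ s * / T ^ s)%R.
    - apply Rmult_le_compat_l; [apply pow_le; lra|]. apply Rinv_le_contravar; [apply pow_lt; lra|].
      apply pow_incr; lra.
    - apply (ratio_pow_le A T s ltac:(lra) ltac:(lra)); exact hwm. }
  assert (hImod : forall a V, Cmod (V / (zeta * circle a) ^ r * (zeta ^ r * omega ^ s / RtoC (2 * PI)))
     = (Cmod V * (Cmod omega ^ s) / (2 * PI))%R).
  { intros a V. rewrite Cmod_mult, !Cmod_div, Cmod_mult, !Cmod_pow, hrotmod, Cmod_R, Rabs_right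
      by (lra || apply twoPI_nz || apply Cpow_nz, hcn).
    pose proof (proj1 (Cmod_gt_0 _) hzn) as hzp. pose proof (pow_lt _ r hzp). field; lra. }
  assert (hfarb : forall a (Mx : R), (eps <= Rabs a <= PI)%R ->
    (forall b, (- PI <= b <= PI)%R -> (Cmod (Q (zeta * circle a)%C (RtoC T2 * circle b)%C) <= Mx)%R) ->
    (0 < Mx)%R -> (Cmod (I0 a) <= Mx * E0)%R).
  { intros a Mx ha hMx hMp. unfold I0; rewrite hImod.
    assert (hz3 : (Cmod (zeta - zc) < Rmin d3 n2)%R) by lra.
    (* On the far arc no zero of [H] is met between the radii [t] and [T2]. *)
    assert (hPT : Phi s (zeta * circle a) = circ (fun w => Q (zeta * circle a) w / w ^ s) (RtoC T2)).
    { unfold Phi; symmetry; apply circ_const_real; [lra|unfold T2; lra|].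
      intros w hw2 hw0. destruct (hfar zeta a hz3 ha w hw2) as [p1 p2].
      destruct (hholw _ _ p1) as [p3 p4].
      apply hol_div; [apply (hol_div (G (zeta * circle a)) (H (zeta * circle a))); assumption
        |apply hol_pow, hol_id|apply Cpow_nz, hw0]. }
    rewrite hPT.
    assert (hcb : (Cmod (circ (fun w => Q (zeta * circle a) w / w ^ s)%C (RtoC T2)) <= (PI - - PI) * (Mx * / T2 ^ s))%R).
    { apply (Cmod_circ_le (Q (zeta * circle a))); [exact hT2| |exact hMx].
      intros b. apply (continuous_comp (V := CU) (fun b => RtoC T2 * circle b) (Q (zeta * circle a))); [cont|].
      destruct (hfar zeta a hz3 ha (RtoC T2 * circle b)) as [p1 p2]; [rewrite Cmod_scaled_circle; lra|].
      apply (continuous_section (X := CU) (Y := CU) (Z := CU) Q), hQc; assumption. }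
    pose proof (hpw T2 ltac:(unfold T, T2; lra)) as hq.
    pose proof (pow_le _ s (proj1 hwm)) as hws.
    apply Rle_trans with ((PI - - PI) * (Mx * / T2 ^ s) * Cmod omega ^ s / (2 * PI))%R.
    - apply Rmult_le_compat_r; [left; apply Rinv_0_lt_compat; lra|]. apply Rmult_le_compat_r; assumption.
    - replace ((PI - - PI) * (Mx * / T2 ^ s) * Cmod omega ^ s / (2 * PI))%R
        with (Mx * (Cmod omega ^ s * / T2 ^ s))%R by (field; split; [apply pow_nonzero; lra|lra]).
      apply Rmult_le_compat_l; lra. }
  pose (J := fun a => residue G H g (zeta * circle a) * (omega / g (zeta * circle a)) ^ s / circle a ^ r).
  assert (hin : forall a, (- eps <= a <= eps)%R -> (Cmod (zeta * circle a - zc) < d2)%R).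
  { intros a ha. apply (hd4 zeta a); [apply ball_C_Cmod; lra|].
    change (Rabs (a - 0) < d4)%R. apply Rabs_def1; lra. }
  assert (hJc : segcont J (- eps) eps).
  { intros a ha; unfold J. destruct (hnear _ (hin a ha)) as [[[q1 [q2 _]] [_ q6]] _].
    assert (c1 : continuous (U := CU) (fun a => residue G H g (zeta * circle a)) a).
    { apply (continuous_comp (V := CU) (fun a => zeta * circle a) (residue G H g)); [cont|apply hol_continuous, q6]. }
    assert (c2 : continuous (U := CU) (fun a => g (zeta * circle a)) a).
    { apply (continuous_comp (V := CU) (fun a => zeta * circle a) g); [cont|apply hol_continuous, q1]. }
    cont; apply Cpow_nz, circle_nz. }
  assert (hb1 : (Cmod (CInt I0 (- eps) eps - CInt J (- eps) eps) <= (eps - - eps) * (M1 * E0))%R).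
  { assert (hIs : segcont I0 (- eps) eps) by (intros a ha; apply hIc; lra).
    rewrite <- CInt_minus; [|lra|exact hIs|exact hJc].
    apply Cmod_CInt_le; [lra|intros a ha; apply continuous_Cminus; [apply hIs, ha|apply hJc, ha]|].
    intros a ha. destruct (hnear _ (hin a ha)) as [[[q1 [q2 _]] _] _].
    pose proof (hnearPhi (zeta * circle a) s (hin a ha)) as hn.
    set (z := zeta * circle a) in *.
    replace (I0 a - J a) with ((Phi s z - RtoC (2 * PI) * (residue G H g z / g z ^ s)) / (zeta * circle a) ^ r
      * (zeta ^ r * omega ^ s / RtoC (2 * PI))).
    - rewrite hImod. pose proof (hpw T1 ltac:(unfold T, T1; lra)) as hq.
      pose proof (pow_le _ s (proj1 hwm)) as hws.
      apply Rle_trans with ((PI - - PI) * (M1 * / T1 ^ s) * Cmod omega ^ s / (2 * PI))%R.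
      + apply Rmult_le_compat_r; [left; apply Rinv_0_lt_compat; lra|]. apply Rmult_le_compat_r; assumption.
      + replace ((PI - - PI) * (M1 * / T1 ^ s) * Cmod omega ^ s / (2 * PI))%R
          with (M1 * (Cmod omega ^ s * / T1 ^ s))%R by (field; split; [apply pow_nonzero; lra|lra]).
        apply Rmult_le_compat_l; lra.
    - unfold I0, J; fold z.
      assert (hdiv : (omega / g z) ^ s = omega ^ s / g z ^ s)
        by (unfold Cdiv; rewrite Cpow_mult_l, Cpow_inv by exact q2; reflexivity).
      assert (hzr : z ^ r = zeta ^ r * circle a ^ r) by (unfold z; apply Cpow_mult_l).
      rewrite hdiv, hzr.
      pose proof (Cpow_nz _ s q2). pose proof (Cpow_nz _ r hzn). pose proof (Cpow_nz _ r (circle_nz a)).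
      pose proof twoPI_nz. field; auto. }
  assert (hb4 : (Cmod (CInt I0 (- PI) (- eps)) <= (- eps - - PI) * (M3 * E0))%R).
  { apply Cmod_CInt_le; [lra|intros a ha; apply hIc; lra|]. intros a ha.
    apply hfarb; [rewrite Rabs_left; lra| |exact hM3].
    intros b hb. apply (hbound zeta ltac:(lra)); assumption. }
  assert (hb5 : (Cmod (CInt I0 eps PI) <= (PI - eps) * (M2 * E0))%R).
  { apply Cmod_CInt_le; [lra|intros a ha; apply hIc; lra|]. intros a ha.
    apply hfarb; [rewrite Rabs_right; lra| |exact hM2].
    intros b hb. apply (hbound zeta ltac:(lra)); assumption. }
  fold J.
  match goal with |- (Cmod (?a + (?b + ?c) - ?e) <= _)%R =>
    replace (a + (b + c) - e) with ((a - e) + (b + c)) by ring end.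
  eapply Rle_trans; [apply Cmod_triangle|].
  eapply Rle_trans; [apply Rplus_le_compat_l, Cmod_triangle|].
  assert (p1 : ((eps - - eps) * (M1 * E0) <= 2 * PI * (M1 * E0))%R).
  { apply Rmult_le_compat_r; [apply Rmult_le_pos; lra|lra]. }
  assert (p2 : ((- eps - - PI) * (M3 * E0) <= 2 * PI * (M3 * E0))%R).
  { apply Rmult_le_compat_r; [apply Rmult_le_pos; lra|lra]. }
  assert (p3 : ((PI - eps) * (M2 * E0) <= 2 * PI * (M2 * E0))%R).
  { apply Rmult_le_compat_r; [apply Rmult_le_pos; lra|lra]. }
  replace (2 * PI * (M1 + M2 + M3) * E0)%R
    with (2 * PI * (M1 * E0) + (2 * PI * (M3 * E0) + 2 * PI * (M2 * E0)))%R by ring.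
  lra.
Qed.

(** * Amplitude and phase *)

Lemma jhol_analytic2 (H : C -> C -> C) (rho1 rho2 : R) (z w : C) :
  (forall z w, polydisk rho1 rho2 z w -> analytic2_at H z w) -> polydisk rho1 rho2 z w -> jhol H z w.
Proof.
  intros hH [h1 h2].
  assert (hl : forall (c : C) rho, (Cmod c < rho)%R -> locally (T := CU) c (fun y => (Cmod y < rho)%R)).
  { intros c rho hc; apply (locally_lt_continuous (T := CU) (fun y => Cmod y) (fun _ => rho)); [|cont|exact hc].
    apply (continuous_Cmod (T := CU) (fun y => y)); cont. }
  unfold jhol.
  generalize (filter_and _ _ (locally_fst (X := CU) (Y := CU) _ (z, w) (hl z rho1 h1))
    (locally_snd (X := CU) (Y := CU) _ (z, w) (hl w rho2 h2))).
  apply filter_imp; intros [x y] hxy; split; [|split].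
  - apply analytic2_continuous, hH, hxy.
  - apply (analytic2_hol H (fun z => z) (fun _ => y)); [apply hH, hxy|apply hol_id|apply hol_const].
  - apply (analytic2_hol H (fun _ => x) (fun w => w)); [apply hH, hxy|apply hol_const|apply hol_id].
Qed.

(** The increment is split at [(x, g z)]: the first part has a slope by holomorphy in [z] alone, the
    second is the mean of [Dsnd H x] over the segment from [g z] to [g x] times the slope of [g]. *)
Lemma cder_two_variables (H : C -> C -> C) (g : C -> C) (z : C) :
  jhol H z (g z) -> hol g z ->
  cder (fun x => H x (g x)) z (Dz H z (g z) + Dw H z (g z) * C_derive g z).
Proof.
  intros hH hg.
  destruct (jhol_at _ _ _ hH) as [_ [hz _]]; cbn [fst snd] in hz.
  destruct (hol_cder _ _ hz) as [p1 [c1 [e1 l1]]].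
  destruct (hol_cder _ _ hg) as [p2 [c2 [e2 l2]]].
  pose proof (hol_continuous _ _ hg) as hgc.
  pose (I := fun x => CInt (fun t => Dsnd H x (g z + RtoC t * (g x - g z))) 0 1).
  assert (hIc : continuous (T := CU) (U := CU) I z).
  { apply (continuous_CInt_param (X := CU) (fun x t => Dsnd H x (g z + RtoC t * (g x - g z)))); [lra|].
    intros t _.
    pose (m := fun q : C * R => (fst q, g z + RtoC (snd q) * (g (fst q) - g z))).
    assert (hgq : forall q : C * R, hol g (fst q) -> continuous (T := prod_UniformSpace CU RU) (U := CU)
       (fun q => g (fst q)) q).
    { intros q hq; apply (continuous_comp (U := prod_UniformSpace CU RU) (V := CU) (W := CU) (fun q => fst q) g);
        [cont|apply hol_continuous, hq]. }
    assert (hm : forall q : C * R, hol g (fst q) -> continuous (T := prod_UniformSpace CU RU) (U := CC) m q).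
    { intros q hq; pose proof (hgq q hq).
      apply (continuous_pair (T := prod_UniformSpace CU RU) (U := CU) (V := CU)); cont. }
    assert (hm0 : m (z, t) = (z, g z)) by (unfold m; simpl; f_equal; ring).
    pose proof (jhol_Dsnd _ _ _ hH) as hD; unfold jhol in hD. rewrite <- hm0 in hD.
    generalize (filter_and _ _ (locally_continuous_comp (X := prod_UniformSpace CU RU) (Y := CC) m (z, t) _
      (hm (z, t) hg) hD) (locally_fst (X := CU) (Y := RU) _ (z, t) (hol_locally _ _ hg))).
    apply filter_imp; intros q [[j1 _] q2].
    exact (continuous_comp (U := prod_UniformSpace CU RU) (V := CC) (W := CU) m
      (fun p => Dsnd H (fst p) (snd p)) q (hm q q2) j1). }
  exists (fun x => p1 x + I x * p2 x); split; [cont|split].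
  - rewrite e1, e2. f_equal; f_equal. unfold I.
    rewrite (CInt_ext _ (fun _ => Dw H z (g z))); [rewrite CInt_const, RtoC_minus; ring|lra|].
    intros t _; unfold Dsnd, Dw. f_equal; ring.
  - destruct (jhol_ball _ _ _ hH) as [r [hr hb]].
    pose proof (continuous_locally_C (T := CU) g z r hgc hr) as l3.
    generalize (filter_and _ _ (filter_and _ _ l1 l2) (filter_and _ _ l3 (locally_Cball z r hr))).
    apply filter_imp; intros x [[q1 q2] [q3 q4]].
    pose proof (cder_increment (H x) (C_derive (H x)) (g z) (g x)) as hi.
    replace (H x (g x) - H z (g z)) with ((H x (g x) - H x (g z)) + (H x (g z) - H z (g z))) by Cring.
    rewrite hi, q1.
    + fold (Dsnd H x). change (CInt (fun t => C_derive (H x) (g z + RtoC t * (g x - g z))) 0 1) with (I x).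
      rewrite q2; Cring.
    + intros t ht.
      destruct (hb x (g z + RtoC t * (g x - g z)) q4 (Cball_segment _ _ _ _ ht q3)) as [_ [_ j]].
      split; [apply hol_cder, j|apply hol_continuous_derive, j].
Qed.

(** Differentiation of [H (x, g x) = 0]. It identifies the linear term of the phase as [i th d], so
    that in the direction [r / s = d] multiplication by [s] turns it into [i r th]. *)
Lemma implicit_dir (rho1 rho2 : R) (H : C -> C -> C) (g : C -> C) (z : C) :
  (forall z w, polydisk rho1 rho2 z w -> analytic2_at H z w) ->
  hol g z -> polydisk rho1 rho2 z (g z) -> g z <> 0 -> Dw H z (g z) <> 0 ->
  locally (T := CU) z (fun x => H x (g x) = 0) ->
  z * C_derive g z / g z = - dir H z (g z).
Proof.
  intros hH hg hp hgn hd hz.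
  pose proof (cder_two_variables H g z (jhol_analytic2 H rho1 rho2 z (g z) hH hp) hg) as h.
  apply cder_C_derive in h.
  assert (h0 : C_derive (fun x => H x (g x)) z = 0).
  { apply cder_C_derive, cder_ext_loc with (fun _ => 0); [|apply cder_const].
    generalize hz; apply filter_imp; intros x hx; symmetry; exact hx. }
  rewrite h0 in h. unfold dir.
  replace (Dz H z (g z)) with (- (Dw H z (g z) * C_derive g z)).
  - field; auto.
  - replace (Dz H z (g z)) with ((Dz H z (g z) + Dw H z (g z) * C_derive g z) - Dw H z (g z) * C_derive g z)
      by ring. rewrite <- h; ring.
Qed.

Lemma jhol_rotation (f : C -> C) (zc : C) : hol f zc -> jhol (fun x th => f (x * Cexp (Ci * th))) zc 0.
Proof.
  intros hf; apply (jhol_comp (fun x th => x * Cexp (Ci * th)) f).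
  - apply jhol_mult; [apply (jhol_fst (fun x => x)), hol_id|].
    apply (jhol_snd (fun th => Cexp (Ci * th))).
    apply (hol_comp (fun th => Ci * th) Cexp); [apply hol_mult; [apply hol_const|apply hol_id]|apply hol_Cexp].
  - rewrite Cmult_0_r, Cexp_0, Cmult_1_r; exact hf.
Qed.

Lemma jhol_phase (g : C -> C) (zc : C) : hol g zc -> g zc <> 0 -> jhol (phase g) zc 0.
Proof.
  intros hg hn; unfold phase; apply jhol_minus.
  - apply (jhol_comp (fun x th => g (x * Cexp (Ci * th)) / g x) Clog).
    + apply jhol_div; [apply jhol_rotation, hg|apply (jhol_fst g), hg|exact hn].
    + apply hol_Clog. rewrite Cmult_0_r, Cexp_0, Cmult_1_r.
      replace (g zc / g zc) with (RtoC 1) by (field; exact hn). simpl; lra.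
  - apply jhol_mult.
    + apply (jhol_snd (fun th => Ci * th)), hol_mult; [apply hol_const|apply hol_id].
    + apply (jhol_fst (fun x => x * C_derive g x / g x)), hol_div; [|exact hg|exact hn].
      apply hol_mult; [apply hol_id|apply hol_derive, hg].
Qed.

Lemma phase_0 (g : C -> C) (z : C) : g z <> 0 -> phase g z 0 = 0.
Proof.
  intros h; unfold phase. rewrite Cmult_0_r, Cexp_0, Cmult_1_r.
  replace (g z / g z) with (RtoC 1) by (field; exact h). rewrite Clog_1; ring.
Qed.

Lemma hol_ray_int (k : nat) (u f : C -> C -> C) (eta zc x : C) (r eps s : R) :
  jholB zc r u -> jholB zc r f -> (0 <= eps < r)%R -> Cmod eta = 1%R -> (Cmod (x - zc) < r)%R ->
  hol (ray_int k u f eta eps s) x.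
Proof.
  intros hu hf he heta hx; unfold ray_int.
  pose (V := fun x th => th ^ k * u x th * Cexp (- (RtoC s * f x th)) * eta).
  assert (hV : jholB zc r V).
  { intros z w hz hw; unfold V. apply jhol_mult; [|apply jhol_const]. apply jhol_mult.
    - apply jhol_mult; [|apply hu; assumption]. apply (jhol_snd (fun th => th ^ k)), hol_pow, hol_id.
    - apply (jhol_comp (fun x th => - (RtoC s * f x th)) Cexp); [|apply hol_Cexp].
      apply jhol_opp, jhol_mult; [apply jhol_const|apply hf; assumption]. }
  apply (hol_CInt (fun x t => V x (RtoC t * eta))); [lra|]; intros t ht.
  assert (hth : (Cmod (RtoC t * eta) < r)%R) by (rewrite Cmod_mult, heta, Cmod_R, Rabs_right; lra).
  pose (m := fun q : C * R => (fst q, RtoC (snd q) * eta)).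
  assert (hm : forall q, continuous (T := prod_UniformSpace CU RU) (U := CC) m q).
  { intros q; apply (continuous_pair (T := prod_UniformSpace CU RU) (U := CU) (V := CU)); cont. }
  generalize (locally_continuous_comp (X := prod_UniformSpace CU RU) (Y := CC) m (x, t) _ (hm _)
    (hV x (RtoC t * eta) hx hth)).
  apply filter_imp; intros q [j1 [j2 _]]; split; [|exact j2].
  exact (continuous_comp (U := prod_UniformSpace CU RU) (V := CC) (W := CU) m
    (fun p => V (fst p) (snd p)) q (hm q) j1).
Qed.

(** The price of moving an endpoint from the real axis to the rotated ray: the integral of [U] over
    an arc of radius [eps] and angle [psi]. *)
Lemma prim_arc (U : C -> C) (r eps psi M : R) (sg : C) :
  (forall y, (Cmod y < r)%R -> hol U y) -> (0 < eps < r)%R -> Cmod sg = 1%R ->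
  (forall t, (0 <= t <= 1)%R -> (Cmod (U (RtoC eps * (sg * circle (psi * t)))%C) <= M)%R) ->
  (Cmod (prim U (RtoC eps * (sg * circle psi)) - prim U (RtoC eps * sg)) <= M * (eps * Rabs psi))%R.
Proof.
  intros hU he hsg hM.
  pose (c := fun t => RtoC eps * sg * Cexp (0 + RtoC t * (Ci * RtoC psi))).
  assert (hceq : forall t, c t = RtoC eps * (sg * circle (psi * t))).
  { intros t; unfold c, circle. rewrite RtoC_mult.
    replace (0 + RtoC t * (Ci * RtoC psi)) with (Ci * (RtoC psi * RtoC t)) by ring. ring. }
  assert (hcm : forall t, Cmod (c t) = eps).
  { intros t; rewrite hceq, !Cmod_mult, hsg, Cmod_circle, Cmod_R, Rabs_right; lra. }
  assert (hcd : forall t, rder c t (c t * (Ci * RtoC psi))).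
  { intros t; unfold c; eapply rder_eq; [apply rder_scale, rder_real_line, cder_Cexp|ring]. }
  assert (hs : segcont (fun t => U (c t) * (c t * (Ci * RtoC psi))) 0 1).
  { intros t _; pose proof (rder_continuous _ _ _ (hcd t)) as h1.
    assert (h2 : continuous (U := CU) (fun t => U (c t)) t).
    { apply (continuous_comp (V := CU) c U); [exact h1|apply hol_continuous, hU; rewrite hcm; lra]. }
    cont. }
  pose proof (CInt_FTC (fun t => prim U (c t)) (fun t => U (c t) * (c t * (Ci * RtoC psi))) 0 1 ltac:(lra)) as hF.
  assert (hF' : CInt (fun t => U (c t) * (c t * (Ci * RtoC psi))) 0 1 = prim U (c 1%R) - prim U (c 0%R)).
  { apply hF; [|exact hs]. intros t _; apply rder_comp; [apply hcd|].
    apply cder_prim with r; [exact hU|rewrite hcm; lra]. }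
  replace (RtoC eps * (sg * circle psi)) with (c 1%R) by (rewrite hceq, Rmult_1_r; reflexivity).
  replace (RtoC eps * sg) with (c 0%R).
  2:{ rewrite hceq, Rmult_0_r; unfold circle; rewrite Cmult_0_r, Cexp_0; ring. }
  rewrite <- hF'. replace (M * (eps * Rabs psi))%R with ((1 - 0) * (M * (eps * Rabs psi)))%R by ring.
  apply Cmod_CInt_le; [lra|exact hs|]. intros t ht.
  rewrite !Cmod_mult, hcm, Cmod_Ci, Cmod_R, Rmult_1_l, hceq.
  apply Rmult_le_compat_r; [apply Rmult_le_pos; [lra|apply Rabs_pos]|apply hM, ht].
Qed.

Lemma CInt_ray_prim (U : C -> C) (r a b : R) (eta : C) :
  (forall y, (Cmod y < r)%R -> hol U y) -> Cmod eta = 1%R -> (- r < a <= b)%R -> (b < r)%R ->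
  CInt (fun t => U (RtoC t * eta) * eta) a b = prim U (RtoC b * eta) - prim U (RtoC a * eta).
Proof.
  intros hU heta ha hb.
  assert (hm : forall t, (a <= t <= b)%R -> (Cmod (RtoC t * eta) < r)%R).
  { intros t ht; rewrite Cmod_mult, heta, Cmod_R, Rmult_1_r. apply Rabs_def1; lra. }
  rewrite (CInt_FTC (fun t => prim U (0 + RtoC t * eta))).
  - rewrite !Cplus_0_l; reflexivity.
  - lra.
  - intros t ht; apply (rder_real_line (prim U)). rewrite Cplus_0_l.
    apply cder_prim with r; [exact hU|apply hm, ht].
  - intros t ht; apply continuous_Cmult; [|cont].
    apply (continuous_comp (V := CU) (fun t => RtoC t * eta) U); [cont|apply hol_continuous, hU, hm, ht].
Qed.

(** Since [z g' / g = - r / s], multiplication by [s] turns both parts of the phase into logarithms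
    of integral powers, and the branch of the logarithm disappears. *)
Lemma Cexp_phase (g : C -> C) (z : C) (t : R) (r s : nat) :
  g z <> 0 -> (0 < Re (g (z * circle t)%C / g z))%R -> (s <> 0)%nat ->
  z * C_derive g z / g z = - RtoC (INR r / INR s) ->
  Cexp (- (RtoC (INR s) * phase g z (RtoC t))) = (g z / g (z * circle t)) ^ s / circle t ^ r.
Proof.
  intros hn hre hs hd. unfold phase. rewrite hd. fold (circle t).
  set (q := g (z * circle t) / g z) in *.
  assert (hsn : INR s <> 0%R) by (apply not_0_INR, hs).
  assert (hgn : g (z * circle t) <> 0).
  { intros h. unfold q in hre; rewrite h in hre. replace (0 / g z) with (RtoC 0) in hre by (field; exact hn).
    simpl in hre; lra. }
  replace (- (RtoC (INR s) * (Clog q - Ci * RtoC t * - RtoC (INR r / INR s))))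
    with (RtoC (INR s) * (- Clog q) + RtoC (INR r) * (- (Ci * RtoC t))).
  2:{ rewrite RtoC_div by exact hsn. field. apply RtoC_nz, hsn. }
  rewrite Cexp_plus, <- !Cexp_pow, !Cexp_opp, Cexp_Clog by (apply Re_pos_Clog_dom, hre).
  fold (circle t). rewrite (Cpow_inv (circle t)) by apply circle_nz. unfold Cdiv at 1. f_equal.
  f_equal. unfold q. field; auto.
Qed.

(** For a real direction the linear term is imaginary at real angles, which leaves the logarithm of
    a ratio of moduli; minimality can then decide its sign. *)
Lemma Re_phase_real (g : C -> C) (z : C) (t d : R) :
  g z <> 0 -> g (z * circle t) <> 0 -> z * C_derive g z / g z = - RtoC d ->
  Re (phase g z (RtoC t)) = ln (Cmod (g (z * circle t)%C) / Cmod (g z)).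
Proof.
  intros h1 h2 hd; unfold phase; rewrite hd; fold (circle t).
  unfold Clog. rewrite Cmod_div by exact h1.
  Creduce. ring.
Qed.

Lemma locally_forall_lt {T : UniformSpace} (x : T) (P : nat -> T -> Prop) (n : nat) :
  (forall k, (k < n)%nat -> locally x (P k)) -> locally x (fun y => forall k, (k < n)%nat -> P k y).
Proof.
  induction n as [|n IH]; intros h.
  - apply filter_forall; intros y k hk; lia.
  - generalize (filter_and _ _ (IH (fun k hk => h k (Nat.lt_lt_succ_r _ _ hk))) (h n (Nat.lt_succ_diag_r n))).
    apply filter_imp; intros y [a b] k hk. destruct (Nat.eq_dec k n) as [->|hne]; [exact b|apply a; lia].
Qed.

Lemma fsum_mult_l (c : C) (f : nat -> C) (p d : nat) : c * fsum f p d = fsum (fun k => c * f k) p d.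
Proof. induction d as [|d IH]; simpl; [ring|]. rewrite <- IH; ring. Qed.

Lemma fsum_minus (f h : nat -> C) (p d : nat) :
  fsum f p d - fsum h p d = fsum (fun k => f k - h k) p d.
Proof. induction d as [|d IH]; simpl; [ring|]. rewrite <- IH; ring. Qed.

(** Collects finitely many smallness conditions on a radius, in place of nested minima. *)
Lemma small_pos (l : list R) :
  List.Forall (fun x => (0 < x)%R) l -> exists d, (0 < d)%R /\ List.Forall (fun x => (d < x)%R) l.
Proof.
  induction l as [|x l IH]; intros h.
  - exists 1%R; split; [lra|constructor].
  - inversion h as [|y l' hx hl]; subst. destruct (IH hl) as [d [hd hall]].
    exists (Rmin d x / 2)%R. pose proof (Rmin_l d x); pose proof (Rmin_r d x).
    pose proof (Rmin_glb_lt d x 0 hd hx). split; [lra|]. constructor; [lra|].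
    revert hall; apply List.Forall_impl; intros y hy; lra.
Qed.

Lemma jholB_const (c z0 : C) (r : R) : jholB z0 r (fun _ _ => c).
Proof. intros z w _ _; apply jhol_const. Qed.

Lemma amplitude_expand (a : C -> C -> C) (zc x th : C) (r : R) (p q : nat) :
  jholB zc r a -> (p <= q)%nat -> (Cmod (x - zc) < r)%R -> (Cmod th < r)%R ->
  (forall k, (k < p)%nat -> hartogs a 0 k x = 0) ->
  a x th = fsum (fun k => (if Nat.ltb k q then ddn k a x 0 else 1) *
     (th ^ k * (if Nat.ltb k q then 1 else ddn q a x th))) p (S (q - p)).
Proof.
  intros ha hpq hx hth hv.
  rewrite (ddn_vanish a zc r p x th ha hx hth hv).
  rewrite (ddn_expand a zc r x th p (q - p) ha hx hth).
  replace (p + (q - p))%nat with q by lia. simpl fsum.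
  replace (p + (q - p))%nat with q by lia. rewrite Nat.ltb_irrefl. f_equal; [|ring].
  apply fsum_ext; intros k hk. assert (hl : Nat.ltb k q = true) by (apply Nat.ltb_lt; lia).
  rewrite hl; ring.
Qed.

(** By linearity the ray integrals reassemble the whole integrand [a e^(-s f)]. As it has a
    primitive, only the endpoint [eps eta] matters afterwards, which allows the path to be
    changed. *)
Lemma ray_sum (a f : C -> C -> C) (A : nat -> C) (u : nat -> C -> C -> C) (zc x eta : C)
    (r eps s : R) (p d : nat) :
  jholB zc r a -> jholB zc r f -> (forall k, jholB zc r (u k)) -> (Cmod (x - zc) < r)%R ->
  (0 < eps < r)%R -> Cmod eta = 1%R ->
  (forall th, (Cmod th < r)%R -> a x th = fsum (fun k => A k * (th ^ k * u k x th)) p d) ->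
  fsum (fun k => A k * ray_int k (u k) f eta eps s x) p d =
    prim (fun th => a x th * Cexp (- (RtoC s * f x th))) (RtoC eps * eta).
Proof.
  intros ha hf hu hx he heta hexp.
  set (U := fun th => a x th * Cexp (- (RtoC s * f x th))).
  assert (hU : forall y, (Cmod y < r)%R -> hol U y).
  { intros y hy; unfold U; apply hol_mult; [apply (jhol_at _ _ _ (ha x y hx hy))|].
    apply (hol_comp (fun th => - (RtoC s * f x th)) Cexp); [|apply hol_Cexp].
    apply hol_opp, hol_mult; [apply hol_const|apply (jhol_at _ _ _ (hf x y hx hy))]. }
  assert (hm : forall t, (0 <= t <= eps)%R -> (Cmod (RtoC t * eta) < r)%R).
  { intros t ht; rewrite Cmod_mult, heta, Cmod_R, Rabs_right; lra. }
  pose proof (CInt_ray_prim U r 0 eps eta hU heta ltac:(lra) ltac:(lra)) as hp.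
  rewrite Cmult_0_l, prim_0, Cminus_0_r in hp. rewrite <- hp.
  assert (hc : forall (V : C -> C -> C) t, jholB zc r V -> (0 <= t <= eps)%R ->
     continuous (U := CU) (fun t => V x (RtoC t * eta)) t).
  { intros V t hV ht. apply (continuous_comp (V := CU) (fun t => RtoC t * eta) (V x)); [cont|].
    apply hol_continuous, (jhol_at _ _ _ (hV x _ hx (hm t ht))). }
  assert (hri : forall k, segcont (ray_integrand k (u k) f eta s x) 0 eps).
  { intros k t ht; unfold ray_integrand. pose proof (hc _ t (hu k) ht). pose proof (hc _ t hf ht). cont. }
  destruct (CInt_fsum (fun k t => A k * ray_integrand k (u k) f eta s x t) 0 eps p d ltac:(lra)) as [h1 _].
  { intros k _ t ht; apply continuous_Cmult; [cont|apply hri, ht]. }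
  rewrite (fsum_ext _ (fun k => CInt (fun t => A k * ray_integrand k (u k) f eta s x t) 0 eps)).
  - rewrite <- h1. apply CInt_ext; [lra|]; intros t ht. unfold U.
    rewrite (hexp _ (hm t ht)).
    transitivity (Cexp (- (RtoC s * f x (RtoC t * eta))) * eta *
      fsum (fun k => A k * ((RtoC t * eta) ^ k * u k x (RtoC t * eta))) p d); [|ring].
    rewrite fsum_mult_l. apply fsum_ext; intros k _; unfold ray_integrand; ring.
  - intros k _. rewrite CInt_Cmult; [reflexivity|lra|apply hri].
Qed.

Theorem theorem1
  (rho1 rho2 : R) (Hrho1 : (0 < rho1)%R) (Hrho2 : (0 < rho2)%R)
  (G H : C -> C -> C)
  (HG : forall z w, polydisk rho1 rho2 z w -> analytic2_at G z w)
  (HH : forall z w, polydisk rho1 rho2 z w -> analytic2_at H z w)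
  (HH0 : H 0 0 <> 0)
  (F : nat -> nat -> C)
  (HF : is_pseries2_near F (fun z w => G z w / H z w) 0 0)
  (K : C * C -> Prop)
  (HKD : forall z w, K (z, w) -> polydisk rho1 rho2 z w)
  (HKc : compact_set (T := prod_UniformSpace C_UniformSpace C_UniformSpace) K)
  (HKmin : forall z w, K (z, w) -> strictly_minimal H z w /\ simple_zero H z w)
  (zetac omegac : C)
  (Hc : K (zetac, omegac))
  (Hcw : Dw H zetac omegac <> 0)
  (g : C -> C)
  (Hg : analytic_at g zetac)
  (Hgc : g zetac = omegac)
  (Hgzero : locally (T := prod_UniformSpace C_UniformSpace C_UniformSpace)
     (zetac, omegac) (fun x => H (fst x) (snd x) = 0 <-> snd x = g (fst x)))
  (zeta omega : R -> R -> C)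
  (Hsel : forall r s : R, Lambda H K r s ->
     K (zeta r s, omega r s) /\ has_direction H r s (zeta r s) (omega r s))
  (Hselc : forall r s : R, Lambda H K r s ->
     RtoC (r / s)%R = dir H zetac omegac ->
     zeta r s = zetac /\ omega r s = omegac)
  (Hsellim : forall eps : R, (0 < eps)%R -> exists delta : R, (0 < delta)%R /\
     forall r s : R, Lambda H K r s ->
       (Cmod (RtoC (r / s) - dir H zetac omegac) < delta)%R ->
       (Cmod (zeta r s - zetac) < eps)%R /\ (Cmod (omega r s - omegac) < eps)%R)
  (p q n : nat) (Hpq : (p <= q)%nat)
  (Ha : change_of_degree p q (amplitude G H g) zetac 0)
  (Hf : constant_degree n (phase g) zetac 0) :
  exists (C0 : R) (A : nat -> C -> C) (B : nat -> C -> R -> C),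
    (0 < C0)%R /\
    (exists rho : R, (0 < rho)%R /\
       forall k, (p <= k <= q)%nat ->
       forall z, (Cmod (z - zetac) < rho)%R ->
         analytic_at (A k) z /\
         forall s : R, (0 < s)%R -> analytic_at (fun x => B k x s) z) /\
    (forall k, (p <= k < q)%nat -> A k zetac = 0) /\
    A q zetac <> 0 /\
    (exists delta M : R, (0 < delta)%R /\
       forall r s : nat, Lambda H K (INR r) (INR s) ->
         (Cmod (RtoC (INR r / INR s) - dir H zetac omegac) < delta)%R ->
         let z := zeta (INR r) (INR s) in
         let w := omega (INR r) (INR s) in
         exists E : C,
           (Cmod E <= M * exp (- (INR s * C0)))%R /\
           F r s = / (z ^ r) * / (w ^ s) / RtoC (2 * PI) *
             (sum_n_m (G := C_AbelianGroup)
                (fun k => A k z * B k z (INR s)) p q + E)) /\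
    exists c : nat -> C -> nat -> C,
      (exists rho : R, (0 < rho)%R /\
         forall k j, (p <= k <= q)%nat -> (k <= j)%nat ->
         forall z, (Cmod (z - zetac) < rho)%R ->
           analytic_at (fun x => c k x j) z) /\
      exists delta : R, (0 < delta)%R /\
        forall k m, (p <= k <= q)%nat -> (k <= m)%nat ->
        exists M s0 : R, (0 < s0)%R /\
          forall r s : R, Lambda H K r s ->
            (Cmod (RtoC (r / s) - dir H zetac omegac) < delta)%R ->
            (s0 <= s)%R ->
            (Cmod (B k (zeta r s) s
               - sum_n_m (G := C_AbelianGroup)
                   (fun j =>
                     (c k (zeta r s) j
                      * (1 + (-1) ^ j
                           * Dfactor (hartogs (phase g) 0 n zetac) j n)
                      * RtoC (1 / INR n * Gamma (INR (j + 1) / INR n))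
                      * RtoC (Rpower s (- (INR (j + 1) / INR n))))%C) k m)
             <= M * Rpower s (- (INR (m + 2) / INR n)))%R.
Proof.
  destruct (HKmin zetac omegac Hc) as [[hzw [_ hmin]] _].
  pose proof (HKD _ _ Hc) as hpd.
  assert (hz : zetac <> 0) by (intros h; apply hzw; rewrite h; ring).
  assert (hw : omegac <> 0) by (intros h; apply hzw; rewrite h; ring).
  pose proof (analytic_at_hol g zetac Hg) as hg.
  assert (hgn : g zetac <> 0) by (rewrite Hgc; exact hw).
  set (D := dir H zetac omegac) in *.
  destruct (Req_dec (Im D) 0) as [hD|hD].
  (* Real ratios keep a distance of at least [|Im D|] from [D]; with this number as [delta] no
     direction is left, and constant functions serve. *)
  2:{ assert (hbad : forall x : R, (Cmod (RtoC x - D) < Rabs (Im D))%R -> False).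
    { intros x hx. pose proof (im_le_Cmod (RtoC x - D)) as h.
      replace (Im (RtoC x - D)) with (- Im D)%R in h by (Creduce; ring). rewrite Rabs_Ropp in h; lra. }
    assert (hDp : (0 < Rabs (Im D))%R) by (apply Rabs_pos_lt, hD).
    exists 1%R, (fun k _ => if Nat.ltb k q then 0 else 1), (fun _ _ _ => 0).
    split; [lra|]. split; [|split; [|split; [|split]]].
    - exists 1%R; split; [lra|]; intros k _ z _; split; [|intros s _]; apply hol_analytic, hol_const.
    - intros k hk; cbv beta. rewrite (proj2 (Nat.ltb_lt k q)) by lia. reflexivity.
    - rewrite Nat.ltb_irrefl; apply C1_nz.
    - exists (Rabs (Im D)), 0%R; split; [exact hDp|]. intros r s _ h; exfalso; exact (hbad _ h).
    - exists (fun _ _ _ => 0); split.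
      + exists 1%R; split; [lra|]; intros k j _ _ z _; apply hol_analytic, hol_const.
      + exists (Rabs (Im D)); split; [exact hDp|]. intros k m _ _; exists 0%R, 1%R; split; [lra|].
        intros r s _ h; exfalso; exact (hbad _ h). }
  assert (hDr : D = RtoC (Re D)) by (apply injective_projections; [reflexivity|exact hD]).
  set (f := phase g) in *. set (a := amplitude G H g) in *.
  pose proof (near_facts rho1 rho2 G H g zetac omegac HG HH hpd hw Hcw hg Hgc Hgzero) as hnf.
  assert (hjf : jhol f zetac 0) by (apply jhol_phase; assumption).
  assert (hja : jhol a zetac 0).
  { change (jhol (fun x th => residue G H g (x * Cexp (Ci * th))) zetac 0).
    apply jhol_rotation, (locally_singleton _ _ hnf). }
  destruct Hf as [hf1 [_ hf3]]. destruct Ha as [ha1 [ha2 _]].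
  destruct (jhol_jholB f zetac hjf) as [rf [hrf hjBf]].
  destruct (jhol_jholB a zetac hja) as [ra [hra hjBa]].
  destruct (proj1 (locally_C_Cmod _ _) (filter_and _ _
    (filter_and _ _ (locally_forall_lt (T := CU) zetac _ n hf1) (locally_forall_lt (T := CU) zetac _ p ha1))
    (filter_and _ _ hnf (locally_locally _ _ hnf)))) as [d6 [hd6 hfacts]].
  (* For [x] near [zeta_c] and small angles, the ratio [g (x e^(i t)) / g x] stays in the right half
     plane, where the logarithm of the phase is inverted by the exponential. *)
  assert (hrot : locally (T := prod_UniformSpace CU RU) (zetac, 0%R) (fun v =>
    (Cmod (fst v * circle (snd v) - zetac) < d6)%R /\
    (0 < Re (g (fst v * circle (snd v))%C / g (fst v)))%R)).
  { assert (hcirc0 : zetac * circle 0 = zetac) by (unfold circle; rewrite Cmult_0_r, Cexp_0; ring).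
    assert (hc : continuous (T := prod_UniformSpace CU RU) (U := CU) (fun v => fst v * circle (snd v)) (zetac, 0%R))
      by cont.
    apply filter_and.
    - pose proof (continuous_locally_C (T := prod_UniformSpace CU RU) _ _ d6 hc hd6) as h.
      generalize h; apply filter_imp; intros v hv.
      change (Cmod (fst v * circle (snd v) - zetac * circle 0) < d6)%R in hv.
      rewrite hcirc0 in hv; exact hv.
    - apply (locally_lt_continuous (T := prod_UniformSpace CU RU) (fun _ => 0%R)
        (fun v => Re (g (fst v * circle (snd v))%C / g (fst v)))); [cont| |].
      + apply (continuous_Re (T := prod_UniformSpace CU RU)).
        apply (continuous_Cdiv (T := prod_UniformSpace CU RU)); [| |exact hgn].
        * apply (continuous_comp (U := prod_UniformSpace CU RU) (V := CU) (W := CU)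
            (fun v => fst v * circle (snd v)) g); [exact hc|].
          cbn [fst snd]; rewrite hcirc0; apply hol_continuous, hg.
        * apply (continuous_comp (U := prod_UniformSpace CU RU) (V := CU) (W := CU) (fun v => fst v) g);
            [cont|apply hol_continuous, hg].
      + cbn [fst snd]. rewrite hcirc0. replace (g zetac / g zetac) with (RtoC 1) by (field; exact hgn).
        simpl; lra. }
  destruct (locally_prod_ball (X := CU) (Y := RU) _ _ _ hrot) as [d3 hd3].
  assert (hrotb : forall x (t : R), (Cmod (x - zetac) < d3)%R -> (Rabs t < d3)%R ->
    (Cmod (x * circle t - zetac) < d6)%R /\ (0 < Re (g (x * circle t)%C / g x))%R).
  { intros x t hx ht; apply (hd3 x t); [apply ball_C_Cmod, hx|].
    change (Rabs (t - 0) < d3)%R; rewrite Rminus_0_r; exact ht. }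
  pose proof (cond_pos d3) as hd3p.
  assert (hdirx : forall x, (Cmod (x - zetac) < d6)%R -> x * C_derive g x / g x = - dir H x (g x)).
  { intros x hx; destruct (hfacts x hx) as [_ [[[q1 [q2 [q3 q4]]] [q5 q6]] q7]].
    apply implicit_dir with rho1 rho2; try assumption.
    generalize q7; apply filter_imp; intros y [[_ [_ [_ hy]]] _]; exact hy. }
  assert (hzc0 : forall r : R, (0 < r)%R -> (Cmod (zetac - zetac) < r)%R).
  { intros r hr; replace (zetac - zetac) with (RtoC 0) by ring; rewrite Cmod_0; exact hr. }
  destruct (small_pos (cons rf (cons ra (cons d6 (cons (pos d3) (cons PI nil)))))) as [r0 [hr0 hr0l]].
  { repeat constructor; try assumption. apply PI_RGT_0. }
  assert (hr0s : (r0 < rf /\ r0 < ra /\ r0 < d6 /\ r0 < d3 /\ r0 < PI)%R).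
  { inversion_clear hr0l as [|? ? x1 l1]. inversion_clear l1 as [|? ? x2 l2].
    inversion_clear l2 as [|? ? x3 l3]. inversion_clear l3 as [|? ? x4 l4].
    inversion_clear l4 as [|? ? x5 l5]. tauto. }
  (* [f] vanishes at [th = 0], so degree 0 would contradict the nonvanishing coefficient. *)
  assert (hn : (1 <= n)%nat).
  { destruct n as [|m]; [|lia]. exfalso; apply hf3. unfold hartogs; simpl C_derive_n.
    unfold f; rewrite (phase_0 g zetac hgn). simpl. field. }
  (* If [|g| <= |omega_c|] held at [zeta_c e^(i t)], the graph of [g] would give a second zero of
     [H] in the closed polydisc. *)
  assert (hpos : forall t : R, (0 < Rabs t < r0)%R -> (0 < Re (f zetac (RtoC t)))%R).
  { intros t ht.
    destruct (hrotb zetac t (hzc0 _ hd3p) ltac:(lra)) as [h1 h2].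
    destruct (hfacts _ h1) as [_ [[[q1 [q2 [q3 q4]]] _] _]].
    unfold f; rewrite (Re_phase_real g zetac t (Re D) hgn q2).
    - rewrite <- ln_1; apply ln_increasing; [lra|].
      pose proof (proj1 (Cmod_gt_0 _) hgn) as hm.
      apply Rmult_lt_reg_r with (Cmod (g zetac)); [exact hm|].
      unfold Rdiv; rewrite Rmult_assoc, Rinv_l, Rmult_1_r, Rmult_1_l by lra.
      apply Rnot_le_lt; intros hle. rewrite Hgc in hle.
      destruct (hmin (zetac * circle t) (g (zetac * circle t))) as [he _]; [|exact hle|exact q4|].
      + rewrite Cmod_mult, Cmod_circle; lra.
      + pose proof (circle_minus_1 t (Rabs t) ltac:(lra) ltac:(lra)) as hcm.
        assert (hc1 : circle t - 1 = 0).
        { replace (circle t - 1) with ((zetac * circle t - zetac) / zetac) by (field; exact hz).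
          rewrite he; field; exact hz. }
        rewrite hc1, Cmod_0 in hcm.
        assert (hsq : (0 < sqrt (2 - 2 * cos (Rabs t)))%R).
        { apply sqrt_lt_R0. assert (cos (Rabs t) < cos 0)%R by (apply cos_decreasing_1; lra).
          rewrite cos_0 in *; lra. }
        lra.
    - rewrite hdirx by (apply hzc0, hd6). rewrite Hgc; fold D. rewrite <- hDr; reflexivity. }
  destruct (phase_geometry n f zetac (hartogs f 0 n zetac) r0 hn hr0)
    as [r [yh [rp [rm [chi [pp [pm [b [L [hr [hyB [hy [hchin [hb [hrp [hrm [hDf harc]]]]]]]]]]]]]]]]].
  { apply jholB_le with rf; [lra|exact hjBf]. }
  { intros z hzz k hk; apply (hfacts z ltac:(lra)), hk. }
  { reflexivity. }
  { exact hf3. }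
  { exact hpos. }
  assert (hfB : jholB zetac r f) by (apply jholB_le with rf; [lra|exact hjBf]).
  assert (haB : jholB zetac r a) by (apply jholB_le with ra; [lra|exact hjBa]).
  destruct (coefficient_integral rho1 rho2 G H F g zetac omegac HG HH HF hpd hz hw hmin Hcw hg Hgc Hgzero)
    as [e1 [he1 hci]].
  (* Two demands on the length of the segment: the bidisc of the phase and the arc allowed by the
     coefficient integral. The constants of the exponential errors are chosen after it. *)
  destruct (small_pos (cons r (cons e1 nil))) as [eps [heps hepsl]].
  { repeat constructor; lra. }
  assert (hes : (eps < r /\ eps < e1)%R).
  { inversion_clear hepsl as [|? ? x1 l1]. inversion_clear l1 as [|? ? x2 l2]. tauto. }
  destruct (hci eps ltac:(lra)) as [dlc [Mc [C1 [hdlc [hC1 hcint]]]]].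
  destruct (harc eps ltac:(lra)) as [c0 [dla [hc0 [hdla harcb]]]].
  assert (hmodm : Cmod (- (1)) = 1%R) by (rewrite Cmod_opp; apply Cmod_1).
  assert (hbnd : forall (sg : C) (psi : R), Cmod sg = 1%R -> exists M, (0 < M)%R /\
     locally (T := CU) zetac (fun x => forall t, (0 <= t <= 1)%R ->
       (Cmod (a x (RtoC eps * (sg * circle (psi * t)))%C) <= M)%R)).
  { intros sg psi hsg.
    apply (bounded_param (X := CU) (fun x t => a x (RtoC eps * (sg * circle (psi * t))))).
    intros t _; unfold jointly_continuous.
    apply (continuous_uncurry (T := prod_UniformSpace CU RU) (U := CU) (V := CU) (W := CU) a
      (fun v => fst v) (fun v => RtoC eps * (sg * circle (psi * snd v)))); [cont|cont|].
    assert (hmod : (Cmod (RtoC eps * (sg * circle (psi * t))) < r)%R)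
      by (rewrite !Cmod_mult, hsg, Cmod_circle, Cmod_R, Rabs_right; lra).
    destruct (jhol_at _ _ _ (haB zetac _ (hzc0 _ (proj1 hr)) hmod)) as [hac _]; exact hac. }
  destruct (hbnd 1 pp Cmod_1) as [Ma1 [hMa1 hba1]]. destruct (hbnd (- (1)) pm hmodm) as [Ma2 [hMa2 hba2]].
  destruct (proj1 (locally_C_Cmod _ _) (filter_and _ _ hba1 hba2)) as [d7 [hd7 hba]].
  destruct (locally_prod_ball (X := CU) (Y := CU) _ _ _ Hgzero) as [d8 hd8].
  pose proof (cond_pos d8) as hd8p.
  destruct (small_pos (cons (r / 2)%R (cons dlc (cons dla (cons d7 (cons (pos d8) nil)))))) as [dl [hdl hdll]].
  { repeat constructor; lra. }
  assert (hds : (2 * dl < r /\ dl < dlc /\ dl < dla /\ dl < d7 /\ dl < d8)%R).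
  { inversion_clear hdll as [|? ? x1 l1]. inversion_clear l1 as [|? ? x2 l2].
    inversion_clear l2 as [|? ? x3 l3]. inversion_clear l3 as [|? ? x4 l4].
    inversion_clear l4 as [|? ? x5 l5]. lra. }
  destruct (Hsellim dl hdl) as [delta [hdelta hnearsel]].
  pose (A := fun k x => if Nat.ltb k q then ddn k a x 0 else 1).
  pose (u := fun k x th => if Nat.ltb k q then RtoC 1 else ddn q a x th).
  pose (etap := circle pp). pose (etam := - circle pm).
  assert (hep : Cmod etap = 1%R) by apply Cmod_circle.
  assert (hem : Cmod etam = 1%R) by (unfold etam; rewrite Cmod_opp; apply Cmod_circle).
  (* Both rays start at 0; the difference is the integral along the path from [eps etam] through 0
     to [eps etap], which replaces the real segment. *)
  pose (B := fun k x s => ray_int k (u k) f etap eps s x - ray_int k (u k) f etam eps s x).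
  assert (huB : forall k, jholB zetac r (u k)).
  { intros k; unfold u; destruct (Nat.ltb k q); [apply jholB_const|apply jholB_ddn, haB]. }
  assert (hyn0 : forall x, (Cmod (x - zetac) < r)%R -> yh x 0 <> 0).
  { intros x hx; apply (hy x 0 hx); rewrite Cmod_0; lra. }
  assert (hchi1 : Cmod chi = 1%R) by (apply Cmod_root_of_unity with n; assumption).
  (* [C1] comes from the torus integral, [c0] from the arcs that join the real segment to the
     rotated rays. *)
  exists (Rmin C1 c0), A, B.
  split; [apply Rmin_glb_lt; assumption|]. split; [|split; [|split; [|split]]].
  - exists r; split; [lra|]; intros k _ z hzr; split.
    + apply hol_analytic. unfold A; destruct (Nat.ltb k q); [|apply hol_const].
      apply (jhol_at _ _ _ (jholB_ddn k a zetac r haB z 0 hzr ltac:(rewrite Cmod_0; lra))).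
    + intros s _; apply hol_analytic. unfold B; apply hol_minus; apply hol_ray_int with zetac r;
        (assumption || apply huB || lra).
  - intros k hk; unfold A. rewrite (proj2 (Nat.ltb_lt k q)) by lia.
    rewrite <- (hartogs_ddn k a zetac r zetac haB (hzc0 r (proj1 hr))). apply ha2; exact hk.
  - unfold A; rewrite Nat.ltb_irrefl; apply C1_nz.
  - exists delta, (Mc + Ma1 * (eps * Rabs pp) + Ma2 * (eps * Rabs pm))%R; split; [exact hdelta|].
    intros r1 s1 hL hdist z w.
    destruct (hnearsel _ _ hL hdist) as [hz1 hw1]; fold z w in hz1, hw1.
    destruct (Hsel _ _ hL) as [hK [hs0 [_ hdir]]]; fold z w in hK, hdir.
    destruct (HKmin _ _ hK) as [[hzw1 [hH1 _]] _].
    (* The selected point is a zero of [H] close to the critical one, hence lies on the graph of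
       [g]. *)
    assert (hwg : w = g z).
    { apply (hd8 z w); [apply ball_C_Cmod; lra|apply ball_C_Cmod; lra|exact hH1]. }
    assert (hs1 : (s1 <> 0)%nat) by (intros ->; apply hs0; reflexivity).
    assert (hzn : z <> 0) by (intros h; apply hzw1; rewrite h; ring).
    assert (hwn : w <> 0) by (intros h; apply hzw1; rewrite h; ring).
    assert (hzr : (Cmod (z - zetac) < r)%R) by lra.
    pose (S := sum_n_m (G := C_AbelianGroup) (fun k => A k z * B k z (INR s1)) p q).
    (* The error is defined as the exact difference, so the identity is algebra and the bound
       carries the content. *)
    exists (RtoC (2 * PI) * F r1 s1 * z ^ r1 * w ^ s1 - S). split.
    2:{ fold S. pose proof twoPI_nz. pose proof (Cpow_nz _ r1 hzn). pose proof (Cpow_nz _ s1 hwn).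
        clearbody S. change (AbelianMonoid.sort C_AbelianGroup) with C in S.
        replace (S + (RtoC (2 * PI) * F r1 s1 * z ^ r1 * w ^ s1 - S))
          with (RtoC (2 * PI) * F r1 s1 * z ^ r1 * w ^ s1) by Cring.
        field; auto. }
    pose (U := fun th => a z th * Cexp (- (RtoC (INR s1) * f z th))).
    assert (hU : forall y, (Cmod y < r)%R -> hol U y).
    { intros y hyr; unfold U; apply hol_mult; [apply (jhol_at _ _ _ (haB z y hzr hyr))|].
      apply (hol_comp (fun th => - (RtoC (INR s1) * f z th)) Cexp); [|apply hol_Cexp].
      apply hol_opp, hol_mult; [apply hol_const|apply (jhol_at _ _ _ (hfB z y hzr hyr))]. }
    assert (hexp : forall th, (Cmod th < r)%R ->
       a z th = fsum (fun k => A k z * (th ^ k * u k z th)) p (Datatypes.S (q - p))).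
    { intros th hth; apply (amplitude_expand a zetac z th r p q haB Hpq hzr hth).
      intros k hk; apply (hfacts z ltac:(lra)), hk. }
    assert (hS : S = prim U (RtoC eps * etap) - prim U (RtoC eps * etam)).
    { unfold S, B. replace q with (p + (q - p))%nat at 1 by lia. rewrite sum_n_m_fsum.
      unfold U. rewrite <- (ray_sum a f (fun k => A k z) u zetac z etap r eps (INR s1) p (Datatypes.S (q - p)))
        by (assumption || lra).
      rewrite <- (ray_sum a f (fun k => A k z) u zetac z etam r eps (INR s1) p (Datatypes.S (q - p)))
        by (assumption || lra).
      rewrite fsum_minus. apply fsum_ext; intros k _; ring. }
    (* In the direction [r / s] the residue integral over the arc is the integral of [a e^(-s f)]
       over the real segment; it depends on the endpoints only and can be compared with the rotated
       path. *)
    assert (hJ : CInt (fun al => residue G H g (z * circle al) * (w / g (z * circle al)) ^ s1 / circle al ^ r1)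
       (- eps) eps = prim U (RtoC eps * 1) - prim U (RtoC eps * - (1))).
    { replace (RtoC eps * - (1)) with (RtoC (- eps) * 1) by (rewrite RtoC_opp; ring).
      rewrite <- (CInt_ray_prim U r (- eps) eps 1 hU Cmod_1) by lra.
      apply CInt_ext; [lra|]; intros al hal.
      destruct (hrotb z al ltac:(lra) ltac:(apply Rabs_def1; lra)) as [_ hre].
      rewrite !Cmult_1_r. unfold U.
      change (a z (RtoC al)) with (residue G H g (z * circle al)).
      unfold f; rewrite (Cexp_phase g z al r1 s1).
      - rewrite hwg. unfold Cdiv; ring.
      - rewrite <- hwg; exact hwn.
      - exact hre.
      - exact hs1.
      - rewrite hdirx by lra. rewrite <- hwg, <- hdir; reflexivity. }
    pose proof (hcint z w ltac:(lra) ltac:(lra) r1 s1) as hc1. rewrite hJ in hc1.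
    rewrite hS.
    set (E1 := exp (- (INR s1 * Rmin C1 c0))).
    pose proof (pos_INR s1) as hsp. pose proof (Rmin_l C1 c0) as hml. pose proof (Rmin_r C1 c0) as hmr.
    assert (hEC : (exp (- (INR s1 * C1)) <= E1)%R) by (apply exp_le_compat; nra).
    assert (hEc : forall x, (c0 <= x)%R -> (exp (- (INR s1 * x)) <= E1)%R)
      by (intros x hx; apply exp_le_compat; nra).
    assert (hUb : forall th M, (Cmod (a z th) <= M)%R -> (c0 <= Re (f z th))%R -> (Cmod (U th) <= M * E1)%R).
    { intros th M h1 h2; unfold U; rewrite Cmod_mult, Cmod_Cexp, re_opp, re_scal_l.
      apply Rmult_le_compat; [apply Cmod_ge_0|left; apply exp_pos|exact h1|apply hEc, h2]. }
    destruct (hba z ltac:(lra)) as [hb1 hb2].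
    pose proof (prim_arc U r eps pp (Ma1 * E1) 1 hU ltac:(lra) Cmod_1) as harc1.
    pose proof (prim_arc U r eps pm (Ma2 * E1) (- (1)) hU ltac:(lra) hmodm) as harc2.
    assert (hk1 : (Cmod (prim U (RtoC eps * (1 * circle pp)) - prim U (RtoC eps * 1)) <= Ma1 * E1 * (eps * Rabs pp))%R).
    { apply harc1; intros t ht. apply hUb; [apply hb1, ht|]. rewrite Cmult_1_l. apply (harcb z t ltac:(lra) ht). }
    assert (hk2 : (Cmod (prim U (RtoC eps * (- (1) * circle pm)) - prim U (RtoC eps * - (1))) <= Ma2 * E1 * (eps * Rabs pm))%R).
    { apply harc2; intros t ht. apply hUb; [apply hb2, ht|].
      replace (- (1) * circle (pm * t)) with (- circle (pm * t)) by ring. apply (harcb z t ltac:(lra) ht). }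
    replace (1 * circle pp) with etap in hk1 by (unfold etap; ring).
    replace (- (1) * circle pm) with etam in hk2 by (unfold etam; ring).
    (* The sign of [Mc] is read off from the bound it provides for a modulus. *)
    assert (hMc : (0 <= Mc)%R).
    { pose proof (Cmod_ge_0 (RtoC (2 * PI) * F r1 s1 * z ^ r1 * w ^ s1
        - (prim U (RtoC eps * 1) - prim U (RtoC eps * - (1))))) as h.
      pose proof (exp_pos (- (INR s1 * C1))). apply Rnot_lt_le; intros hlt. nra. }
    set (T0 := RtoC (2 * PI) * F r1 s1 * z ^ r1 * w ^ s1) in *.
    set (P1 := prim U (RtoC eps * 1)) in *. set (P2 := prim U (RtoC eps * - (1))) in *.
    set (P3 := prim U (RtoC eps * etap)) in *. set (P4 := prim U (RtoC eps * etam)) in *.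
    replace (T0 - (P3 - P4)) with ((T0 - (P1 - P2)) + (- (P3 - P1) + (P4 - P2))) by ring.
    eapply Rle_trans; [apply Cmod_triangle|].
    eapply Rle_trans; [apply Rplus_le_compat_l, Cmod_triangle|]. rewrite Cmod_opp.
    pose proof (Rmult_le_compat_l Mc _ _ hMc hEC). lra.
  - exists (fun k x j => ycoef yh (u k) k j x). split.
    + exists r; split; [lra|]; intros k j _ _ z hzr.
      apply hol_analytic. apply (hol_ycoef yh (u k) k j zetac r z hyB (huB k) hyn0 hzr).
    (* [delta] is fixed before [k] and [m]; only the constant [M] depends on the order. *)
    + exists delta; split; [exact hdelta|]. intros k m _ hkm.
      assert (hyf : forall x th, (Cmod (x - zetac) < r)%R -> (Cmod th < r)%R -> f x th = yfun yh x th ^ n)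
        by (intros x th h1 h2; apply (hy x th h1 h2)).
      (* On the positive ray the root of unity is 1; with [d = m - k] the last term kept has index
         [m]. *)
      destruct (ray_expansion n k (m - k) f (u k) yh rp zetac etap 1 r dl eps b L hn (huB k) hyB hyn0 hyf hep
        Cmod_1 (Cpow_1_l n) ltac:(lra) ltac:(lra) ltac:(lra) hb) as [M1 [hM1 h1]].
      { intros x t hx ht; apply hrp; lra. }
      destruct (ray_expansion n k (m - k) f (u k) yh rm zetac etam chi r dl eps b L hn (huB k) hyB hyn0 hyf hem
        hchi1 hchin ltac:(lra) ltac:(lra) ltac:(lra) hb) as [M2 [hM2 h2]].
      { intros x t hx ht; apply hrm; lra. }
      exists (M1 + M2)%R, 1%R; split; [lra|]. intros r1 s1 hL hdist hs1.
      destruct (hnearsel _ _ hL hdist) as [hz1 _].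
      set (x := zeta r1 s1) in *.
      specialize (h1 s1 x ltac:(lra) ltac:(lra)). specialize (h2 s1 x ltac:(lra) ltac:(lra)).
      replace (k + (m - k) + 2)%nat with (m + 2)%nat in h1, h2 by lia.
      replace m with (k + (m - k))%nat at 1 by lia. rewrite sum_n_m_fsum.
      unfold B.
      match goal with |- (Cmod (?b1 - ?b2 - ?S) <= _)%R =>
        replace (b1 - b2 - S) with ((b1 - ray_main n k (m - k) yh (u k) 1 s1 x)
          - (b2 - ray_main n k (m - k) yh (u k) chi s1 x)) end.
      * eapply Rle_trans; [apply Cmod_triangle|]. rewrite Cmod_opp. lra.
      * unfold ray_main.
        match goal with |- (?b1 - ?m1) - (?b2 - ?m2) = _ =>
          transitivity ((b1 - b2) - (m1 - m2)); [ring|] end.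
        (* The positive ray contributes 1 and the negative one [- chi^(j+1)], which is
           [(-1)^j D(j, n)]. *)
        f_equal. f_equal. rewrite fsum_minus. apply fsum_ext; intros j _.
        rewrite Cpow_1_l. unfold gterm.
        assert (hm1 : RtoC (-1) = - (1)) by (rewrite <- RtoC_opp; f_equal; ring).
        rewrite ?hm1. rewrite <- hDf. ring.
Qed.
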